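(* Let $\Omega\subset\mathbb{R}^N$, $N\ge2$, be a bounded domain with Lipschitz boundary $\partial\Omega$, let $p,q\in C^{0,1}(\overline\Omega)$ and $0\le\mu\in C^{0,1}(\overline\Omega)$. Assume that $1<p(x)\le q(x)<N$ and $\frac{q(x)}{p(x)}<1+\frac1N$ for all $x\in\overline\Omega$. Let $1\le\delta\le e$ and $\eta\ge0$ satisfy $\delta+\eta>1$. Suppose that $f\colon\Omega\times\mathbb{R}\times\mathbb{R}^N\to\mathbb{R}$ is a Carathéodory function such that $$|f(x,t,\xi)|\le C\Big[|t|^{p^*(x)-1}+\big(\mu(x)\log(\delta+\eta|t|)\big)^{\frac{q^*(x)}{q(x)}}|t|^{q^*(x)-1}+|\xi|^{\frac{p(x)}{(p^* )'(x)}}+\big(\mu(x)\log(\delta+\eta|t|)\big)^{\frac1{q(x)}}\big(\mu(x)\log(\delta+\eta|\xi|)\big)^{\frac1{(q^* )'(x)}}|\xi|^{\frac{q(x)}{(q^* )'(x)}}+1\Big]$$ for a.a. $x\in\Omega$ and all $(t,\xi)\in\mathbb{R}\times\mathbb{R}^N$, where $C>0$. Then every weak solution $u\in W^{1,\mathcal{H}_{\delta,\eta}}_0(\Omega)$ of $$-\operatorname{div}\left(|\nabla u|^{p(x)-2}\nabla u+\mu(x)\left(\log(\delta+\eta|\nabla u|)+\frac{\eta|\nabla u|}{q(x)(\delta+\eta|\nabla u|)}\right)|\nabla u|^{q(x)-2}\nabla u\right)=f(x,u,\nabla u)\quad\text{in }\Omega,$$ with $u=0$ on $\partial\Omega$,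 belongs to $C^{0,\beta}(\overline\Omega)$ for some $\beta\in(0,1]$.
   Context: $\kappa^*(x):=\frac{N\kappa(x)}{N-\kappa(x)}$ for $1<\kappa(x)<N$, and $\kappa'(x):=\frac{\kappa(x)}{\kappa(x)-1}$ for $\kappa(x)>1$. $\mathcal{H}_{\delta,\eta}(x,t):=t^{p(x)}+\mu(x)t^{q(x)}\log(\delta+\eta t)$ for $(x,t)\in\Omega\times[0,\infty)$. For $\mathcal{H}=\mathcal{H}_{\delta,\eta}$: $L^{\mathcal{H}}(\Omega)$ is the set of measurable $u\colon\Omega\to\mathbb{R}$ with $\int_\Omega\mathcal{H}(x,\lambda|u|)\,dx<\infty$ for some $\lambda>0$; $W^{1,\mathcal{H}}(\Omega)$ is the set of weakly differentiable $u\in L^{\mathcal{H}}(\Omega)$ with $|\nabla u|\in L^{\mathcal{H}}(\Omega)$, normed by $\inf\{\lambda>0:\int_\Omega[\mathcal{H}(x,|u|/\lambda)+\mathcal{H}(x,|\nabla u|/\lambda)]\,dx\le1\}$; $W^{1,\mathcal{H}}_0(\Omega)$ is the closure of $C_0^\infty(\Omega)$ in $W^{1,\mathcal{H}}(\Omega)$. Writing the equation as $-\operatorname{div}\mathcal{A}(x,\nabla u)=f(x,u,\nabla u)$, a weak solution is a $u\in W_0^{1,\mathcal{H}}(\Omega)$ with $\int_\Omega\mathcal{A}(x,\nabla u)\cdot\nabla\varphi\,dx=\int_\Omega f(x,u,\nabla u)\varphi\,dx$ for all $\varphi\in W_0^{1,\mathcal{H}}(\Omega)$. Membership in $C^{0,\beta}(\overline\Omega)$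 means having a representative that is Hölder continuous with exponent $\beta$ on $\overline\Omega$. *)

(* Defs.v *)
From HB Require Import structures.
From mathcomp Require Import all_boot all_order all_algebra.
From mathcomp Require Import all_classical all_reals all_analysis.

Set Implicit Arguments.
Unset Strict Implicit.
Unset Printing Implicit Defensive.

Import Order.TTheory GRing.Theory Num.Theory.
Import numFieldNormedType.Exports.

Local Open Scope classical_set_scope.
Local Open Scope ring_scope.

(* Lebesgue measure on R^N, with R^N the space 'rV[R]_N. It is not in the
   library; it is obtained by Caratheodory's construction from the outer
   measure given by countable covers with closed boxes. The index set D of a
   cover may be finite or empty, so that the empty set is null when N = 0. *)
Section lebesgue_measure_rV.
Context {R : realType} {N : nat}.
Implicit Types A : set 'rV[R]_N.

Definition box (a b : 'rV[R]_N) : set 'rV[R]_N :=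
  [set x | forall i, a 0 i <= x 0 i <= b 0 i].

Definition box_volume (a b : 'rV[R]_N) : R := \prod_i Num.max 0 (b 0 i - a 0 i).

Definition box_cover A (D : set nat) (a b : nat -> 'rV[R]_N) :=
  A `<=` \bigcup_(k in D) box (a k) (b k).

Definition lebesgue_outer A : \bar R :=
  ereal_inf [set v | exists D a b, box_cover A D a b /\
    v = \esum_(k in D) (box_volume (a k) (b k))%:E]%E.

Local Open Scope ereal_scope.

Lemma box_volume_ge0 a b : 0 <= (box_volume a b)%:E.
Proof.
by rewrite lee_fin; apply: prodr_ge0 => i _; rewrite le_max lexx.
Qed.

Lemma lebesgue_outer_ge0 A : 0 <= lebesgue_outer A.
Proof.
apply: le_ereal_inf_tmp => _ [D [a [b [_ ->]]]].
by apply: esum_ge0 => k _; exact: box_volume_ge0.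
Qed.

Lemma lebesgue_outer0 : lebesgue_outer set0 = 0.
Proof.
apply/eqP; rewrite eq_le lebesgue_outer_ge0 andbT.
apply: ereal_inf_lbound; exists set0, (fun=> 0%R), (fun=> 0%R).
by split; [exact: sub0set|rewrite esum_set0].
Qed.

Lemma le_lebesgue_outer :
  {homo lebesgue_outer : A B / A `<=` B >-> A <= B}.
Proof.
move=> A B AB; apply/ereal_inf_le_tmp => _ [D [a [b [cB ->]]]].
by exists D, a, b; split => //; exact: subset_trans AB cB.
Qed.

Lemma lebesgue_outer_sigma_subadditive : sigma_subadditive lebesgue_outer.
Proof.
move=> A; have [[i ioo]|] := pselect (exists i, lebesgue_outer (A i) = +oo).
  rewrite (eseries_pinfty _ _ ioo) ?leey// => n _.
  by rewrite -ltNye (lt_le_trans _ (lebesgue_outer_ge0 _)).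
rewrite -forallNE => Aoo.
apply/lee_addgt0Pr => e e0.
rewrite (le_trans _ (epsilon_trick _ _ (ltW e0)))//; last first.
  by move=> n; exact: lebesgue_outer_ge0.
pose v (c : set nat * ((nat -> 'rV[R]_N) * (nat -> 'rV[R]_N))) k :=
  (box_volume (c.2.1 k) (c.2.2 k))%:E.
have [c Pc] : {c : nat -> set nat * ((nat -> 'rV[R]_N) * (nat -> 'rV[R]_N)) &
    forall n, box_cover (A n) (c n).1 (c n).2.1 (c n).2.2 /\
    \esum_(k in (c n).1) v (c n) k <=
      lebesgue_outer (A n) + (e / (2 ^ n.+1)%:R)%:E}.
  apply: (@choice _ _ (fun n c => box_cover (A n) c.1 c.2.1 c.2.2 /\
    \esum_(k in c.1) v c k <=
      lebesgue_outer (A n) + (e / (2 ^ n.+1)%:R)%:E)) => n.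
  have fA : lebesgue_outer (A n) \is a fin_num.
    by rewrite ge0_fin_numE ?lebesgue_outer_ge0// ltey; exact/eqP/Aoo.
  have en1 : (0 < e / (2 ^ n.+1)%:R)%R by rewrite divr_gt0// ltr0n expn_gt0.
  have [_ [D [a [b [cA ->]]]] /ltW le_e] := lb_ereal_inf_adherent en1 fA.
  by exists (D, (a, b)).
pose V (p : nat * nat) := v (c p.1) p.2.
have V0 p : 0 <= V p by exact: box_volume_ge0.
pose J := [set: nat] `*`` (fun n => (c n).1).
have le1 : lebesgue_outer (\bigcup_n A n) <= \esum_(p in J) V p.
  have /card_esym/ppcard_eqP[f] := card_nat2.
  apply: ereal_inf_lbound.
  exists (f @^-1` J), (fun m => (c (f m).1).2.1 (f m).2),
    (fun m => (c (f m).1).2.2 (f m).2); split.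
    move=> x [n _ Anx]; have [k ck xk] := (Pc n).1 _ Anx.
    exists (f^-1%FUN (n, k)) => /=; first by rewrite /J/= invK ?inE.
    by rewrite invK ?inE.
  rewrite (reindex_esum (f @^-1` J) J f)//; split => //.
  - by move=> x y _ _; apply: inj; rewrite inE.
  - move=> p Jp; exists (f^-1%FUN p) => /=; last by rewrite invK ?inE.
    by rewrite invK ?inE.
apply: (le_trans le1).
rewrite nneseries_esumT; last first.
  move=> n; rewrite adde_ge0 ?lebesgue_outer_ge0// lee_fin.
  by rewrite divr_ge0 ?ltW.
rewrite -(esum_esum (J := fun n => (c n).1) (a := fun n k => V (n, k)))//=.
by apply: le_esum => n _; exact: (Pc n).2.
Qed.

HB.instance Definition _ := isOuterMeasure.Build R 'rV[R]_N lebesgue_outer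
  lebesgue_outer0 lebesgue_outer_ge0 le_lebesgue_outer
  lebesgue_outer_sigma_subadditive.

End lebesgue_measure_rV.

(* R^N with the sigma-algebra of Lebesgue measurable sets; its carrier is
   'rV[R]_N, so points and sets may be used at either type. *)
Notation lebesgue_space R N := (caratheodory_type (@lebesgue_outer R N)).

Definition leb (R : realType) (N : nat) : set (lebesgue_space R N) -> \bar R :=
  @lebesgue_outer R N.

Arguments leb : clear implicits.

HB.instance Definition _ (R : realType) (N : nat) :=
  isMeasure.Build _ _ _ (leb R N)
    (@caratheodory_measure0 R 'rV[R]_N (@lebesgue_outer R N))
    (@caratheodory_measure_ge0 R 'rV[R]_N (@lebesgue_outer R N))
    (@caratheodory_measure_sigma_additive R 'rV[R]_N (@lebesgue_outer R N)).

Section euclidean_space.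
Context {R : realType} {N : nat}.
Implicit Types (x v w : 'rV[R]_N) (A Omega : set 'rV[R]_N).

Definition dotp v w : R := \sum_i v 0 i * w 0 i.

(* The norm `|v| of the library is the maximum norm. *)
Definition enorm v : R := Num.sqrt (dotp v v).

Definition lebesgue_measurable_fun A (u : 'rV[R]_N -> R) :=
  measurable_fun (A : set (lebesgue_space R N)) (u : lebesgue_space R N -> R).

(* C^{0,beta}(A) for bounded A; beta = 1 gives the Lipschitz functions. *)
Definition holder_on A (beta : R) (u : 'rV[R]_N -> R) :=
  exists L : R, forall x y, A x -> A y ->
    `|u x - u y| <= L * enorm (x - y) `^ beta.

Definition bounded_domain Omega :=
  [/\ Omega !=set0, open Omega, connected Omega & bounded_set Omega].

End euclidean_space.

(* After an orthogonal change of coordinates and the choice of a coordinate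
   axis i, Omega is near each boundary point the strict epigraph of a
   Lipschitz function of the N - 1 remaining coordinates. *)
Definition lipschitz_boundary (R : realType) (N : nat)
    (Omega : set 'rV[R]_N) :=
  forall x0, (closure Omega `\` interior Omega) x0 ->
  exists (Q : 'M[R]_N) (i : 'I_N) (gamma : 'rV[R]_N.-1 -> R),
    [/\ Q *m Q^T = 1%:M, holder_on setT 1 gamma &
      \forall x \near x0,
        Omega x <-> gamma (col' i (x *m Q)) < (x *m Q) 0 i].

Section sobolev.
Context {R : realType} {N : nat}.
Variable Omega : set 'rV[R]_N.
Implicit Types (u v phi : 'rV[R]_N -> R) (g : 'rV[R]_N -> 'rV[R]_N).

Definition partial (i : 'I_N) u : 'rV[R]_N -> R :=
  fun x => 'D_(delta_mx 0 i) u x.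

Definition iter_partial (s : seq 'I_N) u := foldr partial u s.

Definition smooth u := forall s : seq 'I_N,
  continuous (iter_partial s u) /\
  forall i x, derivable (iter_partial s u) x (delta_mx 0 i).

Definition support_of u : set 'rV[R]_N := closure [set x | u x != 0].

(* C_0^infty(Omega) *)
Definition test_fun u :=
  [/\ smooth u, compact (support_of u) & support_of u `<=` Omega].

Definition loc_integrable u :=
  lebesgue_measurable_fun Omega u /\
  forall K, K `<=` Omega -> compact K ->
    (\int[leb R N]_(x in K) `|u x|%:E < +oo)%E.

Definition is_weak_gradient u g :=
  loc_integrable u /\
  forall i : 'I_N, loc_integrable (fun x => g x 0 i) /\
    forall phi, test_fun phi ->
      (\int[leb R N]_(x in Omega) (u x * partial i phi x)%:E =
       - \int[leb R N]_(x in Omega) (g x 0 i * phi x)%:E)%E.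

Definition weakly_differentiable u := exists g, is_weak_gradient u g.

(* The weak gradient, which is unique up to a null subset of Omega; it is 0
   when u is not weakly differentiable. *)
Definition nabla u : 'rV[R]_N -> 'rV[R]_N :=
  xget (fun=> 0) [set g | is_weak_gradient u g].

Variable H : 'rV[R]_N -> R -> R.

Definition LH u :=
  lebesgue_measurable_fun Omega u /\
  exists2 lambda : R, 0 < lambda &
    (\int[leb R N]_(x in Omega) (H x (lambda * `|u x|))%:E < +oo)%E.

Definition W1H u :=
  [/\ weakly_differentiable u, LH u & LH (fun x => enorm (nabla u x))].

Definition W1H_norm u : \bar R :=
  ereal_inf [set lambda%:E | lambda in [set lambda : R | 0 < lambda /\
    (\int[leb R N]_(x in Omega)
      (H x (`|u x| / lambda) + H x (enorm (nabla u x) / lambda))%:E <= 1)%E]].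

(* The closure of C_0^infty(Omega) in W^{1,H}(Omega). *)
Definition W1H0 u :=
  W1H u /\ forall eps : R, 0 < eps ->
    exists2 phi, test_fun phi & (W1H_norm (u \- phi)%R < eps%:E)%E.

Variables (A : 'rV[R]_N -> 'rV[R]_N -> 'rV[R]_N)
  (f : 'rV[R]_N -> R -> 'rV[R]_N -> R).

(* Weak solutions of - div A(x, grad u) = f(x, u, grad u) in Omega, u = 0 on
   the boundary. *)
Definition weak_solution u :=
  W1H0 u /\ forall phi, W1H0 phi ->
    (\int[leb R N]_(x in Omega) (dotp (A x (nabla u x)) (nabla phi x))%:E =
     \int[leb R N]_(x in Omega) (f x (u x) (nabla u x) * phi x)%:E)%E.

Definition caratheodory_fun :=
  (forall t xi, lebesgue_measurable_fun Omega (fun x => f x t xi)) /\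
  {ae leb R N, forall x, Omega x ->
    continuous (fun z : R * 'rV[R]_N => f x z.1 z.2)}.

End sobolev.

Section double_phase.
Context {R : realType} {N : nat}.
Implicit Types (k t : R) (x xi : 'rV[R]_N).

Definition sobolev_exp k : R := N%:R * k / (N%:R - k).

Definition conj_exp k : R := k / (k - 1).

Variables (p q mu : 'rV[R]_N -> R) (delta eta : R).

Definition Hlog x t : R :=
  t `^ p x + mu x * t `^ q x * ln (delta + eta * t).

Definition Alog x xi : 'rV[R]_N :=
  enorm xi `^ (p x - 2) *: xi +
  (mu x * (ln (delta + eta * enorm xi) +
           eta * enorm xi / (q x * (delta + eta * enorm xi)))
        * enorm xi `^ (q x - 2)) *: xi.

Definition growth_bound x t xi : R :=
  let L s := ln (delta + eta * s) in
  let ps := sobolev_exp (p x) in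
  let qs := sobolev_exp (q x) in
  `|t| `^ (ps - 1)
  + (mu x * L `|t|) `^ (qs / q x) * `|t| `^ (qs - 1)
  + enorm xi `^ (p x / conj_exp ps)
  + (mu x * L `|t|) `^ (q x)^-1 * (mu x * L (enorm xi)) `^ (conj_exp qs)^-1
    * enorm xi `^ (q x / conj_exp qs)
  + 1.

End double_phase.

(* Main.v *)
(* Let B(x,t) = t^{p*(x)} + (mu(x) t^{q(x)} log(delta + eta t))^{N/(N-q(x))}.  There is V with
   V^{N/(N-1)} >= c B such that the slope of x |-> V(x, phi(x)) is at most
   e B(x,phi) + C (phi + H(x,|grad phi|)): this uses the Lipschitz exponents and q/p < 1 + 1/N.
   The Sobolev inequality in L^1 then bounds the integral of B(x,phi) by the power N/(N-1) of the
   energy of phi.  Testing the equation with the truncations (sg u - k)_+, sg = 1 or -1, and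
   iterating over the levels k as De Giorgi did shows that u is bounded.  With a cut-off, the same
   test gives a local energy estimate; on a cube of side r at most the oscillation om of u, the
   densities H(x, om/r) at different points x are comparable, so the estimate becomes a bound for
   the L^1 norm of the gradient over superlevel sets.  Such bounds and the isoperimetric lemma of
   De Giorgi make the oscillation decay geometrically on concentric cubes; at the boundary the
   exterior of a Lipschitz domain has positive density.  A suitable limit of centres of the range
   of u on shrinking cubes is the Hoelder continuous representative. *)
Require Import Defs.
From HB Require Import structures.
From mathcomp Require Import all_boot all_order all_algebra.
From mathcomp Require Import all_classical all_reals all_analysis.
From mathcomp Require Import measurable_realfun ring lra.
Import Order.TTheory GRing.Theory Num.Theory.
Import numFieldNormedType.Exports.
Local Open Scope classical_set_scope.
Local Open Scope ring_scope.

Set Implicit Arguments.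
Unset Strict Implicit.
Unset Printing Implicit Defensive.

(* Automation for sign conditions *)
Create HintDb nonneg.
#[global] Hint Extern 1 (is_true (0 <= powR _ _)) => exact: powR_ge0 : nonneg.
#[global] Hint Extern 1 (is_true (0 <= `|_|)) => exact: normr_ge0 : nonneg.
#[global] Hint Extern 1 (is_true (0 <= Num.sqrt _)) => exact: sqrtr_ge0 : nonneg.
#[global] Hint Extern 1 (is_true (0 <= expR _)) => exact: expR_ge0 : nonneg.
#[global] Hint Extern 1 (is_true (0 <= fine _)) => exact: fine_ge0 : nonneg.
#[global] Hint Extern 1 (is_true (0 <= _ - _)) => rewrite subr_ge0 : nonneg.
#[global] Hint Extern 1 (is_true (0 < _ - _)) => rewrite subr_gt0 : nonneg.
#[global] Hint Extern 3 (is_true (0 <= _)) => exact: ltW : nonneg.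
Ltac pos := solve
  [ assumption | lazymatch goal with
    | h : is_true (0 < ?x) |- is_true (0 <= ?x) => exact: ltW h
    | |- is_true (0 <= _ * _) => refine (mulr_ge0 _ _); pos
    | |- is_true (0 <= _ + _) => refine (addr_ge0 _ _); pos
    | |- is_true (0 <= _^-1) => rewrite invr_ge0; pos
    | |- is_true (0 <= _ ^+ _) => refine (exprn_ge0 _ _); pos
    | |- is_true (0 < _ * _) => refine (mulr_gt0 _ _); pos
    | |- is_true (0 < _^-1) => rewrite invr_gt0; pos
    | |- is_true (0 < _ ^+ _) => refine (exprn_gt0 _ _); pos
    | |- is_true (0 < powR _ _) => refine (powR_gt0 _ _); pos
    | |- is_true (0 < _ + _) =>
        first [refine (addr_gt0 _ _); pos | refine (ltr_wpDl _ _); pos | refine (ltr_wpDr _ _); pos]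
    end | auto 3 with nonneg nocore | done | lra ].

(** The exponents are merely Lipschitz, so x |-> V(x, phi x) need not be differentiable. Gradients
    are therefore replaced by pointwise Lipschitz constants ([slope]), and the Poincare, Faber-Krahn
    and Gagliardo-Nirenberg inequalities are proved for a function paired with such a slope, by
    translating and halving cubes. Cubes are measured by [vol], through translation, monotonicity
    and halving; its positivity is a hypothesis up to the theorem, where the alternative makes Omega
    null. Membership in W_0 is handled through test functions that converge almost everywhere
    together with their gradients under one integrable majorant: chain and product rules are applied
    to the sequence, and dominated convergence does the rest. H and B are not homogeneous in t;
    inequalities for shrinking and dilating t take the place of scaling. In the local theory r <= om
    is assumed throughout: then H(x, om/r) >= 1 dominates all bounded terms. The radius shrinks by
    16 while the bound on the oscillation shrinks by a factor th >= 3/4, so a relation r <= Ra * om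
    persists along the iteration. *)

Lemma eq_ler d {T : porderType d} (x y : T) : x = y -> (x <= y)%O.
Proof. by move=> ->. Qed.

Tactic Notation "via" uconstr(t) := refine (@le_trans _ _ t _ _ _ _).

(** * The maximum norm and the Lebesgue measure of cubes *)

Section rV_norm.
Context {R : realType} {N : nat}.
Implicit Types (x : 'rV[R]_N) (e : R).

Lemma norm_coord x i : `|x 0 i| <= `|x|.
Proof.
rewrite [leRHS]mx_normrE.
exact: (@le_bigmax _ _ _ 0 (fun ij : 'I_1 * 'I_N => `|x ij.1 ij.2|) (0, i)).
Qed.

Lemma norm_rV_le x e : 0 <= e -> (forall i, `|x 0 i| <= e) -> `|x| <= e.
Proof.
move=> e0 xe; rewrite [leLHS]mx_normrE; apply/bigmax_leP; split => // -[j i] _ /=.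
by rewrite ord1.
Qed.

Lemma norm_rV_lt x e : 0 < e -> (forall i, `|x 0 i| < e) -> `|x| < e.
Proof.
move=> e0 xe; rewrite [ltLHS]mx_normrE; apply/bigmax_ltP; split => // -[j i] _ /=.
by rewrite ord1.
Qed.

End rV_norm.

Notation lmfun := lebesgue_measurable_fun.
Notation mset A := (measurable (A : set (lebesgue_space _ _))).
Notation emfun D f :=
  (measurable_fun (D : set (lebesgue_space _ _)) (f : lebesgue_space _ _ -> \bar _)).

Section lebesgue_measurability.
Context {R : realType} {N : nat}.
Implicit Types (A D : set 'rV[R]_N) (c h x : 'rV[R]_N) (r s t : R).

Definition upd (a : 'rV[R]_N) (i : 'I_N) (t : R) : 'rV[R]_N :=
  \row_j if j == i then t else a 0 j.

(** Both pieces arise by clamping one face at t. If the hyperplane misses the box, one of them gets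
    a negative side, which [box_volume] counts as 0. *)
Lemma box_volume_split (a b : 'rV[R]_N) i t :
  box_volume a (upd b i (Num.min (b 0 i) t)) +
  box_volume (upd a i (Num.max (a 0 i) t)) b = box_volume a b.
Proof.
rewrite /box_volume [X in X + _](bigD1 i)//= [X in _ + X](bigD1 i)//= [RHS](bigD1 i)//=.
rewrite !mxE eqxx.
rewrite (eq_bigr (fun j => Num.max 0 (b 0 j - a 0 j))); last first.
  by move=> j /negbTE ji; rewrite mxE ji.
rewrite [X in _ + _ * X](eq_bigr (fun j => Num.max 0 (b 0 j - a 0 j))); last first.
  by move=> j /negbTE ji; rewrite mxE ji.
rewrite -mulrDl; congr (_ * _).
by case: (leP (b 0 i) t) => ?; case: (leP (a 0 i) t) => ?; do 3?[case: (leP 0 _) => ?]; lra.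
Qed.

(** Cutting every box of a cover along the hyperplane yields covers of the two parts of the test set
    with the same total volume. *)
Lemma halfspace_caratheodory i (t : R) :
  caratheodory_measurable (@lebesgue_outer R N) [set x | x 0 i < t].
Proof.
apply: le_caratheodory_measurable => X.
apply: le_ereal_inf_tmp => _ [D [a [b [cB ->]]]].
apply: (@le_trans _ _ (\esum_(k in D) (box_volume (a k) (upd (b k) i (Num.min (b k 0 i) t)))%:E +
   \esum_(k in D) (box_volume (upd (a k) i (Num.max (a k 0 i) t)) (b k))%:E)%E).
  apply: leeD; apply: ereal_inf_lbound.
    exists D, a, (fun k => upd (b k) i (Num.min (b k 0 i) t)); split => //.
    move=> x [Xx xt]; have [k Dk xk] := cB _ Xx; exists k => // j.
    rewrite mxE; case: eqP => [->|_]; last exact: xk.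
    have /andP[-> xb] := xk i; rewrite /= le_min xb/=; exact: ltW.
  exists D, (fun k => upd (a k) i (Num.max (a k 0 i) t)), b; split => //.
  move=> x [Xx xt]; have [k Dk xk] := cB _ Xx; exists k => // j.
  rewrite mxE; case: eqP => [->|_]; last exact: xk.
  have /andP[ax ->] := xk i; rewrite /= andbT ge_max ax/= leNgt; exact/negP.
rewrite -esumD; [|by move=> *; exact: box_volume_ge0..].
by apply: le_esum => k _; rewrite -EFinD box_volume_split.
Qed.

Lemma measurable_coord (i : 'I_N) :
  measurable_fun (setT : set (lebesgue_space R N))
    (fun x : lebesgue_space R N => (x : 'rV[R]_N) 0 i).
Proof.
apply: (measurability _ (RGenCInfty.measurableE R)) => _ [_ [a ->] <-].
rewrite setTI.
have -> : (fun x : lebesgue_space R N => (x : 'rV[R]_N) 0 i) @^-1` `[a, +oo[ =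
  ~` [set x : lebesgue_space R N | (x : 'rV[R]_N) 0 i < a].
  by apply/seteqP; split => x; rewrite /= in_itv/= andbT leNgt => /negP.
apply: measurableC; exact: (halfspace_caratheodory i a).
Qed.

Lemma measurable_coord_itv (J : 'I_N -> interval R) :
  mset [set x : 'rV[R]_N | forall i, x 0 i \in J i].
Proof.
have -> : [set x : 'rV[R]_N | forall i, x 0 i \in J i] =
    \bigcap_(i in [set: 'I_N]) ((fun x : 'rV[R]_N => x 0 i) @^-1` [set` J i]).
  by apply/seteqP; split => x /= xJ i; [move=> _; exact: xJ|exact: xJ].
apply: fin_bigcap_measurable => // i _.
rewrite -[X in measurable X]setTI; apply: (measurable_coord i) => //.
Qed.

Lemma open_mset A : open A -> mset A.
Proof.
move=> oA.
pose d (n : nat) : R := n.+1%:R^-1.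
pose B (q : 'rV[rat]_N * nat) : set 'rV[R]_N :=
  [set x | forall i, x 0 i \in `]ratr (q.1 0 i) - d q.2, ratr (q.1 0 i) + d q.2[].
have -> : A = \bigcup_(q in [set q | B q `<=` A]) B q.
  apply/seteqP; split => [x Ax|x [q /= BA Bx]]; last exact: BA.
  have [e /= e0 xeA] := (iffLR (nbhs_ballP _ _) (open_nbhs_nbhs (conj oA Ax))).
  have [n ne] : exists n : nat, d n < e / 2.
    have := near_infty_natSinv_lt (PosNum (divr_gt0 e0 (ltr0n R 2))).
    by move=> [n _ /(_ n)]/= h; exists n; apply: h.
  have nn0 : 0 < d n by rewrite invr_gt0 ltr0n.
  have /choice[q Hq] : forall i : 'I_N, exists q : rat,
      (ratr q : R) \in `]x 0 i - d n, x 0 i + d n[.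
    move=> i; apply: rat_in_itvoo; lra.
  exists (\row_i q i, n).
  - move=> y /= By; apply: xeA; rewrite -ball_normE /=. apply: norm_rV_lt => // i; rewrite !mxE.
    have := By i; have := Hq i; rewrite !in_itv/= mxE ltr_norml => /andP[? ?] /andP[? ?]. pos.
  - move=> i /=; rewrite mxE; have := Hq i; rewrite !in_itv/= => /andP[? ?]. pos.
rewrite bigcup_mkcond; apply: countable_bigcupT_measurable => [|q]; first exact: countableP.
case: ifP => _; last exact: measurable0.
 exact: measurable_coord_itv.
Qed.

Lemma closed_mset A : closed A -> mset A.
Proof.
move=> cA; rewrite -[A]setCK.
apply: (measurableC (_ : mset (~` A))); apply: open_mset; exact: closed_openC.
Qed.

(** Half-open, so that the dyadic children are disjoint and cover the cube exactly. *)
Definition cube c (r : R) : set 'rV[R]_N :=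
  [set x | forall i, c 0 i <= x 0 i < c 0 i + r].

Lemma cube_mset c r : mset (cube c r).
Proof.
have -> : cube c r = [set x | forall i, x 0 i \in `[c 0 i, c 0 i + r[ ].
  by apply/seteqP; split => x /= h i; have := h i; rewrite in_itv.
exact: measurable_coord_itv.
Qed.

Lemma leb_box_le a b : (leb R N (box a b) <= (box_volume a b)%:E)%E.
Proof.
apply: ereal_inf_lbound; exists [set 0%N], (fun=> a), (fun=> b); split.
  by move=> x xb; exists 0%N.
by rewrite esum_set1// box_volume_ge0.
Qed.

Lemma leb_cube_fin c r : (leb R N (cube c r) < +oo)%E.
Proof.
apply: (@le_lt_trans _ _ (box_volume c (\row_i (c 0 i + r)))%:E); last exact: ltry.
apply: le_trans (leb_box_le _ _); apply: le_lebesgue_outer => x h i.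
by have /andP[-> /ltW] := h i; rewrite mxE.
Qed.

Lemma lebesgue_outer_shift A h : lebesgue_outer [set x | A (x + h)] = lebesgue_outer A.
Proof.
suff S : forall (A : set 'rV[R]_N) (h : 'rV[R]_N),
    (lebesgue_outer [set x | A (x + h)%R] <= lebesgue_outer A)%E.
  apply/eqP; rewrite eq_le S/=.
  have := S [set x | A (x + h)] (- h); congr (lebesgue_outer _ <= _)%E.
  by apply/seteqP; split => x /=; rewrite subrK.
move=> {}A {}h; apply: le_ereal_inf_tmp => _ [D [a [b [cB ->]]]].
apply: ereal_inf_lbound; exists D, (fun k => a k - h), (fun k => b k - h); split.
  move=> x /= /cB[k Dk xk]; exists k => // i; have := xk i; rewrite !mxE.
  pos.
apply: eq_esum => k _; congr (_%:E); apply: eq_bigr => i _; rewrite !mxE.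
by congr Num.max; lra.
Qed.

Lemma shift_mset A h : mset A -> mset [set x | A (x + h)].
Proof.
move=> mA; have {}mA : caratheodory_measurable (@lebesgue_outer R N) A := mA.
suff : caratheodory_measurable (@lebesgue_outer R N) [set x | A (x + h)] by [].
move=> X; rewrite -[LHS](lebesgue_outer_shift _ (- h)) [LHS](mA [set x | X (x - h)]).
congr (_ + _)%E; rewrite -[RHS](lebesgue_outer_shift _ (- h)); congr lebesgue_outer;
by apply/seteqP; split => x /=; rewrite subrK.
Qed.

Lemma int_shift D (f : 'rV[R]_N -> \bar R) h : mset D ->
  emfun D f -> (forall x, D x -> 0 <= f x)%E ->
  (\int[leb R N]_(x in [set x | D (x + h)%R]) f (x + h)%R = \int[leb R N]_(x in D) f x)%E.
Proof.
move=> mD mf f0.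
pose phi : lebesgue_space R N -> lebesgue_space R N := fun x => (x : 'rV[R]_N) + h.
have mphi : measurable_fun setT phi.
  by move=> _ B mB; rewrite setTI; exact: shift_mset.
rewrite -(ge0_integral_pushforward mphi (leb R N) mD mf); last first.
  by move=> x /[!inE]; exact: f0.
apply: eq_measure_integral => B mB _; rewrite /pushforward.
exact: lebesgue_outer_shift.
Qed.

Lemma leb_shift A h : leb R N [set x | A (x + h)] = leb R N A.
Proof. exact: lebesgue_outer_shift. Qed.

Lemma open_continuous_mfun A (f : 'rV[R]_N -> R) : open A ->
  (forall x, A x -> {for x, continuous f}) -> lmfun A f.
Proof.
move=> oA cf; apply: (measurability _ (RGenOpens.measurableE R)).
move=> _ [_ [a [b ->] <-]].
apply: (@open_mset (A `&` f @^-1` `]a, b[)).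
rewrite openE => x [Ax fx]; apply: filterI; first exact: open_nbhs_nbhs.
apply: cf => //; apply: open_nbhs_nbhs; split => //; exact: interval_open.
Qed.

Lemma continuous_mfun (f : 'rV[R]_N -> R) D : continuous f -> mset D ->
  lmfun D f.
Proof.
move=> cf mD; apply: (@measurable_funS _ _ _ _ setT) => //.
by apply: (@open_continuous_mfun setT); [exact: (@openT 'rV[R]_N)|]; by move=> x _; exact: cf.
Qed.

Definition child_corner c (r : R) (b : {ffun 'I_N -> bool}) : 'rV[R]_N :=
  \row_i (c 0 i + if b i then r / 2 else 0).

Definition child c (r : R) b := cube (child_corner c r b) (r / 2).

Lemma cube_split c r : 0 < r ->
  cube c r = \big[setU/set0]_(b <- enum {: {ffun 'I_N -> bool}}) child c r b.
Proof.
move=> r0; rewrite -bigcup_seq; apply/seteqP; split => x.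
  move=> xc; exists [ffun i => c 0 i + r / 2 <= x 0 i].
    by rewrite /= mem_enum.
  move=> i; rewrite !mxE ffunE; have /andP[? ?] := xc i.
  by case: (leP (c 0 i + r / 2) (x 0 i)) => ?; lra.
move=> [b _ xb] i; have := xb i; rewrite !mxE.
by case: ifP => _ /andP[? ?]; lra.
Qed.

Lemma trivIset_child c r : 0 < r -> trivIset setT (child c r).
Proof.
move=> r0 b1 b2 _ _ [x [x1 x2]]; apply/ffunP => i.
have := x1 i; have := x2 i; rewrite !mxE.
by case: (b1 i); case: (b2 i) => // /andP[? ?] /andP[? ?]; lra.
Qed.

Lemma ge0_int_cube_split c r (f : 'rV[R]_N -> \bar R) : 0 < r -> emfun (cube c r) f ->
  (forall x, cube c r x -> 0 <= f x)%E ->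
  (\int[leb R N]_(x in cube c r) f x =
   \sum_(b : {ffun 'I_N -> bool}) \int[leb R N]_(x in child c r b) f x)%E.
Proof.
move=> r0 mf f0; rewrite cube_split // in mf f0 *.
rewrite ge0_integral_bigsetU //.
- by rewrite big_enum.
- by move=> b; exact: cube_mset.
- exact: enum_uniq.
- by move=> b1 b2 _ _; exact: trivIset_child.
Qed.

Lemma child_sub c r b : 0 < r -> child c r b `<=` cube c r.
Proof.
move=> r0 x xb i; have := xb i; rewrite !mxE.
by case: ifP => _ /andP[? ?]; lra.
Qed.

Definition vol (r : R) : R := fine (leb R N (cube 0 r)).

Lemma leb_cube c r : leb R N (cube c r) = (vol r)%:E.
Proof.
rewrite /vol fineK; last by rewrite ge0_fin_numE// leb_cube_fin.
rewrite -(leb_shift (cube 0 r) (- c)); congr (leb R N _); apply/seteqP.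
by split => x /= h i; have := h i; rewrite !mxE => ?; lra.
Qed.

Lemma vol_ge0 r : 0 <= vol r.
Proof. by rewrite fine_ge0// measure_ge0. Qed.

Lemma le_vol r s : r <= s -> vol r <= vol s.
Proof.
move=> rs; rewrite -lee_fin -!(leb_cube 0); apply: le_lebesgue_outer => x h i.
by have /andP[-> ?] := h i; lra.
Qed.

Lemma int_cst1 D : mset D -> (\int[leb R N]_(x in D) (cst 1%:E x) = leb R N D)%E.
Proof. by move=> mD; rewrite integral_cst// mul1e. Qed.

(** The 2^N children partition the cube and are translates of each other. *)
Lemma vol_half r : 0 < r -> vol (r / 2) = vol r / 2 ^+ N.
Proof.
move=> r0.
have : (\int[leb R N]_(x in cube 0 r) (cst 1%:E x) =
   \sum_(b : {ffun 'I_N -> bool}) \int[leb R N]_(x in child 0 r b) (cst 1%:E x))%E.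
  by apply: ge0_int_cube_split => //; exact: measurable_cst.
rewrite int_cst1 ?leb_cube; last exact: cube_mset.
rewrite (eq_bigr (fun=> (vol (r / 2))%:E)); last first.
  by move=> b _; rewrite int_cst1 ?leb_cube//; exact: cube_mset.
rewrite sumEFin sumr_const => -[->].
have -> : #|xpredT : pred {ffun 'I_N -> bool}| = (2 ^ N)%N.
  by rewrite (eq_card (B := {: {ffun 'I_N -> bool}})) // card_ffun card_bool card_ord.
by rewrite -[_ *+ (2 ^ N)]mulr_natr natrX mulfK// expf_neq0// pnatr_eq0.
Qed.

Lemma vol_half_iter r k : 0 < r -> vol (r / 2 ^+ k) = vol r / 2 ^+ (N * k).
Proof.
move=> r0; elim: k => [|k ih]; first by rewrite muln0 !expr0 !divr1.
rewrite exprSr invfM mulrA vol_half ?ih; last pos.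
by rewrite mulnS exprD invfM; ring.
Qed.

End lebesgue_measurability.
#[global] Hint Extern 1 (is_true (0 <= vol _ _)) => exact: vol_ge0 : nonneg.

(** * Monotonicity of the integral almost everywhere *)

Section integral_monotonicity.
Context d (T : measurableType d) {R : realType} (m : {measure set T -> \bar R}).
Implicit Types (D : set T) (f g : T -> \bar R).

Import HBNNSimple.

Local Definition nn f := ereal_sup [set sintegral m h | h in [set h : {nnsfun T >-> R} |
  forall x, ((h x)%:E <= f x)%E]].

(** A simple function below [f] is multiplied by the indicator of the complement of the exceptional
    set: its integral does not change, and it now lies below [g] everywhere. *)
Lemma nn_le_ae f g : (forall x, 0 <= g x)%E -> {ae m, forall x, f x <= g x}%E ->
  (nn f <= nn g)%E.
Proof.
move=> g0 [Z [mZ Z0 fgZ]]; apply: ge_ereal_sup => _ [h /= hf <-].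
have mC : measurable (~` Z) by exact: measurableC.
have -> : sintegral m h = sintegral m (proj_nnsfun h mC).
  rewrite -!integralT_nnsfun; apply: ae_eq_integral => //.
  - exact/measurable_EFinP.
  - exact/measurable_EFinP.
  exists Z; split => // x /= /not_implyP[_ hx]; apply: contrapT => Zx; apply: hx.
  by rewrite /= /mindic/= indicE mem_set// mulr1.
apply: ereal_sup_ubound; exists (proj_nnsfun h mC) => //= x.
rewrite /= /mindic/= indicE; case: (boolP (x \in ~` Z)) => [|_]; last by rewrite mulr0.
rewrite mulr1 inE => Zx; apply: le_trans (hf x) _; apply: contrapT => nfg.
by apply: Zx; apply: fgZ.
Qed.

(** Here [f] and [g] are arbitrary functions, since only the simple functions below them are
    modified on a null set. In [energy_test] both integrands of the weak equation are compared with
    integrable functions in this way. *)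
Lemma le_integral_ae D f g :
  {ae m, forall x, D x -> f x <= g x}%E ->
  (\int[m]_(x in D) f x <= \int[m]_(x in D) g x)%E.
Proof.
move=> [Z [mZ Z0 fg]]; rewrite /integral; apply: leeB; apply: nn_le_ae.
- pos.
- exists Z; split => // x /= fgx; apply: fg => /= DZ; apply: fgx.
  rewrite !funeposE/= !patchE; case: ifPn => // /[!inE] /DZ fgx.
  by rewrite ge_max !le_max fgx lexx orbT.
- pos.
- exists Z; split => // x /= fgx; apply: fg => /= DZ; apply: fgx.
  rewrite !funenegE/= !patchE; case: ifPn => // /[!inE] /DZ fgx.
  by rewrite ge_max !le_max leeN2 fgx lexx orbT.
Qed.

Lemma eq_integral_ae D f g :
  {ae m, forall x, D x -> f x = g x} ->
  (\int[m]_(x in D) f x = \int[m]_(x in D) g x)%E.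
Proof.
move=> fg; apply/eqP; rewrite eq_le; apply/andP; split; apply: le_integral_ae;
by apply: filterS fg => x /= h /h ->.
Qed.

End integral_monotonicity.

(** * Pointwise Lipschitz constants *)

Section slope.
Context {R : realType} {V : normedModType R}.
Implicit Types (v w : V -> R) (x y : V) (g k e : R) (F : R -> R).

(** An upper bound [g] for the pointwise Lipschitz constant of [v] at [x], in the maximum norm. It
    stands for the length of the gradient when [v] need not be differentiable. *)
Definition slope v x g :=
  forall e, 0 < e -> \forall y \near x, `|v y - v x| <= (g + e) * `|y - x|.

Lemma slope_le v x g k : g <= k -> slope v x g -> slope v x k.
Proof.
move=> gk vg e /vg; apply: filterS => y /le_trans; apply.
by rewrite ler_wpM2r// lerD2r.
Qed.

Lemma slope_near v w x g : (\forall y \near x, v y = w y) -> slope v x g -> slope w x g.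
Proof.
move=> vw vg e e0; have vwx := nbhs_singleton vw.
by apply: filterS2 vw (vg _ e0) => y <-; rewrite -vwx.
Qed.

Lemma slope_lip v x g : (\forall y \near x, `|v y - v x| <= g * `|y - x|) -> slope v x g.
Proof.
move=> vg e e0; apply: filterS vg => y /le_trans; apply.
by rewrite ler_wpM2r// lerDl ltW.
Qed.

Lemma slope_cst (c : R) x : slope (fun=> c) x 0.
Proof. by apply: slope_lip; near=> y; rewrite subrr normr0 mul0r. Unshelve. all: end_near. Qed.

Lemma slope_continuous v x g : slope v x g -> {for x, continuous v}.
Proof.
move=> vg; apply/cvgrPdist_le => e e0.
pose K := `|g| + 1; have K0 : 0 < K by rewrite ltr_wpDl.
have d0 : 0 < e / K by rewrite divr_gt0.
near=> y; rewrite distrC.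
via ((g + 1) * `|y - x|); first by near: y; exact: vg.
via (K * `|y - x|).
  by rewrite ler_wpM2r// lerD2r ler_norm.
rewrite -ler_pdivlMl// mulrC distrC.
near: y; apply/nbhs_normP; exists (e / K) => // y /= /ltW; by [].
Unshelve. all: end_near. Qed.

Lemma slopeD v w x g k : slope v x g -> slope w x k -> slope (fun y => v y + w y) x (g + k).
Proof.
move=> vg wk e e0; have e2 : 0 < e / 2 by lra.
apply: filterS2 (vg _ e2) (wk _ e2) => y h1 h2.
have -> : v y + w y - (v x + w x) = (v y - v x) + (w y - w x) by ring.
apply: le_trans (ler_normD _ _) _; apply: le_trans (lerD h1 h2) _.
lra.
Qed.

Lemma slope_sum (I : Type) (r : seq I) (v : I -> V -> R) x (g : I -> R) :
  (forall i, slope (v i) x (g i)) ->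
  slope (fun y => \sum_(i <- r) v i y) x (\sum_(i <- r) g i).
Proof.
move=> vg; elim: r => [|i r ih].
  under [X in slope X]funext => y do rewrite big_nil.
  by rewrite big_nil; exact: slope_cst.
under [X in slope X]funext => y do rewrite big_cons.
by rewrite big_cons; exact: slopeD.
Qed.

Lemma slopeM v w x g k : 0 <= g -> 0 <= k -> slope v x g -> slope w x k ->
  slope (fun y => v y * w y) x (`|v x| * k + `|w x| * g).
Proof.
move=> g0 k0 vg wk e e0.
pose a := `|v x| + `|w x| + g + 2.
have a0 : 0 < a by rewrite /a; have := normr_ge0 (v x); have := normr_ge0 (w x); lra.
pose d := Num.min 1 (e / a).
have d0 : 0 < d by rewrite lt_min ltr01 divr_gt0.
have da : d * a <= e by rewrite -ler_pdivlMr// ge_min lexx orbT.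
have d1 : d <= 1 by rewrite ge_min lexx.
have /cvgrPdist_le/(_ _ d0) cw := slope_continuous wk.
apply: filterS3 (vg _ d0) (wk _ d0) cw => y h1 h2 h3.
have -> : v y * w y - v x * w x = v x * (w y - w x) + w y * (v y - v x) by ring.
apply: le_trans (ler_normD _ _) _; rewrite !normrM.
have wy : `|w y| <= `|w x| + d.
  have -> : w y = w x - (w x - w y) by ring.
  by apply: le_trans (ler_normB _ _) _; rewrite lerD2l.
via (`|v x| * ((k + d) * `|y - x|) + (`|w x| + d) * ((g + d) * `|y - x|)).
  by apply: lerD; [rewrite ler_wpM2l|rewrite ler_pM].
rewrite !mulrA -mulrDl ler_wpM2r//.
have := normr_ge0 (v x); have := normr_ge0 (w x); rewrite /a in da.
have : d * d <= d by rewrite ler_piMl// ltW.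
nra.
Qed.

Lemma slope_comp v x g F k : 0 <= g -> 0 <= k -> slope v x g ->
  (forall e, 0 < e -> \forall s \near (v x), `|F s - F (v x)| <= (k + e) * `|s - v x|) ->
  slope (F \o v) x (k * g).
Proof.
move=> g0 k0 vg Fk e e0.
pose a := k + g + 1.
have a0 : 0 < a by rewrite /a; lra.
pose d := Num.min 1 (e / a).
have d0 : 0 < d by rewrite lt_min ltr01 divr_gt0.
have da : d * a <= e by rewrite -ler_pdivlMr// ge_min lexx orbT.
have d1 : d <= 1 by rewrite ge_min lexx.
have cF : \forall y \near x, `|F (v y) - F (v x)| <= (k + d) * `|v y - v x|.
  exact: (slope_continuous vg (Fk _ d0)).
apply: filterS2 cF (vg _ d0) => y h1 h2 /=.
apply: le_trans h1 _; via ((k + d) * ((g + d) * `|y - x|)).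
  by rewrite ler_wpM2l//; lra.
rewrite mulrA ler_wpM2r//; rewrite /a in da.
have : d * d <= d by rewrite ler_piMl// ltW.
nra.
Qed.

End slope.

Lemma slope_derive {R : realType} (F : R -> R) (a d : R) : is_derive a 1 F d -> slope F a `|d|.
Proof.
move=> [dF <-] e e0.
have /cvgrPdist_le/(_ _ e0) h : h^-1 *: ((F \o shift a) (h *: 1) - F a) @[h --> 0^'] -->
  'D_1 F a by exact: dF.
have {}h : \forall s \near a, s != a -> `|'D_1 F a - (s - a)^-1 * (F s - F a)| <= e.
  have /nbhs_normP[r /= r0 hr] : \forall t \near (0 : R), t != 0 ->
    `|'D_1 F a - t^-1 *: ((F \o shift a) (t *: 1) - F a)| <= e by exact: h.
  apply/nbhs_normP; exists r => // s /= sa sna.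
  have := hr (s - a); rewrite /= sub0r normrN distrC subr_eq0 /GRing.scale/= mulr1 subrK.
  by apply.
apply: filterS h => s.
have [->|sa] := eqVneq s a; first by move=> _; rewrite !subrr !normr0 mulr0.
move=> /(_ isT); have sa0 : 0 < `|s - a| by rewrite normr_gt0 subr_eq0.
move=> H; rewrite -ler_pdivrMr//.
rewrite -normf_div [in X in X <= _]mulrC.
have -> : (s - a)^-1 * (F s - F a) = 'D_1 F a - ('D_1 F a - (s - a)^-1 * (F s - F a)) by ring.
by apply: le_trans (ler_normB _ _) _; rewrite lerD2l.
Qed.

Lemma slope_comp_derive {R : realType} {V : normedModType R} (v : V -> R) x g F (d : R) :
  0 <= g -> slope v x g -> is_derive (v x) 1 F d -> slope (F \o v) x (`|d| * g).
Proof.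
by move=> g0 vg /slope_derive Fd; apply: slope_comp => //; exact: Fd.
Qed.

Section lipschitz.
Context {R : realType} {V : normedModType R}.

(** Continuous induction along the segment from x to y: with a slack e, the set of parameters at
    which the bound holds contains its supremum, and a supremum below 1 could be passed. *)
Lemma bounded_slope_lipschitz (v : V -> R) (C : R) : 0 <= C ->
  (forall x, slope v x C) -> forall x y, `|v y - v x| <= C * `|y - x|.
Proof.
move=> C0 vC x y; apply/ler_addgt0Pr => e' e'0.
pose D := `|y - x|.
pose e := e' / (D + 1).
have D0 : 0 <= D by exact: normr_ge0.
have e0 : 0 < e by rewrite divr_gt0// ltr_wpDl.
have eD : e * D <= e'.
  by rewrite /e mulrAC ler_pdivrMr ?ltr_wpDl//; rewrite ler_wpM2l ?ltW// ltrDl.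
suff : `|v y - v x| <= (C + e) * D by move=> /le_trans; apply; rewrite mulrDl lerD2l.
pose p t := x + t *: (y - x).
pose S := [set t : R | 0 <= t <= 1 /\ `|v (p t) - v x| <= (C + e) * (t * D)].
have S0 : S 0 by split; [pos|rewrite /p scale0r addr0 subrr normr0 !mul0r mulr0].
have hS : has_sup S.
  by split; [exists 0|exists 1 => t [/andP[]]].
pose s := sup S.
have s01 : 0 <= s <= 1.
  by rewrite (ub_le_sup (proj2 hS)) //=; apply: ge_sup; [exists 0|move=> t [/andP[]]].
have pd t r : `|p t - p r| = `|t - r| * D.
  by rewrite /p opprD addrACA subrr add0r -scalerBl normrZ.
have /nbhs_normP[d /= d0 nd] := vC (p s) _ e0.
have D1 : 0 < D + 1 by rewrite ltr_wpDl.
pose d' := d / (D + 1).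
have d'0 : 0 < d' by rewrite divr_gt0.
have step t : `|t - s| < d' -> `|v (p t) - v (p s)| <= (C + e) * (`|t - s| * D).
  move=> ts; rewrite -pd; apply: nd; rewrite /= distrC pd.
  apply: (@le_lt_trans _ _ (`|t - s| * (D + 1))); first by rewrite ler_wpM2l// lerDl.
  by rewrite -ltr_pdivlMr.
have Ss : `|v (p s) - v x| <= (C + e) * (s * D).
  have [t [t01 St] st] := sup_adherent d'0 hS.
  have ts : t <= s by exact: (ub_le_sup (proj2 hS)).
  have h := step t; rewrite distrC ger0_norm ?subr_ge0// in h.
  have {}h := h _; have : s - t < d' by rewrite /s; lra.
  move=> /h {}h.
  have -> : v (p s) - v x = (v (p t) - v x) - (v (p t) - v (p s)) by ring.
  apply: le_trans (ler_normB _ _) _; apply: le_trans (lerD St h) _.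
  by rewrite (_ : _ + _ = (C + e) * (s * D)) //; ring.
have [s1|s1] := ltP s 1; last first.
  have s1' : s = 1 by lra.
  by move: Ss; rewrite s1' mul1r /p scale1r addrCA subrr addr0.
pose t := Num.min 1 (s + d' / 2).
have st : s < t by rewrite lt_min s1 ltrDl divr_gt0.
have td' : t <= s + d' / 2 by rewrite ge_min lexx orbT.
have td : t - s < d' by lra.
have t1 : t <= 1 by rewrite ge_min lexx.
have St : S t.
  split; first pos.
  have := step t; rewrite ger0_norm ?subr_ge0 ?(ltW st)// => /(_ td) h.
  have -> : v (p t) - v x = (v (p s) - v x) + (v (p t) - v (p s)) by ring.
  apply: le_trans (ler_normD _ _) _; apply: le_trans (lerD Ss h) _.
  by rewrite (_ : _ + _ = (C + e) * (t * D)) //; ring.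
by have := ub_le_sup (proj2 hS) St; rewrite -/s leNgt st.
Qed.

End lipschitz.

Section C1_slope.
Context {R : realType} {N : nat}.
Implicit Types (phi : 'rV[R]_N -> R) (x y z : 'rV[R]_N).

Lemma is_derive_line phi (z e : 'rV[R]_N) (t d : R) :
  derivable phi (z + (t * d) *: e) e ->
  is_derive t 1 (fun s => phi (z + (s * d) *: e)) (d * 'D_e phi (z + (t * d) *: e)).
Proof.
move=> dphi.
have h1 : is_derive (t * d) 1 (fun s => phi (z + s *: e)) ('D_e phi (z + (t * d) *: e)).
  have E : (fun h : R => h^-1 *: (((fun s => phi (z + s *: e)) \o shift (t * d)) (h *: 1) -
      phi (z + (t * d) *: e))) =
      (fun h : R => h^-1 *: ((phi \o shift (z + (t * d) *: e)) (h *: e) -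
      phi (z + (t * d) *: e))).
    apply/funext => h; congr (_ *: (phi _ - _)) => /=.
    by rewrite [h *: 1]mulr1 scalerDl addrA addrAC addrC addrA.
  by split; rewrite /derivable /derive E.
have h2 : is_derive t 1 (fun s : R => s * d) d.
  have -> : (fun s : R => s * d) = (d \*: @id R) by apply/funext => s /=; rewrite mulrC.
  by apply: is_derive_eq; rewrite /GRing.scale/= mulr1.
rewrite mulrC.
exact: (@is_derive1_comp R (fun s => phi (z + s *: e)) (fun s => s * d) t _ _ h1 h2).
Qed.

(** The sum of absolute values is the norm dual to the maximum norm. Passing from x to y one
    coordinate at a time, each increment is a partial derivative at an intermediate point, by the
    mean value theorem. *)
Lemma C1_slope phi x : (forall i z, derivable phi z (delta_mx 0 i)) ->
  (forall i, {for x, continuous (partial i phi)}) ->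
  slope phi x (\sum_i `|partial i phi x|).
Proof.
move=> dphi cphi.
pose zz (y : 'rV[R]_N) (k : nat) : 'rV[R]_N := \row_i (if (i < k)%N then y 0 i else x 0 i).
have E y : phi y = phi x + \sum_(i < N) (phi (zz y i.+1) - phi (zz y i)).
  rewrite -(big_mkord xpredT (fun i => phi (zz y i.+1) - phi (zz y i))) telescope_sumr//.
  have -> : zz y N = y by apply/rowP => i; rewrite mxE ltn_ord.
  have -> : zz y 0 = x by apply/rowP => i; rewrite mxE.
  by rewrite addrC subrK.
suff S (i : 'I_N) : slope (fun y => phi (zz y i.+1) - phi (zz y i)) x `|partial i phi x|.
  have := slopeD (slope_cst (phi x) x) (slope_sum (index_enum 'I_N) S).
  by rewrite add0r; apply: slope_near; near=> y; rewrite -E.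
have zzx k : zz x k = x by apply/rowP => j; rewrite mxE if_same.
move=> e e0; rewrite !zzx subrr.
have /cvgrPdist_le/(_ _ e0)/nbhs_normP[d /= d0 nd] := cphi i.
apply/nbhs_normP; exists d => //= y xy; rewrite subr0.
pose dl := y 0 i - x 0 i.
have zE : zz y i.+1 = zz y i + dl *: delta_mx 0 i.
  apply/rowP => j; rewrite !mxE eqxx/= ltnS leq_eqVlt.
  have [->|ij] := eqVneq j i; first by rewrite eqxx ltnn /= mulr1 addrC subrK.
  by rewrite (inj_eq val_inj) (negbTE ij) /= mulr0 addr0.
have dh (t : R) : is_derive t 1 (fun s : R => phi (zz y i + (s * dl) *: delta_mx 0 i))
    (dl * 'D_(delta_mx 0 i) phi (zz y i + (t * dl) *: delta_mx 0 i)).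
  exact: is_derive_line.
have [t t01] : exists2 t, t \in `[(0 : R), 1] &
    phi (zz y i + (1 * dl) *: delta_mx 0 i) - phi (zz y i + (0 * dl) *: delta_mx 0 i) =
    dl * 'D_(delta_mx 0 i) phi (zz y i + (t * dl) *: delta_mx 0 i) * (1 - 0).
  apply: (@MVT_segment _ (fun s : R => phi (zz y i + (s * dl) *: delta_mx 0 i))) => //.
  apply: derivable_within_continuous => s _; exact: ex_derive.
rewrite mul1r mul0r scale0r addr0 -zE => ->.
rewrite subr0 mulr1 normrM mulrC.
have dly : `|dl| <= `|y - x| by rewrite /dl; have := norm_coord (y - x) i; rewrite !mxE.
apply: ler_pM => //.
rewrite -/(partial i phi _).
set z := (X in partial i phi X).
have zx : ball_ Num.Def.normr x d z.
  rewrite /ball_/=; apply: le_lt_trans xy; apply: norm_rV_le => // j.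
  move: t01; rewrite in_itv/= => /andP[t0 t1].
  rewrite !mxE eqxx/=.
  have := norm_coord (x - y) j; rewrite !mxE => xyj.
  have [ji|ij] := eqVneq j i.
    rewrite ji ltnn mulr1; have := norm_coord (x - y) i; rewrite !mxE; apply: le_trans.
    have -> : x 0 i - (x 0 i + t * dl) = t * (x 0 i - y 0 i) by rewrite /dl; ring.
    by rewrite normrM ger0_norm// ler_piMl.
  by case: ifP => _; rewrite mulr0 addr0// subrr normr0.
have := nd _ zx => H.
have -> : partial i phi z = partial i phi x - (partial i phi x - partial i phi z) by ring.
by apply: le_trans (ler_normB _ _) _; rewrite lerD2l.
Unshelve. all: end_near. Qed.

End C1_slope.

(** * Real-valued integrals and their translation and subdivision *)

Section Rintegral_theory.
Context d (T : measurableType d) {R : realType} (m : {measure set T -> \bar R}).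
Implicit Types (D E : set T) (f g h : T -> R) (k : R).

Definition itg D f := m.-integrable D (EFin \o f).
Definition Int D f : R := \int[m]_(x in D) f x.

Lemma itg_mfun D f : itg D f -> measurable_fun D f.
Proof. by move=> /integrableP[/measurable_EFinP]. Qed.

Lemma IntE D f : measurable D -> itg D f -> (\int[m]_(x in D) (f x)%:E)%E = (Int D f)%:E.
Proof. by move=> mD fi; rewrite fineK//; exact: (integrable_fin_num mD fi). Qed.

Lemma itg_bounded D f k : measurable D -> (m D < +oo)%E -> measurable_fun D f ->
  (forall x, D x -> `|f x| <= k) -> itg D f.
Proof.
move=> mD Doo mf fk; apply: measurable_bounded_integrable => //.
exists k; split; first exact: num_real.
by move=> M kM x /= Dx; apply: le_trans (fk _ Dx) _; exact: ltW.
Qed.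

Lemma itg_le D f g : measurable D -> measurable_fun D f ->
  (forall x, D x -> `|f x| <= g x) -> itg D g -> itg D f.
Proof.
move=> mD mf fg; apply: le_integrable => //; first exact/measurable_EFinP.
by move=> x Dx /=; rewrite lee_fin; apply: le_trans (fg _ Dx) _; exact: ler_norm.
Qed.

Lemma itgS D E f : measurable D -> measurable E -> E `<=` D -> itg D f -> itg E f.
Proof. by move=> mD mE; exact: integrableS. Qed.

Lemma itgD D f g : measurable D -> itg D f -> itg D g -> itg D (fun x => f x + g x).
Proof. move=> mD fi gi; exact: (integrableD mD fi gi). Qed.

Lemma itgB D f g : measurable D -> itg D f -> itg D g -> itg D (fun x => f x - g x).
Proof. move=> mD fi gi; exact: (integrableB mD fi gi). Qed.

Lemma itgZ D f k : measurable D -> itg D f -> itg D (fun x => k * f x).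
Proof. move=> mD; exact: (integrableZl mD k). Qed.

Lemma itgN D f : measurable D -> itg D f -> itg D (fun x => - f x).
Proof.
by move=> mD /(itgZ (-1) mD) /integrableP h; apply/integrableP; move: h;
  have -> : (fun x => -1 * f x) = (fun x => - f x) by apply/funext => x; rewrite mulN1r.
Qed.

Lemma itg_norm D f : measurable D -> itg D f -> itg D (fun x => `|f x|).
Proof. by move=> mD fi; exact: integrable_norm. Qed.

Lemma itg_cst D k : measurable D -> (m D < +oo)%E -> itg D (fun=> k).
Proof. by move=> mD Doo; apply: (@itg_bounded _ _ `|k|) => //; exact: measurable_cst. Qed.

Lemma itg_eq D f g : measurable D -> (forall x, D x -> f x = g x) -> itg D f -> itg D g.
Proof.
by move=> mD fg; apply: (eq_integrable mD) => x /[!inE] Dx /=; rewrite fg.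
Qed.

Lemma itg_sum D (I : Type) (s : seq I) (f : I -> T -> R) : measurable D ->
  (forall i, itg D (f i)) -> itg D (fun x => \sum_(i <- s) f i x).
Proof.
move=> mD fi; elim: s => [|i s ih].
  apply: (itg_eq (f := cst 0)) => //; last exact: integrable0.
  by move=> x _; rewrite big_nil.
by apply: (itg_eq (f := fun x => f i x + \sum_(j <- s) f j x)) => //;
  [move=> x _; rewrite big_cons|exact: itgD].
Qed.

Lemma eq_Int D f g : (forall x, D x -> f x = g x) -> Int D f = Int D g.
Proof. by move=> fg; apply: eq_Rintegral => x /[!inE]; exact: fg. Qed.

Lemma Int_ge0 D f : (forall x, D x -> 0 <= f x) -> 0 <= Int D f.
Proof. exact: Rintegral_ge0. Qed.

Lemma le_Int D f g : measurable D -> itg D f -> itg D g ->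
  (forall x, D x -> f x <= g x) -> Int D f <= Int D g.
Proof. exact: le_Rintegral. Qed.

Lemma IntD D f g : measurable D -> itg D f -> itg D g ->
  Int D (fun x => f x + g x) = Int D f + Int D g.
Proof. exact: RintegralD. Qed.

Lemma IntB D f g : measurable D -> itg D f -> itg D g ->
  Int D (fun x => f x - g x) = Int D f - Int D g.
Proof. exact: RintegralB. Qed.

Lemma IntZ D f k : measurable D -> itg D f -> Int D (fun x => k * f x) = k * Int D f.
Proof. by move=> mD fi; exact: RintegralZl. Qed.

Lemma Int_cst D k : measurable D -> Int D (fun=> k) = k * fine (m D).
Proof. by move=> mD; exact: Rintegral_cst. Qed.

Lemma Int_sum D (I : Type) (s : seq I) (f : I -> T -> R) : measurable D ->
  (forall i, itg D (f i)) ->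
  Int D (fun x => \sum_(i <- s) f i x) = \sum_(i <- s) Int D (f i).
Proof.
move=> mD fi; elim: s => [|i s ih].
  rewrite big_nil -[RHS](mul0r (fine (m D))) -Int_cst//.
  by apply: eq_Int => x _; rewrite big_nil.
rewrite big_cons -ih -IntD//; last exact: itg_sum.
by apply: eq_Int => x _; rewrite big_cons.
Qed.

Lemma Int_norm D f : measurable D -> itg D f -> `|Int D f| <= Int D (fun x => `|f x|).
Proof. exact: le_normr_Rintegral. Qed.

Lemma IntS D E f : measurable D -> measurable E -> E `<=` D -> itg D f ->
  (forall x, D x -> 0 <= f x) -> Int E f <= Int D f.
Proof.
move=> mD mE ED fi f0; rewrite -lee_fin -!IntE//; last exact: itgS fi.
by apply: ge0_subset_integral => //; case/integrableP: fi.
Qed.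

Lemma IntU D E f : measurable D -> measurable E -> [disjoint D & E] ->
  itg (D `|` E) f -> Int (D `|` E) f = Int D f + Int E f.
Proof. by move=> mD mE DE fi; exact: Rintegral_setU. Qed.

Lemma le_fine_measure D E : measurable D -> measurable E -> (m E < +oo)%E -> D `<=` E ->
  fine (m D) <= fine (m E).
Proof.
move=> mD mE Eoo DE.
have DEm : (m D <= m E)%E by apply: le_measure => //; rewrite inE.
apply: fine_le => //; rewrite ge0_fin_numE//; exact: le_lt_trans Eoo.
Qed.

Lemma fine_measureD D E : measurable D -> measurable E -> (m D < +oo)%E -> E `<=` D ->
  fine (m (D `\` E)) = fine (m D) - fine (m E).
Proof.
move=> mD mE Doo ED.
have fD : m D \is a fin_num by rewrite ge0_fin_numE.
have fE : m E \is a fin_num.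
  by rewrite ge0_fin_numE//; apply: le_lt_trans Doo; apply: le_measure => //; rewrite inE.
by rewrite measureD// (setIidr ED) fineB.
Qed.

Lemma IntS_restrict D E f : measurable D -> measurable E -> E `<=` D ->
  (forall x, D x -> ~ E x -> f x = 0) -> Int D f = Int E f.
Proof.
move=> mD mE ED f0; rewrite /Int (Rintegral_mkcond _ D) (Rintegral_mkcond _ E).
apply: eq_Rintegral => x _; rewrite !patchE.
case: (boolP (x \in D)) => Dx; case: (boolP (x \in E)) => // Ex.
- by apply: f0; [rewrite inE in Dx|move=> Ex'; move/negP: Ex; apply; rewrite inE].
- by exfalso; move/negP: Dx; apply; rewrite inE in Ex; rewrite inE; exact: ED.
Qed.

Lemma Int_markov D E f k : measurable D -> measurable E -> E `<=` D -> itg D f ->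
  (m E < +oo)%E ->
  (forall x, D x -> 0 <= f x) -> (forall x, E x -> k <= f x) -> k * fine (m E) <= Int D f.
Proof.
move=> mD mE ED fi Eoo f0 fk; rewrite -Int_cst//.
apply: le_trans (IntS mD mE ED fi f0); apply: le_Int => //; first exact: itg_cst.
exact: itgS fi.
Qed.

Lemma Int_dominated D (f_ : nat -> T -> R) f g : measurable D ->
  (forall n, measurable_fun D (f_ n)) -> measurable_fun D f ->
  {ae m, forall x, D x -> f_ ^~ x @ \oo --> f x} -> itg D g ->
  {ae m, forall x, D x -> forall n, `|f_ n x| <= g x} ->
  itg D f /\ Int D (f_ n) @[n --> \oo] --> Int D f.
Proof.
move=> mD mf_ mf ff gi fg.
have H1 n : measurable_fun D (EFin \o f_ n) by exact/measurable_EFinP.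
have H2 : measurable_fun D (EFin \o f) by exact/measurable_EFinP.
have H3 : {ae m, forall x, D x -> (EFin \o f_ n) x @[n --> \oo] --> (EFin \o f) x}.
  by apply: filterS ff => x h Dx; apply/cvg_EFin; [exact: nearW|exact: h].
have H4 : {ae m, forall x n, D x -> (`|(EFin \o f_ n) x| <= (EFin \o g) x)%E}.
  by apply: filterS fg => x h n Dx /=; rewrite lee_fin; exact: h.
have [fi _ fc] := dominated_convergence mD H1 H2 H3 gi H4.
split => //.
have fn n : itg D (f_ n).
  apply/integrableP; split; first exact/measurable_EFinP.
  case/integrableP: gi => _; apply: le_lt_trans; apply: le_integral_ae.
  apply: filterS fg => x h Dx /=; rewrite lee_fin; apply: le_trans (h Dx n) _.
  exact: ler_norm.
apply: fine_cvg; rewrite /= -/(Int D f) -IntE//; exact: fc.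
Qed.

Lemma Int_fatou D (f_ : nat -> T -> R) f k : measurable D ->
  (forall n, itg D (f_ n)) -> measurable_fun D f ->
  (forall n x, D x -> 0 <= f_ n x) ->
  {ae m, forall x, D x -> f_ ^~ x @ \oo --> f x} ->
  (forall n, Int D (f_ n) <= k) -> itg D f /\ Int D f <= k.
Proof.
move=> mD fi mf f0 ff fk.
have H : (\int[m]_(x in D) `|(f x)%:E| <= k%:E)%E.
  have F := @fatou _ _ _ m _ mD (fun n x => `|(f_ n x)%:E|)%E.
  via (\int[m]_(x in D) limn_einf (fun n => `|(f_ n x)%:E|))%E.
    apply: le_integral_ae; apply: filterS ff => x h Dx.
    have hx : (`|(f_ n x)%:E| @[n --> \oo] --> `|(f x)%:E|)%E.
      by apply/cvg_EFin; [exact: nearW|apply: cvg_norm; exact: h].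
    by rewrite (cvg_limn_einf_sup hx).1.
  apply: le_trans (F _ _) _.
  - by move=> n; apply: measurableT_comp => //; apply/measurable_EFinP; exact: itg_mfun.
  - pos.
  rewrite limn_einf_lim; apply: lime_le; first exact: is_cvg_einfs.
  apply: nearW => n; via (\int[m]_(x in D) `|(f_ n x)%:E|)%E.
    by apply: ereal_inf_lbound; exists n => /=.
  have -> : (\int[m]_(x in D) `|(f_ n x)%:E|)%E = (Int D (f_ n))%:E.
    rewrite -IntE//; apply: eq_integral => x /[!inE] Dx. by rewrite gee0_abs// lee_fin f0.
  by rewrite lee_fin.
have fint : itg D f.
  apply/integrableP; split; first exact/measurable_EFinP.
  exact: le_lt_trans H (ltry _).
split => //; rewrite -lee_fin -IntE//; apply: le_trans H.
by apply: le_integral_ae; apply: nearW => x _; exact: lee_abs.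
Qed.

End Rintegral_theory.

Section Lebesgue_Int.
Context {R : realType} {N : nat}.
Implicit Types (D : set 'rV[R]_N) (c h x : 'rV[R]_N) (f g v : 'rV[R]_N -> R) (r : R).

Notation mu := (leb R N).

Lemma normrDge0 r : 0 <= `|r| + r.
Proof. by have := ler_norm (- r); rewrite normrN; lra. Qed.

Lemma mfun_shift D f h : mset D -> lmfun D f ->
  lmfun [set x | D (x + h)] (fun x => f (x + h)).
Proof.
move=> mD mf _ B mB.
have := shift_mset h (mf mD B mB); congr measurable; by apply/seteqP; split.
Qed.

Lemma itg_shift D f h : mset D -> itg mu D f -> itg mu [set x | D (x + h)] (fun x => f (x + h)).
Proof.
move=> mD fi; have [mf foo] := integrableP _ _ _ fi; apply/integrableP; split.
  by apply/measurable_EFinP; apply: mfun_shift => //; exact/measurable_EFinP.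
have [ma _] := integrableP _ _ _ (itg_norm mD fi).
rewrite (@int_shift _ _ D (fun x => `|(f x)%:E|%E) h mD); [exact: foo|exact: ma|].
pos.
Qed.

Lemma Int_shift D f h : mset D -> lmfun D f -> (forall x, D x -> 0 <= f x) ->
  Int mu [set x | D (x + h)] (fun x => f (x + h)) = Int mu D f.
Proof.
move=> mD mf f0; rewrite /Int /Rintegral.
rewrite (@int_shift _ _ D (fun x => (f x)%:E) h mD) //; exact/measurable_EFinP.
Qed.

Lemma Int_shift_itg D f h : mset D -> itg mu D f ->
  Int mu [set x | D (x + h)] (fun x => f (x + h)) = Int mu D f.
Proof.
move=> mD fi.
have mf := itg_mfun fi.
have fa : itg mu D (fun x => `|f x|) by exact: itg_norm.
pose f1 x := `|f x| + f x.
have f1i : itg mu D f1 by exact: itgD.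
have E1 x : f x = f1 x - `|f x| by rewrite /f1 addrAC subrr add0r.
have mD' : mset [set x | D (x + h)] by exact: shift_mset.
transitivity (Int mu [set x | D (x + h)] (fun x => f1 (x + h) - `|f (x + h)|)).
  by apply: eq_Int => x _; rewrite -E1.
rewrite (@IntB _ _ _ mu _ (fun x => f1 (x + h)) (fun x => `|f (x + h)|)) //; last 2 first.
- exact: (itg_shift h mD f1i).
- exact: (itg_shift h mD fa).
rewrite (@Int_shift D f1) //; last 2 first.
- exact: itg_mfun f1i.
- by move=> x _; exact: normrDge0.
rewrite (@Int_shift D (fun x => `|f x|)) //; last exact: itg_mfun fa.
by rewrite -IntB//; apply: eq_Int => x _; rewrite -E1.
Qed.

Lemma fine_leb_cube c r : fine (mu (cube c r)) = @vol R N r.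
Proof. by rewrite leb_cube. Qed.

Lemma itg_cube c r f k : lmfun (cube c r) f ->
  (forall x, cube c r x -> `|f x| <= k) -> itg mu (cube c r) f.
Proof.
by move=> mf fk; apply: (itg_bounded (k := k)) => //; [exact: cube_mset|exact: leb_cube_fin].
Qed.

Lemma Int_cube_split c r f : 0 < r -> itg mu (cube c r) f ->
  Int mu (cube c r) f = \sum_(b : {ffun 'I_N -> bool}) Int mu (child c r b) f.
Proof.
move=> r0 fi; have mC := @cube_mset R N c r.
suff P g : itg mu (cube c r) g -> (forall x, cube c r x -> 0 <= g x) ->
    Int mu (cube c r) g = \sum_(b : {ffun 'I_N -> bool}) Int mu (child c r b) g.
  have fa : itg mu (cube c r) (fun x => `|f x|) by exact: itg_norm.
  have f1i := itgD mC fa fi.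
  have E1 x : f x = (`|f x| + f x) - `|f x| by rewrite addrAC subrr add0r.
  transitivity (Int mu (cube c r) (fun x => (`|f x| + f x) - `|f x|)).
    by apply: eq_Int => x _; exact: E1.
  rewrite IntB// !P//; last first.
    by move=> x _; exact: normrDge0.
  rewrite -sumrB; apply: eq_bigr => b _.
  have mb := @cube_mset R N (child_corner c r b) (r / 2).
  have sb := child_sub (c := c) (b := b) r0.
  rewrite -IntB//; [|exact: itgS f1i|exact: itgS fa].
  by apply: eq_Int => x _; rewrite -E1.
move=> gi g0; apply: EFin_inj; rewrite -IntE//.
rewrite ge0_int_cube_split//; last by case/integrableP: gi.
rewrite -sumEFin; apply: eq_bigr => b _; rewrite IntE//; first exact: cube_mset.
by apply: itgS gi => //; [exact: cube_mset|exact: child_sub].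
Qed.

End Lebesgue_Int.

Lemma sum_ffun_cst {R : realType} N (k : R) :
  \sum_(b : {ffun 'I_N -> bool}) k = 2 ^+ N * k.
Proof.
have C2 : #|{: {ffun 'I_N -> bool}}|%:R = 2 ^+ N :> R.
  by rewrite card_ffun card_bool card_ord natrX.
rewrite sumr_const -C2 [RHS]mulr_natl; congr (_ *+ _); exact: eq_card.
Qed.

Lemma lipschitz_continuous {R : realType} {V : normedModType R} (f : V -> R) K :
  (forall x y, `|f y - f x| <= K * `|y - x|) -> continuous f.
Proof.
by move=> fK x; apply: (slope_continuous (g := K)); apply: slope_lip; near=> y; exact: fK.
Unshelve. all: end_near. Qed.

Lemma itg_sub_cube {R : realType} N (c : 'rV[R]_N) (r k : R) (E : set 'rV[R]_N) f :
  mset E -> E `<=` cube c r -> lmfun E f ->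
  (forall x, E x -> `|f x| <= k) -> itg (leb R N) E f.
Proof.
move=> mE EQ mf fk; apply: (itg_bounded (k := k) mE _ mf fk).
apply: le_lt_trans (leb_cube_fin c r); apply: le_measure; rewrite ?inE//.
exact: cube_mset.
Qed.

(** * The Poincare inequality on cubes *)

Section Poincare.
Context {R : realType} {N : nat}.
Notation mu := (leb R N).
Hypothesis vol_gt0 : forall r : R, 0 < r -> 0 < @vol R N r.
Variables (v g : 'rV[R]_N -> R) (L : R).
Hypothesis vg : forall x, slope v x (g x).
Hypothesis g0L : forall x, 0 <= g x <= L.
Hypothesis mg : lmfun setT g.
Implicit Types (c h x : 'rV[R]_N) (r s : R) (D E A : set 'rV[R]_N).

Lemma Int_cst_cube c r (k : R) : Int mu (cube c r) (fun=> k) = k * @vol R N r.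
Proof.
by rewrite Int_cst; [congr (_ * _); exact: fine_leb_cube|exact: cube_mset].
Qed.

Let L0 : 0 <= L. Proof. by have /andP[h1 h2] := g0L 0; exact: le_trans h2. Qed.

Lemma slope_lipschitz x y : `|v y - v x| <= L * `|y - x|.
Proof.
apply: bounded_slope_lipschitz => // z; apply: slope_le (vg z).
by case/andP: (g0L z).
Qed.

Lemma slope_lipschitz_shift x h : `|v (x + h) - v x| <= L * `|h|.
Proof. by have := slope_lipschitz x (x + h); rewrite addrAC subrr add0r. Qed.

Let cv : continuous v. Proof. by move=> x; exact: slope_continuous (vg x). Qed.

Let mgD D : mset D -> lmfun D g.
Proof. by move=> mD; apply: measurable_funS mg. Qed.

Let g_itg c r : itg mu (cube c r) g.
Proof.
apply: (itg_cube (k := L)); first by apply: mgD; exact: cube_mset.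
by move=> x _; have /andP[? ?] := g0L x; rewrite ger0_norm.
Qed.

(** The translation by h is split into n + 1 equal steps. Each step stays in the cube, so it
    contributes at most one integral of [w n] over the cube. The excess [f n] of (n + 1) w_n over s
    g tends to 0 pointwise by the definition of the slope and is bounded, so its integral vanishes
    in the limit. *)
Lemma slope_translation D c r h s : mset D ->
  (forall x t, D x -> 0 <= t <= 1 -> cube c r (x + t *: h)) -> `|h| <= s ->
  Int mu D (fun x => `|v (x + h) - v x|) <= s * Int mu (cube c r) g.
Proof.
move=> mD DQ hs.
have mQ : mset (cube c r) := cube_mset c r.
have DsQ : D `<=` cube c r.
  by move=> x Dx; have := DQ x 0 Dx; rewrite scale0r addr0 lexx ler01; exact.
have s0 : 0 <= s by exact: le_trans hs.
pose d n : 'rV[R]_N := n.+1%:R^-1 *: h.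
pose w (n : nat) (y : 'rV[R]_N) : R := `|v (y + d n) - v y|.
have dn n : `|d n| = n.+1%:R^-1 * `|h|.
  by rewrite normrZ ger0_norm// invr_ge0.
have lvs (k x y : 'rV[R]_N) : `|v (y + k) - v (x + k)| <= L * `|y - x|.
  by apply: le_trans (slope_lipschitz _ _) _; rewrite opprD addrACA subrr addr0.
have cw (k l : 'rV[R]_N) : continuous (fun y : 'rV[R]_N => `|v (y + l + k) - v (y + l)|).
  apply: (lipschitz_continuous (K := L + L)) => x y.
  apply: le_trans (ler_dist_dist _ _) _.
  have -> : v (y + l + k) - v (y + l) - (v (x + l + k) - v (x + l)) =
    (v (y + (l + k)) - v (x + (l + k))) - (v (y + l) - v (x + l)). by rewrite !addrA; ring.
  apply: le_trans (ler_normB _ _) _; rewrite mulrDl.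
  by apply: lerD; exact: lvs.
have cw0 (k : 'rV[R]_N) : continuous (fun y : 'rV[R]_N => `|v (y + k) - v y|).
  by have := cw k 0; under [X in continuous X]funext => y do rewrite addr0.
have wi (E : set 'rV[R]_N) (k : 'rV[R]_N) : mset E -> E `<=` cube c r -> itg mu E (fun y => `|v (y + k) - v y|).
  move=> mE EQ; apply: (itg_sub_cube (k := L * `|k|) mE EQ).
    exact: (continuous_mfun (cw0 k) mE).
  by move=> x _; rewrite normr_id; exact: slope_lipschitz_shift.
have step1 n : Int mu D (fun x => `|v (x + h) - v x|) <=
    Int mu (cube c r) (fun y => n.+1%:R * w n y).
  rewrite IntZ//; last exact: wi.
  have jt (j : 'I_n.+1) : 0 <= (j%:R / n.+1%:R : R) <= 1.
    by rewrite divr_ge0//= ler_pdivrMr// mul1r ler_nat ltnW.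
  have wj (j : 'I_n.+1) : itg mu D (fun x => w n (x + j%:R *: d n)).
    apply: (itg_sub_cube (k := L * `|d n|) mD DsQ).
      exact: (continuous_mfun (cw _ _) mD).
    by move=> x _; rewrite normr_id; exact: slope_lipschitz_shift.
  via (Int mu D (fun x => \sum_(j < n.+1) w n (x + j%:R *: d n))).
    apply: le_Int => //; [exact: wi|exact: itg_sum|]. move=> x _.
    have -> : v (x + h) - v x = \sum_(j < n.+1) (v (x + j%:R *: d n + d n) - v (x + j%:R *: d n)).
      transitivity (\sum_(0 <= j < n.+1) (v (x + j.+1%:R *: d n) - v (x + j%:R *: d n))).
        rewrite telescope_sumr// scale0r addr0 /d scalerA divff ?scale1r// pnatr_eq0.
      rewrite big_mkord; apply: eq_bigr => j _. by rewrite -natr1 scalerDl scale1r addrA.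
    exact: ler_norm_sum.
  rewrite Int_sum//.
  via (\sum_(j < n.+1) Int mu (cube c r) (w n)); last first.
    by rewrite sumr_const card_ord mulr_natl.
  apply: ler_sum => j _.
  pose D' := [set y | D (y - j%:R *: d n)].
  have mD' : mset D' by exact: shift_mset.
  have D'Q : D' `<=` cube c r.
    move=> y D'y; have := DQ _ (j%:R / n.+1%:R) D'y (jt j). by rewrite /d scalerA subrK.
  have -> : D = [set x | D' (x + j%:R *: d n)].
    by apply/seteqP; split => x; rewrite /D' /= addrK.
  rewrite (Int_shift (f := w n)); [|exact: mD'|exact: (continuous_mfun (cw0 _) mD')|by move=> y _; exact: normr_ge0].
  by apply: (IntS mQ mD' D'Q (wi _ _ mQ (fun _ H => H))) => y _; exact: normr_ge0.
pose f (n : nat) (y : 'rV[R]_N) : R := Num.max 0 (n.+1%:R * w n y - s * g y).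
have sgi : itg mu (cube c r) (fun y => s * g y) by exact: itgZ.
have Fi n : itg mu (cube c r) (fun y => n.+1%:R * w n y) by apply: itgZ => //; exact: wi.
have mf n : lmfun (cube c r) (f n).
  apply: measurable_maxr; first exact: measurable_cst.
  by apply: itg_mfun; apply: itgB.
have Fb n y : n.+1%:R * w n y <= s * L.
  rewrite mulrC -ler_pdivlMr//.
  have := slope_lipschitz y (y + d n); rewrite addrAC subrr add0r dn => /le_trans; apply.
  rewrite mulrCA [leRHS]mulrC ler_wpM2l//.
  by rewrite [leLHS]mulrC ler_wpM2r.
have fb n y : `|f n y| <= s * L.
  rewrite ger0_norm; last by rewrite le_max lexx.
  rewrite ge_max mulr_ge0//= lerBlDr; apply: le_trans (Fb n y) _.
  by rewrite lerDl mulr_ge0//; case/andP: (g0L y).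
have fc y : f ^~ y @ \oo --> (0 : R).
  apply/cvgrPdist_le => e e0.
  have e1 : 0 < e / (s + 1) by rewrite divr_gt0// ltr_wpDl.
  have /nbhs_normP[rho /= rho0 nr] := vg y e1.
  have K0 : 0 < `|h| + 1 by rewrite ltr_wpDl.
  have := near_infty_natSinv_lt (PosNum (divr_gt0 rho0 K0)).
  apply: filterS => n /= hn.
  rewrite sub0r normrN ger0_norm; last by rewrite le_max lexx.
  rewrite ge_max (ltW e0)/= lerBlDr.
  have := nr (y + d n); rewrite /= opprD addNKr normrN dn.
  have hh : n.+1%:R^-1 * `|h| < rho.
    apply: (@le_lt_trans _ _ (n.+1%:R^-1 * (`|h| + 1))).
      by rewrite ler_wpM2l// lerDl.
    by rewrite -ltr_pdivlMr.
  move=> /(_ hh); rewrite addrAC subrr add0r dn -/(w n y) => hw.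
  have g0 : 0 <= g y by case/andP: (g0L y).
  via ((g y + e / (s + 1)) * `|h|).
    via (n.+1%:R * ((g y + e / (s + 1)) * (n.+1%:R^-1 * `|h|))).
      by rewrite ler_wpM2l.
    apply: eq_ler. by rewrite mulrCA [n.+1%:R * _]mulrA divff ?mul1r// pnatr_eq0.
  via ((g y + e / (s + 1)) * s).
    by rewrite ler_wpM2l// addr_ge0// ltW.
  rewrite mulrDl [g y * s]mulrC addrC lerD2r.
  by rewrite mulrAC ler_pdivrMr ?ltr_wpDl// ler_wpM2l ?(ltW e0)// lerDl.
have A1 : {ae mu, forall y, cube c r y -> f ^~ y @ \oo --> (0 : R)}.
  by apply: nearW => y _; exact: fc.
have A2 : {ae mu, forall y, cube c r y -> forall n, `|f n y| <= s * L}.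
  by apply: nearW => y _ n; exact: fb.
have sLi : itg mu (cube c r) (fun=> s * L) by apply: itg_cst => //; exact: leb_cube_fin.
have [_ lim0] := Int_dominated mQ mf (measurable_cst _) A1 sLi A2.
apply/ler_addgt0Pr => e e0.
rewrite Int_cst_cube mul0r in lim0.
have /cvgrPdist_le/(_ _ e0)[n _ /(_ n)/= hn] := lim0.
have {hn} := hn (leqnn n); rewrite sub0r normrN => hn.
apply: le_trans (step1 n) _.
have fni : itg mu (cube c r) (f n).
  by apply: (itg_cube (k := s * L)).
via (Int mu (cube c r) (fun y => s * g y + f n y)).
  apply: le_Int => //; first exact: itgD.
  by move=> y _; rewrite -lerBlDl le_max lexx orbT.
rewrite IntD// IntZ// lerD2l; exact: le_trans (ler_norm _) hn.
Qed.

Definition avg c r := Int mu (cube c r) v / @vol R N r.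

Let v_itg c r : 0 < r -> itg mu (cube c r) v.
Proof.
move=> r0; apply: (itg_cube (k := `|v c| + L * r)).
  by apply: continuous_mfun => //; exact: cube_mset.
move=> x xc; have -> : v x = v c + (v x - v c) by rewrite addrCA subrr addr0.
apply: le_trans (ler_normD _ _) _; rewrite lerD2l.
apply: le_trans (slope_lipschitz _ _) _; rewrite ler_wpM2l//.
apply: norm_rV_le => [|i]; first pos.
have /andP[? ?] := xc i; rewrite !mxE ger0_norm//; lra.
Qed.

(** Two children differ by a translation of length at most r / 2 inside the parent, and the parent
    integral divided by 2^N is the mean of the integrals over the children. *)
Lemma avg_child c r b : 0 < r ->
  `|Int mu (child c r b) v - Int mu (cube c r) v / 2 ^+ N| <= r / 2 * Int mu (cube c r) g.
Proof.
move=> r0.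
have r20 : 0 < r / 2 by lra.
have D b1 b2 : `|Int mu (child c r b1) v - Int mu (child c r b2) v| <= r / 2 * Int mu (cube c r) g.
  pose h := child_corner c r b2 - child_corner c r b1.
  have hr : `|h| <= r / 2.
    apply: norm_rV_le => [|i]; first lra.
    by rewrite /h !mxE; case: (b1 i); case: (b2 i); rewrite ler_norml; lra.
  have E : child c r b1 = [set x | child c r b2 (x + h)].
    by apply/seteqP; split => x /= H i; have := H i; rewrite /h !mxE => /andP[? ?]; lra.
  have m1 := cube_mset (child_corner c r b1) (r / 2).
  have m2 := cube_mset (child_corner c r b2) (r / 2).
  have i1 := v_itg (child_corner c r b1) r20.
  have i2 := v_itg (child_corner c r b2) r20.
  have i3 : itg mu (child c r b1) (fun x => v (x + h)).
    by rewrite E; exact: (itg_shift h m2 i2).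
  have -> : Int mu (child c r b2) v = Int mu (child c r b1) (fun x => v (x + h)).
    by rewrite E; rewrite Int_shift_itg.
  rewrite -IntB//; apply: le_trans (Int_norm m1 (itgB m1 i1 i3)) _.
  via (Int mu (child c r b1) (fun x => `|v (x + h) - v x|)).
    apply: eq_ler; apply: eq_Int => x _. by rewrite distrC.
  apply: slope_translation => // x t x1 /andP[t0 t1] i.
  have := x1 i; rewrite /h !mxE.
  by case: (b1 i); case: (b2 i) => /andP[? ?]; apply/andP; split; nra.
rewrite (Int_cube_split r0 (v_itg c r0)).
have P2 : 0 < 2 ^+ N :> R by rewrite exprn_gt0.
have -> : Int mu (child c r b) v = (\sum_(b' : {ffun 'I_N -> bool}) Int mu (child c r b) v) / 2 ^+ N.
  by rewrite sum_ffun_cst mulrC mulKf// gt_eqF.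
rewrite -mulrBl -sumrB normrM [X in _ * X]ger0_norm//.
rewrite ler_pdivrMr//; apply: le_trans (ler_norm_sum _ _ _) _.
apply: le_trans (ler_sum _ (fun b' _ => D b b')) _.
by rewrite sum_ffun_cst mulrC.
Qed.

(** Induction on the number of subdivisions. The inequality on the children accounts for half of the
    constant, because their side is r / 2, and the passage from their averages to that of the parent
    for the other half; so 2^N reproduces itself. The last term is the Lipschitz bound at the finest
    scale. *)
Lemma poincare_depth n c r : 0 < r ->
  Int mu (cube c r) (fun x => `|v x - avg c r|) <=
  2 ^+ N * r * Int mu (cube c r) g + L * r / 2 ^+ n * @vol R N r.
Proof.
have P2 : 0 < 2 ^+ N :> R by rewrite exprn_gt0.
have Ni c' r' k : 0 < r' -> itg mu (cube c' r') (fun x => `|v x - k|).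
  move=> r0'; apply: itg_norm; first exact: cube_mset.
  apply: itgB; [exact: cube_mset|exact: v_itg|apply: itg_cst; first exact: cube_mset].
  exact: leb_cube_fin.
elim: n c r => [|n ih] c r r0.
  have V0 := vol_gt0 r0; have mQ := cube_mset c r.
  rewrite expr0 divr1.
  via (L * r * @vol R N r); last first.
    rewrite lerDr mulr_ge0//; first pos. by apply: Int_ge0 => x _; case/andP: (g0L x).
  via (Int mu (cube c r) (fun=> L * r)); last first.
    by rewrite Int_cst_cube.
  apply: le_Int => //; [exact: Ni|by apply: itg_cst => //; exact: leb_cube_fin|].
  move=> x xQ.
  have ci k : itg mu (cube c r) (fun=> k) by apply: itg_cst => //; exact: leb_cube_fin.
  have -> : v x - avg c r = Int mu (cube c r) (fun y => v x - v y) / @vol R N r.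
    rewrite IntB//; last exact: v_itg. by rewrite Int_cst_cube mulrBl mulfK ?gt_eqF.
  rewrite normrM [X in _ * X]ger0_norm ?invr_ge0 ?(ltW V0)// ler_pdivrMr//.
  apply: le_trans (Int_norm _ _) _ => //; first by apply: itgB => //; exact: v_itg.
  have -> : L * r * @vol R N r = Int mu (cube c r) (fun=> L * r) by rewrite Int_cst_cube.
  apply: le_Int => //.
    by apply: itg_norm => //; apply: itgB => //; exact: v_itg.
  move=> y yQ; apply: le_trans (slope_lipschitz _ _) _; rewrite ler_wpM2l//.
  apply: norm_rV_le => [|i]; first pos.
  have /andP[? ?] := xQ i; have /andP[? ?] := yQ i.
  by rewrite !mxE ler_norml; lra.
have r20 : 0 < r / 2 by lra.
rewrite (Int_cube_split r0 (Ni _ _ _ r0)).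
pose K := 2 ^+ N * (r / 2).
via (\sum_(b : {ffun 'I_N -> bool})
  (K * Int mu (child c r b) g + L * (r / 2) / 2 ^+ n * (@vol R N r / 2 ^+ N) +
   r / 2 * Int mu (cube c r) g)).
  apply: ler_sum => b _.
  pose cb := child_corner c r b.
  have mb : mset (child c r b) := cube_mset cb (r / 2).
  have ci k : itg mu (child c r b) (fun=> k) by apply: itg_cst => //; exact: leb_cube_fin.
  via (Int mu (child c r b) (fun x => `|v x - avg cb (r / 2)| + `|avg cb (r / 2) - avg c r|)).
    apply: le_Int => //; [exact: Ni|by apply: itgD => //; exact: Ni|].
    by move=> x _; exact: ler_distD.
  rewrite IntD//; last exact: Ni.
  rewrite -vol_half//; apply: lerD; first exact: ih.
  rewrite Int_cst_cube.
  have V2 := vol_gt0 r20; have V1 := vol_gt0 r0.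
  have -> : `|avg cb (r / 2) - avg c r| * @vol R N (r / 2) =
     `|Int mu (child c r b) v - Int mu (cube c r) v / 2 ^+ N|.
    rewrite -[X in _ * X](@ger0_norm _ (@vol R N (r / 2))) ?(ltW V2)// -normrM; congr (`| _ |).
    rewrite mulrBl /avg divfK ?gt_eqF//; congr (_ - _). by rewrite vol_half// mulrA divfK ?gt_eqF.
  exact: avg_child.
rewrite !big_split /= -mulr_sumr -(Int_cube_split r0 (g_itg c r)).
rewrite !sum_ffun_cst /K exprS invfM.
apply: eq_ler; field.
by rewrite !expf_neq0.
Qed.

Lemma poincare c r : 0 < r ->
  Int mu (cube c r) (fun x => `|v x - avg c r|) <= 2 ^+ N * r * Int mu (cube c r) g.
Proof.
move=> r0; apply/ler_addgt0Pr => e e0.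
have [n hn] : exists n : nat, L * r * @vol R N r / 2 ^+ n <= e.
  have : (fun n => L * r * @vol R N r * (2^-1 : R) ^+ n) @ \oo --> L * r * @vol R N r * (0 : R).
    by apply: cvgMr; apply: cvg_expr; rewrite ger0_norm// invf_lt1// ltr1n.
  rewrite mulr0 => /cvgrPdist_le/(_ _ e0)[n _ /(_ n (leqnn n))].
  rewrite sub0r normrN => h; exists n; apply: le_trans h.
  by rewrite exprVn; exact: ler_norm.
apply: le_trans (poincare_depth n c r0) _; rewrite lerD2l.
by apply: le_trans hn; rewrite mulrAC.
Qed.

Lemma slope_poincare_pair c r : 0 < r -> [/\ itg mu (cube c r) v, itg mu (cube c r) g &
  Int mu (cube c r) (fun x => `|v x - avg c r|) <= 2 ^+ N * r * Int mu (cube c r) g].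
Proof. by move=> r0; split; [exact: v_itg|exact: g_itg|exact: poincare]. Qed.

End Poincare.

(** Detached from [slope] because it survives limits: [level_poincare] obtains it for truncations of
    the solution. *)
Definition poincare_pair {R : realType} {N : nat} (v g : 'rV[R]_N -> R) :=
  forall c (r : R), 0 < r -> [/\ itg (leb R N) (cube c r) v, itg (leb R N) (cube c r) g &
  Int (leb R N) (cube c r) (fun x => `|v x - avg v c r|) <=
    2 ^+ N * r * Int (leb R N) (cube c r) g].

Section poincare_consequences.
Context {R : realType} {N : nat}.
Notation mu := (leb R N).
Implicit Types (x c : 'rV[R]_N) (r : R).
Hypothesis vol_gt0 : forall r : R, 0 < r -> 0 < @vol R N r.
Variables (v g : 'rV[R]_N -> R).
Hypothesis vg : poincare_pair v g.

Let v_itg c r : 0 < r -> itg mu (cube c r) v. Proof. by move=> /(vg c)[]. Qed.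
Let g_itg c r : 0 < r -> itg mu (cube c r) g. Proof. by move=> /(vg c)[]. Qed.

(** On E the function |v - avg| equals the average, so by Markov's inequality the average times the
    measure of E is at most the integral of |v - avg|. *)
Lemma poincare_zero c r E th : 0 < r -> 0 < th -> mset E -> E `<=` cube c r ->
  (forall x, cube c r x -> 0 <= v x) -> (forall x, E x -> v x = 0) ->
  th * @vol R N r <= fine (mu E) ->
  Int mu (cube c r) v <= th^-1 * (2 ^+ N * r * Int mu (cube c r) g).
Proof.
move=> r0 th0 mE EQ v0 vE thE.
have mQ : mset (cube c r) := cube_mset c r.
have V0 := vol_gt0 r0.
have a0 : 0 <= avg v c r by rewrite /avg divr_ge0 ?(ltW V0)//; exact: Int_ge0.
have Eoo : (mu E < +oo)%E.
  by apply: le_lt_trans (leb_cube_fin c r); apply: le_measure => //; rewrite inE.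
rewrite mulrC ler_pdivlMr//; have [_ _ P] := vg c r0; apply: le_trans P.
have -> : Int mu (cube c r) v * th = avg v c r * (th * @vol R N r).
  by rewrite /avg; field; rewrite gt_eqF.
apply: le_trans (ler_wpM2l a0 thE) _.
apply: Int_markov => //.
- apply: itg_norm => //; apply: itgB => //; first exact: v_itg.
  by apply: itg_cst => //; exact: leb_cube_fin.
- by move=> x /vE ->; rewrite sub0r normrN ger0_norm.
Qed.

(* Tiling the cube by dyadic cubes of side [r / 2 ^ i], each of which is at
   least half covered by the zero set. *)
Lemma faber_krahn_dyadic i c r A : 0 < r -> mset A -> A `<=` cube c r ->
  (forall x, cube c r x -> 0 <= v x) -> (forall x, cube c r x -> ~ A x -> v x = 0) ->
  fine (mu A) <= @vol R N r / 2 / 2 ^+ (N * i) ->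
  Int mu (cube c r) v <= 2 * (2 ^+ N * (r / 2 ^+ i) * Int mu (cube c r) g).
Proof.
elim: i c r A => [|i ih] c r A r0 mA AQ v0 vA Av.
  rewrite expr0 divr1; rewrite muln0 expr0 divr1 in Av.
  have mQ : mset (cube c r) := cube_mset c r.
  rewrite -[X in _ <= X * _]invrK.
  apply: (@poincare_zero c r (cube c r `\` A)) => //.
  - exact: measurableD.
  - by move=> x [Qx Ax]; exact: vA.
  have Qoo := leb_cube_fin c r.
  rewrite (fine_measureD mQ mA Qoo AQ).
  have -> : fine (mu (cube c r)) = @vol R N r by exact: fine_leb_cube.
  lra.
have r20 : 0 < r / 2 by lra.
rewrite (Int_cube_split r0 (v_itg c r0)) (Int_cube_split r0 (g_itg c r0)).
rewrite !mulr_sumr; apply: ler_sum => b _.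
have -> : r / 2 ^+ i.+1 = r / 2 / 2 ^+ i by rewrite exprS invfM mulrA.
have sb := child_sub (c := c) (b := b) r0.
have mb := cube_mset (child_corner c r b) (r / 2).
apply: (ih _ _ (A `&` child c r b)) => //.
- exact: measurableI.
- by move=> x /sb; exact: v0.
- by move=> x bx Ax; apply: vA; [exact: sb|move=> Ax'; apply: Ax].
via (fine (mu A)).
  apply: le_fine_measure => //; first exact: measurableI.
  by apply: le_lt_trans (leb_cube_fin c r); apply: le_measure => //; rewrite inE//; exact: cube_mset.
apply: le_trans Av _; rewrite vol_half// mulnS exprD.
apply: eq_ler; field.
by rewrite !expf_neq0.
Qed.

End poincare_consequences.

(** * Real powers, smooth truncation between two levels, and fast geometric convergence *)

Section powR_facts.
Context {R : realType}.
Implicit Types (x y a b r s t : R).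

Lemma powR_le x y r : 0 <= r -> 0 <= x -> x <= y -> x `^ r <= y `^ r.
Proof.
by move=> r0 x0 xy; apply: ge0_ler_powR => //; rewrite nnegrE//; exact: le_trans xy.
Qed.

Lemma powRVK x r : r != 0 -> 0 <= x -> (x `^ r^-1) `^ r = x.
Proof. by move=> r0 x0; rewrite -powRrM mulVf// powRr1. Qed.

Lemma powRKV x r : r != 0 -> 0 <= x -> (x `^ r) `^ r^-1 = x.
Proof. by move=> r0 x0; rewrite -powRrM divff// powRr1. Qed.

Lemma powRD_pos x r s : 0 < x -> x `^ (r + s) = x `^ r * x `^ s.
Proof. by move=> x0; rewrite powRD//; apply/implyP => _; rewrite gt_eqF. Qed.

End powR_facts.

Section smoothstep.
Context {R : realType}.
Implicit Types (k d t x y : R).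

Definition clamp t : R := if t <= 0 then 0 else if 1 <= t then 1 else t.

Lemma clamp01 t : 0 <= clamp t <= 1.
Proof. by rewrite /clamp; case: (leP t 0) => ?; case: (leP 1 t) => ?; lra. Qed.

Lemma clamp_lip x y : `|clamp y - clamp x| <= `|y - x|.
Proof.
have h1 := ler_norm (y - x); have h2 := ler_norm (x - y); rewrite distrC in h2.
rewrite ler_norml /clamp; case: (leP x 0) => ?; case: (leP 1 x) => ?;
  case: (leP y 0) => ?; case: (leP 1 y) => ?; lra.
Qed.

(** The cubic step c^2 (3 - 2 c), scaled to rise from 0 at k to d at k + d. It is of class C^1 with
    derivative [dsm], so it maps slopes to slopes. *)
Definition smst k d t : R := let c := clamp ((t - k) / d) in d * (c ^+ 2 * (3 - 2 * c)).

Definition dsm k d t : R := let c := clamp ((t - k) / d) in 6 * (c * (1 - c)).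

Lemma dsm_ge0 k d t : 0 <= dsm k d t.
Proof. by have /andP[? ?] := clamp01 ((t - k) / d); rewrite /dsm; nra. Qed.

Lemma dsm_le k d t : dsm k d t <= 2.
Proof. by have /andP[? ?] := clamp01 ((t - k) / d); rewrite /dsm; nra. Qed.

Lemma clamp_le0 t : t <= 0 -> clamp t = 0.
Proof. by move=> t0; rewrite /clamp; case: (leP t 0) => ?; case: (leP 1 t) => ?; lra. Qed.

Lemma clamp_ge1 t : 1 <= t -> clamp t = 1.
Proof. by move=> t0; rewrite /clamp; case: (leP t 0) => ?; case: (leP 1 t) => ?; lra. Qed.

Lemma dsm_eq0 k d t : 0 < d -> t <= k \/ k + d <= t -> dsm k d t = 0.
Proof.
rewrite /dsm => d0 [tk|kt]; first by rewrite clamp_le0 ?mul0r ?mulr0// ler_pdivrMr// mul0r; lra.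
by rewrite clamp_ge1 ?subrr ?mulr0// ler_pdivlMr// mul1r; lra.
Qed.

Lemma smst_eq0 k d t : 0 < d -> t <= k -> smst k d t = 0.
Proof.
rewrite /smst => d0 tk; rewrite clamp_le0 ?expr0n/= ?mul0r ?mulr0// ler_pdivrMr// mul0r; lra.
Qed.

Lemma smst_eq k d t : 0 < d -> k + d <= t -> smst k d t = d.
Proof.
rewrite /smst => d0 tk; rewrite clamp_ge1; first by rewrite expr1n; ring.
by rewrite ler_pdivlMr// mul1r; lra.
Qed.

Lemma smst_ge0 k d t : 0 < d -> 0 <= smst k d t.
Proof.
move=> d0; have /andP[? ?] := clamp01 ((t - k) / d).
by rewrite /smst mulr_ge0 ?(ltW d0)// mulr_ge0 ?sqr_ge0//; lra.
Qed.

Lemma smst_le k d t : 0 < d -> smst k d t <= d.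
Proof.
move=> d0; have := clamp01 ((t - k) / d); rewrite /smst.
move: (clamp _) => c /andP[c0 c1]; have -> : c ^+ 2 * (3 - 2 * c) = 1 - (1 - c) ^+ 2 * (1 + 2 * c) by ring.
have : 0 <= (1 - c) ^+ 2 * (1 + 2 * c) by rewrite mulr_ge0 ?sqr_ge0//; lra.
move=> h; have {h} : 1 - (1 - c) ^+ 2 * (1 + 2 * c) <= 1 by lra.
by move=> h; rewrite -[leRHS]mulr1 ler_pM2l.
Qed.

Lemma smst_slope k d t e : 0 < d -> 0 < e ->
  \forall s \near t, `|smst k d s - smst k d t| <= (dsm k d t + e) * `|s - t|.
Proof.
move=> d0 e0.
apply/nbhs_normP; exists (d * (e / 9)); first by rewrite /= mulr_gt0// divr_gt0.
move=> s /= ts.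
have hl : `|clamp ((s - k) / d) - clamp ((t - k) / d)| <= `|s - t| / d.
  apply: le_trans (clamp_lip _ _) _.
  rewrite -mulrBl opprB addrA subrK normrM ler_wpM2l// ger0_norm// invr_ge0.
  pos.
have hl9 : 9 * `|clamp ((s - k) / d) - clamp ((t - k) / d)| <= e.
  rewrite mulrC -ler_pdivlMr//; apply: le_trans hl _.
  by rewrite ler_pdivrMr// mulrC distrC ltW.
have /andP[a0 a1] := clamp01 ((t - k) / d).
have /andP[b0 b1] := clamp01 ((s - k) / d).
rewrite /smst /dsm; set b := clamp ((s - k) / d) in hl hl9 b0 b1 *.
set a := clamp ((t - k) / d) in hl hl9 a0 a1 *.
have -> : d * (b ^+ 2 * (3 - 2 * b)) - d * (a ^+ 2 * (3 - 2 * a)) =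
  d * ((b - a) * (6 * (a * (1 - a)) + (b - a) * (3 - 2 * (b + 2 * a)))) by ring.
rewrite normrM ger0_norm ?(ltW d0)// normrM.
have h3 : `|6 * (a * (1 - a)) + (b - a) * (3 - 2 * (b + 2 * a))| <= 6 * (a * (1 - a)) + e.
  apply: le_trans (ler_normD _ _) _; apply: lerD.
    by rewrite ger0_norm//; nra.
  rewrite normrM; apply: le_trans hl9; rewrite mulrC ler_wpM2r//.
  by rewrite ler_norml; lra.
have K0 : 0 <= 6 * (a * (1 - a)) + e by nra.
via (d * (`|s - t| / d * (6 * (a * (1 - a)) + e))).
  by rewrite ler_pM2l//; apply: ler_pM.
apply: eq_ler; field; exact: lt0r_neq0.
Qed.

Lemma dsm_lip k d x y : 0 < d -> `|dsm k d y - dsm k d x| <= 6 / d * `|y - x|.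
Proof.
move=> d0.
have hl : `|clamp ((y - k) / d) - clamp ((x - k) / d)| <= `|y - x| / d.
  apply: le_trans (clamp_lip _ _) _.
  rewrite -mulrBl opprB addrA subrK normrM ler_wpM2l// ger0_norm// invr_ge0.
  pos.
have /andP[a0 a1] := clamp01 ((x - k) / d).
have /andP[b0 b1] := clamp01 ((y - k) / d).
rewrite /dsm; set b := clamp ((y - k) / d) in hl b0 b1 *.
set a := clamp ((x - k) / d) in hl a0 a1 *.
have -> : 6 * (b * (1 - b)) - 6 * (a * (1 - a)) = 6 * ((b - a) * (1 - (b + a))) by ring.
rewrite normrM ger0_norm// -mulrA ler_pM2l// normrM [leRHS]mulrC.
rewrite -[leRHS]mulr1; apply: ler_pM => //.
by rewrite ler_norml; lra.
Qed.

Lemma dsm_continuous k d : 0 < d -> continuous (dsm k d).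
Proof. by move=> d0; apply: lipschitz_continuous => x y; exact: dsm_lip. Qed.

Lemma smst_continuous k d : 0 < d -> continuous (smst k d).
Proof. by move=> d0 t; apply: (@slope_continuous _ _ _ _ (dsm k d t)) => e; exact: smst_slope. Qed.

(** The i-th derivative is supported between tau 2^i and tau 2^(i+1). These intervals do not
    overlap, so at most one summand is nonzero. *)
Lemma sum_dsm (tau t : R) n : 0 < tau ->
  \sum_(i < n) dsm (tau * 2 ^+ i) (tau * 2 ^+ i) t <= 2.
Proof.
move=> tau0.
suff [//] : \sum_(i < n) dsm (tau * 2 ^+ i) (tau * 2 ^+ i) t <= 2 /\
  (tau * 2 ^+ n <= t -> \sum_(i < n) dsm (tau * 2 ^+ i) (tau * 2 ^+ i) t = 0).
have p i : 0 < tau * 2 ^+ i by rewrite mulr_gt0// exprn_gt0.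
elim: n => [|n [ih1 ih2]]; first by rewrite big_ord0; split; [lra|].
rewrite big_ord_recr/=; have E : tau * 2 ^+ n.+1 = tau * 2 ^+ n + tau * 2 ^+ n.
  by rewrite exprS; ring.
have pn := p n.
split.
  have [nt|tn] := leP (tau * 2 ^+ n) t.
    by rewrite ih2// add0r dsm_le.
  by rewrite [X in _ + X]dsm_eq0 ?addr0//; left; exact: ltW.
rewrite E => nt; rewrite ih2; last pos.
by rewrite add0r dsm_eq0//; right.
Qed.

End smoothstep.

(** With q = b^(-1/al), the threshold for y_0 says C y_0^al <= q. Then y_j <= y_0 q^j by induction,
    since (q^j)^al cancels b^j. *)
Lemma fast_geometric {R : realType} (C b al : R) (y : nat -> R) :
  0 < C -> 1 < b -> 0 < al -> (forall j, 0 <= y j) ->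
  (forall j, y j.+1 <= C * b ^+ j * y j `^ (1 + al)) ->
  y 0 <= (C * b `^ al^-1) `^ (- al^-1) ->
  y @ \oo --> (0 : R).
Proof.
move=> C0 b1 al0 y0 yS y00.
have b0 : 0 < b by exact: lt_trans b1.
have al1 : al^-1 != 0 by rewrite invr_eq0 gt_eqF.
have aln : al != 0 by rewrite gt_eqF.
have q0 : 0 < b `^ al^-1 by exact: powR_gt0.
pose q := (b `^ al^-1)^-1.
have qq0 : 0 < q by rewrite invr_gt0.
have M0 : 0 < C * b `^ al^-1 by rewrite mulr_gt0.
have H j : y j <= y 0 * q ^+ j.
  elim: j => [|j ih]; first by rewrite expr0 mulr1.
  apply: le_trans (yS j) _.
  have h : y j `^ (1 + al) <= (y 0 * q ^+ j) `^ (1 + al).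
    by apply: powR_le => //; rewrite addr_ge0// ltW.
  via (C * b ^+ j * (y 0 * q ^+ j) `^ (1 + al)).
    by rewrite ler_wpM2l// mulr_ge0 ?ltW// exprn_gt0.
  have [y00e|y00n] := eqVneq (y 0) 0.
    by rewrite y00e !mul0r powR0 ?mulr0// gt_eqF// addr_gt0.
  have y0p : 0 < y 0 by rewrite lt_neqAle eq_sym y00n y0.
  have qj0 : 0 < q ^+ j by rewrite exprn_gt0.
  rewrite powRD_pos ?mulr_gt0// powRr1; last pos.
  rewrite powRM ?(ltW qj0)//.
  have -> : (q ^+ j) `^ al = (b ^+ j)^-1.
    have qal : q `^ al = b^-1.
      by rewrite /q -powRN -powRrM mulNr mulVf// powR_inv1// ltW.
    rewrite -(powR_mulrn j (ltW qq0)) -powRrM [j%:R * _]mulrC powRrM qal.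
    by rewrite powR_mulrn ?invr_ge0 ?(ltW b0)// exprVn.
  have y0al : y 0 `^ al <= (C * b `^ al^-1)^-1.
    have := powR_le (ltW al0) (y0 0) y00. by rewrite -powRrM mulNr mulVf// powR_inv1// ltW.
  have -> : C * b ^+ j * (y 0 * q ^+ j * (y 0 `^ al * (b ^+ j)^-1)) =
     y 0 * q ^+ j * (C * y 0 `^ al).
    by field; rewrite expf_neq0// gt_eqF.
  rewrite exprS mulrA [q * _]mulrC -!mulrA ler_pM2l// ler_pM2l//.
  rewrite -ler_pdivlMl// /q; apply: le_trans y0al _; rewrite invfM mulrC.
  by [].
have q1 : q < 1.
  rewrite invf_lt1// -(powRr0 b) /powR !gt_eqF// mul0r ltr_expR.
  by rewrite mulr_gt0 ?invr_gt0// ln_gt0.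
have qc : y 0 * q ^+ n @[n --> \oo] --> (0 : R).
  by rewrite -(mulr0 (y 0)); apply: cvgMr; apply: cvg_expr; rewrite ger0_norm// ltW.
apply: (squeeze_cvgr _ (cvg_cst 0) qc).
by apply: nearW => n; rewrite y0 H.
Qed.

(** * Level sets and the Sobolev inequality in L^1 *)

Section level_sets.
Context {R : realType} {N : nat}.
Implicit Types (D : set 'rV[R]_N) (v : 'rV[R]_N -> R) (t : R).

Lemma mset_gt D v t : mset D -> lmfun D v ->
  mset (D `&` [set x | t < v x]).
Proof.
move=> mD mv; have -> : D `&` [set x | t < v x] = D `&` v @^-1` `]t, +oo[.
  by apply/seteqP; split => x; rewrite /= in_itv/= andbT.
exact: mv.
Qed.

Lemma mset_ge D v t : mset D -> lmfun D v ->
  mset (D `&` [set x | t <= v x]).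
Proof.
move=> mD mv; have -> : D `&` [set x | t <= v x] = D `&` v @^-1` `[t, +oo[.
  by apply/seteqP; split => x; rewrite /= in_itv/= andbT.
exact: mv.
Qed.

Lemma mset_le D v t : mset D -> lmfun D v ->
  mset (D `&` [set x | v x <= t]).
Proof.
move=> mD mv; have -> : D `&` [set x | v x <= t] = D `&` v @^-1` `]-oo, t].
  by apply/seteqP; split => x; rewrite /= in_itv/=.
exact: mv.
Qed.

Lemma mset_lt D v t : mset D -> lmfun D v ->
  mset (D `&` [set x | v x < t]).
Proof.
move=> mD mv; have -> : D `&` [set x | v x < t] = D `&` v @^-1` `]-oo, t[.
  by apply/seteqP; split => x; rewrite /= in_itv/=.
exact: mv.
Qed.

End level_sets.

Section Sobolev.
Context {R : realType} {N : nat}.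
Notation mu := (leb R N).
Hypothesis vol_gt0 : forall r : R, 0 < r -> 0 < @vol R N r.
Hypothesis N_gt1 : (1 < N)%N.
Implicit Types (c h x : 'rV[R]_N) (r s : R) (D E A : set 'rV[R]_N) (v g : 'rV[R]_N -> R).

Let Nr0 : (N%:R : R) != 0. Proof. by rewrite pnatr_eq0 -lt0n ltnW. Qed.
Let Nr1 : 1 < N%:R :> R. Proof. by rewrite ltr1n. Qed.

Definition sobolev_pair v g (L : R) :=
  [/\ forall x, slope v x (g x), forall x, 0 <= g x <= L & lmfun setT g].

Lemma sobolev_pair_ge0 v g L x : sobolev_pair v g L -> 0 <= g x.
Proof. by move=> [_ /(_ x)/andP[]]. Qed.

Lemma sobolev_poincare v g L : sobolev_pair v g L -> poincare_pair v g.
Proof. by move=> [h1 h2 h3] c r; exact: slope_poincare_pair. Qed.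

(** Let a be the relative measure of A. [faber_krahn_dyadic] is applied at the finest scale at which
    A still has at most half the measure of a dyadic cube; there 2^-i <= 4 a^(1/N). If a = 0, every
    scale is allowed and the integral is 0. *)
Lemma faber_krahn v g c r A : poincare_pair v g -> (forall x, 0 <= g x) -> 0 < r -> mset A -> A `<=` cube c r ->
  (forall x, cube c r x -> 0 <= v x) -> (forall x, cube c r x -> ~ A x -> v x = 0) ->
  fine (mu A) <= @vol R N r / 2 ->
  Int mu (cube c r) v <=
    2 ^+ (N + 3) * r * (fine (mu A) / @vol R N r) `^ N%:R^-1 * Int mu (cube c r) g.
Proof.
move=> vg g0 r0 mA AQ v0 vA Av.
have FK i := @faber_krahn_dyadic R N vol_gt0 v g vg i c r A r0 mA AQ v0 vA.
have V0 := vol_gt0 r0.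
have G0 : 0 <= Int mu (cube c r) g by apply: Int_ge0 => x _.
set a := fine (mu A) / @vol R N r.
have a0 : 0 <= a by rewrite divr_ge0// fine_ge0.
have FK' i : a <= 2^-1 / 2 ^+ (N * i) -> Int mu (cube c r) v <= 2 * (2 ^+ N * (r / 2 ^+ i) * Int mu (cube c r) g).
  move=> h; apply: FK; move: h; rewrite /a ler_pdivrMr// => /le_trans; apply.
  by apply: eq_ler; rewrite mulrC mulrA.
have [ae|an] := eqVneq a 0.
  rewrite ae powR0 ?invr_eq0// mulr0 mul0r.
  apply/ler_addgt0Pr => e e0; rewrite add0r.
  pose K := 2 * (2 ^+ N * r * Int mu (cube c r) g).
  have : (fun n => K * (2^-1 : R) ^+ n) @ \oo --> K * (0 : R).
    by apply: cvgMr; apply: cvg_expr; rewrite ger0_norm// invf_lt1// ltr1n.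
  rewrite mulr0 => /cvgrPdist_le/(_ _ e0)[n _ /(_ n (leqnn n))].
  rewrite sub0r normrN => h; apply: le_trans (FK' n _) _.
    by rewrite ae divr_ge0// exprn_ge0.
  apply: le_trans h; apply: le_trans (ler_norm _).
  by apply: eq_ler; rewrite /K exprVn; ring.
have ap : 0 < a by rewrite lt_neqAle eq_sym an.
pose P i := 2^-1 / 2 ^+ (N * i) < a.
have exP : exists i, P i.
  have : (fun n => 2^-1 * (2^-1 : R) ^+ n) @ \oo --> 2^-1 * (0 : R).
    by apply: cvgMr; apply: cvg_expr; rewrite ger0_norm// invf_lt1// ltr1n.
  rewrite mulr0 => /cvgrPdist_lt/(_ _ ap)[n _ /(_ n (leqnn n))].
  rewrite sub0r normrN => h; exists n; apply: le_lt_trans (le_lt_trans (ler_norm _) h).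
  rewrite exprVn ler_wpM2l// lef_pV2 ?posrE// ler_weXn2l ?ler1n//.
  by rewrite leq_pmull// ltnW.
have [i Pi Pmin] := ex_minnP exP.
have a12 : a <= 2^-1 by rewrite /a ler_pdivrMr// mulrC.
case: i Pi Pmin => [|i] Pi Pmin.
  by move: Pi; rewrite /P muln0 expr0 divr1 ltNge a12.
have ai : a <= 2^-1 / 2 ^+ (N * i).
  by rewrite leNgt; apply/negP => /Pmin; rewrite ltnn.
apply: le_trans (FK' _ ai) _.
have h : (2 ^+ i)^-1 <= 4 * a `^ N%:R^-1.
  have N1 : N%:R^-1 != 0 :> R by rewrite invr_eq0.
  have N0 : 0 <= N%:R^-1 :> R by rewrite invr_ge0.
  have z0 : 0 <= (2 : R)^-1 ^+ i.+1 by rewrite exprn_ge0.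
  have h1 : (2 : R)^-1 ^+ i.+1 <= (2 * a) `^ N%:R^-1.
    rewrite -[leLHS](powRKV Nr0 z0) powR_mulrn//; apply: powR_le => //.
    rewrite -exprM mulnC exprVn -ler_pdivrMl//; exact: ltW.
  have h2 : (2 * a) `^ N%:R^-1 <= 2 * a `^ N%:R^-1.
    rewrite powRM// ler_wpM2r ?powR_ge0//. have {2}<- : (2 : R) `^ 1 = 2 by rewrite powRr1.
    by apply: ler_powR; rewrite ?ler1n// invf_le1// ?ltW// ltr0n ltnW.
  rewrite exprS exprVn in h1; lra.
have -> : 2 * (2 ^+ N * (r / 2 ^+ i) * Int mu (cube c r) g) =
   2 ^+ N * 2 * r * Int mu (cube c r) g * (2 ^+ i)^-1 by ring.
apply: le_trans (ler_wpM2l _ h) _.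
  pos.
by apply: eq_ler; rewrite exprD; ring.
Qed.

Lemma sobolev_pair_smst v g L k d : 0 < d -> sobolev_pair v g L ->
  sobolev_pair (fun x => smst k d (v x)) (fun x => dsm k d (v x) * g x) (2 * L).
Proof.
move=> d0 [vg g0L mg]; split.
- move=> x; have /andP[g0 gL] := g0L x.
  apply: (@slope_comp _ _ v x (g x) (smst k d)) => //; first exact: dsm_ge0.
  by move=> e e0; exact: smst_slope.
- move=> x; have /andP[g0 gL] := g0L x; have D0 := dsm_ge0 k d (v x); have D2 := dsm_le k d (v x).
  by rewrite mulr_ge0//= ler_pM.
- apply: (measurable_funM _ mg).
  apply: continuous_mfun; last exact: measurableT.
  move=> x; apply: continuous_comp; first exact: slope_continuous (vg x).
  exact: dsm_continuous.
Qed.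

(** The constant of [gagliardo_nirenberg]: a power of 4 from comparing v with its dyadic levels, the
    constant of [faber_krahn], and 2 from [sum_dsm]. *)
Definition sobolev_cst (r : R) : R :=
  4 `^ (N%:R / (N%:R - 1)) * (2 ^+ (N + 3) * r / @vol R N r `^ N%:R^-1 * 2).

(** Truncation method of Maz'ya. At a level k, Faber-Krahn for the step between k and 2 k and
    Markov's inequality for v^s bound k^s |{v >= 2 k}| by X^(1/N) times the integral of the slope of
    that step. Summation over k = tau 2^i gives X <= C X^(1/N) G, and 1 - 1/N = 1/s. *)
Lemma gagliardo_nirenberg v g L c r S : sobolev_pair v g L -> 0 < r -> mset S ->
  S `<=` cube c r -> fine (mu S) <= @vol R N r / 2 ->
  (forall x, 0 <= v x) -> (forall x, ~ S x -> v x = 0) ->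
  Int mu (cube c r) (fun x => v x `^ (N%:R / (N%:R - 1))) <=
  (sobolev_cst r * Int mu (cube c r) g) `^ (N%:R / (N%:R - 1)).
Proof.
move=> vgL r0 mS SQ Svol v0 vS.
have [vg g0L mg] := vgL.
set s := N%:R / (N%:R - 1).
have N10 : 0 < N%:R - 1 :> R by rewrite subr_gt0.
have s1 : s - 1 = (N%:R - 1)^-1 by rewrite /s; field; exact: lt0r_neq0.
have s0 : 0 < s by rewrite divr_gt0//; lra.
have sN : s / N%:R = s - 1 by rewrite s1 /s; field; rewrite Nr0 lt0r_neq0.
have s10 : 0 < s - 1 by rewrite s1 invr_gt0.
have V0 := vol_gt0 r0.
have mQ : mset (cube c r) := cube_mset c r.
have Qoo := leb_cube_fin c r.
have cv : continuous v by move=> x; exact: slope_continuous (vg x).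
have mv D : mset D -> lmfun D v by move=> mD; exact: (continuous_mfun cv mD).
have gi : itg mu (cube c r) g.
  apply: (itg_cube (k := L)); first exact: measurable_funS mg.
  by move=> x _; have /andP[? ?] := g0L x; rewrite ger0_norm.
have G0 : 0 <= Int mu (cube c r) g by apply: Int_ge0 => x _; case/andP: (g0L x).
have L0 : 0 <= L by have /andP[h1 h2] := g0L 0; exact: le_trans h2.
pose M := `|v c| + L * r + 1.
have M0 : 0 < M by rewrite /M ltr_wpDl// addr_ge0// mulr_ge0// ltW.
have vM x : cube c r x -> v x <= M.
  move=> xc; apply: le_trans (ler_norm _) _.
  have -> : v x = v c + (v x - v c) by rewrite addrCA subrr addr0.
  apply: le_trans (ler_normD _ _) _; rewrite /M -addrA lerD2l.
  via (L * r); last by rewrite lerDl.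
  apply: le_trans (slope_lipschitz vg g0L _ _) _; rewrite ler_wpM2l//.
  apply: norm_rV_le => [|i]; first pos.
  have /andP[? ?] := xc i; rewrite !mxE ger0_norm//; lra.
have mvs : lmfun (cube c r) (fun x => v x `^ s).
  exact: (measurableT_comp (measurable_powR s) (mv _ mQ)).
have vsi : itg mu (cube c r) (fun x => v x `^ s).
  apply: (itg_cube (k := M `^ s)) => // x xQ.
  by rewrite ger0_norm ?powR_ge0//; apply: powR_le => //; [pos|exact: vM].
set X := Int mu (cube c r) (fun x => v x `^ s).
have X0 : 0 <= X by apply: Int_ge0 => x _; exact: powR_ge0.
set G := Int mu (cube c r) g.
pose C1 := 2 ^+ (N + 3) * r / @vol R N r `^ N%:R^-1.
have C10 : 0 <= C1 by rewrite mulr_ge0 ?invr_ge0 ?powR_ge0// mulr_ge0// ltW.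
have mlev t : mset (cube c r `&` [set x | t < v x]).
  by apply: mset_gt => //; exact: mv.
have mlev' t : mset (cube c r `&` [set x | t <= v x]).
  by apply: mset_ge => //; exact: mv.
have levoo D : mset D -> D `<=` cube c r -> (mu D < +oo)%E.
  by move=> mD DQ; apply: le_lt_trans Qoo; apply: le_measure; rewrite ?inE.
have lev k : 0 < k -> k `^ s * fine (mu (cube c r `&` [set x | k + k <= v x])) <=
    C1 * X `^ N%:R^-1 * Int mu (cube c r) (fun x => dsm k k (v x) * g x).
  move=> k0.
  have [sl1 sl2 sl3] := sobolev_pair_smst k k0 vgL.
  pose A := cube c r `&` [set x | k < v x].
  have AQ : A `<=` cube c r by move=> x [].
  have AS : A `<=` S.
    move=> x [_ /= kv]; apply: contrapT => /vS vx; rewrite vx in kv.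
    by have := lt_trans k0 kv; rewrite ltxx.
  have AV : fine (mu A) <= @vol R N r / 2.
    by apply: le_trans Svol; apply: le_fine_measure => //; [exact: mlev|exact: levoo].
  have FK := faber_krahn (sobolev_poincare (sobolev_pair_smst k k0 vgL))
    (fun x => sobolev_pair_ge0 x (sobolev_pair_smst k k0 vgL)) r0 (mlev k) AQ
    (fun x _ => smst_ge0 k (v x) k0) _ AV.
  have {}FK := FK _.
  have T1 : itg mu (cube c r) (fun x => smst k k (v x)).
    apply: (itg_cube (k := k)).
      apply: (continuous_mfun _ mQ) => x; exact: slope_continuous (sl1 x).
    by move=> x _; rewrite ger0_norm ?smst_ge0// smst_le.
  have h1 : k * fine (mu (cube c r `&` [set x | k + k <= v x])) <=
      Int mu (cube c r) (fun x => smst k k (v x)).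
    apply: (Int_markov mQ (mlev' (k + k)) _ T1).
    - by move=> x [].
    - by apply: levoo; [exact: mlev'|move=> x []].
    - by move=> x _; exact: smst_ge0.
    - by move=> x [_ /= kv]; rewrite smst_eq.
  have h2 : k `^ s * fine (mu A) <= X.
    apply: (Int_markov mQ (mlev k) AQ vsi).
    - by apply: levoo => //; exact: mlev.
    - pos.
    - by move=> x [_ /= kv]; apply: powR_le; rewrite ?ltW.
  have {}FK : Int mu (cube c r) (fun x => smst k k (v x)) <=
      C1 * fine (mu A) `^ N%:R^-1 * Int mu (cube c r) (fun x => dsm k k (v x) * g x).
    apply: le_trans (FK _) _.
      move=> x xQ xA; apply: smst_eq0 => //; rewrite leNgt; apply/negP => kv. by apply: xA.
    rewrite powRM ?fine_ge0 ?invr_ge0 ?(ltW V0)//.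
    rewrite -(powR_inv1 (ltW V0)) -powRrM mulN1r powRN. by apply: eq_ler; rewrite /C1; ring.
  have DG0 : 0 <= Int mu (cube c r) (fun x => dsm k k (v x) * g x).
    by apply: Int_ge0 => x _; case/andP: (sl2 x).
  have -> : k `^ s = k `^ (s - 1) * k by rewrite mulrC mulr_powRB1// ltW.
  rewrite -mulrA; apply: le_trans (ler_wpM2l (powR_ge0 _ _) (le_trans h1 FK)) _.
  have e1 : k `^ (s - 1) * fine (mu A) `^ N%:R^-1 <= X `^ N%:R^-1.
    rewrite -sN powRrM -powRM ?powR_ge0 ?fine_ge0//.
    by apply: powR_le => //; rewrite// mulr_ge0 ?powR_ge0 ?fine_ge0.
  have -> : k `^ (s - 1) * (C1 * fine (mu A) `^ N%:R^-1 *
      Int mu (cube c r) (fun x => dsm k k (v x) * g x)) =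
    C1 * (k `^ (s - 1) * fine (mu A) `^ N%:R^-1) *
      Int mu (cube c r) (fun x => dsm k k (v x) * g x) by ring.
  by rewrite ler_wpM2r// ler_wpM2l.
have key : X <= 4 `^ s * (C1 * X `^ N%:R^-1 * (2 * G)).
  apply/ler_addgt0Pr => e e0.
  (* Chosen so that the part of the integral where v < 2 tau is at most e. *)
  pose tau := (e / @vol R N r) `^ s^-1 / 2.
  have eV : 0 < e / @vol R N r by rewrite divr_gt0.
  have tau0 : 0 < tau by rewrite divr_gt0// powR_gt0.
  have tauE : (2 * tau) `^ s * @vol R N r = e.
    have -> : 2 * tau = (e / @vol R N r) `^ s^-1 by rewrite /tau mulrC divfK.
    by rewrite powRVK ?(ltW eV) ?gt_eqF// divfK// gt_eqF.
  pose kk i := tau * 2 ^+ i.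
  have kk0 i : 0 < kk i by rewrite mulr_gt0// exprn_gt0.
  have kkS i : kk i.+1 = kk i + kk i by rewrite /kk exprS; ring.
  have [n hn] : exists n, M < kk n.+1.
    have tM : 0 < tau / M by rewrite divr_gt0. have [n _ hn] := near_infty_natSinv_lt (PosNum tM).
    exists n; have := hn n (leqnn n); rewrite /= invf_plt ?posrE//.
    rewrite invf_div ltr_pdivrMr// => h; apply: lt_le_trans h _.
    rewrite mulrC ler_wpM2l ?(ltW tau0)// -natrX ler_nat. by apply: ltnW; exact: ltn_expl.
  (* A value between [kk m.+1] and [kk m.+2], which is 4 times [kk m], is charged to the level m. *)
  have layer t : 0 <= t -> t < kk n.+1 ->
      t `^ s <= (2 * tau) `^ s + \sum_(i < n) 4 `^ s * (kk i `^ s * (if kk i + kk i <= t then 1 else 0)).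
    move=> t0; elim: n {hn} => [|m ih] tm.
      rewrite big_ord0 addr0; apply: powR_le => //; first pos.
      by move: tm; rewrite /kk expr1 mulrC => /ltW.
    rewrite big_ord_recr/= -kkS. have [mt|tlt] := leP (kk m.+1) t.
      via (4 `^ s * (kk m `^ s * 1)).
        rewrite mulr1 -powRM// ?(ltW (kk0 _))//; apply: powR_le => //; first pos.
        by apply: ltW; apply: lt_le_trans tm _; rewrite !kkS; lra.
      rewrite addrA lerDr addr_ge0 ?powR_ge0//; apply: sumr_ge0 => i _.
      by rewrite mulr_ge0// mulr_ge0 ?powR_ge0//; case: ifP.
    by rewrite mulr0 mulr0 addr0; exact: ih.
  pose I i x : R := if kk i + kk i <= v x then 1 else 0.
  have mI i : lmfun (cube c r) (I i).
    apply: (@measurable_funS _ _ _ _ setT) => //.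
    apply: measurable_fun_ifT; [|exact: measurable_cst|exact: measurable_cst].
    by apply: measurable_fun_ler; [exact: measurable_cst|apply: mv].
  have Ii i : itg mu (cube c r) (I i).
    apply: (itg_cube (k := 1)) => // x _; rewrite /I; case: ifP; rewrite ?normr1 ?normr0//.
  have IE i : Int mu (cube c r) (I i) = fine (mu (cube c r `&` [set x | kk i + kk i <= v x])).
    rewrite (@IntS_restrict _ _ _ mu _ _ (I i) mQ (mlev' (kk i + kk i))).
    - rewrite -[RHS]mul1r -Int_cst; last exact: mlev'. by apply: eq_Int => x [_ /= h]; rewrite /I h.
    - by move=> x [].
    - by move=> x xQ; rewrite /I; case: ifP => // h nx; exfalso; apply: nx.
  have ti i : itg mu (cube c r) (fun x => 4 `^ s * (kk i `^ s * I i x)).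
    by apply: itgZ => //; apply: itgZ.
  via (Int mu (cube c r) (fun x => (2 * tau) `^ s + \sum_(i < n) 4 `^ s * (kk i `^ s * I i x))).
    apply: le_Int => //.
      by apply: itgD => //; [exact: itg_cst|apply: itg_sum => // i; exact: ti].
    by move=> x xQ; apply: layer => //; apply: le_lt_trans hn; exact: vM.
  rewrite IntD//; [|exact: itg_cst|by apply: itg_sum => // i; exact: ti].
  rewrite Int_cst_cube tauE addrC lerD2r Int_sum//.
  via (\sum_(i < n) 4 `^ s * (C1 * X `^ N%:R^-1 *
      Int mu (cube c r) (fun x => dsm (kk i) (kk i) (v x) * g x))).
    apply: ler_sum => i _; rewrite IntZ//; last by apply: itgZ.
    rewrite ler_wpM2l// IntZ// IE; exact: lev.
  rewrite -mulr_sumr -mulr_sumr ler_wpM2l// (ler_wpM2l (mulr_ge0 C10 (powR_ge0 _ _)))//.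
  have di i : itg mu (cube c r) (fun x => dsm (kk i) (kk i) (v x) * g x).
    have [_ d2 d3] := sobolev_pair_smst (kk i) (kk0 i) vgL.
    apply: (itg_cube (k := 2 * L)); first exact: measurable_funS d3.
    by move=> x _; have /andP[? ?] := d2 x; rewrite ger0_norm.
  rewrite -Int_sum// -IntZ//; apply: le_Int => //; [exact: itg_sum|exact: itgZ|].
  move=> x _; rewrite -mulr_suml ler_wpM2r ?sum_dsm//; by case/andP: (g0L x).
have [X00|Xn0] := eqVneq X 0; first by rewrite X00 powR_ge0.
have Xp : 0 < X by rewrite lt_neqAle eq_sym Xn0.
rewrite -/s -/G.
have h : X `^ s^-1 <= sobolev_cst r * G.
  have XE : X = X `^ N%:R^-1 * X `^ s^-1.
    rewrite -powRD_pos// -[LHS](powRr1 X0); congr (_ `^ _).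
    by rewrite /s; field; rewrite Nr0 lt0r_neq0.
  have XN : 0 < X `^ N%:R^-1 by exact: powR_gt0.
  rewrite -(ler_pM2l XN) -XE; apply: le_trans key _.
  by apply: eq_ler; rewrite /sobolev_cst -/s /C1; ring.
by rewrite -[leLHS](powRVK (lt0r_neq0 s0) X0); apply: powR_le => //; rewrite ?(ltW s0) ?powR_ge0.
Qed.

End Sobolev.

(** * Calculus of smooth functions *)

Section smooth_functions.
Context {R : realType} {N : nat}.
Implicit Types (u v w : 'rV[R]_N -> R) (x z : 'rV[R]_N) (i : 'I_N) (F : R -> R).

Notation dl i := (delta_mx 0 i : 'rV[R]_N).

(** [smooth] quantifies over lists of directions, whereas product and chain rules call for induction
    on the order of differentiation. *)
Fixpoint Ck (n : nat) u : Prop :=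
  if n is n'.+1 then
    [/\ continuous u, forall i x, derivable u x (dl i) & forall i, Ck n' (partial i u)]
  else continuous u.

Lemma CkS n u : Ck n.+1 u -> Ck n u.
Proof.
elim: n u => [|n ih] u; first by case.
by move=> [cu du Cu]; split => // i; apply: ih; exact: Cu.
Qed.

Lemma iter_partial_rcons s i u : iter_partial (rcons s i) u = iter_partial s (partial i u).
Proof. by rewrite /iter_partial foldr_rcons. Qed.

Lemma smoothP u : smooth u <-> forall n, Ck n u.
Proof.
split=> [su n|Cu].
  elim: n u su => [|n ih] u su; first by have [] := su [::].
  split; [by have [] := su [::]|by have [] := su [::]|].
  move=> i; apply: ih => s; have := su (rcons s i); by rewrite iter_partial_rcons.
move=> s; have := Cu (size s).+1.
elim/last_ind: s u {Cu} => [|s i ih] u; first by case.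
by rewrite iter_partial_rcons size_rcons => -[_ _ /(_ i)/ih].
Qed.

Lemma smooth_cont u : smooth u -> continuous u.
Proof. by move=> su; have [] := su [::]. Qed.

Lemma smooth_derivable u i x : smooth u -> derivable u x (dl i).
Proof. by move=> su; have [_] := su [::]; exact. Qed.

Lemma smooth_partial u i : smooth u -> smooth (partial i u).
Proof. by move=> /smoothP Cu; apply/smoothP => n; have [_ _] := Cu n.+1; exact. Qed.

Lemma smooth_is_derive u i x : smooth u -> is_derive x (dl i) u (partial i u x).
Proof. by move=> su; split => //; exact: smooth_derivable. Qed.

Lemma partialE u i v : (forall x, is_derive x (dl i) u (v x)) -> partial i u = v.
Proof. by move=> uv; apply/funext => x; rewrite /partial; have [_] := uv x. Qed.

Lemma cont_cst (c : R) : continuous (fun _ : 'rV[R]_N => c).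
Proof.
by apply: (lipschitz_continuous (K := 0)) => x y; rewrite subrr normr0 mul0r.
Qed.

Lemma contD u v : continuous u -> continuous v -> continuous (fun x => u x + v x).
Proof. move=> cu cv x; exact: (cvgD (cu x) (cv x)). Qed.

Lemma contM u v : continuous u -> continuous v -> continuous (fun x => u x * v x).
Proof. move=> cu cv x; exact: (cvgM (cu x) (cv x)). Qed.

Lemma Ck_cst n (c : R) : Ck n (fun=> c).
Proof.
elim: n c => [|n ih] c; first exact: cont_cst.
split; [exact: cont_cst|by move=> i x; exact: derivable_cst|].
by move=> i; rewrite (@partialE _ _ (fun=> 0)).
Qed.

Lemma CkD n u v : Ck n u -> Ck n v -> Ck n (fun x => u x + v x).
Proof.
elim: n u v => [|n ih] u v.
  exact: contD.
move=> [cu du Cu] [cv dv Cv].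
have D i x : is_derive x (dl i) (fun x => u x + v x) (partial i u x + partial i v x).
  by apply: is_deriveD; split.
split; first exact: contD.
  by move=> i x; have [] := D i x.
by move=> i; rewrite (@partialE _ i _ (D i)); apply: ih; [exact: Cu|exact: Cv].
Qed.

Lemma CkM n u v : Ck n u -> Ck n v -> Ck n (fun x => u x * v x).
Proof.
elim: n u v => [|n ih] u v.
  exact: contM.
move=> Cu' Cv'; have [cu du Cu] := Cu'; have [cv dv Cv] := Cv'.
have D i x : is_derive x (dl i) (fun x => u x * v x) (u x * partial i v x + v x * partial i u x).
  by apply: is_deriveM; split.
split; first exact: contM.
  by move=> i x; have [] := D i x.
move=> i; rewrite (@partialE _ i _ (D i)); apply: CkD; apply: ih;
  [exact: CkS|exact: Cv|exact: CkS|exact: Cu].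
Qed.

Fixpoint Ck1 (n : nat) F : Prop :=
  if n is n'.+1 then
    exists F', (forall t : R, is_derive t 1 F (F' t)) /\ continuous F /\ Ck1 n' F'
  else continuous F.

Lemma Ck1_cont n F : Ck1 n F -> continuous F.
Proof. by case: n => [//|n [F' [_ []]]]. Qed.

Lemma Ck1S n F : Ck1 n.+1 F -> Ck1 n F.
Proof.
elim: n F => [|n ih] F; first by move=> [F' [_ []]].
by move=> [F' [dF [cF CF]]]; exists F'; do 2?split => //; exact: ih.
Qed.

(** The one-variable chain rule along the line s |-> x + s e. *)
Lemma is_derive_comp u F x (e : 'rV[R]_N) (a b : R) :
  is_derive x e u a -> is_derive (u x) 1 F b -> is_derive x e (F \o u) (b * a).
Proof.
move=> du dF.
have E w : (fun h : R => h^-1 *: (((fun s => w (x + s *: e)) \o shift 0) (h *: 1) -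
      w (x + 0 *: e))) =
      (fun h : R => h^-1 *: ((w \o shift x) (h *: e) - w x)).
  apply/funext => h; rewrite scale0r addr0; congr (_ *: (w _ - _)) => /=.
  by rewrite [h *: 1]mulr1 addr0 addrC.
have h1 : is_derive (0 : R) 1 (fun s : R => u (x + s *: e)) a.
  by have [d1 d2] := du; split; rewrite ?/derivable ?/derive E.
have h2 : is_derive (u (x + (0 : R) *: e)) 1 F b by rewrite scale0r addr0.
have h3 : is_derive (0 : R) 1 (fun s : R => (F \o u) (x + s *: e)) (b * a).
  exact: (@is_derive1_comp R F (fun s : R => u (x + s *: e)) 0 b a h2 h1).
have [d1 d2] := h3; rewrite /derivable (E (F \o u)) in d1.
by rewrite /derive (E (F \o u)) in d2; split.
Qed.

Lemma Ck_comp n u F : Ck n u -> Ck1 n F -> Ck n (F \o u).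
Proof.
elim: n u F => [|n ih] u F.
  by move=> cu cF x; apply: continuous_comp; [exact: cu|exact: cF].
move=> Cu' [F' [dF [cF CF]]]; have [cu du Cu] := Cu'.
have D i x : is_derive x (dl i) (F \o u) (F' (u x) * partial i u x).
  by apply: is_derive_comp => //; split.
split; first by move=> x; apply: continuous_comp; [exact: cu|exact: cF].
  by move=> i x; have [] := D i x.
move=> i; rewrite (@partialE _ i _ (D i)); apply: CkM; last exact: Cu.
by apply: (ih u F') => //; exact: CkS.
Qed.

Definition smooth1 F := forall n, Ck1 n F.

Lemma smooth_cst (c : R) : smooth (fun _ : 'rV[R]_N => c).
Proof. by apply/smoothP => n; exact: Ck_cst. Qed.

Lemma smoothD u v : smooth u -> smooth v -> smooth (fun x => u x + v x).
Proof. by move=> /smoothP Cu /smoothP Cv; apply/smoothP => n; exact: CkD. Qed.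

Lemma smoothM u v : smooth u -> smooth v -> smooth (fun x => u x * v x).
Proof. by move=> /smoothP Cu /smoothP Cv; apply/smoothP => n; exact: CkM. Qed.

Lemma smooth_comp u F : smooth u -> smooth1 F -> smooth (F \o u).
Proof. by move=> /smoothP Cu CF; apply/smoothP => n; exact: Ck_comp. Qed.

Lemma smooth_affine (a b : R) u : smooth u -> smooth (fun x => a * u x + b).
Proof. move=> su; exact: (smoothD (smoothM (smooth_cst a) su) (smooth_cst b)). Qed.

Lemma smooth_prod (I : Type) (s : seq I) (u : I -> 'rV[R]_N -> R) :
  (forall k, smooth (u k)) -> smooth (fun x => \prod_(k <- s) u k x).
Proof.
move=> su; elim: s => [|i s ih].
  by under [X in smooth X]funext => x do rewrite big_nil; exact: smooth_cst.
under [X in smooth X]funext => x do rewrite big_cons.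
exact: (smoothM (su i) ih).
Qed.

Lemma smoothX u n : smooth u -> smooth (fun x => u x ^+ n).
Proof.
move=> su; elim: n => [|n ih].
  by under [X in smooth X]funext => x do rewrite expr0; exact: smooth_cst.
by under [X in smooth X]funext => x do rewrite exprS; exact: (smoothM su ih).
Qed.

Lemma is_derive_coord i j x : is_derive x (dl i) (fun z => z 0 j) ((j == i)%:R : R).
Proof.
have E : (fun h : R => h^-1 *: (((fun z : 'rV[R]_N => z 0 j) \o shift x) (h *: dl i) - x 0 j))
     = (fun h : R => h^-1 * (h * (j == i)%:R)).
  by apply/funext => h /=; rewrite !mxE addrK eqxx.
have C : h^-1 * (h * (j == i)%:R) @[h --> (0 : R)^'] --> ((j == i)%:R : R).
  apply/cvgrPdist_lt => e e0; near=> h.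
  have h0 : h != 0 by near: h; exact: nbhs_dnbhs_neq.
  by rewrite mulrA mulVf// mul1r subrr normr0.
split; first by rewrite /derivable E; apply/cvg_ex; exists (j == i)%:R.
by rewrite /derive E; exact: cvg_lim.
Unshelve. all: end_near. Qed.

Lemma smooth_coord j : smooth (fun z : 'rV[R]_N => z 0 j).
Proof.
apply/smoothP; case=> [|n]; first by move=> x; exact: coord_continuous.
split; first by move=> x; exact: coord_continuous.
  by move=> i x; have [] := is_derive_coord i j x.
by move=> i; rewrite (partialE (is_derive_coord i j)); exact: Ck_cst.
Qed.

Lemma smooth_slope u x : smooth u -> slope u x (\sum_i `|partial i u x|).
Proof.
move=> su; apply: C1_slope => [i z|i]; first exact: smooth_derivable.
exact: (smooth_cont (smooth_partial i su)).
Qed.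

End smooth_functions.

(** * The functions exp(-c/t) and smooth approximations of the positive part *)

Section exp_inv.
Context {R : realType}.
Implicit Types (c t y : R) (P : {poly R}).

Lemma is_derive_val {V W : normedModType R} (f : V -> W) (x v : V) (a b : W) :
  is_derive x v f a -> a = b -> is_derive x v f b.
Proof. by move=> fa <-. Qed.

Lemma poly_expR_bound P c : 0 < c -> exists K, forall y, 0 < y -> `|P.[y]| <= K * expR (c * y).
Proof.
elim/poly_ind: P c => [|P a ih] c c0.
  by exists 0 => y _; rewrite horner0 normr0 mul0r.
have c2 : 0 < c / 2 by lra.
have [K hK] := ih _ c2.
exists (K * (2 / c) + `|a|) => y y0; rewrite hornerMXaddC.
have K0 : 0 <= K.
  by have := le_trans (normr_ge0 _) (hK 1 ltr01); rewrite pmulr_lge0// expR_gt0.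
have ey : y <= 2 / c * expR (c / 2 * y).
  have := expR_ge1Dx (c / 2 * y) => h.
  rewrite -ler_pdivrMl; last pos.
  pos.
have e1 : 1 <= expR (c * y).
  by rewrite -expR0 ler_expR mulr_ge0// ltW.
apply: le_trans (ler_normD _ _) _; rewrite mulrDl; apply: lerD; last by rewrite ler_peMr.
rewrite normrM (ger0_norm (ltW y0)).
apply: le_trans (ler_pM _ _ (hK y y0) ey) _ => //; first pos.
have -> : c * y = c / 2 * y + c / 2 * y by rewrite -mulrDl -splitr.
by rewrite expRD mulrACA.
Qed.

(** P(1/t) exp(-c/t), continued by 0: a class that contains exp(-c/t) and is closed under
    differentiation. *)
Definition expinv c P t : R := if 0 < t then P.[t^-1] * expR (- (c * t^-1)) else 0.

(** With y = 1/t, the exponential dominates P(y) y^2. The quadratic decay gives the derivative 0 at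
    the origin, the only delicate point. *)
Lemma expinv_bound c P : 0 < c -> exists K, forall t, `|expinv c P t| <= K * t ^+ 2.
Proof.
move=> c0; have [K hK] := poly_expR_bound (P * 'X^2) c0.
have K0 : 0 <= K.
  by have := le_trans (normr_ge0 _) (hK 1 ltr01); rewrite pmulr_lge0// expR_gt0.
exists K => t; rewrite /expinv; case: ifPn => [t0|_]; last first.
  by rewrite normr0 mulr_ge0// sqr_ge0.
have y0 : 0 < t^-1 by rewrite invr_gt0.
have := hK _ y0; rewrite hornerM hornerXn normrM [X in _ * X]ger0_norm ?exprn_ge0 ?(ltW y0)//.
move=> h; rewrite exprVn in h.
rewrite normrM (ger0_norm (expR_ge0 _)) expRN ler_pdivrMr ?expR_gt0// mulrAC.
by rewrite -ler_pdivrMr// exprn_gt0.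
Qed.

Lemma is_derive_expinv c P t : 0 < c ->
  is_derive t 1 (expinv c P) (expinv c ((c *: P - P^`()) * 'X^2) t).
Proof.
move=> c0; have [t0|] := ltP 0 t.
  have D : is_derive t 1 (fun s : R => P.[s^-1] * expR (- (c * s^-1)))
     (((c *: P - P^`()) * 'X^2).[t^-1] * expR (- (c * t^-1))).
    have i1 : is_derive t 1 (fun s : R => s^-1) (- t^-2).
      apply: (is_derive_val (@is_deriveV R id t 1 1 (lt0r_neq0 t0) (is_derive_id _ _))).
      by rewrite /GRing.scale/= mulr1.
    have p1 : is_derive t 1 (fun s : R => P.[s^-1]) (P^`().[t^-1] * - t^-2).
      exact: (@is_derive1_comp R (fun y => P.[y]) (fun s => s^-1) t _ _ (is_derive_poly P t^-1) i1).
    have l1 : is_derive t 1 (fun s : R => - (c * s^-1)) (c * t^-2).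
      apply: (is_derive_val (is_deriveN (is_deriveZ c i1))). by rewrite /GRing.scale/= mulrN opprK.
    have e1 := @is_derive1_comp R expR (fun s => - (c * s^-1)) t _ _ (is_derive_expR _) l1.
    apply: (is_derive_val (is_deriveM p1 e1)).
    rewrite /GRing.scale/= hornerM hornerXn hornerD hornerN hornerZ exprVn; ring.
  rewrite {2}/expinv t0; apply: near_eq_is_derive D.
  near=> s; rewrite /expinv; case: ifPn => // /negP ns; exfalso; apply: ns.
  by near: s; exact: lt_nbhsr.
rewrite le_eqVlt => /orP[/eqP ->|t0].
  have [K hK] := @expinv_bound c P c0.
  have K0 : 0 <= K by have := le_trans (normr_ge0 _) (hK 1); rewrite expr1n mulr1.
  have e0 Q : expinv c Q 0 = 0 by rewrite /expinv ltxx.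
  rewrite e0.
  have C : h^-1 *: ((expinv c P \o shift 0) (h *: (1 : R)) - expinv c P 0) @[h --> (0 : R)^'] --> (0 : R).
    apply/cvgrPdist_le => e ep. have dp : 0 < e / (K + 1) by rewrite divr_gt0// ltr_wpDl. near=> h.
    have h0 : h != 0 by near: h; exact: nbhs_dnbhs_neq.
    rewrite e0 subr0 /= addr0 [h *: 1]mulr1 sub0r normrN normrM normfV.
    rewrite mulrC ler_pdivrMr ?normr_gt0//; apply: le_trans (hK h) _.
    rewrite -real_normK ?num_real// expr2 mulrA ler_wpM2r//.
    rewrite (@le_trans _ _ ((K + 1) * `|h|)) ?ler_wpM2r ?lerDl//.
    rewrite mulrC -ler_pdivlMr ?ltr_wpDl//.
    by near: h; apply: nbhs_dnbhs; apply/nbhs_normP; exists (e / (K + 1)) => // z /=;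
      rewrite sub0r normrN => /ltW.
  split; first by apply/cvg_ex; exists 0.
  by rewrite /derive; exact: cvg_lim.
have -> : expinv c ((c *: P - P^`()) * 'X^2) t = 0 by rewrite /expinv ltNge (ltW t0).
have D0 : is_derive t 1 (cst (0 : R) : R -> R) (0 : R) by exact: is_derive_cst.
apply: near_eq_is_derive D0.
near=> s; rewrite /expinv /=; case: ifPn => // s0; exfalso.
have : s < 0 by near: s; exact: lt_nbhsl.
by move=> /(lt_trans s0); rewrite ltxx.
Unshelve. all: end_near. Qed.

Lemma smooth1_expinv c P : 0 < c -> smooth1 (expinv c P).
Proof.
move=> c0 n; have cE Q : continuous (expinv c Q).
  move=> t; apply: differentiable_continuous; apply/derivable1_diffP.
  by have [] := is_derive_expinv Q t c0.
elim: n P => [|n ih] P; first exact: cE.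
by exists (expinv c ((c *: P - P^`()) * 'X^2)); split=> [t|]; [exact: is_derive_expinv|split].
Qed.

(** Tends to the indicator of t > 0 as c tends to 0, and stands for that indicator wherever a smooth
    function is required. *)
Definition sexp c t : R := if 0 < t then expR (- (c / t)) else 0.

Lemma sexpE c : sexp c = expinv c 1.
Proof. by apply/funext => t; rewrite /sexp /expinv hornerC mul1r. Qed.

Lemma smooth1_sexp c : 0 < c -> smooth1 (sexp c).
Proof. by move=> c0; rewrite sexpE; exact: smooth1_expinv. Qed.

Definition dsexp c t : R := if 0 < t then c / t ^+ 2 * expR (- (c / t)) else 0.

Lemma is_derive_sexp c t : 0 < c -> is_derive t 1 (sexp c) (dsexp c t).
Proof.
move=> c0; rewrite sexpE; apply: (is_derive_val (is_derive_expinv 1 t c0)).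
rewrite /expinv /dsexp; case: ifP => // _; rewrite derivC subr0 hornerM hornerZ hornerC hornerXn.
by rewrite mulr1 exprVn.
Qed.

Lemma sexp_ge0 c t : 0 <= sexp c t.
Proof. by rewrite /sexp; case: ifP => // _; exact: expR_ge0. Qed.

Lemma sexp_le1 c t : 0 < c -> sexp c t <= 1.
Proof.
by move=> c0; rewrite /sexp; case: ifP => // t0; rewrite -expR0 ler_expR oppr_le0 divr_ge0// ltW.
Qed.

Lemma sexp_eq0 c t : t <= 0 -> sexp c t = 0.
Proof. by rewrite /sexp leNgt => /negbTE ->. Qed.

Lemma sexp_neq0 c t : sexp c t != 0 -> 0 < t.
Proof. by rewrite /sexp; case: ifP => //; rewrite eqxx. Qed.

Lemma dsexp_ge0 c t : 0 < c -> 0 <= dsexp c t.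
Proof.
move=> c0; rewrite /dsexp; case: ifP => // t0.
pos.
Qed.

(* (1 + y) exp (- y) <= 1 with y = c / t *)
Lemma sexp_dsexp_le1 c t : 0 < c -> sexp c t + t * dsexp c t <= 1.
Proof.
move=> c0; rewrite /sexp /dsexp; case: ifP => [t0|]; last by rewrite mulr0 addr0.
have -> : expR (- (c / t)) + t * (c / t ^+ 2 * expR (- (c / t))) = (1 + c / t) / expR (c / t).
  by rewrite expRN; field; rewrite !gt_eqF// expR_gt0.
by rewrite ler_pdivrMr ?expR_gt0// mul1r expR_ge1Dx.
Qed.

Lemma dsexp_le c t : 0 < c -> dsexp c t <= 2 / c.
Proof.
move=> c0; rewrite /dsexp; case: ifP => [t0|_]; last pos.
have ct : 0 <= c / t by rewrite divr_ge0// ltW.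
have := expR_ge1Dxn 1 ct; rewrite (_ : (1.+1)`!%:R = 2 :> R)// => h.
rewrite expRN ler_pdivrMr ?expR_gt0//.
have h2 : (c / t) ^+ 2 / 2 <= expR (c / t) by apply: le_trans h; rewrite lerDr.
have -> : c / t ^+ 2 = 2 / c * ((c / t) ^+ 2 / 2).
  by rewrite exprMn exprVn; field; rewrite !lt0r_neq0.
by rewrite ler_wpM2l// divr_ge0// ltW.
Qed.

End exp_inv.

Section truncation.
Context {R : realType}.
Implicit Types (c t : R).

(* A smooth approximation of the positive part from below, as c -> 0 *)
Definition spos c t : R := t * sexp c t.

Definition dspos c t : R := sexp c t + t * dsexp c t.

Lemma is_derive_spos c t : 0 < c -> is_derive t 1 (spos c) (dspos c t).
Proof.
move=> c0; apply: (is_derive_val (is_deriveM (is_derive_id t 1) (is_derive_sexp t c0))).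
by rewrite /GRing.scale/= /dspos mulr1 addrC.
Qed.

Lemma dspos_le1 c t : 0 < c -> dspos c t <= 1.
Proof. exact: sexp_dsexp_le1. Qed.

Lemma dspos_ge c t : 0 < c -> sexp c t <= dspos c t.
Proof.
move=> c0; rewrite /dspos lerDl; have [t0|t0] := leP t 0.
  by rewrite /dsexp ltNge t0 mulr0.
by rewrite mulr_ge0 ?dsexp_ge0// ltW.
Qed.

Lemma dspos_ge0 c t : 0 < c -> 0 <= dspos c t.
Proof. by move=> c0; apply: le_trans (dspos_ge t c0); exact: sexp_ge0. Qed.

Lemma dspos_eq0 c t : t <= 0 -> dspos c t = 0.
Proof. by move=> t0; rewrite /dspos sexp_eq0// /dsexp ltNge t0 mulr0 addr0. Qed.

Lemma spos_eq0 c t : t <= 0 -> spos c t = 0.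
Proof. by move=> t0; rewrite /spos sexp_eq0// mulr0. Qed.

Lemma spos_ge0 c t : 0 <= spos c t.
Proof.
have [t0|t0] := leP t 0; first by rewrite spos_eq0.
by rewrite /spos mulr_ge0 ?sexp_ge0// ltW.
Qed.

Lemma spos_le c t : 0 < c -> spos c t <= Num.max 0 t.
Proof.
move=> c0; have [t0|t0] := leP t 0; first by rewrite spos_eq0.
by rewrite /spos ler_piMr ?sexp_le1// ltW.
Qed.

Lemma sexp_continuous c : 0 < c -> continuous (sexp c).
Proof.
move=> c0 t; apply: differentiable_continuous; apply/derivable1_diffP.
by have [] := is_derive_sexp t c0.
Qed.

Lemma dsexp_continuous c : 0 < c -> continuous (dsexp c).
Proof.
move=> c0; have -> : dsexp c = expinv c (c *: 'X^2).
  apply/funext => t; rewrite /dsexp /expinv; case: ifP => // _.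
  by rewrite hornerZ hornerXn exprVn.
exact: (Ck1_cont (smooth1_expinv _ c0 0)).
Qed.

Lemma dspos_continuous c : 0 < c -> continuous (dspos c).
Proof.
move=> c0 t; apply: (@cvgD _ _ _ _ _ (sexp c) (fun t => t * dsexp c t)).
  exact: sexp_continuous.
by apply: (@cvgM _ _ _ _ id (dsexp c)); [exact: cvg_id|exact: dsexp_continuous].
Qed.

Lemma sexp_cvg t : sexp n.+1%:R^-1 t @[n --> \oo] --> (if 0 < t then 1 else 0 : R).
Proof.
rewrite /sexp; case: ifPn => t0; last exact: cvg_cst.
have h : - (n.+1%:R^-1 / t) @[n --> \oo] --> (- (0 / t) : R).
  by apply: cvgN; apply: cvgMl; exact: cvg_harmonic.
rewrite mul0r oppr0 in h; rewrite -[X in _ --> X]expR0.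
by apply: continuous_cvg h; exact: continuous_expR.
Qed.

Lemma spos_cvg t : spos n.+1%:R^-1 t @[n --> \oo] --> Num.max 0 t.
Proof.
have -> : Num.max 0 t = t * (if 0 < t then 1 else 0).
  by case: (ltP 0 t) => t0; rewrite ?mulr1 ?mulr0.
by apply: cvgMr; exact: sexp_cvg.
Qed.

End truncation.

(** * Absolute continuity of the integral, norms of vectors, limits of sequences *)

Section integral_facts.
Context d (T : measurableType d) {R : realType} (m : {measure set T -> \bar R}).
Implicit Types (D F : set T) (f g : T -> R) (e k : R).

Lemma itgM_bounded D f g k : measurable D -> itg m D f -> measurable_fun D g ->
  (forall x, D x -> `|g x| <= k) -> itg m D (fun x => f x * g x).
Proof.
move=> mD fi mg gk; apply: (itg_le (g := fun x => k * `|f x|)) => //.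
- by apply: measurable_funM => //; exact: itg_mfun fi.
- by move=> x Dx; rewrite normrM mulrC ler_wpM2r// gk.
- by apply: itgZ => //; exact: itg_norm.
Qed.

Lemma Int_eq0_ae D f : measurable D -> itg m D f -> (forall x, D x -> 0 <= f x) ->
  Int m D f = 0 -> {ae m, forall x, D x -> f x = 0}.
Proof.
move=> mD fi f0 I0.
have mf : measurable_fun D (EFin \o f) by apply/measurable_EFinP; exact: itg_mfun fi.
have /(ae_eq_integral_abs m mD mf) : (\int[m]_(x in D) `|(EFin \o f) x|)%E = 0.
  transitivity (\int[m]_(x in D) (f x)%:E)%E; last by rewrite IntE// I0.
  by apply: eq_integral => x /[!inE] Dx /=; rewrite ger0_norm// f0.
by apply: filterS => x /= h Dx; have := h Dx => -[].
Qed.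

Lemma ae_imp (P Q : T -> Prop) : {ae m, forall x, P x} -> (forall x, P x -> Q x) ->
  {ae m, forall x, Q x}.
Proof. by move=> h PQ; exact: filterS PQ h. Qed.

Lemma ae_imp2 (P P' Q : T -> Prop) : {ae m, forall x, P x} -> {ae m, forall x, P' x} ->
  (forall x, P x -> P' x -> Q x) -> {ae m, forall x, Q x}.
Proof. by move=> h h' PQ; exact: filterS2 PQ h h'. Qed.

Lemma ae_all (P : T -> Prop) : (forall x, P x) -> {ae m, forall x, P x}.
Proof. by move=> h; exact: nearW. Qed.

Lemma ae_nat (P : nat -> T -> Prop) : (forall n, {ae m, forall x, P n x}) ->
  {ae m, forall x, forall n, P n x}.
Proof. exact: ae_foralln. Qed.

(** At a suitable height n the part of |f| above n has integral at most e / 2; the part below is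
    controlled by the measure of F. *)
Lemma Int_abs_small D f e : measurable D -> (m D < +oo)%E -> itg m D f -> 0 < e ->
  exists2 dl, 0 < dl & forall F, measurable F -> F `<=` D -> fine (m F) <= dl ->
    Int m F (fun x => `|f x|) <= e.
Proof.
move=> mD Doo fi e0.
have mf := itg_mfun fi.
have mt n : measurable_fun D (fun x => Num.max (`|f x| - n%:R) 0).
  apply: measurable_maxr => //; apply: measurable_funB => //.
  exact: (measurableT_comp (@normr_measurable _ _)).
have L1 x : D x -> Num.max (`|f x| - n%:R) 0 @[n --> \oo] --> (0 : R).
  move=> _; apply: cvg_near_cst.
  exists (Num.truncn `|f x|).+1 => // n /= hn; apply/eqP.
  rewrite max_r// subr_le0; apply: le_trans (ltW (truncnS_gt _)) _.
  by rewrite ler_nat.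
have L2 : {ae m, forall x, D x -> forall n, `|Num.max (`|f x| - n%:R) 0| <= `|f x|}.
  apply: nearW => x _ n; rewrite ger0_norm// ge_max normr_ge0 andbT.
  by rewrite lerBlDr lerDl.
have L1' : {ae m, forall x, D x -> (fun n => Num.max (`|f x| - n%:R) 0) @ \oo --> cst 0 x} by apply: nearW.
have m0 : measurable_fun D (cst 0 : T -> R) := measurable_cst _.
have [_ L] := Int_dominated mD mt m0 L1' (itg_norm mD fi) L2.
have I0 : Int m D (cst 0) = 0 :> R by rewrite Int_cst// mul0r.
rewrite I0 in L; have e2 : 0 < e / 2 by lra.
have [n _ /(_ n (leqnn n)) hn] := (cvgr0Pnorm_le _).1 L _ e2.
exists (e / 2 / n.+1%:R); first pos.
move=> F mF FD hF.
have fF := itgS mD mF FD fi.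
have Foo : (m F < +oo)%E by apply: le_lt_trans Doo; apply: le_measure => //; rewrite inE.
have tD : itg m D (fun x => Num.max (`|f x| - n%:R) 0).
  apply: (itg_le (g := fun x => `|f x|)) => //; last exact: itg_norm.
  move=> x Dx; rewrite ger0_norm// ge_max normr_ge0 andbT.
  by rewrite lerBlDr lerDl.
have tF := itgS mD mF FD tD.
have cF : itg m F (fun=> n.+1%:R) by exact: itg_cst.
via (Int m F (fun x => n.+1%:R + Num.max (`|f x| - n%:R) 0)).
  apply: le_Int => //; [exact: itg_norm|exact: itgD|].
  move=> x Fx; have : `|f x| - n%:R <= Num.max (`|f x| - n%:R) 0 by rewrite le_max lexx.
  lra.
rewrite IntD// Int_cst//.
have : n.+1%:R * fine (m F) <= e / 2.
  by rewrite mulrC -ler_pdivlMr.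
have : Int m F (fun x => Num.max (`|f x| - n%:R) 0) <= e / 2.
  apply: le_trans (le_trans (IntS mD mF FD tD _) (le_trans (ler_norm _) hn)).
    by [].
  by move=> x _; rewrite le_max lexx orbT.
lra.
Qed.

End integral_facts.

Section norms.
Context {R : realType} {N : nat}.
Implicit Types (v w : 'rV[R]_N) (i : 'I_N).

(** The norm dual to the maximum norm, hence the one that measures gradients when slopes are taken
    in the maximum norm. *)
Definition norm1 v : R := \sum_i `|v 0 i|.

Lemma norm1_ge0 v : 0 <= norm1 v. Proof. exact: sumr_ge0. Qed.

Lemma norm1D v w : norm1 (v + w) <= norm1 v + norm1 w.
Proof. by rewrite -big_split/=; apply: ler_sum => i _; rewrite mxE; exact: ler_normD. Qed.

Lemma norm1Z (a : R) v : norm1 (a *: v) = `|a| * norm1 v.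
Proof. by rewrite mulr_sumr; apply: eq_bigr => i _; rewrite mxE normrM. Qed.

Lemma norm1B v w : norm1 (v - w) <= norm1 v + norm1 w.
Proof. by apply: le_trans (norm1D _ _) _; rewrite -scaleN1r norm1Z normrN1 mul1r. Qed.

Lemma dotp_ge0 v : 0 <= dotp v v.
Proof. by apply: sumr_ge0 => i _; exact: sqr_ge0. Qed.

Lemma enorm_ge0 v : 0 <= enorm v. Proof. exact: sqrtr_ge0. Qed.

Lemma enorm_coord v i : `|v 0 i| <= enorm v.
Proof.
rewrite -sqrtr_sqr; apply: ler_wsqrtr; rewrite /dotp (bigD1 i)//= expr2 lerDl.
by apply: sumr_ge0 => j _; exact: sqr_ge0.
Qed.

Lemma norm1_enorm v : norm1 v <= N%:R * enorm v.
Proof.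
apply: le_trans (ler_sum _ (fun i _ => enorm_coord v i)) _.
by rewrite sumr_const card_ord mulr_natl.
Qed.

Lemma enorm_norm1 v : enorm v <= norm1 v.
Proof.
rewrite -[leRHS]ger0_norm ?norm1_ge0// -sqrtr_sqr; apply: ler_wsqrtr.
rewrite expr2 {2}/norm1 mulr_sumr; apply: ler_sum => i _.
apply: le_trans (ler_norm _) _; rewrite normrM ler_wpM2r//.
by rewrite /norm1 (bigD1 i)//= lerDl sumr_ge0.
Qed.

Lemma enorm_eq0 v : enorm v = 0 -> v = 0.
Proof.
move=> v0; apply/rowP => i; rewrite mxE; apply/eqP; rewrite -normr_le0 -v0.
exact: enorm_coord.
Qed.

Lemma norm1_cvg (v_ : nat -> 'rV[R]_N) v : (forall i, v_ n 0 i @[n --> \oo] --> v 0 i) ->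
  norm1 (v_ n) @[n --> \oo] --> norm1 v.
Proof.
move=> h; rewrite /norm1; elim: (index_enum _) => [|i s ih].
  by rewrite big_nil; under eq_fun do rewrite big_nil; exact: cvg_cst.
rewrite big_cons; under eq_fun do rewrite big_cons.
by apply: cvgD ih; apply: cvg_norm; exact: h.
Qed.

Lemma mfun_enorm D (g : 'rV[R]_N -> 'rV[R]_N) :
  (forall i, lmfun D (fun x => g x 0 i)) ->
  lmfun D (fun x => enorm (g x)).
Proof.
move=> mg; apply: (measurableT_comp (f := @Num.sqrt R)); first by apply: continuous_measurable_fun => x; exact: sqrt_continuous.
rewrite /dotp; apply: measurable_sum => i; apply: measurable_funM; exact: mg.
Qed.

Lemma mfun_norm1 D (g : 'rV[R]_N -> 'rV[R]_N) :
  (forall i, lmfun D (fun x => g x 0 i)) ->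
  lmfun D (fun x => norm1 (g x)).
Proof.
move=> mg; rewrite /norm1; apply: measurable_sum => i.
by apply: (measurableT_comp (f := @Num.norm R R)); [exact: normr_measurable|exact: mg].
Qed.

Definition grad (phi : 'rV[R]_N -> R) x : 'rV[R]_N := \row_i partial i phi x.

End norms.
#[global] Hint Extern 1 (is_true (0 <= norm1 _)) => exact: norm1_ge0 : nonneg.
#[global] Hint Extern 1 (is_true (0 <= enorm _)) => exact: enorm_ge0 : nonneg.

Section sequences.
Context {R : realType}.
Implicit Types (s t : nat -> R) (l k : R).

Lemma cvg_geo s l k : (forall n, `|s n - l| <= k * 2^-1 ^+ n) -> s n @[n --> \oo] --> l.
Proof.
move=> h; have h2 : `|2^-1 : R| < 1 by rewrite ger0_norm; lra.
have c0 : k * 2^-1 ^+ n @[n --> \oo] --> (0 : R).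
  by rewrite -[X in _ --> X](mulr0 k); apply: cvgMr; exact: cvg_expr.
have cm : l - k * 2^-1 ^+ n @[n --> \oo] --> l.
  by rewrite -[X in _ --> X]subr0; apply: cvgB c0; exact: cvg_cst.
have cp : l + k * 2^-1 ^+ n @[n --> \oo] --> l.
  by rewrite -[X in _ --> X]addr0; apply: cvgD c0; exact: cvg_cst.
apply: (squeeze_cvgr _ cm cp); apply: nearW => n.
by have := h n; rewrite ler_norml => ?; lra.
Qed.

Lemma cvg_le s l k : s n @[n --> \oo] --> l -> (forall n, s n <= k) -> l <= k.
Proof.
move=> h hk; rewrite -(cvg_lim (@Rhausdorff R) h); apply: limr_le; first by apply/cvg_ex; exists l.
exact: nearW.
Qed.

Lemma cvg_norm_le s l k : s n @[n --> \oo] --> l -> (forall n, `|s n| <= k) -> `|l| <= k.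
Proof. by move=> h; apply: cvg_le; exact: cvg_norm. Qed.

Lemma cvg_uniq s l l' : s n @[n --> \oo] --> l -> s n @[n --> \oo] --> l' -> l = l'.
Proof. by move=> h h'; rewrite -(cvg_lim (@Rhausdorff R) h) -(cvg_lim (@Rhausdorff R) h'). Qed.

Lemma squeeze0 s t : (forall n, 0 <= s n <= t n) -> t n @[n --> \oo] --> (0 : R) ->
  s n @[n --> \oo] --> (0 : R).
Proof. by move=> h t0; apply: (squeeze_cvgr _ (cvg_cst 0) t0); apply: nearW => n; exact: h. Qed.

End sequences.

Section itg_ae.
Context d (T : measurableType d) {R : realType} (m : {measure set T -> \bar R}).
Implicit Types (D : set T) (f g : T -> R).

Lemma itg_le_ae D f g : measurable D -> measurable_fun D f ->
  {ae m, forall x, D x -> `|f x| <= g x} -> itg m D g -> itg m D f.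
Proof.
move=> mD mf fg gi; apply/integrableP; split; first exact/measurable_EFinP.
have /integrableP[_] := gi; apply: le_lt_trans; apply: le_integral_ae.
by apply: (ae_imp fg) => x /= h Dx; rewrite lee_fin; apply: le_trans (h Dx) _; exact: ler_norm.
Qed.

Lemma itg_ereal_le D f k : measurable D -> measurable_fun D f -> (forall x, D x -> 0 <= f x) ->
  (\int[m]_(x in D) (f x)%:E <= k%:E)%E -> itg m D f /\ Int m D f <= k.
Proof.
move=> mD mf f0 fk; have fi : itg m D f.
  apply/integrableP; split; first exact/measurable_EFinP.
  apply: (@le_lt_trans _ _ k%:E); last exact: ltry.
  apply: le_trans fk; apply: eq_ler.
  by apply: eq_integral => x /[!inE] Dx /=; rewrite ger0_norm// f0.
by split => //; rewrite -lee_fin -IntE.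
Qed.

(* The weights 2^-(n+1) make the sum integrable, hence finite almost everywhere. *)
Lemma summable_majorant D (a : nat -> T -> R) : measurable D ->
  (forall n, itg m D (a n)) -> (forall n x, D x -> 0 <= a n x) -> (forall n, Int m D (a n) <= 1) ->
  exists2 t, itg m D t & {ae m, forall x, D x -> 0 <= t x /\ forall n, a n x <= 2 ^+ n.+1 * t x}.
Proof.
move=> mD ai a0 a1.
pose b n x := (1 / (2 ^ n.+1)%:R) * a n x.
have p0 n : 0 < 1 / (2 ^ n.+1)%:R :> R by rewrite divr_gt0// ltr0n expn_gt0.
have b0 n x : D x -> 0 <= b n x by move=> Dx; rewrite mulr_ge0// a0.
have bi n : itg m D (b n) by exact: itgZ.
pose S x := (\sum_(n <oo) (b n x)%:E)%E.
have mb n : measurable_fun D (fun x => (b n x)%:E) by apply/measurable_EFinP; exact: itg_mfun (bi n).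
have S0 x : D x -> (0 <= S x)%E by move=> Dx; apply: nneseries_ge0 => n _ _; rewrite lee_fin b0.
have mS : measurable_fun D S.
  by apply: (ge0_emeasurable_sum (P := xpredT)) => n // x Dx _; rewrite lee_fin b0.
have IS : (\int[m]_(x in D) S x < +oo)%E.
  rewrite /S (integral_nneseries m mD mb) => [|n x Dx]; last by rewrite lee_fin b0.
  apply: (@le_lt_trans _ _ 1%:E); last exact: ltry.
  apply: le_trans (epsilon_trick0 xpredT (@ler01 R)).
  apply: lee_nneseries => n _.
    by move=> _; apply: integral_ge0 => x Dx; rewrite lee_fin b0.
  rewrite IntE// IntZ// lee_fin -[leRHS]mulr1.
  by rewrite ler_wpM2l// ltW.
have Si : m.-integrable D S.
  apply/integrableP; split => //; apply: le_lt_trans IS; rewrite le_eqVlt; apply/orP; left.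
  by apply/eqP; apply: eq_integral => x /[!inE] Dx; rewrite gee0_abs// S0.
exists (fine \o S).
  have mf : measurable_fun D (fine \o S) by apply: measurableT_comp mS; exact: (fine_measurable measurableT).
  apply/integrableP; split; first exact/measurable_EFinP.
  have /integrableP[_] := Si; apply: le_lt_trans; apply: le_integral_ae.
  apply: ae_all => x Dx /=.
  case: (S x) (S0 x Dx) => [r| |]; rewrite//=; first by rewrite normr0.
have Sf := integrable_ae mD Si; apply: (ae_imp Sf) => x hx Dx.
have fx := hx Dx; split; first by rewrite /= fine_ge0// S0.
move=> n; have : ((b n x)%:E <= S x)%E.
  apply: le_trans (nneseries_lim_ge n.+1 (P := xpredT) _); last by move=> k _ _; rewrite lee_fin b0.
  rewrite big_mkord big_ord_recr/= leeDr// sumEFin lee_fin.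
  by apply: sumr_ge0 => k _; exact: b0.
rewrite -(fineK fx) lee_fin /b div1r mulrC ler_pdivrMr; last pos.
by rewrite natrX mulrC.
Qed.

End itg_ae.

Section measurable_comparison.
Context {R : realType} {N : nat}.
Implicit Types (D : set 'rV[R]_N) (f g : 'rV[R]_N -> R) (k : R).

Lemma lmfM (D : set 'rV[R]_N) f g : mset D -> lmfun D f -> lmfun D g ->
  lmfun D (fun x => f x * g x).
Proof. by move=> mD mf mg; exact: (measurable_funM mf mg). Qed.

Lemma lmf_cst D k : lmfun D (fun=> k).
Proof. exact: measurable_cst. Qed.

Lemma lmfD D f g : mset D -> lmfun D f -> lmfun D g ->
  lmfun D (fun x => f x + g x).
Proof. by move=> mD mf mg; exact: (measurable_funD mf mg). Qed.

Lemma lmfB D f g : mset D -> lmfun D f -> lmfun D g ->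
  lmfun D (fun x => f x - g x).
Proof. by move=> mD mf mg; exact: (measurable_funB mf mg). Qed.

Lemma lmfZ D f k : mset D -> lmfun D f ->
  lmfun D (fun x => k * f x).
Proof. by move=> mD mf; apply: lmfM => //; exact: lmf_cst. Qed.

Lemma lmf_norm D f : mset D -> lmfun D f ->
  lmfun D (fun x => `|f x|).
Proof. by move=> mD mf; exact: (measurableT_comp (@normr_measurable _ _) mf). Qed.

End measurable_comparison.

Lemma cvg_prodr {R : realType} (I : Type) (s : seq I) (f : nat -> I -> R) (l : I -> R) :
  (forall i, f n i @[n --> \oo] --> l i) ->
  \prod_(i <- s) f n i @[n --> \oo] --> \prod_(i <- s) l i.
Proof.
move=> fl; elim: s => [|i s ih].
  by rewrite big_nil; under eq_fun => n do rewrite big_nil; exact: cvg_cst.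
rewrite big_cons; under eq_fun => n do rewrite big_cons.
exact: (cvgM (fl i) ih).
Qed.

(** * Test functions and the fundamental lemma of the calculus of variations *)

Section test_functions.
Context {R : realType} {N : nat}.
Notation mu := (leb R N).
Local Notation vec := 'rV[R]_N.
Implicit Types (x : vec) (phi psi u v w : vec -> R) (i : 'I_N) (K E : set vec) (n m : nat) (s t l c : R).
Variable Omega : set vec.

Lemma support_vanish phi x : ~ support_of phi x -> phi x = 0 /\ forall i, partial i phi x = 0.
Proof.
move=> nx.
have n0 : \forall y \near x, phi y = 0.
  have oC : open (~` support_of phi) by apply: closed_openC; exact: closed_closure.
  have := open_nbhs_nbhs (conj oC nx); apply: filterS => y ny.
  by apply: contrapT => /eqP py; apply: ny; exact: subset_closure.
split; first exact: nbhs_singleton n0.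
move=> i; rewrite /partial.
transitivity ('D_(delta_mx 0 i) (fun=> 0 : R) x); last exact: derive_cst.
exact: near_eq_derive.
Qed.

Lemma support_sub phi K : closed K -> (forall x, phi x != 0 -> K x) -> support_of phi `<=` K.
Proof. by move=> cK pK; apply: (subset_trans (closure_subset pK)); rewrite -(closure_id K).1. Qed.

Lemma test_funP phi K : smooth phi -> compact K -> K `<=` Omega -> (forall x, phi x != 0 -> K x) ->
  test_fun Omega phi.
Proof.
move=> sp kK KO pK.
have cK : closed K by apply: compact_closed => //; exact: norm_hausdorff.
have sK := support_sub cK pK.
split => //; last exact: subset_trans KO.
by apply: subclosed_compact kK sK; exact: closed_closure.
Qed.

Lemma compact_support_bounded phi psi : continuous phi -> compact (support_of psi) ->
  (forall x, ~ support_of psi x -> phi x = 0) -> exists2 M, 0 <= M & forall x, `|phi x| <= M.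
Proof.
move=> cp kp p0.
have : bounded_set (phi @` support_of psi).
  apply: compact_bounded; apply: continuous_compact => //.
  exact: continuous_subspaceT.
move=> [M [_ hM]].
exists (`|M| + 1) => [|x]; first pos.
have [sx|/p0 ->] := pselect (support_of psi x); last by rewrite normr0 addr_ge0.
apply: hM; last by exists x.
by apply: le_lt_trans (ler_norm _) _; rewrite ltrDl.
Qed.

Lemma test_bounded phi : test_fun Omega phi ->
  exists2 M, 0 <= M & forall x, `|phi x| <= M /\ forall i, `|partial i phi x| <= M.
Proof.
move=> [sp kp pO].
have [M0 M00 hM0] := compact_support_bounded (smooth_cont sp) kp (fun x h => (support_vanish h).1).
have /choice[M hM] : forall i, exists M, 0 <= M /\ forall x, `|partial i phi x| <= M.
  move=> i; have [M MM hM] := compact_support_bounded (smooth_cont (smooth_partial i sp)) kp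
    (fun x h => (support_vanish h).2 i).
  by exists M.
exists (M0 + \sum_i M i).
  by rewrite addr_ge0// sumr_ge0// => i _; have [] := hM i.
have Ms i : M i <= \sum_i M i.
  by rewrite (bigD1 i)//= lerDl sumr_ge0// => j _; have [] := hM j.
move=> x; split.
  by apply: le_trans (hM0 x) _; rewrite lerDl sumr_ge0// => i _; have [] := hM i.
move=> i; apply: le_trans ((hM i).2 x) _; apply: le_trans (Ms i) _.
by rewrite lerDr.
Qed.

Hypothesis oO : open Omega.
Variables (c0 : vec) (r0 : R).
Hypothesis OQ : Omega `<=` cube c0 r0.

Lemma Omega_mset : mset Omega. Proof. exact: open_mset. Qed.

Lemma Omega_fin : (mu Omega < +oo)%E.
Proof. by apply: le_lt_trans (leb_cube_fin c0 r0); exact: le_lebesgue_outer. Qed.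
Let mO : mset Omega := Omega_mset.
Let Ooo : (mu Omega < +oo)%E := Omega_fin.

Lemma itg_vanish (f : vec -> R) D K : mset D -> mset K -> K `<=` D ->
  lmfun D f ->
  (forall x, D x -> ~ K x -> f x = 0) -> itg mu K f -> itg mu D f.
Proof.
move=> mD mK KD mf f0 fi.
apply/integrableP; split; first exact/measurable_EFinP.
have [_ +] := integrableP _ _ _ fi; apply: le_lt_trans.
apply: eq_ler.
rewrite integral_mkcond [RHS]integral_mkcond; apply: eq_integral => x _; rewrite !patchE.
case: (boolP (x \in D)) => Dx; case: (boolP (x \in K)) => // Kx.
- rewrite /= f0 ?normr0//; first by rewrite inE in Dx.
  by move=> Kx'; move/negP: Kx; apply; rewrite inE.
- by exfalso; move/negP: Dx; apply; rewrite inE in Kx; rewrite inE; exact: KD.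
Qed.

(** Difference quotients of phi have integral 0 by translation invariance, and they converge
    boundedly to the partial derivative. *)
Lemma Int_partial phi i : test_fun Omega phi -> Int mu Omega (partial i phi) = 0.
Proof.
move=> tp; have [sp kp pO] := tp.
(* Enlarged so as to contain Omega together with its translates by at most 1 along an axis. *)
pose Q := cube (c0 - const_mx 1) (r0 + 2).
have mQ : mset Q := cube_mset _ _.
have OinQ : Omega `<=` Q.
  by move=> x /OQ h j; have := h j; rewrite !mxE => ?; lra.
have v0 x : ~ Omega x -> phi x = 0 /\ forall i, partial i phi x = 0.
  by move=> nx; apply: support_vanish => /pO.
rewrite -(@IntS_restrict _ _ _ mu Q Omega (partial i phi) mQ Omega_mset OinQ); last first.
  by move=> x _ /v0[_]; exact.
have [M M0 hM] := test_bounded tp.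
have sl x : slope phi x (N%:R * M).
  apply: slope_le (smooth_slope x sp).
  apply: le_trans (ler_sum _ (fun j _ => (hM x).2 j)) _.
  by rewrite sumr_const card_ord mulr_natl.
have lip x y : `|phi y - phi x| <= N%:R * M * `|y - x|.
  by apply: bounded_slope_lipschitz => //; rewrite mulr_ge0.
pose e : vec := delta_mx 0 i.
have e1 : `|e| <= 1.
  apply: norm_rV_le => // j; rewrite mxE; case: eqP => //= _; case: eqP; rewrite ?normr1 ?normr0//.
pose h (n : nat) : R := n.+1%:R^-1.
have h0 n : 0 < h n by rewrite invr_gt0.
have h1 n : h n <= 1 by rewrite invf_le1// ler1n.
pose q n x := n.+1%:R * (phi (x + h n *: e) - phi x).
have cs (k : vec) : continuous (fun x => phi (x + k)).
  apply: (lipschitz_continuous (K := N%:R * M)) => x y.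
  by apply: le_trans (lip _ _) _; rewrite opprD addrACA subrr addr0.
have mphi : lmfun Q phi := continuous_mfun (smooth_cont sp) mQ.
have iphi : itg mu Q phi by apply: (itg_cube (k := M)) => // x _; exact: (hM x).1.
have iphis n : itg mu Q (fun x => phi (x + h n *: e)).
  apply: (itg_cube (k := M)); first exact: (continuous_mfun (cs _) mQ).
  by move=> x _; exact: (hM _).1.
have q0 n : Int mu Q (q n) = 0.
  rewrite /q IntZ//; last exact: itgB.
  rewrite IntB// [X in X - _](_ : _ = Int mu Q phi) ?subrr ?mulr0//.
  have mQh : mset [set x | Omega (x + h n *: e)] by exact: (shift_mset (h n *: e) Omega_mset).
  transitivity (Int mu [set x | Omega (x + h n *: e)] (fun x => phi (x + h n *: e))).
    apply: IntS_restrict => //.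
      move=> x /= /OQ hx j; have := hx j; rewrite !mxE. have := h0 n; have := h1 n.
      by case: eqP => //= _; case: (j == i) => /= ? ? /andP[? ?]; lra.
    by move=> x _ /v0[].
  rewrite (Int_shift_itg (h n *: e) Omega_mset); last exact: itgS mQ Omega_mset OinQ iphi.
  by symmetry; apply: IntS_restrict => // x _ /v0[].
have mq n : lmfun Q (q n).
  by apply: itg_mfun; apply: itgZ => //; exact: itgB.
have cpar : continuous (partial i phi) := smooth_cont (smooth_partial i sp).
have A1 : {ae mu, forall x, Q x -> q ^~ x @ \oo --> partial i phi x}.
  apply: nearW => x _.
  have dp : derivable phi x e := @smooth_derivable _ _ _ i x sp.
  have L := (cvgr_dnbhsP _ _ _).1 dp h (conj (fun n => lt0r_neq0 (h0 n)) cvg_harmonic).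
  rewrite (_ : q ^~ x = fun n => (h n)^-1 *: ((phi \o shift x) (h n *: e) - phi x))//.
  by apply/funext => n; rewrite /q /= invrK [x + _]addrC.
have A2 : {ae mu, forall x, Q x -> forall n, `|q n x| <= N%:R * M}.
  apply: nearW => x _ n; rewrite /q normrM ger0_norm//.
  rewrite -ler_pdivlMl//; apply: le_trans (lip _ _) _.
  rewrite addrAC subrr add0r normrZ ger0_norm ?(ltW (h0 n))// mulrC ler_wpM2r//.
    pos.
  by rewrite -[leRHS]mulr1 ler_wpM2l// ltW.
have ci : itg mu Q (fun=> N%:R * M) by apply: itg_cst => //; exact: leb_cube_fin.
have [_ L] := Int_dominated mQ mq (continuous_mfun cpar mQ) A1 ci A2.
rewrite (_ : (fun n => _) = cst 0) in L; last by apply/funext => n; exact: q0.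
by rewrite -(cvg_lim (@Rhausdorff R) L) lim_cst.
Qed.

Lemma lmf_cvg (D : set vec) (f_ : nat -> vec -> R) (f : vec -> R) :
  (forall n, lmfun D (f_ n)) ->
  (forall x, D x -> f_ n x @[n --> \oo] --> f x) -> lmfun D f.
Proof. by move=> mf cf; exact: (@measurable_fun_cvg _ (lebesgue_space R N) R D f_ f mf cf). Qed.

Lemma box_compact (a b : vec) : compact (box a b).
Proof.
have -> : box a b = [set v : vec | forall i, `[a 0 i, b 0 i]%classic (v ord0 i)].
  apply/seteqP; split => x /= h i; have := h i; pos.
apply: (@rV_compact _ _ (fun i => `[a 0 i, b 0 i]%classic)) => i; exact: segment_compact.
Qed.

Lemma box_mset (a b : vec) : mset (box a b).
Proof. by apply: closed_mset; apply: compact_closed; [exact: norm_hausdorff|exact: box_compact]. Qed.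

Lemma itg_loc (g : vec -> R) phi psi : loc_integrable Omega g -> test_fun Omega phi -> continuous psi ->
  (forall x, ~ support_of phi x -> psi x = 0) -> itg mu Omega (fun x => g x * psi x).
Proof.
move=> [mg gK] [sp kp pO] cpsi psi0.
have [M M0 hM] := compact_support_bounded cpsi kp psi0.
have mK : mset (support_of phi) by apply: closed_mset; exact: closed_closure.
apply: (itg_vanish mO mK pO).
- by apply: lmfM => //; exact: (continuous_mfun cpsi mO).
- by move=> x _ /psi0 ->; rewrite mulr0.
have gi : itg mu (support_of phi) g.
  apply/integrableP; split; last by apply: le_lt_trans (gK _ pO kp); rewrite le_eqVlt eqxx.
  by apply/measurable_EFinP; apply: measurable_funS mg.
apply: (itgM_bounded (k := M)) => //; exact: (continuous_mfun cpsi mK).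
Qed.

Section boxes.
Variables (D : set nat) (a b : nat -> vec).

(** Smooth approximation of the indicator of a closed box: a factor equals 1 on the inner side of
    its face, the face included, and tends to 0 beyond it. *)
Definition box_ind n k x : R := \prod_i ((1 - sexp n.+1%:R^-1 (a k 0 i - x 0 i)) *
  (1 - sexp n.+1%:R^-1 (x 0 i - b k 0 i))).

Lemma box_ind01 n k x : 0 <= box_ind n k x <= 1.
Proof.
have n0 : 0 < n.+1%:R^-1 :> R by rewrite invr_gt0.
have P (t : R) : 0 <= 1 - sexp n.+1%:R^-1 t <= 1.
  by have := sexp_ge0 n.+1%:R^-1 t; have := sexp_le1 t n0 => ? ?; lra.
apply/andP; split; first by apply: prodr_ge0 => i _; apply: mulr_ge0; exact: (andP (P _)).1.
rewrite -[leRHS](@big1_eq _ 1 *%R _ (index_enum 'I_N) xpredT).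
apply: ler_prod => i _; apply/andP; split.
  by apply: mulr_ge0; exact: (andP (P _)).1.
by apply: mulr_ile1; exact: (andP (P _)).1 || exact: (andP (P _)).2.
Qed.

Lemma smooth_box_ind n k : smooth (box_ind n k).
Proof.
have n0 : 0 < n.+1%:R^-1 :> R by rewrite invr_gt0.
apply: smooth_prod => i; apply: smoothM.
  have := smooth_affine (-1) 1 (smooth_comp (smooth_affine (-1) (a k 0 i) (smooth_coord i))
    (smooth1_sexp n0)).
  by congr smooth; apply/funext => x /=; rewrite !mulN1r ![- _ + _]addrC.
have := smooth_affine (-1) 1 (smooth_comp (smooth_affine 1 (- b k 0 i) (smooth_coord i))
    (smooth1_sexp n0)).
by congr smooth; apply/funext => x /=; rewrite mul1r !mulN1r [- _ + 1]addrC.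
Qed.

Lemma box_ind_cvg k x : box_ind n k x @[n --> \oo] --> ((x \in box (a k) (b k))%:R : R).
Proof.
rewrite (_ : (_ \in _)%:R = \prod_i ((1 - (if 0 < a k 0 i - x 0 i then 1 else 0)) *
    (1 - (if 0 < x 0 i - b k 0 i then 1 else 0)))).
  apply: cvg_prodr => i.
  by apply: cvgM; apply: cvgB; [exact: cvg_cst|exact: sexp_cvg|exact: cvg_cst|exact: sexp_cvg].
have [xB|xB] := boolP (x \in _).
  rewrite big1// => i _; rewrite inE in xB; have /andP[h1 h2] := xB i.
  by rewrite !subr_gt0 !ltNge h1 h2 !subr0 mulr1.
have [i hi] : exists i, ~ (a k 0 i <= x 0 i <= b k 0 i).
  by apply/existsNP => h; move/negP: xB; apply; rewrite inE.
rewrite (bigD1 i)//= !subr_gt0.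
move/negP: hi; rewrite negb_and -!ltNge => /orP[] ->; rewrite subrr ?mulr0 ?mul0r//.
Qed.

(** As n and afterwards m tend to infinity, this approaches the indicator of the complement of the
    union of the boxes. *)
Definition box_co n m x : R := \prod_(k < m) (1 - (val k \in D)%:R * box_ind n k x).

Lemma box_co01 n m x : 0 <= box_co n m x <= 1.
Proof.
have P k : 0 <= 1 - (k \in D)%:R * box_ind n k x <= 1.
  have /andP[h1 h2] := box_ind01 n k x.
  by case: (k \in D); rewrite ?mul1r ?mul0r; lra.
apply/andP; split; first by apply: prodr_ge0 => i _; have /andP[] := P i.
rewrite -[leRHS](@big1_eq _ 1 *%R _ (index_enum 'I_m) xpredT).
by apply: ler_prod => i _; exact: P.
Qed.

Lemma smooth_box_co n m : smooth (box_co n m).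
Proof.
apply: smooth_prod => k.
have := smooth_affine (- (val k \in D)%:R) 1 (smooth_box_ind n k).
by congr smooth; apply/funext => x; rewrite mulNr addrC.
Qed.

Definition box_U := \bigcup_(k in D) box (a k) (b k).

Lemma box_U_mset : mset box_U.
Proof. by apply: bigcup_measurable => k _; exact: box_mset. Qed.

Lemma box_U_int (h : vec -> R) : itg mu Omega h ->
  (forall n m, Int mu Omega (fun x => h x * box_co n m x) = 0) ->
  Int mu (Omega `\` box_U) h = 0.
Proof.
move=> hi h0.
pose P m x : R := \prod_(k < m) (1 - (val k \in D)%:R * (x \in box (a k) (b k))%:R).
have P01 m x : 0 <= P m x <= 1.
  have PP k : 0 <= 1 - ((k \in D)%:R : R) * (x \in box (a k) (b k))%:R <= 1.
    by case: (k \in D); case: (x \in _); rewrite ?mul1r ?mul0r ?subr0 ?subrr ?lexx ?ler01.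
  apply/andP; split; first by apply: prodr_ge0 => i _; have /andP[] := PP i.
  rewrite -[leRHS](@big1_eq _ 1 *%R _ (index_enum 'I_m) xpredT).
  by apply: ler_prod => i _; exact: PP.
have c1 m x : box_co n m x @[n --> \oo] --> P m x.
  apply: cvg_prodr => k; apply: cvgB; first exact: cvg_cst.
  by apply: cvgMr; exact: box_ind_cvg.
have mh := itg_mfun hi.
have mco n m : lmfun Omega (fun x => h x * box_co n m x).
  apply: lmfM => //; apply: (continuous_mfun (smooth_cont _) mO).
  exact: smooth_box_co.
have mP m : lmfun Omega (P m).
  apply: (lmf_cvg (f_ := fun n => box_co n m)) => [n|x _]; last exact: c1.
  exact: (continuous_mfun (smooth_cont (smooth_box_co n m)) mO).
have le1 (c : R) t : 0 <= c <= 1 -> `|t * c| <= `|t|.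
  by move=> /andP[c0' c1']; rewrite normrM ler_piMr// ger0_norm.
have IP m : Int mu Omega (fun x => h x * P m x) = 0.
  have mhP : lmfun Omega (fun x => h x * P m x) by exact: lmfM.
  have A1 : {ae mu, forall x, Omega x -> (fun n => h x * box_co n m x) @ \oo --> h x * P m x}.
    by apply: nearW => x _; apply: cvgMr; exact: c1.
  have A2 : {ae mu, forall x, Omega x -> forall n, `|h x * box_co n m x| <= `|h x|}.
    by apply: nearW => x _ n; apply: le1; exact: box_co01.
  have [_ L] := Int_dominated mO (fun n => mco n m) mhP A1 (itg_norm mO hi) A2.
  rewrite (_ : (fun n => _) = cst 0) in L; last by apply/funext => n; exact: h0.
  by rewrite -(cvg_lim (@Rhausdorff R) L) lim_cst.
have c2 x : P m x @[m --> \oo] --> ((x \notin box_U)%:R : R).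
  apply: cvg_near_cst; have [xU|xU] := boolP (x \in box_U).
    move: (xU); rewrite inE => -[k Dk xk]; exists k.+1 => // m /= km; apply/eqP.
    rewrite /P (bigD1 (Ordinal km))//= (_ : k \in D); last by rewrite inE.
    by rewrite (_ : x \in _) ?mulr1 ?subrr ?mul0r// inE.
  apply: nearW => m; apply/eqP; rewrite /P big1// => k _.
  case: (boolP (val k \in D)) => Dk; last by rewrite mul0r subr0.
  rewrite (_ : x \in _ = false) ?mulr0 ?subr0//; apply/negbTE/negP => xk.
  by move/negP: xU; apply; rewrite inE; exists (val k); rewrite ?inE in Dk xk *.
have mU : mset (Omega `\` box_U) by apply: measurableD => //; exact: box_U_mset.
have mhU : lmfun Omega (fun x => h x * (x \notin box_U)%:R).
  apply: (lmf_cvg (f_ := fun n x => h x * P n x)) => [n|x _].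
    exact: lmfM.
  by apply: cvgMr; exact: c2.
have A1 : {ae mu, forall x, Omega x -> (fun n => h x * P n x) @ \oo --> h x * (x \notin box_U)%:R}.
  by apply: nearW => x _; apply: cvgMr; exact: c2.
have A2 : {ae mu, forall x, Omega x -> forall n, `|h x * P n x| <= `|h x|}.
  by apply: nearW => x _ n; apply: le1; exact: P01.
have mhP m : lmfun Omega (fun x => h x * P m x) by exact: lmfM.
have [_ L] := Int_dominated mO mhP mhU A1 (itg_norm mO hi) A2.
rewrite (_ : (fun n => _) = cst 0) in L; last by apply/funext => n; exact: IP.
transitivity (Int mu Omega (fun x => h x * (x \notin box_U)%:R)); last first.
  by rewrite -(cvg_lim (@Rhausdorff R) L) lim_cst.
symmetry; rewrite (@IntS_restrict _ _ _ mu Omega (Omega `\` box_U) _ mO mU).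
- apply: eq_Int => x [_ nU]; rewrite (_ : x \notin _) ?mulr1//.
  by apply/negP; rewrite inE.
- by move=> x [].
- move=> x Ox nU; rewrite (_ : x \notin box_U = false) ?mulr0//; apply/negbTE.
  by rewrite negbK inE; apply: contrapT => nx; apply: nU.
Qed.

End boxes.

Lemma outer_box_cover E (e : R) : E `<=` Omega -> 0 < e ->
  exists D a b, E `<=` @box_U D a b /\ (mu (@box_U D a b) <= mu E + e%:E)%E.
Proof.
move=> EO e0.
have Efin : lebesgue_outer E \is a fin_num.
  rewrite ge0_fin_numE; last exact: lebesgue_outer_ge0.
  by apply: le_lt_trans Ooo; exact: le_lebesgue_outer.
have [v [D [a [b [cE ->]]]] h] := lb_ereal_inf_adherent e0 Efin.
exists D, a, b; split => //; apply: le_trans (ltW h).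
by apply: ereal_inf_lbound; exists D, a, b; split.
Qed.

(** E is covered by boxes with small excess measure. Off the boxes the integral vanishes by
    [box_U_int]; absolute continuity takes care of the excess. *)
Lemma box_co_zero_ae (h : vec -> R) : itg mu Omega h ->
  (forall D a b n m, Int mu Omega (fun x => h x * box_co D a b n m x) = 0) ->
  forall E, mset E -> E `<=` Omega -> Int mu (Omega `\` E) h = 0.
Proof.
move=> hi h0 E mE EO; apply/eqP; rewrite -normr_le0; apply/ler_addgt0Pl => e e0.
rewrite addr0; have [dl dl0 hdl] := Int_abs_small mO Ooo hi e0.
have [D [a [b [EU Uoo]]]] := outer_box_cover EO dl0.
set U := box_U D a b in EU Uoo; have mU : mset U := box_U_mset D a b.
have mOE : mset (Omega `\` E) by apply: measurableD.
have mOU : mset (Omega `\` U) by apply: measurableD.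
have mF : mset (Omega `&` (U `\` E)) by apply: measurableI => //; apply: measurableD.
have EE : Omega `\` E = (Omega `\` U) `|` (Omega `&` (U `\` E)).
  apply/seteqP; split => x /=.
    by move=> [Ox nE]; have [Ux|nU] := pselect (U x); [right|left].
  by move=> [[Ox nU]|[Ox [Ux nE]]]; split => // Ex; apply: nU; exact: EU.
have hiE : itg mu (Omega `\` E) h by apply: itgS hi => //; exact: subDsetl.
have hiF : itg mu (Omega `&` (U `\` E)) h by apply: itgS hi => //; exact: subIsetl.
have dj : [disjoint (Omega `\` U) & (Omega `&` (U `\` E))].
  by apply/disj_setPS => x /= [[_ nU] [_ [Ux _]]]; exact: nU.
rewrite EE IntU//; last by rewrite -EE.
rewrite box_U_int// add0r; apply: le_trans (Int_norm mF hiF) _.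
apply: hdl => //.
have Efin : (mu E < +oo)%E by apply: le_lt_trans Ooo; exact: le_lebesgue_outer.
have Ufin : (mu U < +oo)%E by apply: le_lt_trans Uoo _; rewrite lte_add_pinfty// ltry.
via (fine (mu (U `\` E))).
  apply: le_fine_measure => //; [exact: measurableD|].
  by apply: le_lt_trans Ufin; apply: le_lebesgue_outer; exact: subDsetl.
rewrite fine_measureD// lerBlDl.
have := Uoo; have /fineK <- : mu E \is a fin_num by rewrite ge0_fin_numE// measure_ge0.
have /fineK <- : mu U \is a fin_num by rewrite ge0_fin_numE// measure_ge0.
by rewrite -EFinD lee_fin /=.
Qed.

Lemma rational_box x : Omega x -> exists ab : 'rV[rat]_N * 'rV[rat]_N,
  (forall i, ratr (ab.1 0 i) < x 0 i < ratr (ab.2 0 i)) /\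
  box (map_mx ratr ab.1) (map_mx ratr ab.2) `<=` Omega.
Proof.
move=> Ox; have [e /= e0 he] := (nbhs_ballP _ _).1 (open_nbhs_nbhs (conj oO Ox)).
have ex (s t : R) : s < t -> exists q : rat, s < ratr q < t.
  by move=> st; have [q] := rat_in_itvoo st; rewrite in_itv/=; exists q.
have /choice[a ha] : forall i, exists q : rat, x 0 i - e / 2 < ratr q < x 0 i.
  by move=> i; apply: ex; lra.
have /choice[b hb] : forall i, exists q : rat, x 0 i < ratr q < x 0 i + e / 2.
  by move=> i; apply: ex; lra.
exists (\row_i a i, \row_i b i); split.
  by move=> i; rewrite !mxE; have /andP[_ ->] := ha i; have /andP[-> _] := hb i.
move=> y /= hy; apply: he; rewrite -ball_normE /= ; apply: (@le_lt_trans _ _ (e / 2)); last pos.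
apply: norm_rV_le => [|i]; first pos.
have := hy i; have := ha i; have := hb i; rewrite !mxE => /andP[? ?] /andP[? ?] /andP[? ?].
by rewrite ler_norml; lra.
Qed.

(** For a test function psi the products of psi with [box_co] are test functions too, so h = g psi
    falls under [box_co_zero_ae]. Taking E = {h <= 0} gives h <= 0 almost everywhere, and the same
    holds for - h. Countably many psi, each positive inside a rational box, exhaust Omega. *)
Lemma fundamental_lemma (g : vec -> R) : loc_integrable Omega g ->
  (forall phi, test_fun Omega phi -> Int mu Omega (fun x => g x * phi x) = 0) ->
  {ae mu, forall x, Omega x -> g x = 0}.
Proof.
move=> lg g0.
have onetest psi : test_fun Omega psi -> {ae mu, forall x, Omega x -> g x * psi x = 0}.
  move=> tp; have [sp kp pO] := tp.
  have cp := smooth_cont sp.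
  pose h x := g x * psi x.
  have hi : itg mu Omega h by apply: (itg_loc lg tp cp) => x /support_vanish[].
  have h0 D a b n m : Int mu Omega (fun x => h x * box_co D a b n m x) = 0.
    rewrite -[RHS](g0 (fun x => psi x * box_co D a b n m x)).
      by apply: eq_Int => x _; rewrite mulrA.
    apply: (test_funP (K := support_of psi)) kp pO _; first exact: (smoothM sp (smooth_box_co _ _ _ _ _)).
    move=> x nz; apply: subset_closure => /=; apply: contra_neq nz => ->. by rewrite mul0r.
  have half f : itg mu Omega f ->
    (forall D a b n m, Int mu Omega (fun x => f x * box_co D a b n m x) = 0) ->
    {ae mu, forall x, Omega x -> f x <= 0}. move=> fi f0; pose E := Omega `&` [set x | f x <= 0].
    have mE : mset E by apply: mset_le => //; exact: itg_mfun fi.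
    have EO : E `<=` Omega by move=> x []. have I0 := box_co_zero_ae fi f0 mE EO.
    have mOE : mset (Omega `\` E) by apply: measurableD.
    have fiE : itg mu (Omega `\` E) f by apply: itgS fi => //; exact: subDsetl.
    have pos x : (Omega `\` E) x -> 0 <= f x.
      by move=> [Ox nE]; rewrite leNgt; apply/negP => fx; apply: nE; split => //; exact: ltW.
    have := Int_eq0_ae mOE fiE pos I0.
    apply: filterS => x /= hx Ox; rewrite leNgt; apply/negP => fx. have : f x = 0.
      by apply: hx; split => // -[_ /=]; rewrite leNgt fx.
    by move=> f00; rewrite f00 ltxx in fx.
  have H1 := half h hi h0.
  have H2 : {ae mu, forall x, Omega x -> - h x <= 0}.
    apply: (half (fun x => - h x)); first exact: itgN. move=> D a b n m; have := h0 D a b n m.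
    have -> : (fun x => - h x * box_co D a b n m x) = (fun x => -1 * (h x * box_co D a b n m x)).
      by apply/funext => x; ring.
    rewrite IntZ// => [->|]; first by rewrite mulr0. apply: (itgM_bounded (k := 1)) => //.
      exact: (continuous_mfun (smooth_cont (smooth_box_co _ _ _ _ _)) mO).
    by move=> x _; have /andP[? ?] := box_co01 D a b n m x; rewrite ger0_norm.
  apply: (ae_imp2 H1 H2) => x h1 h2 Ox; apply/eqP; rewrite eq_le (h1 Ox)/=.
  by rewrite -oppr_le0 (h2 Ox).
pose psi (ab : 'rV[rat]_N * 'rV[rat]_N) x : R :=
  \prod_i (sexp 1 (x 0 i - ratr (ab.1 0 i)) * sexp 1 (ratr (ab.2 0 i) - x 0 i)).
have tpsi ab : box (map_mx ratr ab.1) (map_mx ratr ab.2) `<=` Omega -> test_fun Omega (psi ab).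
  move=> bO; apply: (test_funP (K := box (map_mx ratr ab.1) (map_mx ratr ab.2))) => //.
  - apply: smooth_prod => i; apply: smoothM.
      have := smooth_comp (smooth_affine 1 (- ratr (ab.1 0 i)) (smooth_coord i)) (smooth1_sexp (@ltr01 R)).
      by congr smooth; apply/funext => x /=; rewrite mul1r.
    have := smooth_comp (smooth_affine (-1) (ratr (ab.2 0 i)) (smooth_coord i)) (smooth1_sexp (@ltr01 R)).
    by congr smooth; apply/funext => x /=; rewrite mulN1r addrC.
  - exact: box_compact.
  - move=> x /prodf_neq0 h i; have := h i isT; rewrite mulf_eq0 negb_or !mxE => /andP[].
    by move=> /sexp_neq0 h1 /sexp_neq0 h2; lra.
have X : {ae mu, forall x, forall n, Omega x -> forall ab, unpickle n = Some ab ->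
    box (map_mx ratr ab.1) (map_mx ratr ab.2) `<=` Omega -> g x * psi ab x = 0}.
  apply: ae_nat => n.
  case E : (unpickle n) => [ab|]; last by apply: nearW.
  have [bO|nbO] := pselect (box (map_mx ratr ab.1) (map_mx ratr ab.2) `<=` Omega).
    by apply: (ae_imp (onetest _ (tpsi _ bO))) => x h Ox _ [<-] _; exact: h.
  by apply: nearW => x _ _ [<-].
apply: (ae_imp X) => x h Ox; have [ab [xab bO]] := rational_box Ox.
have := h (pickle ab) Ox ab (pickleK _) bO => /eqP; rewrite mulf_eq0 => /orP[/eqP//|].
rewrite -[psi ab x == 0]negbK; move/negP => p0; exfalso; apply: p0.
apply/prodf_neq0 => i _; rewrite mulf_neq0//.
  by have /andP[h1 _] := xab i; rewrite /sexp subr_gt0 h1 gt_eqF ?expR_gt0.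
by have /andP[_ h1] := xab i; rewrite /sexp subr_gt0 h1 gt_eqF ?expR_gt0.
Qed.

(** * Weak gradients, and the closure of the test functions described by pointwise approximation *)

Implicit Types (g h : vec -> vec) (k : R).

Lemma ae_fin (J : finType) (P : J -> vec -> Prop) : (forall j : J, {ae mu, forall x, P j x}) ->
  {ae mu, forall x, forall j : J, P j x}.
Proof.
move=> h; have X : {ae mu, forall x, forall n, forall j : J, unpickle n = Some j -> P j x}.
  apply: ae_nat => n; case E : (unpickle n) => [j|]; last by apply: ae_all.
  by apply: (ae_imp (h j)) => x Px _ [<-].
by apply: (ae_imp X) => x hx j; exact: hx _ _ (pickleK j).
Qed.

Lemma compact_mset K : compact K -> mset K.
Proof. by move=> kK; apply: closed_mset; apply: compact_closed => //; exact: norm_hausdorff. Qed.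

Lemma loc_integrableP u : loc_integrable Omega u <-> lmfun Omega u /\
  forall K, K `<=` Omega -> compact K -> itg mu K u.
Proof.
split=> -[mu_ uK]; split => // K KO kK.
  apply/integrableP; split; last by apply: le_lt_trans (uK _ KO kK); rewrite le_eqVlt eqxx.
  by apply/measurable_EFinP; apply: measurable_funS mu_.
by have /integrableP[_] := uK K KO kK; apply: le_lt_trans; rewrite le_eqVlt eqxx.
Qed.

Lemma loc_integrableB u v : loc_integrable Omega u -> loc_integrable Omega v ->
  loc_integrable Omega (u \- v).
Proof.
move=> /loc_integrableP[mu_ uK] /loc_integrableP[mv vK]; apply/loc_integrableP; split.
  exact: (measurable_funB mu_ mv).
by move=> K KO kK; apply: itgB; [exact: compact_mset|exact: uK|exact: vK].
Qed.

Lemma itg_loc_integrable u : itg mu Omega u -> loc_integrable Omega u.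
Proof.
move=> ui; apply/loc_integrableP; split; first exact: itg_mfun ui.
by move=> K KO kK; exact: (itgS mO (compact_mset kK) KO ui).
Qed.

Lemma itg_test phi : test_fun Omega phi -> itg mu Omega phi.
Proof.
move=> tp; have [M M0 hM] := test_bounded tp; have [sp _ _] := tp.
apply: (itg_bounded (k := M)) => //; first exact: (continuous_mfun (smooth_cont sp) mO).
by move=> x _; have [] := hM x.
Qed.

Lemma itg_test_partial phi i : test_fun Omega phi -> itg mu Omega (partial i phi).
Proof.
move=> tp; have [M M0 hM] := test_bounded tp; have [sp _ _] := tp.
apply: (itg_bounded (k := M)) => //.
  exact: (continuous_mfun (smooth_cont (smooth_partial i sp)) mO).
by move=> x _; have [_] := hM x.
Qed.

Lemma test_partial_vanish phi i x : ~ support_of phi x -> partial i phi x = 0.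
Proof. by move=> /support_vanish[]. Qed.

Lemma itg_loc_test u phi : loc_integrable Omega u -> test_fun Omega phi ->
  itg mu Omega (fun x => u x * phi x).
Proof.
move=> lu tp; have [sp _ _] := tp.
by apply: (itg_loc lu tp (smooth_cont sp)) => x /support_vanish[].
Qed.

Lemma itg_loc_partial u phi i : loc_integrable Omega u -> test_fun Omega phi ->
  itg mu Omega (fun x => u x * partial i phi x).
Proof.
move=> lu tp; have [sp _ _] := tp.
by apply: (itg_loc lu tp (smooth_cont (smooth_partial i sp))) => x; exact: test_partial_vanish.
Qed.

Lemma is_weak_gradientP u g : is_weak_gradient Omega u g <->
  loc_integrable Omega u /\ forall i, loc_integrable Omega (fun x => g x 0 i) /\
    forall phi, test_fun Omega phi ->
      Int mu Omega (fun x => u x * partial i phi x) = - Int mu Omega (fun x => g x 0 i * phi x).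
Proof.
split=> -[lu hg]; split => // i; have [lg e] := hg i; split => // phi tp; have := e phi tp;
  rewrite (IntE mO (itg_loc_partial i lu tp)) (IntE mO (itg_loc_test lg tp)) -EFinN.
  by case.
by move=> ->.
Qed.

Lemma weak_gradient_unique u g h : is_weak_gradient Omega u g -> is_weak_gradient Omega u h ->
  {ae mu, forall x, Omega x -> g x = h x}.
Proof.
move=> /is_weak_gradientP[lu hg] /is_weak_gradientP[_ hh].
have A i : {ae mu, forall x, Omega x -> g x 0 i - h x 0 i = 0}.
  have [lg eg] := hg i; have [lh eh] := hh i.
  apply: (fundamental_lemma (loc_integrableB lg lh)) => phi tp.
  transitivity (Int mu Omega (fun x => g x 0 i * phi x - h x 0 i * phi x)).
    by apply: eq_Int => x _ /=; rewrite mulrBl.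
  rewrite (IntB mO (itg_loc_test lg tp) (itg_loc_test lh tp)); apply/eqP; rewrite subr_eq0.
  by rewrite -[X in X == _]opprK -eg// eh// opprK.
apply: (ae_imp (ae_fin A)) => x hx Ox; apply/rowP => i; apply/eqP.
by rewrite -subr_eq0 hx.
Qed.

Lemma is_weak_gradientB u v g h : is_weak_gradient Omega u g -> is_weak_gradient Omega v h ->
  is_weak_gradient Omega (u \- v) (fun x => g x - h x).
Proof.
move=> /is_weak_gradientP[lu hg] /is_weak_gradientP[lv hh].
apply/is_weak_gradientP; split; first exact: loc_integrableB.
move=> i; have [lg eg] := hg i; have [lh eh] := hh i.
have -> : (fun x => (g x - h x) 0 i) = (fun x => g x 0 i) \- (fun x => h x 0 i).
  by apply/funext => x; rewrite !mxE.
split; first exact: loc_integrableB.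
move=> phi tp.
transitivity (Int mu Omega (fun x => u x * partial i phi x - v x * partial i phi x)).
  by apply: eq_Int => x _ /=; rewrite mulrBl.
rewrite (IntB mO (itg_loc_partial i lu tp) (itg_loc_partial i lv tp)) eg// eh//.
rewrite -opprD; congr (- _); rewrite -(IntB mO (itg_loc_test lg tp) (itg_loc_test lh tp)).
by apply: eq_Int => x _ /=; rewrite !mxE mulrBl.
Qed.

Lemma partialM phi psi i : smooth phi -> smooth psi ->
  partial i (fun x => phi x * psi x) = fun x => phi x * partial i psi x + psi x * partial i phi x.
Proof.
move=> sp sq; apply: partialE => x.
exact: (is_derive_val (is_deriveM (smooth_is_derive i x sp) (smooth_is_derive i x sq))).
Qed.

Lemma Int_parts phi psi i : test_fun Omega phi -> test_fun Omega psi ->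
  Int mu Omega (fun x => phi x * partial i psi x) = - Int mu Omega (fun x => partial i phi x * psi x).
Proof.
move=> tp tq; have [sp kp pO] := tp; have [sq _ _] := tq.
have tpq : test_fun Omega (fun x => phi x * psi x).
  apply: (test_funP (smoothM sp sq) kp pO) => x nz; apply: subset_closure => /=.
  by apply: contra_neq nz => ->; rewrite mul0r.
have := Int_partial i tpq; rewrite partialM// IntD//.
- move/eqP; rewrite addr_eq0 => /eqP ->; congr (- _).
  by apply: eq_Int => x _; rewrite mulrC.
- exact: itg_loc_partial (itg_loc_integrable (itg_test tp)) tq.
- exact: itg_loc_partial (itg_loc_integrable (itg_test tq)) tp.
Qed.

Lemma is_weak_gradient_test phi : test_fun Omega phi -> is_weak_gradient Omega phi (grad phi).
Proof.
move=> tp; apply/is_weak_gradientP; split; first exact: itg_loc_integrable (itg_test tp).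
move=> i; rewrite /grad (_ : (fun x => _ 0 i) = partial i phi); last first.
  by apply/funext => x; rewrite mxE.
split; first exact: itg_loc_integrable (itg_test_partial i tp).
by move=> psi tq; rewrite Int_parts//; congr (- _); apply: eq_Int => x _; rewrite mxE.
Qed.

(** [nabla] is a choice among all weak gradients, so it agrees with a given one almost everywhere
    only. *)
Lemma nablaP u g : is_weak_gradient Omega u g ->
  is_weak_gradient Omega u (nabla Omega u) /\ {ae mu, forall x, Omega x -> nabla Omega u x = g x}.
Proof.
move=> ug; have un : is_weak_gradient Omega u (nabla Omega u).
  exact: (@xgetPex _ (fun=> 0) [set g | is_weak_gradient Omega u g] (ex_intro _ g ug)).
by split => //; exact: (weak_gradient_unique un ug).
Qed.

(** The growth of H in t on which the function space rests: shrinking stands for convexity with H(x,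
    0) = 0, dilation for doubling, [mod_low] for the embedding into L^1; all constants are uniform
    in x. *)
Record modular (H : vec -> R -> R) m k : Prop := Modular {
  mod_meas : forall v, lmfun Omega v -> (forall x, Omega x -> 0 <= v x) ->
    lmfun Omega (fun x => H x (v x));
  mod_ge0 : forall x t, Omega x -> 0 <= t -> 0 <= H x t;
  mod_le : forall x s t, Omega x -> 0 <= s -> s <= t -> H x s <= H x t;
  mod_shrink : forall x l t, Omega x -> 0 <= l -> l <= 1 -> 0 <= t -> H x (l * t) <= l * H x t;
  mod_dil : forall x l t, Omega x -> 1 <= l -> 0 <= t -> H x (l * t) <= l ^+ m * H x t;
  mod_low : forall x t, Omega x -> 0 <= t -> t <= 1 + H x t;
  mod_one : forall x, Omega x -> H x 1 <= k }.

Variables (H : vec -> R -> R) (m : nat) (k1 : R).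
Hypothesis Hm : modular H m k1.

Lemma modD x s t : Omega x -> 0 <= s -> 0 <= t -> H x (s + t) <= 2 ^+ m * (H x s + H x t).
Proof.
move=> Ox; wlog st : s t / s <= t.
  move=> h s0 t0; have [st|/ltW ts] := leP s t; first exact: h.
  by rewrite addrC [H x s + _]addrC; exact: h.
move=> s0 t0; via (H x (2 * t)).
  by apply: (mod_le Hm) => //; [pos|lra].
apply: (le_trans (mod_dil Hm Ox _ t0)); first pos.
by rewrite ler_wpM2l// lerDr (mod_ge0 Hm).
Qed.

Lemma mod0 x : Omega x -> H x 0 = 0.
Proof.
move=> Ox; apply/eqP; rewrite eq_le (mod_ge0 Hm)// andbT.
by have := mod_shrink Hm Ox (lexx 0) ler01 (lexx 0); rewrite !mul0r.
Qed.

(** Monotonicity and doubling act in place of continuity in t: eventually t <= 2 t_n, at the price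
    of 2^m. *)
Lemma mod_lsc x (t_ : nat -> R) t k : Omega x -> (forall n, 0 <= t_ n) -> 0 <= t ->
  t_ n @[n --> \oo] --> t -> (forall n, H x (t_ n) <= k) -> H x t <= 2 ^+ m * k.
Proof.
move=> Ox t_0 t0 tc hk; have k0 : 0 <= k := le_trans (mod_ge0 Hm Ox (t_0 0%N)) (hk 0%N).
move: t0; rewrite le_eqVlt => /orP[/eqP <-|t0].
  by rewrite mod0// mulr_ge0// exprn_ge0.
have t2 : t / 2 < t by lra.
have [n _ /(_ n (leqnn n)) hn] := cvgr_gt _ tc _ t2.
via (H x (2 * t_ n)).
  by apply: (mod_le Hm Ox (ltW t0)); move: hn => /=; lra.
apply: (le_trans (mod_dil Hm Ox _ (t_0 n))); first pos.
by rewrite ler_wpM2l// exprn_ge0.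
Qed.

Lemma mod_cvg0 x (t_ : nat -> R) : Omega x -> (forall n, 0 <= t_ n) ->
  t_ n @[n --> \oo] --> (0 : R) -> H x (t_ n) @[n --> \oo] --> (0 : R).
Proof.
move=> Ox t_0 tc.
have c : t_ n * H x 1 @[n --> \oo] --> (0 : R).
  by rewrite -[X in _ --> X](mul0r (H x 1)); apply: cvgMl.
apply: (squeeze_cvgr _ (cvg_cst 0) c).
have : \forall n \near \oo, t_ n <= 1 by apply: (cvgr_le _ tc).
apply: filterS => n tn; rewrite (mod_ge0 Hm)//= -{1}[t_ n]mulr1.
exact: (mod_shrink Hm).
Qed.

(** A workable form of membership in W_0 with gradient g. In contrast to convergence in norm, it
    passes directly through chain and product rules. *)
Definition approx w g (phi : nat -> vec -> R) (Phi : vec -> R) :=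
  [/\ lmfun Omega w, forall i, lmfun Omega (fun x => g x 0 i),
    forall n, test_fun Omega (phi n), itg mu Omega Phi &
    {ae mu, forall x, Omega x -> [/\ phi n x @[n --> \oo] --> w x,
      forall i, partial i (phi n) x @[n --> \oo] --> g x 0 i &
      forall n, H x `|phi n x| + H x (norm1 (grad (phi n) x)) <= Phi x]}].

Definition approximable w g := exists (phi : nat -> vec -> R) Phi, approx w g phi Phi.

(** By doubling, finiteness of the modular for one multiple of v gives finiteness for all larger
    ones. *)
Lemma LH_itg v l : LH Omega H v -> 1 <= l -> itg mu Omega (fun x => H x (l * `|v x|)).
Proof.
move=> [mv [l' l'0 Hi]] l1.
have ma (a : R) : 0 <= a -> lmfun Omega (fun x => H x (a * `|v x|)).
  move=> a0; apply: (mod_meas Hm) => [|x _]; last pos.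
  by apply: lmfZ => //; exact: lmf_norm.
pose L := Num.max l (l / l').
have L1 : 1 <= L by rewrite le_max l1.
have Ll : l <= L * l' by rewrite -ler_pdivrMr// le_max lexx orbT.
apply: (@itg_le _ _ _ mu Omega _ (fun x => L ^+ m * H x (l' * `|v x|)) mO).
- by apply: ma; lra.
- move=> x Ox; rewrite ger0_norm; last by apply: (mod_ge0 Hm) => //; rewrite mulr_ge0//; lra.
  apply: le_trans (mod_dil Hm Ox L1 _); last pos.
  by apply: (mod_le Hm Ox); [pos|rewrite mulrA ler_wpM2r].
- apply: itgZ => //; apply/integrableP; split; first by apply/measurable_EFinP; apply: ma; exact: ltW.
  apply: le_lt_trans Hi; apply: eq_ler; apply: eq_integral => x.
  by rewrite inE => Ox /=; rewrite ger0_norm// (mod_ge0 Hm)// mulr_ge0// ltW.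
Qed.

(** Test functions are chosen at Luxemburg distance l_n < 4^-n, so that the modulars a_n of the
    differences divided by l_n have integral at most 1. [summable_majorant] gives a_n <= 2^(n+1) T
    almost everywhere; then l_n a_n is of order 2^-n, which yields both the convergence and the
    majorant. *)
Lemma W1H0_approx u : W1H0 Omega H u ->
  approximable u (nabla Omega u) /\ is_weak_gradient Omega u (nabla Omega u).
Proof.
move=> [[[g0 ug0] LHu LHg] cl].
have [ug _] := nablaP ug0; set g := nabla Omega u in LHg ug *.
split => //.
have e0 n : 0 < (4^-1 : R) ^+ n by rewrite exprn_gt0//.
have /choice[c hc] : forall n, exists c : (vec -> R) * R,
  [/\ test_fun Omega c.1, 0 < c.2, c.2 < 4^-1 ^+ n &
  (\int[mu]_(x in Omega) (H x (`|(u \- c.1) x| / c.2) +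
     H x (enorm (nabla Omega (u \- c.1) x) / c.2))%:E <= 1)%E].
  move=> n; have [phi tp] := cl _ (e0 n).
  by move=> /ereal_inf_lt[_ [l [l0 hl] <-]]; rewrite lte_fin => ln; exists (phi, l).
pose phi n := (c n).1; pose l n := (c n).2.
have tphi n : test_fun Omega (phi n) by have [] := hc n.
have l0 n : 0 < l n by have [] := hc n.
have ln n : l n <= 4^-1 ^+ n by have [_ _ /ltW] := hc n.
have V n := nablaP (is_weak_gradientB ug (is_weak_gradient_test (tphi n))).
pose d n x := nabla Omega (u \- phi n) x.
pose a n x := H x (`|(u \- phi n) x| / l n) + H x (enorm (d n x) / l n).
have [[mu_ _] hg] := ug.
have mdv n (v : vec -> R) : lmfun Omega v -> (forall x, 0 <= v x) ->
    lmfun Omega (fun x => H x (v x / l n)).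
  move=> mv v0; apply: (mod_meas Hm) => [|x _]; last pos.
  by apply: (lmfM mO mv); exact: lmf_cst.
have mphi n : lmfun Omega (phi n).
  by have [sp _ _] := tphi n; exact: (continuous_mfun (smooth_cont sp) mO).
have ma n : lmfun Omega (a n).
  apply: (lmfD mO); apply: mdv.
  - by apply: (lmf_norm mO); exact: lmfB.
  - by move=> x.
  - by apply: mfun_enorm => i; have [_ /(_ i)[[]]] := (V n).1.
  - pos.
have dv0 n t : 0 <= t -> 0 <= t / l n by move=> t0; rewrite divr_ge0// ltW.
have a0 n x : Omega x -> 0 <= a n x.
  by move=> Ox; rewrite addr_ge0// (mod_ge0 Hm)// dv0// enorm_ge0.
have aI n : itg mu Omega (a n) /\ Int mu Omega (a n) <= 1.
  apply: (itg_ereal_le mO (ma n)) => [x|]; first exact: a0.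
  by have [] := hc n.
have [T Ti hT] := summable_majorant mO (fun n => (aI n).1) a0 (fun n => (aI n).2).
pose K : R := N.+1%:R.
have K1 : 1 <= K by rewrite ler1n.
pose Phi x := 2 ^+ m * (H x (1 * `|u x|) + 2 * T x) +
  2 ^+ m * (H x (K * `|enorm (g x)|) + K ^+ m * (2 * T x)).
exists phi, Phi; split => //.
- by move=> i; have [[]] := hg i.
- have i1 := LH_itg LHu (lexx 1); have i2 := LH_itg LHg K1.
  by do ![apply: itgD => //|apply: itgZ => //|exact: i1|exact: i2].
have Vae : {ae mu, forall x, forall n, Omega x -> d n x = g x - grad (phi n) x}.
  by apply: ae_nat => n; exact: (V n).2.
apply: (ae_imp2 hT Vae) => x hx vx Ox.
have [T0 aT] := hx Ox.
(* Shrinking by l_n bounds the modular of t by l_n a_n, and [mod_low] at t / l_n bounds t itself. *)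
have bnd n t : 0 <= t -> H x (t / l n) <= a n x -> H x t <= 2 * T x /\ t <= (1 + 2 * T x) * 2^-1 ^+ n.
  move=> t0 ht; have tl : t = l n * (t / l n) by rewrite mulrCA divff ?mulr1// gt_eqF.
  have l1 : l n <= 1 by apply: le_trans (ln n) _; rewrite exprn_ile1//; lra.
  have p2 : 0 < (2 : R) ^+ n by rewrite exprn_gt0.
  have l4 : l n * 2 ^+ n <= 2^-1 ^+ n.
    rewrite -ler_pdivlMr//; apply: le_trans (ln n) _.
    by rewrite -exprVn -exprMn; apply: lerXn2r; rewrite ?nnegrE; lra.
  have h2 : 2^-1 ^+ n <= (1 : R) by rewrite exprn_ile1//; lra.
  have h20 : 0 <= (2^-1 : R) ^+ n by rewrite exprn_ge0//.
  have la : l n * a n x <= 2 * T x * 2^-1 ^+ n.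
    apply: le_trans (ler_wpM2l (ltW (l0 n)) (aT n)) _.
    rewrite exprS (_ : l n * _ = 2 * T x * (l n * 2 ^+ n)); last by ring.
    by apply: ler_wpM2l => //; rewrite mulr_ge0.
  have T20 : 0 <= 2 * T x by rewrite mulr_ge0.
  split.
    rewrite tl; apply: le_trans (mod_shrink Hm Ox (ltW (l0 n)) l1 (dv0 n _ t0)) _.
    apply: le_trans (ler_wpM2l (ltW (l0 n)) ht) (le_trans la _). by rewrite -[leRHS]mulr1 ler_wpM2l.
  rewrite tl; apply: le_trans (ler_wpM2l (ltW (l0 n)) (mod_low Hm Ox (dv0 n _ t0))) _.
  rewrite mulrDr mulr1 mulrDl mul1r; apply: lerD.
    apply: le_trans (ln n) _; apply: lerXn2r; rewrite ?nnegrE; lra.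
  exact: le_trans (ler_wpM2l (ltW (l0 n)) ht) la.
have H1 n : H x `|(u \- phi n) x| <= 2 * T x /\ `|(u \- phi n) x| <= (1 + 2 * T x) * 2^-1 ^+ n.
  by apply: bnd => //; rewrite lerDl (mod_ge0 Hm)// dv0// enorm_ge0.
have H2 n : H x (enorm (d n x)) <= 2 * T x /\ enorm (d n x) <= (1 + 2 * T x) * 2^-1 ^+ n.
  by apply: bnd; [pos|rewrite lerDr (mod_ge0 Hm)// dv0].
split.
- apply: (cvg_geo (k := 1 + 2 * T x)) => n; have [_] := H1 n.
  by rewrite /= distrC.
- move=> i; apply: (cvg_geo (k := 1 + 2 * T x)) => n; have [_] := H2 n.
  apply: le_trans; apply: le_trans (enorm_coord _ i).
  by rewrite vx// !mxE distrC.
move=> n; apply: lerD.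
  via (H x (1 * `|u x| + `|(u \- phi n) x|)).
    apply: (mod_le Hm Ox) => //; rewrite mul1r /= -lerBlDl.
    by apply: le_trans (lerB_dist _ _) _; rewrite distrC.
  apply: le_trans (modD Ox _ (normr_ge0 _)) _; first by rewrite mul1r.
  by rewrite ler_wpM2l// lerD2l; have [] := H1 n.
via (H x (K * `|enorm (g x)| + K * enorm (d n x))).
  apply: (mod_le Hm Ox); first pos.
  rewrite (_ : grad (phi n) x = g x - d n x); last by rewrite vx// opprB addrC subrK.
  apply: le_trans (norm1B _ _) _.
  have E (y : vec) : norm1 y <= K * enorm y.
    apply: le_trans (norm1_enorm _) _; rewrite ler_wpM2r ?enorm_ge0//. by rewrite ler_nat.
  by apply: lerD; rewrite ?ger0_norm ?enorm_ge0.
apply: le_trans (modD Ox _ _) _ => //; try pos; try lra.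
rewrite ler_wpM2l// lerD2l; apply: le_trans (mod_dil Hm Ox K1 (enorm_ge0 _)) _.
by apply: ler_wpM2l; [pos|have [] := H2 n].
Qed.

Lemma mfun_mod (v : vec -> R) : lmfun Omega v -> (forall x, 0 <= v x) ->
  lmfun Omega (fun x => H x (v x)).
Proof. by move=> mv v0; apply: (mod_meas Hm). Qed.

(** Dominated convergence carries integration by parts to the limit. The modular of the differences
    divided by a fixed small l is dominated as well, with a constant depending on l; its integral
    tends to 0, so it drops below 1 and the norm is then at most l. *)
Lemma approx_W1H0 w g : approximable w g ->
  [/\ W1H0 Omega H w, {ae mu, forall x, Omega x -> nabla Omega w x = g x},
    itg mu Omega (fun x => H x `|w x|), itg mu Omega (fun x => H x (norm1 (g x))) &
    itg mu Omega w /\ forall i, itg mu Omega (fun x => g x 0 i)].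
Proof.
move=> [phi [Phi [mw mg tphi Pi ae0]]].
have sphi n : smooth (phi n) by have [] := tphi n.
have mphi n : lmfun Omega (phi n) := continuous_mfun (smooth_cont (sphi n)) mO.
have mdphi n i : lmfun Omega (partial i (phi n)) :=
  continuous_mfun (smooth_cont (smooth_partial i (sphi n))) mO.
have P1 : itg mu Omega (fun x => 1 + Phi x) by apply: itgD => //; exact: itg_cst.
have Pb : {ae mu, forall x, Omega x -> forall n, `|phi n x| <= 1 + Phi x /\
    norm1 (grad (phi n) x) <= 1 + Phi x}.
  apply: (ae_imp ae0) => x hx Ox n; have [_ _ /(_ n) h] := hx Ox.
  have h1 := mod_ge0 Hm Ox (normr_ge0 (phi n x)).
  have h2 := mod_ge0 Hm Ox (norm1_ge0 (grad (phi n) x)).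
  have h3 := mod_low Hm Ox (normr_ge0 (phi n x)).
  have h4 := mod_low Hm Ox (norm1_ge0 (grad (phi n) x)).
  pos.
have Pb' : {ae mu, forall x, Omega x -> forall n i, `|partial i (phi n) x| <= 1 + Phi x}.
  apply: (ae_imp Pb) => x hx Ox n i; have [_] := hx Ox n; apply: le_trans.
  by rewrite /norm1 (bigD1 i)//= mxE lerDl sumr_ge0.
have wi : itg mu Omega w.
  apply: (itg_le_ae mO mw _ P1); apply: (ae_imp2 ae0 Pb) => x hx bx Ox.
  by have [cw _ _] := hx Ox; apply: (cvg_norm_le cw) => n; have [] := bx Ox n.
have gi i : itg mu Omega (fun x => g x 0 i).
  apply: (itg_le_ae mO (mg i) _ P1); apply: (ae_imp2 ae0 Pb') => x hx bx Ox.
  by have [_ cg _] := hx Ox; apply: (cvg_norm_le (cg i)) => n; exact: bx.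
have wg : is_weak_gradient Omega w g.
  apply/(is_weak_gradientP); split; first exact: itg_loc_integrable.
  move=> i; split; first exact: itg_loc_integrable.
  move=> psi tpsi; have [M M0 hM] := test_bounded tpsi; have [spsi _ _] := tpsi.
  have mp : lmfun Omega psi := continuous_mfun (smooth_cont spsi) mO.
  have mdp : lmfun Omega (partial i psi) :=
    continuous_mfun (smooth_cont (smooth_partial i spsi)) mO.
  have MPi : itg mu Omega (fun x => M * (1 + Phi x)) by exact: itgZ.
  have A1 : {ae mu, forall x, Omega x ->
      (fun n => phi n x * partial i psi x) @ \oo --> w x * partial i psi x}.
    by apply: (ae_imp ae0) => x hx Ox; apply: cvgMl; have [] := hx Ox.
  have A2 : {ae mu, forall x, Omega x -> forall n, `|phi n x * partial i psi x| <= M * (1 + Phi x)}.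
    apply: (ae_imp Pb) => x hx Ox n; rewrite normrM mulrC; have [h1 _] := hx Ox n.
    by have [_ h2] := hM x; exact: ler_pM.
  have B1 : {ae mu, forall x, Omega x ->
      (fun n => partial i (phi n) x * psi x) @ \oo --> g x 0 i * psi x}.
    by apply: (ae_imp ae0) => x hx Ox; apply: cvgMl; have [_ h _] := hx Ox; exact: h.
  have B2 : {ae mu, forall x, Omega x -> forall n, `|partial i (phi n) x * psi x| <= M * (1 + Phi x)}.
    apply: (ae_imp Pb') => x hx Ox n; rewrite normrM mulrC.
    by have [h2 _] := hM x; apply: ler_pM => //; exact: hx.
  have [_ L1] := Int_dominated mO (fun n => lmfM mO (mphi n) mdp) (lmfM mO mw mdp) A1 MPi A2.
  have [_ L2] := Int_dominated mO (fun n => lmfM mO (mdphi n i) mp) (lmfM mO (mg i) mp) B1 MPi B2.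
  apply: (cvg_uniq L1); rewrite (_ : (fun n => _) =
    fun n => - Int mu Omega (fun x => partial i (phi n) x * psi x)); first exact: cvgN.
  by apply/funext => n; exact: (Int_parts).
have [wn nae] := nablaP wg.
have H0t x t : Omega x -> 0 <= t -> `|H x t| = H x t by move=> Ox t0; rewrite ger0_norm// (mod_ge0 Hm).
have Pi2 : itg mu Omega (fun x => 2 ^+ m * Phi x) by exact: itgZ.
have Hw_le : {ae mu, forall x, Omega x -> H x `|w x| <= 2 ^+ m * Phi x /\
    H x (norm1 (g x)) <= 2 ^+ m * Phi x}.
  apply: (ae_imp ae0) => x hx Ox; have [cw cg hP] := hx Ox; split.
    apply: (mod_lsc Ox _ _ (cvg_norm cw)) => // n; apply: le_trans (hP n).
    by rewrite lerDl (mod_ge0 Hm)// norm1_ge0.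
  apply: (mod_lsc Ox _ (norm1_ge0 _) (norm1_cvg (v_ := fun n => grad (phi n) x) _)) => [n|i|n].
  - pos.
  - by have := cg i; apply: cvg_trans; apply: near_eq_cvg; apply: nearW => n; rewrite mxE.
  - by apply: le_trans (hP n); rewrite lerDr (mod_ge0 Hm).
have Hwi : itg mu Omega (fun x => H x `|w x|).
  apply: (itg_le_ae mO _ _ Pi2); first by apply: mfun_mod => //; exact: lmf_norm.
  by apply: (ae_imp Hw_le) => x hx Ox; rewrite H0t//; have [] := hx Ox.
have Hgi : itg mu Omega (fun x => H x (norm1 (g x))).
  apply: (itg_le_ae mO _ _ Pi2); first by apply: mfun_mod => [|x]; [exact: mfun_norm1|pos].
  by apply: (ae_imp Hw_le) => x hx Ox; rewrite H0t ?norm1_ge0//; have [] := hx Ox.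
have [_ hn] := wn.
have mn i : lmfun Omega (fun x => nabla Omega w x 0 i) by have [[]] := hn i.
have itgLH (v : vec -> R) : lmfun Omega v -> itg mu Omega (fun x => H x `|v x|) -> LH Omega H v.
  move=> mv /integrableP[_ hv]; split => //; exists 1 => //; apply: le_lt_trans hv.
  apply: eq_ler; apply: eq_integral => x; rewrite inE => Ox /=.
  by rewrite mul1r H0t.
have Hni : itg mu Omega (fun x => H x `|enorm (nabla Omega w x)|).
  apply: (itg_le_ae mO _ _ Pi2).
    by apply: mfun_mod => //; apply: (lmf_norm mO); exact: mfun_enorm.
  apply: (ae_imp2 Hw_le nae) => x hx nx Ox; rewrite H0t//; have [_ +] := hx Ox.
  apply: le_trans; apply: (mod_le Hm Ox) => //; rewrite ger0_norm ?enorm_ge0// nx//.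
  exact: enorm_norm1.
split => //; split; first by split; [exists g|exact: itgLH|apply: itgLH => //; exact: mfun_enorm].
move=> eps eps0; pose l := Num.min (eps / 2) 1.
have l0 : 0 < l by rewrite lt_min; lra.
have l1 : l <= 1 by rewrite ge_min lexx orbT.
have le : l < eps by rewrite gt_min; apply/orP; left; lra.
have li1 : 1 <= l^-1 by rewrite invf_ge1.
have V n := nablaP (is_weak_gradientB wg (is_weak_gradient_test (tphi n))).
pose a n x := H x (`|w x - phi n x| / l) + H x (enorm (g x - grad (phi n) x) / l).
pose C := l^-1 ^+ m * (2 ^+ m * (2 * 2 ^+ m + 1)).
have mgr n i : lmfun Omega (fun x => (g x - grad (phi n) x) 0 i).
  have -> : (fun x => (g x - grad (phi n) x) 0 i) = fun x => g x 0 i - partial i (phi n) x.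
    by apply/funext => x; rewrite !mxE.
  by apply: (lmfB mO).
have ma n : lmfun Omega (a n).
  apply: (lmfD mO); apply: mfun_mod => [|x]; try pos.
    by apply: lmfM; [|apply: (lmf_norm mO); exact: lmfB|exact: lmf_cst].
  by apply: lmfM; [|exact: mfun_enorm|exact: lmf_cst].
have dv t : 0 <= t -> 0 <= t / l by move=> t0; rewrite divr_ge0// ltW.
have A1 : {ae mu, forall x, Omega x -> (fun n => a n x) @ \oo --> (cst 0 x : R)}.
  apply: (ae_imp ae0) => x hx Ox; have [cw cg _] := hx Ox; rewrite /cst -[X in _ --> X]addr0.
  have dl0 (t_ : nat -> R) : t_ n @[n --> \oo] --> (0 : R) -> t_ n / l @[n --> \oo] --> (0 : R).
    by move=> h; rewrite -[X in _ --> X](mul0r (l^-1)); apply: cvgMl.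
  apply: cvgD; apply: (mod_cvg0 Ox) => [n|]; try pos; apply: dl0.
    by rewrite -[X in _ --> X](normr0 R) -(subrr (w x)); apply: cvg_norm; apply: cvgB cw; exact: cvg_cst.
  apply: (@squeeze0 _ _ (fun n => norm1 (g x - grad (phi n) x))) => [n|].
    by rewrite enorm_ge0 enorm_norm1.
  rewrite (_ : 0 = norm1 (0 : vec)); last by rewrite /norm1 big1// => i _; rewrite mxE normr0.
  apply: norm1_cvg => i; rewrite mxE -(subrr (g x 0 i)).
  have : g x 0 i - partial i (phi n) x @[n --> \oo] --> g x 0 i - g x 0 i.
    by apply: cvgB (cg i); exact: cvg_cst.
  by apply: cvg_trans; apply: near_eq_cvg; apply: nearW => n; rewrite !mxE.
have CPi : itg mu Omega (fun x => C * Phi x) by exact: itgZ.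
have A2 : {ae mu, forall x, Omega x -> forall n, `|a n x| <= C * Phi x}.
  apply: (ae_imp2 ae0 Hw_le) => x hx wx Ox n; have [_ _ /(_ n) hP] := hx Ox; have [h1 h2] := wx Ox.
  rewrite ger0_norm; last by rewrite addr_ge0// (mod_ge0 Hm)// dv// enorm_ge0.
  have st s t (y : R) : 0 <= s -> 0 <= t -> 0 <= y -> y <= s + t ->
      H x (y / l) <= l^-1 ^+ m * (2 ^+ m * (H x s + H x t)).
    move=> s0 t0 y0 yst; rewrite mulrC; apply: le_trans (mod_dil Hm Ox li1 y0) _.
    rewrite ler_wpM2l ?exprn_ge0 ?invr_ge0 ?(ltW l0)//; apply: le_trans (modD Ox s0 t0).
    exact: (mod_le Hm).
  have := st _ _ _ (normr_ge0 (w x)) (normr_ge0 (phi n x)) (normr_ge0 (w x - phi n x)) (ler_normB _ _).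
  have := st _ _ _ (norm1_ge0 (g x)) (norm1_ge0 (grad (phi n) x)) (enorm_ge0 (g x - grad (phi n) x))
    (le_trans (enorm_norm1 _) (norm1B _ _)).
  move=> s2 s1; apply: le_trans (lerD s1 s2) _; rewrite /C -!mulrDr -!mulrA.
  rewrite ler_wpM2l ?exprn_ge0 ?invr_ge0 ?(ltW l0)// ler_wpM2l//.
  pos.
have [_ L] := Int_dominated mO ma (lmf_cst 0) A1 CPi A2.
rewrite (_ : Int mu Omega (cst 0) = 0) in L; last by rewrite Int_cst// mul0r.
have [n _ /(_ n (leqnn n)) hn1] := cvgr_lt _ L _ ltr01.
exists (phi n) => //; apply: (@le_lt_trans _ _ l%:E); last by rewrite lte_fin.
apply: ereal_inf_lbound; exists l => //; split => //.
via (\int[mu]_(x in Omega) (a n x)%:E)%E.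
  apply: eq_ler; apply: eq_integral_ae.
  by apply: (ae_imp (V n).2) => x hx Ox /=; rewrite hx.
have ai : itg mu Omega (a n).
  by apply: (itg_le_ae mO (ma n) _ CPi); apply: (ae_imp A2) => x hx Ox; exact: hx.
by rewrite IntE// lee_fin ltW.
Qed.

Lemma lmf_comp (D : set vec) (u : vec -> R) (F : R -> R) : lmfun D u ->
  continuous F -> lmfun D (fun x => F (u x)).
Proof. by move=> mu_ cF; apply: (measurableT_comp (f := F)) => //; exact: continuous_measurable_fun. Qed.

Lemma cvg_continuous (F : R -> R) (s : nat -> R) (l : R) : continuous F -> s n @[n --> \oo] --> l ->
  F (s n) @[n --> \oo] --> F l.
Proof. by move=> cF sl; apply: continuous_cvg => //; exact: cF. Qed.

Lemma partial_comp (F dF : R -> R) (u : vec -> R) i : smooth u ->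
  (forall t, is_derive t 1 F (dF t)) -> partial i (F \o u) = fun x => dF (u x) * partial i u x.
Proof.
move=> su hF; apply: partialE => x.
exact: is_derive_comp (smooth_is_derive i x su) (hF _).
Qed.

Variables (u : vec -> R) (g : vec -> vec) (phi : nat -> vec -> R)
  (Phi : vec -> R).
Hypothesis ug : approx u g phi Phi.
Variables (F dF : R -> R) (z : vec -> R) (M c : R).
Hypotheses (sF : smooth1 F) (dFF : forall t, is_derive t 1 F (dF t)) (cdF : continuous dF)
  (dF1 : forall t, `|dF t| <= 1) (Fc : forall t, `|F t| <= `|t| + c) (sz : smooth z) (M1 : 1 <= M)
  (zM : forall x, `|z x| <= M) (dzM : forall x i, `|partial i z x| <= M)
  (tF : forall n, test_fun Omega (fun x => F (phi n x) * z x)).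

(** Source of all test functions for the equation. The majorant comes from |dF| <= 1, the linear
    growth of F and the bounds on z and its derivatives, through doubling. *)
Lemma approx_comp : approximable (fun x => F (u x) * z x)
  (fun x => (dF (u x) * z x) *: g x + F (u x) *: grad z x).
Proof.
have [mu_ mg tphi Pi ae0] := ug.
have cF : continuous F.
  by move=> t; apply: differentiable_continuous; apply/derivable1_diffP; have [] := dFF t.
have c0' : 0 <= c by have := Fc 0; rewrite normr0 add0r; exact: le_trans.
pose K := M * N.+1%:R.
have N1 : (1 : R) <= N.+1%:R by rewrite ler1n.
have M0 : 0 <= M := le_trans ler01 M1.
have K1 : 1 <= K by rewrite -[leLHS]mulr1 ler_pM.
have K0 : 0 <= K by lra.
have MK : M <= K by rewrite /K ler_peMr.
pose c1 := Num.max 1 c.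
have c11 : 1 <= c1 by rewrite le_max lexx.
pose Phi' x := 2 * (K ^+ m * (2 ^+ m * (2 ^+ m * Phi x + c1 ^+ m * k1))).
have mF := lmf_comp mu_ cF; have mdF := lmf_comp mu_ cdF.
have mz : lmfun Omega z := continuous_mfun (smooth_cont sz) mO.
have sphi n : smooth (phi n) by have [] := tphi n.
have dE n i : partial i (fun x => F (phi n x) * z x) =
    fun x => F (phi n x) * partial i z x + z x * (dF (phi n x) * partial i (phi n) x).
  by rewrite (partialM _ (smooth_comp (sphi n) sF) sz) (partial_comp _ (sphi n) dFF).
exists (fun n x => F (phi n x) * z x), Phi'; split => //.
- exact: lmfM.
- move=> i; rewrite (_ : (fun x => _ 0 i) = fun x => dF (u x) * z x * g x 0 i + F (u x) * partial i z x).
    apply: (lmfD mO); apply: (lmfM mO) => //; first exact: lmfM.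
    exact: (continuous_mfun (smooth_cont (smooth_partial i sz)) mO).
  by apply/funext => x; rewrite !mxE.
- do ![apply: (itgZ _ mO)|apply: (itgD mO)] => //; exact: itg_cst.
apply: (ae_imp ae0) => x hx Ox; have [cu cg hP] := hx Ox.
have cFx : F (phi n x) @[n --> \oo] --> F (u x) by exact: (continuous_cvg _ (cF _) cu).
have cdFx : dF (phi n x) @[n --> \oo] --> dF (u x).
  exact: cvg_continuous.
split.
- exact: cvgMl.
- move=> i; rewrite !mxE (_ : (fun n => _) =
    fun n => dF (phi n x) * z x * partial i (phi n) x + F (phi n x) * partial i z x).
    by apply: cvgD; [apply: cvgM => //; exact: cvgMl|exact: cvgMl].
  by apply/funext => n; rewrite dE; ring.
move=> n; pose y := `|phi n x| + norm1 (grad (phi n) x) + c.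
have a0 : 0 <= `|phi n x| + norm1 (grad (phi n) x) by rewrite addr_ge0 ?norm1_ge0.
have y0 : 0 <= y by rewrite addr_ge0.
have HK s : 0 <= s -> s <= K * y -> H x s <= K ^+ m * (2 ^+ m * (2 ^+ m * Phi x + c1 ^+ m * k1)).
  move=> s0 sy; apply: le_trans (mod_le Hm Ox s0 sy) _.
  apply: le_trans (mod_dil Hm Ox K1 y0) _; rewrite ler_wpM2l ?exprn_ge0//.
  apply: le_trans (modD Ox a0 c0') _; rewrite ler_wpM2l//; apply: lerD.
    apply: le_trans (modD Ox (normr_ge0 _) (norm1_ge0 _)) _. by rewrite ler_wpM2l.
  have cc1 : c <= c1 by rewrite le_max lexx orbT.
  rewrite -[c1]mulr1 in cc1; apply: le_trans (mod_le Hm Ox c0' cc1) _.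
  apply: le_trans (mod_dil Hm Ox c11 ler01) _.
  by rewrite ler_wpM2l ?exprn_ge0 ?(mod_one Hm)//; lra.
have Fy : `|F (phi n x)| <= y.
  by apply: le_trans (Fc _) _; rewrite /y lerD2r lerDl norm1_ge0.
rewrite /Phi' mulrDl mul1r; apply: lerD; apply: HK => //; last 1 first.
- via (\sum_(i < N) M * (y + `|partial i (phi n) x|)).
    apply: ler_sum => i _; rewrite mxE dE mulrDr; apply: le_trans (ler_normD _ _) _.
    rewrite !normrM; apply: lerD; first by rewrite mulrC; exact: ler_pM.
    by apply: ler_pM => //; rewrite -[leRHS]mul1r; exact: ler_pM.
  rewrite -mulr_sumr -mulrA ler_wpM2l//.
  rewrite big_split/= sumr_const card_ord -natr1 mulrDl mul1r mulr_natl lerD2l.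
  have E : \sum_(i < N) `|partial i (phi n) x| = norm1 (grad (phi n) x).
    by apply: eq_bigr => i _; rewrite mxE.
  by rewrite E /y; have := normr_ge0 (phi n x); lra.
- by rewrite normrM mulrC; apply: ler_pM => //; exact: le_trans MK.
- pos.
Qed.

End test_functions.

Section test_closure.
Context {R : realType} {N : nat}.
Variable Omega : set 'rV[R]_N.
Implicit Types (phi z : 'rV[R]_N -> R) (F : R -> R).

Lemma test_fun_comp phi z F : test_fun Omega phi -> smooth1 F -> F 0 = 0 -> smooth z ->
  test_fun Omega (fun x => F (phi x) * z x).
Proof.
move=> [sp kp pO] sF F0 sz.
apply: (test_funP (smoothM (smooth_comp sp sF) sz) kp pO) => x nz; apply: subset_closure => /=.
by apply: contra_neq nz => p0; rewrite /= p0 F0 mul0r.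
Qed.

Lemma test_fun_cutoff phi z F K : smooth phi -> smooth1 F -> smooth z -> compact K -> K `<=` Omega ->
  (forall x, z x != 0 -> K x) -> test_fun Omega (fun x => F (phi x) * z x).
Proof.
move=> sp sF sz kK KO zK; apply: (test_funP (smoothM (smooth_comp sp sF) sz) kK KO) => x nz.
by apply: zK; apply: contra_neq nz => ->; rewrite mulr0.
Qed.

End test_closure.

(** * Young inequalities and logarithms against powers *)

Section young.
Context {R : realType}.
Implicit Types (a b e th t s x y z k l : R).

(** If b <= e a, then b^th brings the factor e^th <= e^th0; otherwise a and b are both at most b /
    e. *)
Lemma young_pow a b e th th0 : 0 <= a -> 0 <= b -> 0 < e -> e <= 1 -> 0 < th0 -> th0 <= th ->
  th <= 1 -> a `^ (1 - th) * b `^ th <= e `^ th0 * a + e^-1 * b.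
Proof.
move=> a0 b0 e0 e1 th00 th0t th1.
have tp : 0 < th by exact: lt_le_trans th0t.
have ei : 0 <= e^-1 by rewrite invr_ge0 ltW.
have [bea|eab] := leP b (e * a).
  move: a0; rewrite le_eqVlt => /orP[/eqP a0|a0].
    have -> : b = 0 by apply/eqP; rewrite eq_le b0 andbT; apply: le_trans bea _; rewrite -a0 mulr0.
    by rewrite powR0 ?gt_eqF// mulr0 -a0 !mulr0 addr0.
  via (e `^ th0 * a); last by rewrite lerDl mulr_ge0.
  via (a `^ (1 - th) * (e * a) `^ th).
    by rewrite ler_wpM2l ?powR_ge0//; apply: powR_le => //; exact: ltW.
  rewrite powRM ?(ltW e0) ?(ltW a0)// mulrCA -powRD_pos// subrK powRr1 ?(ltW a0)//.
  rewrite ler_wpM2r ?(ltW a0)//; apply: ger_powR => //; by rewrite e0.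
via (e^-1 * b); last by rewrite lerDr mulr_ge0// powR_ge0.
have bp : 0 < b by apply: le_lt_trans eab; rewrite mulr_ge0// ltW.
have be : 0 < e^-1 * b by rewrite mulr_gt0// invr_gt0.
have bb : b <= e^-1 * b by rewrite ler_peMl// invf_ge1.
via ((e^-1 * b) `^ (1 - th) * (e^-1 * b) `^ th); last first.
  by rewrite -powRD_pos// subrK powRr1// ltW.
apply: ler_pM; try pos; last by apply: powR_le => //; exact: ltW.
by apply: powR_le => //; [pos|rewrite ler_pdivlMl// ltW].
Qed.

Lemma young_eps th0 e : 0 < th0 -> 0 < e -> exists2 C, 0 <= C & forall a b th, 0 <= a -> 0 <= b ->
  th0 <= th -> th <= 1 -> a `^ (1 - th) * b `^ th <= e * a + C * b.
Proof.
move=> th00 e0; pose e1 := Num.min 1 e; pose e2 := e1 `^ th0^-1.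
have e10 : 0 < e1 by rewrite lt_min ltr01.
have e20 : 0 < e2 by exact: powR_gt0.
have e2th : e2 `^ th0 = e1 by rewrite powRVK ?gt_eqF// ltW.
exists e2^-1; first pos.
move=> a b th a0 b0 h1 h2; apply: le_trans (young_pow a0 b0 e20 _ th00 h1 h2) _.
  via (1 `^ th0^-1); last by rewrite powR1.
  by apply: powR_le; rewrite ?(ltW e10)// ?invr_ge0 ?(ltW th00)// ge_min lexx.
by rewrite e2th lerD2r ler_wpM2r// ge_min lexx orbT.
Qed.

Lemma powR_conv x y z t : 0 <= t -> x * y = z -> t `^ z = (t `^ x) `^ y.
Proof. by move=> t0 <-; rewrite powRrM. Qed.

(* For 1 <= x <= y - k the power t^x interpolates between t and t^y. *)
Lemma powR_interp k bm e : 0 < k -> 1 < bm -> 0 < e -> exists2 C, 0 <= C & forall t x y, 0 < t ->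
  1 <= x -> x <= y - k -> y <= bm -> t `^ x <= e * t `^ y + C * t.
Proof.
move=> k0 bm1 e0; have th00 : 0 < Num.min 1 (k / (bm - 1)).
  by rewrite lt_min ltr01 divr_gt0// subr_gt0.
have [C C0 hC] := young_eps th00 e0; exists C => // t x y t0 x1 xy yb.
have y1 : 0 < y - 1 by lra.
pose th := (y - x) / (y - 1).
have -> : t `^ x = (t `^ y) `^ (1 - th) * t `^ th.
  rewrite -powRrM -powRD_pos//; congr (_ `^ _); rewrite /th; field; pos.
apply: hC; try pos; rewrite /th.
  rewrite ge_min; apply/orP; right; rewrite ler_pdivlMr// mulrAC ler_pdivrMr ?subr_gt0//.
  by apply: ler_pM; lra.
by rewrite ler_pdivrMr//; lra.
Qed.

Lemma ln_le_sub1 y : 0 < y -> ln y <= y - 1.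
Proof.
move=> y0; have h : -1 < y - 1 by lra.
by have := le_ln1Dx h; rewrite [1 + _]addrC subrK.
Qed.

Lemma ln_le_powR k t : 0 < k -> 0 < t -> ln t <= k^-1 * t `^ k.
Proof.
move=> k0 t0; rewrite ler_pdivlMl// -ln_powR; have := powR_gt0 k t0 => tk.
by have := ln_le_sub1 tk; lra.
Qed.

Lemma norm_ln_le_powR k t : 0 < k -> 0 < t -> `|ln t| <= k^-1 * (t `^ k + t `^ (- k)).
Proof.
move=> k0 t0; have h1 := ln_le_powR k0 t0.
have ti : 0 < t^-1 by rewrite invr_gt0.
have h2 := ln_le_powR k0 ti; rewrite lnV// in h2.
have E : t^-1 `^ k = t `^ (- k) by rewrite -powR_inv1 ?(ltW t0)// -powRrM mulN1r.
rewrite E in h2; have k1 : 0 <= k^-1 by rewrite invr_ge0 ltW.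
have p1 := mulr_ge0 k1 (powR_ge0 t k); have p2 := mulr_ge0 k1 (powR_ge0 t (- k)).
by rewrite ler_norml mulrDr; lra.
Qed.

Lemma norm_ln_ge1 k t : 0 < k -> 1 <= t -> `|ln t| <= k^-1 * t `^ k.
Proof.
move=> k0 t1; rewrite ger0_norm ?ln_ge0//; apply: ln_le_powR => //; exact: lt_le_trans t1.
Qed.

Lemma norm_ln_le1 k t : 0 < k -> 0 < t -> t <= 1 -> t `^ k * `|ln t| <= k^-1.
Proof.
move=> k0 t0 t1; have ti : 0 < t^-1 by rewrite invr_gt0.
have := ln_le_powR k0 ti; rewrite lnV// ler0_norm ?ln_le0// => h.
apply: le_trans (ler_wpM2l (powR_ge0 t k) h) _.
rewrite mulrCA -powRM ?(ltW t0) ?(ltW ti)// mulfV ?gt_eqF// powR1 mulr1//.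
Qed.

Lemma powR_le1 t x y : 0 < t -> t <= 1 -> x <= y -> t `^ y <= t `^ x.
Proof. by move=> t0 t1 xy; apply: ger_powR => //; rewrite t0. Qed.

Lemma powR_norm_ln_le k t x : 0 < k -> 0 < t -> t <= 1 -> 1 + k <= x -> t `^ x * `|ln t| <= k^-1 * t.
Proof.
move=> k0 t0 t1 kx.
via (t `^ (1 + k) * `|ln t|); first by rewrite ler_wpM2r// powR_le1.
rewrite powRD_pos// powRr1 ?(ltW t0)// mulrC mulrCA mulrC; apply: ler_wpM2r; first pos.
by rewrite mulrC; exact: norm_ln_le1.
Qed.

End young.

(** * The double phase densities at fixed exponents *)

Section double_phase_numbers.
Context {R : realType}.
Variables (n p0 q1 gap M delta eta : R).
Hypotheses (n2 : 2 <= n) (p01 : 1 < p0) (q1n : q1 < n) (gap0 : 0 < gap) (M0 : 0 <= M)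
  (delta1 : 1 <= delta) (eta0 : 0 <= eta).
Implicit Types (p q m t s l e k : R).

Definition Lg t : R := ln (delta + eta * t).

Let arg1 t : 0 <= t -> 1 <= delta + eta * t.
Proof. by move=> t0; have d1 := delta1; have := mulr_ge0 eta0 t0; lra. Qed.

Lemma Lg_ge0 t : 0 <= t -> 0 <= Lg t.
Proof. by move=> t0; apply: ln_ge0; exact: arg1. Qed.

Lemma Lg_le s t : 0 <= s -> s <= t -> Lg s <= Lg t.
Proof.
move=> s0 st; have t0 := le_trans s0 st; have h1 := arg1 s0; have h2 := arg1 t0.
by rewrite /Lg ler_ln ?posrE ?(lt_le_trans ltr01)// lerD2l ler_wpM2l.
Qed.

(** Put a = delta + eta t and y = delta + eta l t. As delta >= 1, y - 1 <= l (a - 1); the inequality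
    ln x <= x - 1 at y / a and at 1 / a gives the claim. *)
Lemma Lg_dil l t : 1 <= l -> 0 <= t -> Lg (l * t) <= l * Lg t.
Proof.
move=> l1 t0; have lt0 : 0 <= l * t by rewrite mulr_ge0//; lra.
have a1 := arg1 t0; have y1 := arg1 lt0; rewrite /Lg.
set a := delta + eta * t in a1 *; set y := delta + eta * (l * t) in y1 *.
have a0 : 0 < a by lra. have y0 : 0 < y by lra. have l0 : 0 < l by lra.
have yla : y - 1 <= l * (a - 1).
  rewrite /y /a; have d1 := delta1; have : 0 <= (l - 1) * (delta - 1) by rewrite mulr_ge0//; lra.
  lra.
have h1 : ln (y / a) <= y / a - 1 by apply: ln_le_sub1; rewrite divr_gt0.
have h2 : ln a^-1 <= a^-1 - 1 by apply: ln_le_sub1; rewrite invr_gt0.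
rewrite ln_div// in h1; rewrite lnV// in h2.
have h3 : (y / a - 1) + (l - 1) * (a^-1 - 1) <= 0.
  have -> : (y / a - 1) + (l - 1) * (a^-1 - 1) = (y - 1 - l * (a - 1)) / a by field; lra.
  by rewrite pmulr_lle0 ?invr_gt0//; lra.
have h4 : 0 <= (l - 1) * (a^-1 - 1 + ln a) by rewrite mulr_ge0//; lra.
lra.
Qed.

(** 1 - 1/a <= ln a for a = delta + eta t, with delta >= 1. It bounds the additional term of the
    operator, and the derivative of the logarithm, by the logarithm itself. *)
Lemma Lg_tangent t : 0 <= t -> eta * t / (delta + eta * t) <= Lg t.
Proof.
move=> t0; have h := arg1 t0; rewrite /Lg; set a := delta + eta * t in h *.
have a0 : 0 < a by lra.
have h2 : ln a^-1 <= a^-1 - 1 by apply: ln_le_sub1; rewrite invr_gt0.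
rewrite lnV// in h2.
via (1 - a^-1); last pos.
by have d1 := delta1; rewrite ler_pdivrMr// mulrBl mulVf ?gt_eqF// mul1r /a; lra.
Qed.

Lemma Lg_powR k c : 0 < k -> 0 < c -> exists2 C, 0 <= C & forall t, c <= t -> Lg t <= C * t `^ k.
Proof.
move=> k0 c0; pose D := delta / c + eta.
have d1 := delta1; have D0 : 0 <= D by rewrite addr_ge0// divr_ge0//; [lra|pos].
exists (k^-1 * D `^ k); first pos.
move=> t ct; have t0 : 0 < t by lra.
have h := arg1 (ltW t0); have a0 : 0 < delta + eta * t by lra.
apply: le_trans (ln_le_powR k0 a0) _; rewrite -mulrA ler_wpM2l ?invr_ge0 ?(ltW k0)//.
rewrite -powRM ?(ltW t0)//; apply: powR_le; try pos.
rewrite /D mulrDl lerD2r mulrAC ler_pdivlMr// ler_wpM2l//; lra.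
Qed.

(** The values of p, q and mu at one point, with bounds that do not depend on the point. *)
Definition adm p q m := [/\ p0 <= p, p <= q, q <= q1, q / p <= 1 + n^-1 - gap & 0 <= m <= M].
Definition Zf q m t : R := m * t `^ q * Lg t.
Definition Hf p q m t : R := t `^ p + Zf q m t.
Definition Bf p q m t : R := t `^ (n * p / (n - p)) + Zf q m t `^ (n / (n - q)).

Lemma Zf_ge0 q m t : 0 <= m -> 0 <= t -> 0 <= Zf q m t.
Proof. by move=> m0 t0; rewrite !mulr_ge0 ?powR_ge0 ?Lg_ge0. Qed.

Lemma Zf_le q m s t : 0 <= m -> 0 <= q -> 0 <= s -> s <= t -> Zf q m s <= Zf q m t.
Proof.
move=> m0 q0 s0 st; apply: ler_pM; rewrite ?mulr_ge0 ?powR_ge0 ?Lg_ge0 ?Lg_le//.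
by rewrite ler_wpM2l//; exact: powR_le.
Qed.

Lemma Hf_ge0 p q m t : 0 <= m -> 0 <= t -> 0 <= Hf p q m t.
Proof. by move=> m0 t0; rewrite addr_ge0 ?powR_ge0// Zf_ge0. Qed.

Lemma Hf_le p q m s t : 0 <= m -> 0 <= p -> 0 <= q -> 0 <= s -> s <= t -> Hf p q m s <= Hf p q m t.
Proof. by move=> m0 p0' q0 s0 st; apply: lerD; [exact: powR_le|exact: Zf_le]. Qed.

Lemma powR_shrink l t x : 0 <= l -> l <= 1 -> 0 <= t -> 1 <= x -> (l * t) `^ x <= l * t `^ x.
Proof.
move=> l0 l1 t0 x1; rewrite powRM// ler_wpM2r ?powR_ge0//.
move: l0; rewrite le_eqVlt => /orP[/eqP <-|l0]; first by rewrite powR0// gt_eqF//; lra.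
by apply: ge1r_powR => //; rewrite l0.
Qed.

Lemma Zf_shrink q m l t : 0 <= m -> 1 <= q -> 0 <= l -> l <= 1 -> 0 <= t ->
  Zf q m (l * t) <= l * Zf q m t.
Proof.
move=> m0 q11 l0 l1 t0; rewrite /Zf.
have h1 := ler_wpM2l m0 (powR_shrink l0 l1 t0 q11).
have h2 : Lg (l * t) <= Lg t by apply: Lg_le; [pos|rewrite ler_piMl].
have h3 := ler_pM (mulr_ge0 m0 (powR_ge0 _ _)) (Lg_ge0 (mulr_ge0 l0 t0)) h1 h2.
apply: le_trans h3 _; apply: eq_ler; ring.
Qed.

Lemma Hf_shrink p q m l t : 0 <= m -> 1 <= p -> 1 <= q -> 0 <= l -> l <= 1 -> 0 <= t ->
  Hf p q m (l * t) <= l * Hf p q m t.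
Proof. by move=> *; rewrite mulrDr; apply: lerD; [exact: powR_shrink|exact: Zf_shrink]. Qed.

Lemma powR_dil l t x (k : nat) : 1 <= l -> 0 <= t -> x <= k%:R -> (l * t) `^ x <= l ^+ k * t `^ x.
Proof.
move=> l1 t0 xk; have l0 : 0 <= l by lra.
by rewrite powRM// ler_wpM2r ?powR_ge0// -powR_mulrn//; exact: ler_powR.
Qed.

Lemma Zf_dil q m l t (k : nat) : 0 <= m -> q <= k%:R -> 1 <= l -> 0 <= t ->
  Zf q m (l * t) <= l ^+ k.+1 * Zf q m t.
Proof.
move=> m0 qk l1 t0; have l0 : 0 <= l by lra.
have h1 := ler_wpM2l m0 (powR_dil l1 t0 qk).
have h3 := ler_pM (mulr_ge0 m0 (powR_ge0 _ _)) (Lg_ge0 (mulr_ge0 l0 t0)) h1 (Lg_dil l1 t0).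
by apply: le_trans h3 _; rewrite le_eqVlt exprSr; apply/orP; left; apply/eqP; rewrite /Zf; ring.
Qed.

Lemma Hf_dil p q m l t (k : nat) : 0 <= m -> p <= k%:R -> q <= k%:R -> 1 <= l -> 0 <= t ->
  Hf p q m (l * t) <= l ^+ k.+1 * Hf p q m t.
Proof.
move=> m0 pk qk l1 t0; rewrite mulrDr; apply: lerD; last exact: Zf_dil.
apply: le_trans (powR_dil l1 t0 pk) _; rewrite ler_wpM2r ?powR_ge0// exprSr ler_peMr//.
pos.
Qed.

Lemma Hf_low p q m t : 0 <= m -> 1 <= p -> 0 <= t -> t <= 1 + Hf p q m t.
Proof.
move=> m0 p1 t0; have z0 := Zf_ge0 q m0 t0; have [t1|/ltW t1] := leP t 1.
  by have := Hf_ge0 p q m0 t0; lra.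
by have := le1r_powR t1 p1; rewrite /Hf; lra.
Qed.

End double_phase_numbers.

Lemma growth_sum {R : realType} (A B X Y S Z C e t : R) : 0 <= A -> 0 <= B -> 0 <= C -> 0 <= t ->
  X <= e * S + C * A -> Y <= e * Z + C * B ->
  A + B + X + Y + t <= e * (S + Z) + (C + 2) * (A + B + t).
Proof. by move=> A0 B0 C0 t0 hX hY; have := mulr_ge0 C0 t0; lra. Qed.

(** * Control of the slope of V and of the growth condition *)

Section slope_control.
Context {R : realType}.
Variables (n p0 q1 gap M delta eta : R).
Hypotheses (n2 : 2 <= n) (p01 : 1 < p0) (q1n : q1 < n) (gap0 : 0 < gap) (M0 : 0 <= M)
  (delta1 : 1 <= delta) (eta0 : 0 <= eta).
Implicit Types (p q m t s l e x y : R).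

Local Notation Lg := (Lg delta eta).
Local Notation adm := (adm n p0 q1 gap M).
Local Notation Zf := (Zf delta eta).
Local Notation Hf := (Hf delta eta).
Local Notation Bf := (Bf n delta eta).

(** Margin kept between every lower order exponent and the critical one: half the smaller of 1/n,
    which the Sobolev exponent supplies, and [gap]. *)
Definition mg : R := Num.min n^-1 gap / 2.

Lemma mg_gt0 : 0 < mg.
Proof. by have h := n2; rewrite divr_gt0// lt_min gap0 andbT invr_gt0; lra. Qed.
#[local] Hint Resolve mg_gt0 : core.

Lemma mg_le_invn : 2 * mg <= n^-1.
Proof. by rewrite /mg mulrC divfK// ge_min lexx. Qed.

Lemma mg_le_gap : 2 * mg <= gap.
Proof. by rewrite /mg mulrC divfK// ge_min lexx orbT. Qed.

Lemma invn_le : n^-1 <= 2^-1.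
Proof. by have h := n2; rewrite lef_pV2 ?posrE; lra. Qed.

Lemma invn_gt0 : 0 < n^-1.
Proof. by have h := n2; rewrite invr_gt0; lra. Qed.
#[local] Hint Resolve invn_gt0 : core.

(** [a1f p] and [a2f q] are (n - 1)/n times the exponents n p / (n - p) and n / (n - q) of B, so
    that V^(n/(n-1)) grows like B. *)
Definition a1f p : R := p * (n - 1) / (n - p).
Definition a2f q : R := (n - 1) / (n - q).

Lemma adm_bounds p q m : adm p q m -> [/\ 1 < p, p < n, 1 < q, q < n & 0 <= m].
Proof.
by have h1 := p01; have h2 := q1n; move=> [? ? ? _ /andP[? _]]; split => //; lra.
Qed.

Local Ltac bounds a := have [h1 h2 h3 h4 h5] := adm_bounds a; have hn := n2.

(** The constant of a dichotomy: where Z >= 1, t is at least 1 / KZ; where Z <= 1, Z is at most KZ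
    t. *)
Definition KZ : R := M * Lg 1 + 1.

Lemma KZ_ge1 : 1 <= KZ.
Proof. by have := mulr_ge0 M0 (Lg_ge0 delta1 eta0 ler01); rewrite /KZ; lra. Qed.
#[local] Hint Resolve KZ_ge1 : core.

Lemma KZ_ge0 : 0 <= KZ. Proof. exact: le_trans ler01 KZ_ge1. Qed.
#[local] Hint Resolve KZ_ge0 : core.

Lemma Bf_ge0 p q m t : 0 <= Bf p q m t.
Proof. by rewrite addr_ge0 ?powR_ge0. Qed.

#[local] Hint Extern 1 (is_true (0 <= Bf _ _ _ _)) => exact: Bf_ge0 : nonneg.
#[local] Hint Extern 1 (is_true (0 <= Lg _)) => (apply: Lg_ge0; pos) : nonneg.
#[local] Hint Extern 1 (is_true (0 <= Zf _ _ _)) => (apply: Zf_ge0; pos) : nonneg.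
#[local] Hint Extern 1 (is_true (0 <= Hf _ _ _ _)) => (apply: Hf_ge0; pos) : nonneg.

Lemma Zf_le_lin p q m t : adm p q m -> 0 < t -> t <= 1 -> Zf q m t <= M * Lg 1 * t.
Proof.
move=> a t0 t1; have [h1 h2 h3 h4 h5] := adm_bounds a; have [_ _ _ _ /andP[_ mM]] := a.
have tq : t `^ q <= t by rewrite -[leRHS]powRr1 ?(ltW t0)//; apply: powR_le1 => //; exact: ltW.
have LL := Lg_le delta1 eta0 (ltW t0) t1; have L0 := Lg_ge0 delta1 eta0 (ltW t0).
via (M * t * Lg 1); last by rewrite mulrAC.
by apply: ler_pM => //; [pos|apply: ler_pM; rewrite ?powR_ge0].
Qed.

Lemma Zf_big p q m t : adm p q m -> 0 < t -> 1 <= Zf q m t -> 1 <= KZ * t.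
Proof.
move=> a t0 z1; have [t1|/ltW t1] := leP t 1.
  apply: le_trans z1 (le_trans (Zf_le_lin a t0 t1) _).
  by rewrite ler_wpM2r ?(ltW t0)// /KZ lerDl.
by have := KZ_ge1; have := ler_peMl (ltW t0) KZ_ge1; lra.
Qed.

Lemma Zf_small p q m t : adm p q m -> 0 < t -> Zf q m t <= 1 -> Zf q m t <= KZ * t.
Proof.
move=> a t0 z1; have [t1|/ltW t1] := leP t 1.
  apply: (le_trans (Zf_le_lin a t0 t1)).
  by rewrite ler_wpM2r ?(ltW t0)// /KZ lerDl.
by have := KZ_ge1; have := ler_peMl (ltW t0) KZ_ge1; lra.
Qed.

Lemma Zf_powR p q m t x : adm p q m -> 0 <= t -> 0 <= x ->
  Zf q m t `^ x <= Bf p q m t `^ (x * (n - q) / n).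
Proof.
move=> a t0 x0; bounds a.
rewrite (@powR_conv _ (n / (n - q)) (x * (n - q) / n) x) ?Zf_ge0//; last by field; lra.
apply: powR_le; rewrite ?powR_ge0//; last by rewrite lerDr powR_ge0.
pos.
Qed.

Lemma t_powR p q m t x : adm p q m -> 0 <= t -> 0 <= x ->
  t `^ x <= Bf p q m t `^ (x * (p^-1 - n^-1)).
Proof.
move=> a t0 x0; bounds a.
rewrite (@powR_conv _ (n * p / (n - p)) (x * (p^-1 - n^-1)) x)//; last by field; lra.
apply: powR_le; try pos; last by rewrite lerDl powR_ge0.
by rewrite mulr_ge0// subr_ge0 lef_pV2 ?posrE; lra.
Qed.

Lemma Bf_ge1 p q m t : adm p q m -> 0 <= t -> 1 <= Zf q m t -> 1 <= Bf p q m t.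
Proof.
move=> a t0 z1; bounds a.
rewrite -[leLHS]add0r; apply: lerD; first pos.
via (1 `^ (n / (n - q))); first by rewrite powR1.
by apply: powR_le => //; rewrite divr_ge0; lra.
Qed.

(** Young's inequality between B and 1, the latter being at most KZ t where Z >= 1. *)
Lemma big_absorb e : 0 < e -> exists2 C, 0 <= C & forall p q m t x, adm p q m -> 0 < t ->
  1 <= Zf q m t -> x <= 1 - mg -> Bf p q m t `^ x <= e * Bf p q m t + C * t.
Proof.
move=> e0; have [C C0 hC] := young_eps mg_gt0 e0.
exists (C * KZ); first pos.
move=> p q m t x a t0 z1 xk; have B1 := Bf_ge1 a (ltW t0) z1.
via (Bf p q m t `^ (1 - mg)); first exact: ler_powR.
have := hC (Bf p q m t) 1 mg (le_trans ler01 B1) ler01 (lexx _).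
rewrite powR1 mulr1 => /(_ _)/le_trans; apply; first by have := mg_le_invn; have := invn_le; lra.
by rewrite mulr1 lerD2l -mulrA ler_peMr// (Zf_big a).
Qed.

(** The error allowed in the slope of V, with t for phi and s for the length of its gradient: a
    small multiple of B, absorbed in [emb_small], plus a multiple of the energy. *)
Definition controlled (T : R -> R -> R -> R -> R -> R) := forall e, 0 < e ->
  exists2 C, 0 <= C & forall p q m t s, adm p q m -> 0 < t -> 0 <= s ->
    T p q m t s <= e * Bf p q m t + C * (t + Hf p q m s).

Lemma controlledD T T' : controlled T -> controlled T' ->
  controlled (fun p q m t s => T p q m t s + T' p q m t s).
Proof.
move=> hT hT' e e0; have e2 : 0 < e / 2 by lra.
have [C C0 hC] := hT _ e2; have [C' C'0 hC'] := hT' _ e2.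
exists (C + C'); first pos.
move=> p q m t s a t0 s0; have := lerD (hC _ _ _ _ _ a t0 s0) (hC' _ _ _ _ _ a t0 s0).
by move/le_trans; apply; apply: eq_ler; field.
Qed.

Lemma controlled_le K T T' : 0 < K -> controlled T ->
  (forall p q m t s, adm p q m -> 0 < t -> 0 <= s -> T' p q m t s <= K * T p q m t s) ->
  controlled T'.
Proof.
move=> Kp hT TT' e e0; have eK : 0 < e / K by rewrite divr_gt0.
have [C C0 hC] := hT _ eK; exists (K * C); first pos.
move=> p q m t s a t0 s0; apply: le_trans (TT' _ _ _ _ _ a t0 s0) _.
apply: le_trans (ler_wpM2l (ltW Kp) (hC _ _ _ _ _ a t0 s0)) _.
apply: eq_ler; field; lra.
Qed.

Lemma le_tH p q m t s : adm p q m -> 0 < t -> 0 <= s -> t <= t + Hf p q m s /\ Hf p q m s <= t + Hf p q m s.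
Proof.
move=> a t0 s0; have [_ _ _ _ m0] := adm_bounds a; have := Hf_ge0 delta1 eta0 p q m0 s0.
lra.
Qed.

Lemma controlled_case T : (forall e, 0 < e -> exists2 C, 0 <= C & forall p q m t s, adm p q m ->
    0 < t -> 0 <= s -> 1 <= Zf q m t -> T p q m t s <= e * Bf p q m t + C * (t + Hf p q m s)) ->
  (forall e, 0 < e -> exists2 C, 0 <= C & forall p q m t s, adm p q m ->
    0 < t -> 0 <= s -> Zf q m t <= 1 -> T p q m t s <= e * Bf p q m t + C * (t + Hf p q m s)) ->
  controlled T.
Proof.
move=> h1 h2 e e0; have [C C0 hC] := h1 _ e0; have [C' C'0 hC'] := h2 _ e0.
exists (C + C'); first pos.
move=> p q m t s a t0 s0; have [_ _ _ _ m0] := adm_bounds a.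
have thmin : 0 <= t + Hf p q m s by rewrite addr_ge0 ?(ltW t0)//; exact: Hf_ge0.
have := mulr_ge0 C0 thmin; have := mulr_ge0 C'0 thmin; rewrite mulrDl.
have [z1|/ltW z1] := leP 1 (Zf q m t).
  by have := hC _ _ _ _ _ a t0 s0 z1; lra.
by have := hC' _ _ _ _ _ a t0 s0 z1; lra.
Qed.

(** The term is an exact product of t^ps to the power 1 - 1/p and s^p to the power 1/p, where ps = n
    p / (n - p). *)
Lemma controlled_grad1 : controlled (fun p q m t s => t `^ a1f p * (s / t)).
Proof.
move=> e e0; have [C C0 hC] := young_eps invn_gt0 e0.
exists C => // p q m t s a t0 s0; bounds a.
have -> : t `^ a1f p * (s / t) = (t `^ (n * p / (n - p))) `^ (1 - p^-1) * (s `^ p) `^ p^-1.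
  rewrite powRKV; [|lra|by []]; rewrite -powRrM mulrCA mulrC -{1}[t^-1]powR_inv1 ?(ltW t0)//.
  rewrite -powRD_pos//; congr (_ * _); congr (_ `^ _); rewrite /a1f; field; lra.
apply: le_trans (hC _ _ _ (powR_ge0 _ _) (powR_ge0 _ _) _ _) _.
- by rewrite lef_pV2 ?posrE; lra.
- by rewrite invf_le1; lra.
apply: lerD; rewrite ler_wpM2l//; first pos.
  by rewrite lerDl powR_ge0.
by have [_] := le_tH a t0 s0; apply: le_trans; rewrite lerDl Zf_ge0.
Qed.

(** A common upper bound for the exponents n p / (n - p), n / (n - q), [a1f] and [a2f]. *)
Definition emax : R := n * n / (n - q1) + 2.

Lemma emax_gt1 : 1 < emax.
Proof.
have hn := n2; have h1 := q1n; have : 0 <= n * n / (n - q1) by rewrite divr_ge0 ?mulr_ge0; lra.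
by rewrite /emax; lra.
Qed.
#[local] Hint Resolve emax_gt1 : core.

Lemma ps_le_emax p q m : adm p q m -> n * p / (n - p) <= emax.
Proof.
move=> a; bounds a; have hq := q1n.
have [_ pq qq1 _ _] := a.
via (n * n / (n - q1)); last by rewrite /emax; lra.
apply: ler_pM; [pos|pos|rewrite ler_pM2l; lra|].
by rewrite lef_pV2 ?posrE; lra.
Qed.

Lemma a1f_ge p q m : adm p q m -> p <= a1f p.
Proof.
move=> a; bounds a.
by rewrite /a1f ler_pdivlMr ?ler_pM2l; lra.
Qed.

Lemma a2f_ge p q m : adm p q m -> 1 <= a2f q.
Proof.
move=> a; bounds a.
by rewrite /a2f ler_pdivlMr; lra.
Qed.

Lemma a2f_le p q m : adm p q m -> a2f q <= emax.
Proof.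
move=> a; bounds a; have hq := q1n.
have [_ pq qq1 _ _] := a.
via (n * n / (n - q1)); last by rewrite /emax; lra.
apply: ler_pM; [lra|pos| |rewrite lef_pV2 ?posrE; lra].
by via (n * 1); [lra|rewrite ler_pM2l; lra].
Qed.

Lemma a1f_le p q m : adm p q m -> a1f p <= emax.
Proof.
move=> a; bounds a.
apply: le_trans (ps_le_emax a); rewrite /a1f ler_pdivrMr ?divfK; [|lra|lra].
lra.
Qed.

(* The exponents of the lower order terms stay below the critical ones by the margin mg. *)
Lemma a1f_margin p q m : adm p q m -> a1f p + mg <= n * p / (n - p) - mg.
Proof.
move=> a; bounds a.
have -> : n * p / (n - p) = a1f p + p / (n - p) by rewrite /a1f; field; lra.
have : n^-1 <= p / (n - p).
  rewrite ler_pdivlMr; last pos.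
  by via 1; [rewrite ler_pdivrMl; lra|lra].
by have := mg_le_invn; lra.
Qed.

(** p (1 + 1/n) <= n p / (n - p), so q/p <= 1 + 1/n - gap keeps t^q subcritical for the p-phase,
    uniformly. *)
Lemma q_margin p q m : adm p q m -> q + mg <= n * p / (n - p) - mg.
Proof.
move=> a; bounds a; have [_ _ _ qp _] := a.
have hq : q <= p * (1 + n^-1 - gap) by rewrite mulrC -ler_pdivrMr; lra.
have h : p * (1 + n^-1) <= n * p / (n - p).
  rewrite ler_pdivlMr; last pos.
  have -> : p * (1 + n^-1) * (n - p) = p * n - p * (p - 1) - p * p / n by field; lra.
  have : 0 <= p * p / n by rewrite divr_ge0 ?mulr_ge0; lra.
  have : 0 <= p * (p - 1) by rewrite mulr_ge0; lra.
  lra.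
have : gap <= p * gap by rewrite ler_peMl ?(ltW gap0); lra.
by have := mg_le_gap; lra.
Qed.

(** For t <= 1 the logarithm is absorbed by t^(p0 - 1); for t >= 1 it costs the power t^mg, for
    which there is room below the critical exponent. *)
Lemma controlled_log1 : controlled (fun p q m t s => t `^ a1f p * `|ln t|).
Proof.
move=> e e0; have h0 := p01; have pk : 0 < p0 - 1 by lra.
have [C C0 hC] := powR_interp mg_gt0 emax_gt1 (mulr_gt0 mg_gt0 e0).
have Cp : 0 <= (p0 - 1)^-1 by rewrite invr_ge0 ltW.
have Ck : 0 <= mg^-1 * C by rewrite mulr_ge0// invr_ge0 ltW.
exists ((p0 - 1)^-1 + mg^-1 * C); first pos.
move=> p q m t s a t0 s0; have [h1 h2 h3 h4 h5] := adm_bounds a; have [pp _ _ _ _] := a.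
have [ht _] := le_tH a t0 s0; have B0 := mulr_ge0 (ltW e0) (Bf_ge0 p q m t).
have tt : 0 <= t + Hf p q m s := le_trans (ltW t0) ht.
have := mulr_ge0 Cp tt; have := mulr_ge0 Ck tt; rewrite mulrDl.
have [t1|/ltW t1] := leP t 1.
  have := powR_norm_ln_le pk t0 t1 (x := a1f p) _; rewrite addrC subrK => /(_ _)/le_trans h X Y.
  apply: h; first exact: le_trans (a1f_ge a).
  by have := ler_wpM2l Cp ht; lra.
move=> X Y.
via (mg^-1 * t `^ (a1f p + mg)).
  rewrite powRD_pos// mulrCA ler_wpM2l ?powR_ge0//; exact: norm_ln_ge1.
have ap : 1 <= a1f p + mg by have := a1f_ge a; have := mg_gt0; lra.
have := hC t (a1f p + mg) (n * p / (n - p)) t0 ap (a1f_margin a) (ps_le_emax a).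
have ki : 0 <= mg^-1 by rewrite invr_ge0 ltW.
move=> /(ler_wpM2l ki)/le_trans; apply; rewrite mulrDr [mg^-1 * (mg * e * _)]mulrA [mg^-1 * (mg * e)]mulrA mulVf ?gt_eqF// mul1r [mg^-1 * (C * t)]mulrA.
have : e * t `^ (n * p / (n - p)) <= e * Bf p q m t.
  by rewrite ler_wpM2l ?(ltW e0)// lerDl powR_ge0.
by have := ler_wpM2l Ck ht; lra.
Qed.

Lemma powR_1D_big x z : 0 <= z -> 1 <= z -> 0 <= x -> x <= emax -> (1 + z) `^ x <= 2 `^ emax * z `^ x.
Proof.
move=> z0 z1 x0 xb; via ((2 * z) `^ x); first by apply: powR_le; lra.
by rewrite powRM// ler_wpM2r ?powR_ge0//; apply: ler_powR => //; lra.
Qed.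

Lemma powR_1D_small x z : 0 <= z -> z <= 1 -> 0 <= x -> x <= emax -> (1 + z) `^ x <= 2 `^ emax.
Proof.
move=> z0 z1 x0 xb; via (2 `^ x); first by apply: powR_le; lra.
by apply: ler_powR => //; lra.
Qed.

Definition Kexp : R := 2 `^ emax.
Lemma Kexp_gt0 : 0 < Kexp. Proof. exact: powR_gt0. Qed.
#[local] Hint Resolve Kexp_gt0 : core.

Lemma powR_1D_absorb x z : 1 <= z -> 1 <= x -> x <= emax -> (1 + z) `^ (x - 1) * z <= Kexp * z `^ x.
Proof.
move=> z1 x1 xb; have z0 : 0 <= z by lra.
have h : (1 + z) `^ (x - 1) <= 2 `^ emax * z `^ (x - 1) by apply: powR_1D_big => //; lra.
apply: le_trans (ler_wpM2r z0 h) _.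
by rewrite -mulrA ler_wpM2l// -{2}[z]powRr1// -powRD_pos ?subrK; lra.
Qed.

Lemma a2f_expo p q m : adm p q m -> a2f q * (n - q) / n = 1 - n^-1.
Proof. by move=> a; bounds a; rewrite /a2f; field; lra. Qed.

(* A term bounded by a constant times a lower power of B where Z >= 1, and linearly where Z <= 1. *)
Lemma controlled_sub T K K' : 0 < K -> 0 <= K' ->
  (forall p q m t s, adm p q m -> 0 < t -> 0 <= s -> 1 <= Zf q m t ->
    T p q m t s <= K * Bf p q m t `^ (1 - mg)) ->
  (forall p q m t s, adm p q m -> 0 < t -> 0 <= s -> Zf q m t <= 1 ->
    T p q m t s <= K' * (t + Hf p q m s)) -> controlled T.
Proof.
move=> K_0 K'0 big small; apply: controlled_case => e e0.
  have eK : 0 < e / K by rewrite divr_gt0.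
  have [C C0 hC] := big_absorb eK; exists (K * C); first pos.
  move=> p q m t s a t0 s0 z1; apply: le_trans (big _ _ _ _ _ a t0 s0 z1) _.
  apply: le_trans (ler_wpM2l (ltW K_0) (hC _ _ _ _ _ a t0 z1 (lexx _))) _.
  rewrite mulrDr; apply: lerD; first by rewrite mulrA [K * _]mulrC divfK// gt_eqF.
  by rewrite mulrA ler_wpM2l ?mulr_ge0 ?(ltW K_0); have [] := le_tH a t0 s0.
exists K' => // p q m t s a t0 s0 z1; apply: le_trans (small _ _ _ _ _ a t0 s0 z1) _.
by rewrite lerDr mulr_ge0 ?(ltW e0) ?Bf_ge0.
Qed.

Lemma Bf_powR_le p q m t x : adm p q m -> 0 < t -> 1 <= Zf q m t -> x <= 1 - mg ->
  Bf p q m t `^ x <= Bf p q m t `^ (1 - mg).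
Proof. by move=> a t0 z1; apply: ler_powR; exact: Bf_ge1 (ltW t0) z1. Qed.

Lemma controlled_log2 : controlled (fun p q m t s => (1 + Zf q m t) `^ a2f q * ln (1 + Zf q m t)).
Proof.
have ki : 0 < mg^-1 by rewrite invr_gt0.
apply: (@controlled_sub _ (Kexp * (mg^-1 * 2 `^ mg)) (Kexp * KZ)); rewrite ?mulr_ge0 ?(ltW Kexp_gt0)//.
- pos.
- move=> p q m t s a t0 s0 z1; bounds a.
  have z0 := Zf_ge0 delta1 eta0 q h5 (ltW t0).
  set z := Zf q m t in z1 z0 *.
  via (Kexp * z `^ a2f q * (mg^-1 * (2 `^ mg * z `^ mg))).
    apply: ler_pM; rewrite ?powR_ge0 ?ln_ge0//; first pos.
      by apply: powR_1D_big => //; [have := a2f_ge a; lra|exact: a2f_le a].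
    apply: le_trans (ln_le_powR mg_gt0 _) _; first pos.
    rewrite ler_wpM2l ?(ltW ki)// -powRM//; apply: powR_le; [pos|lra|lra].
  have -> : Kexp * z `^ a2f q * (mg^-1 * (2 `^ mg * z `^ mg)) = Kexp * (mg^-1 * 2 `^ mg) * (z `^ a2f q * z `^ mg).
    by ring.
  rewrite ler_wpM2l//; first pos.
  rewrite -powRD_pos; last pos.
  apply: le_trans (Zf_powR a (ltW t0) _) _; first by have := a2f_ge a; have := mg_gt0; lra.
  apply: (Bf_powR_le a t0 z1); rewrite mulrDl mulrDl (a2f_expo a).
  have : mg * (n - q) / n <= mg.
    by rewrite -mulrA ler_piMr ?(ltW mg_gt0)// ler_pdivrMr; lra.
  by have := mg_le_invn; lra.
move=> p q m t s a t0 s0 z1; have [h1 h2 h3 h4 h5] := adm_bounds a.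
have z0 := Zf_ge0 delta1 eta0 q h5 (ltW t0); have zs := Zf_small a t0 z1.
rewrite -mulrA; apply: ler_pM; rewrite ?powR_ge0 ?ln_ge0//; first pos.
  by apply: powR_1D_small => //; [have := a2f_ge a; lra|exact: a2f_le a].
have : ln (1 + Zf q m t) <= Zf q m t by apply: le_ln1Dx; lra.
by have [ht _] := le_tH a t0 s0; have := ler_wpM2l KZ_ge0 ht; lra.
Qed.

(** Where Z >= 1, t is bounded below and |ln t| is at most a multiple of t^mg. Where Z <= 1, t^q
    with q >= p0 > 1 absorbs the logarithm of small t, and |ln t| <= t for the others. *)
Lemma controlled_log3 :
  controlled (fun p q m t s => (1 + Zf q m t) `^ (a2f q - 1) * (Zf q m t * `|ln t|)).
Proof.
have ki : 0 < mg^-1 by rewrite invr_gt0.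
have pk : 0 < p0 - 1 by have := p01; lra.
have pki : 0 <= (p0 - 1)^-1 by rewrite invr_ge0 ltW.
pose C1 := mg^-1 * (1 + KZ `^ (2 * mg)).
have C10 : 0 < C1 by rewrite mulr_gt0// ltr_pwDl// powR_ge0.
have ML : 0 <= M * Lg 1 by rewrite mulr_ge0// Lg_ge0.
pose C2 := M * Lg 1 * (p0 - 1)^-1 + 1.
have C20 : 0 <= C2 by rewrite addr_ge0// mulr_ge0.
apply: (@controlled_sub _ (Kexp * C1) (Kexp * C2) (mulr_gt0 Kexp_gt0 C10) (mulr_ge0 (ltW Kexp_gt0) C20)).
- move=> p q m t s a t0 s0 z1; bounds a.
  have z0 := Zf_ge0 delta1 eta0 q h5 (ltW t0); have zb := Zf_big a t0 z1.
  have a21 := a2f_ge a; have a2b := a2f_le a; have B1 := Bf_ge1 a (ltW t0) z1.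
  have tl : `|ln t| <= C1 * t `^ mg.
    apply: le_trans (norm_ln_le_powR mg_gt0 t0) _; rewrite /C1 -mulrA ler_wpM2l ?(ltW ki)//.
    rewrite mulrDl mul1r lerD2l.
    have -> : t `^ (- mg) = t `^ (- (2 * mg)) * t `^ mg by rewrite -powRD_pos//; congr (_ `^ _); ring.
    rewrite ler_wpM2r ?powR_ge0// powRN -[leLHS]mul1r ler_pdivrMr ?powR_gt0// -powRM ?(ltW t0)//.
    via (1 `^ (2 * mg)); first by rewrite powR1. by apply: powR_le => //; rewrite mulr_ge0// ltW.
  set z := Zf q m t in z1 z0 *.
  have zz := powR_1D_absorb z1 a21 a2b.
  have zB : z `^ a2f q <= Bf p q m t `^ (1 - n^-1).
    by rewrite -(a2f_expo a); apply: Zf_powR; [exact: a|pos|lra].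
  have tB : t `^ mg <= Bf p q m t `^ mg.
    apply: le_trans (t_powR a (ltW t0) (ltW mg_gt0)) _; apply: ler_powR => //.
    rewrite ler_piMr ?(ltW mg_gt0)//; have : p^-1 <= 1 by rewrite invf_le1; lra.
    by have := invn_gt0; lra.
  rewrite mulrA; via (Kexp * z `^ a2f q * (C1 * t `^ mg)).
    by apply: ler_pM => //; rewrite mulr_ge0 ?powR_ge0.
  rewrite mulrACA; apply: ler_wpM2l; first pos.
  via (Bf p q m t `^ (1 - n^-1) * Bf p q m t `^ mg).
    by apply: ler_pM; rewrite ?powR_ge0.
  rewrite -powRD_pos; last pos.
  by apply: (Bf_powR_le a t0 z1); have := mg_le_invn; lra.
move=> p q m t s a t0 s0 z1; have [h1 h2 h3 h4 h5] := adm_bounds a; have [pp pq _ _ /andP[_ mM]] := a.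
have z0 := Zf_ge0 delta1 eta0 q h5 (ltW t0); have a21 := a2f_ge a; have a2b := a2f_le a.
rewrite -(mulrA Kexp); apply: ler_pM; [pos|pos|by apply: powR_1D_small => //; lra|].
have [ht _] := le_tH a t0 s0; apply: le_trans (ler_wpM2l C20 ht).
rewrite /C2 mulrDl mul1r; have [t1|/ltW t1] := leP t 1.
  via (M * Lg 1 * (t `^ q * `|ln t|)).
    have : m * Lg t <= M * Lg 1 by apply: ler_pM; rewrite ?Lg_ge0 ?Lg_le// ltW.
    have : 0 <= t `^ q * `|ln t| by rewrite mulr_ge0 ?powR_ge0.
    move=> X Y; have := ler_wpM2r X Y; rewrite /Zf; lra.
  have := powR_norm_ln_le pk t0 t1 (x := q) _; rewrite addrC subrK => /(_ (le_trans pp pq)) h.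
  by apply: le_trans (ler_wpM2l ML h) _; rewrite mulrA lerDl ltW.
via (1 * t).
  apply: ler_pM => //; rewrite ger0_norm ?ln_ge0//.
  by have := ln_le_sub1 t0; lra.
by rewrite mul1r lerDr; exact: (mulr_ge0 (mulr_ge0 ML pki) (ltW t0)).
Qed.

(** This term comes from the variation of mu: the weight is gone, and t^q with the logarithm must be
    paid for by the p-phase. Where Z >= 1, the exponents of B add up to (q - 1)/n + q (1/p - 1/n) =
    q/p - 1/n, plus at most mg for the logarithm. This is at most 1 - gap + mg, and here q/p < 1 +
    1/n is decisive. Where Z <= 1, [q_margin] is used. *)
Lemma controlled_mu :
  controlled (fun p q m t s => (1 + Zf q m t) `^ (a2f q - 1) * (Lg t * t `^ q)).
Proof.
have kK : 0 < KZ by exact: lt_le_trans ltr01 KZ_ge1.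
have K0i : 0 < KZ^-1 by rewrite invr_gt0.
have K0i1 : KZ^-1 <= 1 by rewrite invf_le1.
have [CL CL0 hL] := Lg_powR delta1 eta0 mg_gt0 K0i.
have L0 t : 0 <= t -> 0 <= Lg t by exact: Lg_ge0.
have CL1 : 0 < CL + 1 by lra.
apply: controlled_case.
  move=> e e0; have eK : 0 < e / (Kexp * (CL + 1)) by rewrite divr_gt0 ?mulr_gt0.
  have [C C0 hC] := big_absorb eK; exists (Kexp * (CL + 1) * C).
    pos.
  move=> p q m t s a t0 s0 z1; bounds a.
  have [_ _ _ qp _] := a.
  have z0 := Zf_ge0 delta1 eta0 q h5 (ltW t0); have zb := Zf_big a t0 z1.
  have a21 := a2f_ge a; have a2b := a2f_le a; have B1 := Bf_ge1 a (ltW t0) z1.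
  have tK : KZ^-1 <= t by rewrite -[leLHS]mulr1 ler_pdivrMl.
  set B := Bf p q m t in B1 *; set x := 1 - mg.
  have zB : Zf q m t `^ (a2f q - 1) <= B `^ ((q - 1) / n).
    rewrite (_ : (q - 1) / n = (a2f q - 1) * (n - q) / n); last by rewrite /a2f; field; lra.
    by apply: Zf_powR; [exact: a|pos|lra].
  have tB : t `^ (mg + q) <= B `^ ((mg + q) * (p^-1 - n^-1)).
    by apply: t_powR; [exact: a|pos|have := mg_gt0; lra].
  via (Kexp * (CL + 1) * B `^ x).
    via (Kexp * Zf q m t `^ (a2f q - 1) * ((CL + 1) * t `^ (mg + q))).
      apply: ler_pM; try pos; first by apply: powR_1D_big => //; lra.
      rewrite powRD_pos// mulrA ler_wpM2r ?powR_ge0//; apply: le_trans (hL _ tK) _.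
      by rewrite ler_wpM2r ?powR_ge0//; lra.
    rewrite mulrACA; apply: ler_wpM2l; first pos.
    via (B `^ ((q - 1) / n) * B `^ ((mg + q) * (p^-1 - n^-1))).
      by apply: ler_pM; rewrite ?powR_ge0.
    rewrite -powRD_pos; last pos. apply: ler_powR => //; rewrite /x.
    have -> : (q - 1) / n + (mg + q) * (p^-1 - n^-1) = q / p - n^-1 + mg * (p^-1 - n^-1).
      lra.
    have : mg * (p^-1 - n^-1) <= mg.
      rewrite ler_piMr ?(ltW mg_gt0)//; have : p^-1 <= 1 by rewrite invf_le1; lra.
      by have := invn_gt0; lra.
    by have := mg_le_gap; lra.
  have KK : 0 < Kexp * (CL + 1) by rewrite mulr_gt0.
  apply: le_trans (ler_wpM2l (ltW KK) (hC _ _ _ _ x a t0 z1 (lexx _))) _.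
  rewrite mulrDr; apply: lerD; first by rewrite mulrA [Kexp * (CL + 1) * (e / _)]mulrC divfK ?gt_eqF.
  by rewrite mulrA; apply: ler_wpM2l; [pos|have [] := le_tH a t0 s0].
move=> e e0; have eK : 0 < e / (Kexp * (CL + 1)) by rewrite divr_gt0 ?mulr_gt0.
have [C C0 hC] := powR_interp mg_gt0 emax_gt1 eK.
have KK : 0 < Kexp * (CL + 1) by rewrite mulr_gt0.
exists (Kexp * (CL + 1) * C + Kexp * Lg 1).
  pos.
move=> p q m t s a t0 s0 z1; bounds a.
have z0 := Zf_ge0 delta1 eta0 q h5 (ltW t0); have a21 := a2f_ge a; have a2b := a2f_le a.
have [ht _] := le_tH a t0 s0; have tt := le_trans (ltW t0) ht.
have B0 := mulr_ge0 (ltW e0) (Bf_ge0 p q m t).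
have P1 : 0 <= Kexp * (CL + 1) * C * (t + Hf p q m s) by rewrite mulr_ge0// mulr_ge0// ltW.
have P2 : 0 <= Kexp * Lg 1 * (t + Hf p q m s) by rewrite mulr_ge0// mulr_ge0 ?L0// ltW.
via (Kexp * (Lg t * t `^ q)).
  rewrite ler_wpM2r ?mulr_ge0 ?powR_ge0 ?L0 ?(ltW t0)//; apply: powR_1D_small => //; lra.
rewrite mulrDl; have [t1|/ltW t1] := leP t 1.
  via (Kexp * Lg 1 * (t + Hf p q m s)); last pos.
  rewrite -mulrA ler_wpM2l ?(ltW Kexp_gt0)//; apply: ler_pM; try pos.
    by apply: Lg_le => //; exact: ltW.
  apply: le_trans ht; rewrite -[leRHS]powRr1 ?(ltW t0)//; apply: powR_le1 => //; lra.
via (Kexp * (CL + 1) * t `^ (q + mg)).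
  rewrite -mulrA ler_wpM2l ?(ltW Kexp_gt0)// [q + mg]addrC powRD_pos// mulrA ler_wpM2r ?powR_ge0//.
  apply: le_trans (hL _ (le_trans K0i1 t1)) _.
  by rewrite ler_wpM2r ?powR_ge0//; lra.
have qk1 : 1 <= q + mg by have := mg_gt0; lra.
apply: le_trans (ler_wpM2l (ltW KK) (hC _ _ _ t0 qk1 (q_margin a) (ps_le_emax a))) _.
rewrite mulrDr mulrA [Kexp * (CL + 1) * (e / _)]mulrC divfK ?gt_eqF//.
have : e * t `^ (n * p / (n - p)) <= e * Bf p q m t by rewrite ler_wpM2l ?(ltW e0)// lerDl powR_ge0.
have : Kexp * (CL + 1) * (C * t) <= Kexp * (CL + 1) * C * (t + Hf p q m s).
  by rewrite mulrA ler_wpM2l// mulr_ge0// ltW.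
lra.
Qed.

(** For s <= t the quotient s / t is dropped and Z^a2f is subcritical. For s > t, Young's inequality
    with exponent q is applied to Z (s/t)^q, which is at most H(s) because the logarithm is
    increasing. *)
Lemma controlled_grad2 :
  controlled (fun p q m t s => (1 + Zf q m t) `^ (a2f q - 1) * (Zf q m t * (s / t))).
Proof.
pose Low (p q m t s : R) := (1 + Zf q m t) `^ (a2f q - 1) * (Zf q m t * Num.min 1 (s / t)).
have Zq p q m t s : adm p q m -> 0 < t -> t <= s -> Zf q m t * (s / t) `^ q <= Hf p q m s.
  move=> a t0 ts; have [h1 h2 h3 h4 h5] := adm_bounds a.
  via (Zf q m s); last by rewrite lerDr powR_ge0.
  have s0 : 0 < s by exact: lt_le_trans ts.
  rewrite powRM ?(ltW s0) ?invr_ge0 ?(ltW t0)//.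
  have -> : Zf q m t * (s `^ q * t^-1 `^ q) = m * s `^ q * Lg t * (t `^ q * t^-1 `^ q).
    by rewrite /Zf; ring.
  rewrite -powRM ?invr_ge0 ?(ltW t0)// mulfV ?gt_eqF// powR1 mulr1.
  by rewrite ler_wpM2l ?mulr_ge0 ?powR_ge0//; apply: Lg_le => //; exact: ltW.
apply: controlled_case.
  move=> e e0; have eK : 0 < e / Kexp by rewrite divr_gt0.
  have [C C0 hC] := big_absorb eK; have [C' C'0 hC'] := young_eps invn_gt0 eK.
  exists (Kexp * (C + C')); first pos.
  move=> p q m t s a t0 s0 z1; bounds a.
  have z0 := Zf_ge0 delta1 eta0 q h5 (ltW t0); have a21 := a2f_ge a; have a2b := a2f_le a.
  have st0 : 0 <= s / t by rewrite divr_ge0// ltW.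
  have [ht hH] := le_tH a t0 s0; have tt := le_trans (ltW t0) ht.
  set B := Bf p q m t; set z := Zf q m t in z1 z0 *.
  via (Kexp * (e / Kexp * B + (C + C') * (t + Hf p q m s))); last first.
    by rewrite mulrDr mulrA [Kexp * (e / Kexp)]mulrC divfK ?gt_eqF// mulrA.
  via (Kexp * (z `^ a2f q * (s / t))).
    by rewrite mulrA [leRHS]mulrA ler_wpM2r// powR_1D_absorb.
  rewrite ler_wpM2l ?(ltW Kexp_gt0)// mulrDl.
  have X1 := mulr_ge0 C0 tt; have X2 := mulr_ge0 C'0 tt.
  have [st|ts] := leP s t.
    via (B `^ (1 - n^-1)).
      rewrite -[leRHS]mulr1; apply: ler_pM; try pos; last by rewrite ler_pdivrMr// mul1r.
      by rewrite -(a2f_expo a); apply: Zf_powR; [exact: a|pos|lra].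
    have xk : 1 - n^-1 <= 1 - mg by have := mg_le_invn; have := mg_gt0; lra.
    apply: le_trans (hC _ _ _ _ _ a t0 z1 xk) _. by have := ler_wpM2l C0 ht; rewrite -/B; lra.
  have E : z `^ a2f q * (s / t) = (z `^ (n / (n - q))) `^ (1 - q^-1) * (z * (s / t) `^ q) `^ q^-1.
    rewrite powRM ?powR_ge0// powRKV//; last pos.
    rewrite [in RHS]mulrA -powRrM -powRD_pos; last pos.
    by congr (_ `^ _ * _); rewrite /a2f; field; lra.
  rewrite E; apply: le_trans (hC' _ _ _ (powR_ge0 _ _) _ _ _) _.
  - pos.
  - by rewrite lef_pV2 ?posrE; lra.
  - by rewrite invf_le1; lra.
  have : e / Kexp * z `^ (n / (n - q)) <= e / Kexp * B by rewrite ler_wpM2l ?(ltW eK)// lerDr powR_ge0.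
  have := ler_wpM2l C'0 (le_trans (Zq _ _ _ _ _ a t0 (ltW ts)) hH); rewrite -/z; lra.
move=> e e0; exists (Kexp * (KZ + 1)); first pos.
move=> p q m t s a t0 s0 z1; bounds a.
have z0 := Zf_ge0 delta1 eta0 q h5 (ltW t0); have a21 := a2f_ge a; have a2b := a2f_le a.
have st0 : 0 <= s / t by rewrite divr_ge0// ltW.
have [ht hH] := le_tH a t0 s0; have tt := le_trans (ltW t0) ht.
have B0 := mulr_ge0 (ltW e0) (Bf_ge0 p q m t).
via (Kexp * (KZ + 1) * (t + Hf p q m s)); last pos.
rewrite -mulrA; apply: ler_pM; [pos|pos|by apply: powR_1D_small => //; lra|].
have zt := Zf_small a t0 z1; rewrite mulrDl mul1r.
have X1 := ler_wpM2l KZ_ge0 ht; have [st|ts] := leP s t.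
  have : Zf q m t * (s / t) <= Zf q m t by rewrite ler_piMr// ler_pdivrMr// mul1r.
  pos.
have : Zf q m t * (s / t) <= Zf q m t * (s / t) `^ q.
  by rewrite ler_wpM2l//; apply: le1r_powR; [rewrite ler_pdivlMr// mul1r ltW|pos].
have := Zq _ _ _ _ _ a t0 (ltW ts); have := mulr_ge0 KZ_ge0 tt; lra.
Qed.

(** What product and chain rules give for the slope of t^a1f + (1 + Z)^a2f: the terms in s / t come
    from phi, those in [la] from mu and the variable exponents. Adding 1 to Z removes the
    singularity of ln Z at 0. *)
Definition Vslope la p q m t s : R :=
  t `^ a1f p * (a1f p * (s / t) + la * `|ln t|) +
  ((1 + Zf q m t) `^ (a2f q - 1) *
     (a2f q * (la * (Lg t * t `^ q) + Zf q m t * ((q + 1) * (s / t) + la * `|ln t|))) +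
   la * ((1 + Zf q m t) `^ a2f q * ln (1 + Zf q m t))).

Lemma Vslope_controlled la : 0 <= la -> controlled (Vslope la).
Proof.
move=> la0; have hn := n2; have b1 := emax_gt1.
pose K := (emax + 1) * (n + 1 + la); have Kn : 0 < K by rewrite mulr_gt0//; lra.
have big1 : emax <= K by rewrite /K; via ((emax + 1) * 1); [lra|rewrite ler_wpM2l; lra].
have big2 : la <= K by rewrite /K; via (1 * (n + 1 + la)); [lra|rewrite ler_wpM2r; lra].
have big3 x y : 0 <= x -> x <= emax -> 0 <= y -> y <= n + 1 + la -> x * y <= K.
  by move=> x0 xb y0 yn; apply: ler_pM => //; lra.
apply: (controlled_le Kn (controlledD (controlledD controlled_grad1 controlled_log1)
  (controlledD (controlledD controlled_mu (controlledD controlled_grad2 controlled_log3)) controlled_log2))).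
move=> p q m t s a t0 s0; have [h1 h2 h3 h4 h5] := adm_bounds a.
have z0 := Zf_ge0 delta1 eta0 q h5 (ltW t0); have st0 : 0 <= s / t by rewrite divr_ge0// ltW.
have l0 := Lg_ge0 delta1 eta0 (ltW t0).
have a10 := a1f_ge a; have a1b := a1f_le a; have a21 := a2f_ge a; have a2b := a2f_le a.
rewrite !mulrDr /Vslope !mulrDr.
have S (k1 x : R) : 0 <= x -> k1 <= K -> k1 * x <= K * x by move=> x0 kK; rewrite ler_wpM2r.
apply: lerD; [apply: lerD|apply: lerD; [apply: lerD; [|apply: lerD]|]].
- rewrite [leLHS]mulrCA; apply: S; first pos.
  exact: le_trans big1.
- by rewrite [leLHS]mulrCA; apply: S; first pos.
- rewrite (_ : _ * (a2f q * _) = a2f q * la * ((1 + Zf q m t) `^ (a2f q - 1) * (Lg t * t `^ q))); last by ring.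
  by apply: S; [pos|apply: big3; lra].
- rewrite (_ : _ * (a2f q * _) = a2f q * (q + 1) * ((1 + Zf q m t) `^ (a2f q - 1) * (Zf q m t * (s / t)))); last by ring.
  by apply: S; [pos|apply: big3; lra].
- rewrite (_ : _ * (a2f q * _) = a2f q * la * ((1 + Zf q m t) `^ (a2f q - 1) * (Zf q m t * `|ln t|))); last by ring.
  by apply: S; [pos|apply: big3; lra].
- by apply: S; rewrite ?mulr_ge0 ?powR_ge0 ?ln_ge0//; lra.
Qed.

(** A lower bound for 1/p - 1/n and 1/q - 1/n, the reciprocals of the Sobolev exponents, which are
    the weights in the Young inequalities for the growth of f. *)
Definition thmin : R := (n - q1) / (n * n).

Lemma thmin_gt0 : 0 < thmin.
Proof. by have hn := n2; have hq := q1n; rewrite divr_gt0// ?mulr_gt0; lra. Qed.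
#[local] Hint Resolve thmin_gt0 : core.

Lemma thmin_le x : 1 < x -> x <= q1 -> thmin <= x^-1 - n^-1 /\ x^-1 - n^-1 <= 1.
Proof.
move=> x1 xq; have hn := n2; have hq := q1n; split; last first.
  have i0 := invn_gt0; have x1' : x^-1 <= 1 by rewrite invf_le1; lra.
  pos.
have -> : x^-1 - n^-1 = (n - x) / (n * x) by field; lra.
apply: ler_pM; [lra|pos|lra|].
by rewrite lef_pV2 ?posrE ?mulr_gt0 ?ler_pM2l; lra.
Qed.

(** After multiplication by t the pure powers of t are the two terms of B, the constant becomes t,
    and the gradient terms are Young products of H(s) and B(t) with weights 1 - 1/ps and 1/ps, or
    the same with qs. *)
Lemma growth_controlled e : 0 < e -> exists2 C, 0 <= C & forall p q m t s, adm p q m ->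
  0 <= t -> 0 <= s ->
  forall ps qs, ps = n * p / (n - p) -> qs = n * q / (n - q) ->
  (t `^ (ps - 1) + (m * Lg t) `^ (qs / q) * t `^ (qs - 1) + s `^ (p / (ps / (ps - 1)))
   + (m * Lg t) `^ q^-1 * (m * Lg s) `^ (qs / (qs - 1))^-1 * s `^ (q / (qs / (qs - 1))) + 1) * t
  <= e * Hf p q m s + C * (Bf p q m t + t).
Proof.
move=> e0; have [C C0 hC] := young_eps thmin_gt0 e0; exists (C + 2); first pos.
move=> p q m t s a t0 s0 ps qs psE qsE; bounds a.
have [_ pq qq1 _ _] := a.
have [thp thp1] := thmin_le h1 (le_trans pq qq1); have [thq thq1] := thmin_le h3 qq1.
have B0 := Bf_ge0 p q m t; have H0 := Hf_ge0 delta1 eta0 p q h5 s0.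
move: t0; rewrite le_eqVlt => /orP[/eqP t0|t0].
  by rewrite -t0 in B0 *; rewrite mulr0 addr0; apply: addr_ge0; apply: mulr_ge0 => //; lra.
have ps1 : 1 < ps by rewrite psE ltr_pdivlMr; have := mulr_gt0 (_ : 0 < n) (_ : 0 < p - 1); lra.
have qs1 : 1 < qs by rewrite qsE ltr_pdivlMr; have := mulr_gt0 (_ : 0 < n) (_ : 0 < q - 1); lra.
have lt0 := Lg_ge0 delta1 eta0 (ltW t0); have ls0 := Lg_ge0 delta1 eta0 s0.
have mlt : 0 <= m * Lg t by exact: mulr_ge0.
have mls : 0 <= m * Lg s by exact: mulr_ge0.
have zt0 := Zf_ge0 delta1 eta0 q h5 (ltW t0); have zs0 := Zf_ge0 delta1 eta0 q h5 s0.
have tm x : t `^ (x - 1) * t = t `^ x by rewrite -{2}[t]powRr1 ?(ltW t0)// -powRD_pos// subrK.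
have E2 : (m * Lg t) `^ (qs / q) * t `^ (qs - 1) * t = Zf q m t `^ (n / (n - q)).
  rewrite -mulrA tm (_ : qs / q = n / (n - q)); last by rewrite qsE; field; lra.
  rewrite (@powR_conv _ q (n / (n - q)) qs) ?(ltW t0)//; last by rewrite qsE; field; lra.
  by rewrite -powRM ?powR_ge0// /Zf mulrAC.
have q0 : q != 0 by lra.
have bqe : n / (n - q) * (q^-1 - n^-1) = q^-1 by field; lra.
have psi : ps^-1 = p^-1 - n^-1 by rewrite psE; field; lra.
have qsi : qs^-1 = q^-1 - n^-1 by rewrite qsE; field; lra.
have cj x (y : R) : 1 < x -> y / (x / (x - 1)) = y * (1 - x^-1) by move=> x1; field; lra.
have psc : p / (ps / (ps - 1)) = p * (1 - (p^-1 - n^-1)) by rewrite cj// psi.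
have qsc : (qs / (qs - 1))^-1 = 1 - (q^-1 - n^-1) by rewrite -[LHS]mul1r cj// mul1r qsi.
have qsci : q / (qs / (qs - 1)) = q * (1 - (q^-1 - n^-1)) by rewrite cj// qsi.
have E3 : s `^ (p / (ps / (ps - 1))) * t = (s `^ p) `^ (1 - (p^-1 - n^-1)) * (t `^ ps) `^ (p^-1 - n^-1).
  rewrite -!powRrM psc -psi; congr (_ * _).
  by rewrite mulfV ?powRr1//; lra.
have E4 : (m * Lg t) `^ q^-1 * (m * Lg s) `^ (qs / (qs - 1))^-1 * s `^ (q / (qs / (qs - 1))) * t =
    Zf q m s `^ (1 - (q^-1 - n^-1)) * (Zf q m t `^ (n / (n - q))) `^ (q^-1 - n^-1).
  rewrite qsci qsc.
  have -> : (Zf q m t `^ (n / (n - q))) `^ (q^-1 - n^-1) = Zf q m t `^ q^-1.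
    by rewrite -powRrM bqe.
  rewrite [Zf q m s]mulrAC [Zf q m t]mulrAC !powRM ?powR_ge0//.
  have -> : (t `^ q) `^ q^-1 = t by rewrite powRKV ?(ltW t0).
  by rewrite [s `^ (q * _)]powRrM; ring.
have -> : Bf p q m t = t `^ ps + Zf q m t `^ (n / (n - q)) by rewrite psE.
rewrite [leLHS]mulrDl mul1r 3!mulrDl tm E2 E3 E4.
by apply: growth_sum; pos; apply: hC; rewrite ?powR_ge0.
Qed.

End slope_control.

(** * Smooth truncations at a level; extension by zero *)

Section smooth1_closure.
Context {R : realType}.
Implicit Types (F G : R -> R) (a b c k sg t : R) (n : nat).

Lemma is_derive1_continuous F (dF : R -> R) : (forall t, is_derive t 1 F (dF t)) -> continuous F.
Proof. by move=> D t; apply: differentiable_continuous; apply/derivable1_diffP; have [] := D t. Qed.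

Lemma contR_D F G : continuous F -> continuous G -> continuous (fun t => F t + G t).
Proof. by move=> cF cG t; exact: (cvgD (cF t) (cG t)). Qed.

Lemma contR_M F G : continuous F -> continuous G -> continuous (fun t => F t * G t).
Proof. by move=> cF cG t; exact: (cvgM (cF t) (cG t)). Qed.

Lemma is_derive_cst_id (a : R) t : is_derive t 1 (fun _ : R => a) 0 /\ is_derive t 1 (@id R) 1.
Proof. by split; [exact: is_derive_cst|exact: is_derive_id]. Qed.

Lemma Ck1_cst n a : Ck1 n (fun _ : R => a).
Proof.
have c a' : continuous (fun _ : R => a').
  exact: (@is_derive1_continuous _ (fun=> 0) (fun t => (is_derive_cst_id a' t).1)).
elim: n a => [|n ih] a; first exact: c.
by exists (fun=> 0); split=> [t|]; [exact: (is_derive_cst_id a t).1|split].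
Qed.

Lemma Ck1_id n : Ck1 n (@id R).
Proof.
have c : continuous (@id R).
  exact: (@is_derive1_continuous _ (fun=> 1) (fun t => (is_derive_cst_id 0 t).2)).
case: n => [|n]; first exact: c.
by exists (fun=> 1); split=> [t|]; [exact: (is_derive_cst_id 0 t).2|split => //; exact: Ck1_cst].
Qed.

Lemma Ck1D n F G : Ck1 n F -> Ck1 n G -> Ck1 n (fun t => F t + G t).
Proof.
elim: n F G => [|n ih] F G; first exact: contR_D.
move=> [F' [dF [cF CF]]] [G' [dG [cG CG]]]; exists (fun t => F' t + G' t); split=> [t|].
  by have h1 := dF t; have h2 := dG t; apply: is_deriveD.
by split; [exact: contR_D|exact: ih].
Qed.

Lemma Ck1M n F G : Ck1 n F -> Ck1 n G -> Ck1 n (fun t => F t * G t).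
Proof.
elim: n F G => [|n ih] F G; first exact: contR_M.
move=> CF' CG'; have [F' [dF [cF CF]]] := CF'; have [G' [dG [cG CG]]] := CG'.
exists (fun t => F t * G' t + G t * F' t); split=> [t|].
  by have h1 := dF t; have h2 := dG t; exact: (is_derive_val (is_deriveM h1 h2)).
split; first exact: contR_M.
by apply: Ck1D; apply: ih => //; exact: Ck1S.
Qed.

Lemma is_derive_affine F (d a b t : R) : is_derive (a * t + b) 1 F d ->
  is_derive t 1 (fun s => F (a * s + b)) (a * d).
Proof.
move=> dF.
have h : is_derive t 1 (fun s : R => a * s + b) a.
  have h0 := is_deriveD (is_deriveM (is_derive_cst_id a t).1 (is_derive_cst_id 0 t).2) (is_derive_cst_id b t).1.
  by apply: (is_derive_val h0); rewrite /GRing.scale/= mulr1 mulr0 !addr0.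
have h2 := @is_derive1_comp R F (fun s : R => a * s + b) t d a dF h.
exact: (is_derive_val h2 (mulrC d a)).
Qed.

Lemma Ck1_affine n F a b : Ck1 n F -> Ck1 n (fun t => F (a * t + b)).
Proof.
have ca : continuous (fun t : R => a * t + b).
  by apply: (Ck1_cont (n := 0)); apply: Ck1D; [apply: Ck1M; [exact: Ck1_cst|exact: Ck1_id]|exact: Ck1_cst].
have cc G : continuous G -> continuous (fun t => G (a * t + b)).
  by move=> cG t; apply: (@continuous_comp _ _ _ (fun t : R => a * t + b) G); [exact: ca|exact: cG].
elim: n F => [|n ih] F; first exact: cc.
move=> [F' [dF [cF CF]]]; exists (fun t => a * F' (a * t + b)); split=> [t|].
  exact: is_derive_affine (dF _).
by split; [exact: cc|apply: Ck1M; [exact: Ck1_cst|exact: ih]].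
Qed.

Definition trunc c sg k t : R := spos c (sg * t - k).
Definition dtrunc c sg k t : R := sg * dspos c (sg * t - k).

Lemma smooth1_trunc c sg k : 0 < c -> smooth1 (trunc c sg k).
Proof.
move=> c0 n; apply: (Ck1_affine (F := spos c)); apply: Ck1M; first exact: Ck1_id.
exact: smooth1_sexp.
Qed.

Lemma is_derive_trunc c sg k t : 0 < c -> is_derive t 1 (trunc c sg k) (dtrunc c sg k t).
Proof. by move=> c0; apply: is_derive_affine; exact: is_derive_spos. Qed.

Lemma dtrunc_continuous c sg k : 0 < c -> continuous (dtrunc c sg k).
Proof.
move=> c0; apply: (Ck1_cont (n := 0)); apply: Ck1M; first exact: Ck1_cst.
by apply: (Ck1_affine (F := dspos c)) => /=; exact: dspos_continuous.
Qed.

Lemma trunc_continuous c sg k : 0 < c -> continuous (trunc c sg k).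
Proof. by move=> c0; apply: is_derive1_continuous => t; exact: is_derive_trunc. Qed.

Lemma dtrunc_le1 c sg k t : 0 < c -> `|sg| = 1 -> `|dtrunc c sg k t| <= 1.
Proof.
move=> c0 sg1; rewrite normrM sg1 mul1r ger0_norm ?dspos_le1//; exact: dspos_ge0.
Qed.

Lemma trunc_ge0 c sg k t : 0 <= trunc c sg k t. Proof. exact: spos_ge0. Qed.

Lemma trunc_norm_le c sg k t : 0 < c -> `|sg| = 1 -> `|trunc c sg k t| <= `|t| + `|k|.
Proof.
move=> c0 sg1; rewrite ger0_norm ?trunc_ge0//; apply: le_trans (spos_le _ c0) _.
rewrite ge_max addr_ge0//=; have : sg * t <= `|t| by rewrite -[leRHS]mul1r -sg1 -normrM ler_norm.
by have := ler_norm (- k); rewrite normrN; lra.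
Qed.

Lemma trunc0 c sg k : 0 <= k -> trunc c sg k 0 = 0.
Proof. by move=> k0; apply: spos_eq0; rewrite mulr0; lra. Qed.

End smooth1_closure.

Lemma partial_cst {R : realType} {N : nat} (c : R) (i : 'I_N) : partial i (fun _ : 'rV[R]_N => c) = fun=> 0.
Proof. by apply: partialE => x; exact: is_derive_cst. Qed.

Lemma lmf_patch {R : realType} {N : nat} (D : set 'rV[R]_N) (f : 'rV[R]_N -> R) : mset D ->
  lmfun D f -> lmfun setT (fun x => if x \in D then f x else 0).
Proof.
move=> mD mf; exact: (@measurable_restrictT _ _ (lebesgue_space R N) R D f mD).1.
Qed.

Section extension_by_zero.
Context {R : realType} {N : nat}.
Notation mu := (leb R N).
Variables (Omega : set 'rV[R]_N) (mO : mset Omega).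

Definition ext0 (v : 'rV[R]_N -> R) x : R := if x \in Omega then v x else 0.

Lemma ext0_in v x : Omega x -> ext0 v x = v x.
Proof. by move=> Ox; rewrite /ext0 mem_set. Qed.

Lemma ext0_out v x : ~ Omega x -> ext0 v x = 0.
Proof. by move=> Ox; rewrite /ext0 memNset. Qed.

Lemma lmf_ext0 v (D : set 'rV[R]_N) : mset D -> lmfun Omega v ->
  lmfun D (ext0 v).
Proof.
by move=> mD mv; apply: (measurable_funS measurableT (@subsetT _ _)); exact: lmf_patch.
Qed.

Lemma itg_ext0 v (D : set 'rV[R]_N) : mset D -> itg mu Omega v -> itg mu D (ext0 v).
Proof.
move=> mD iv; have mDO : mset (D `&` Omega) by exact: measurableI.
apply: (itg_vanish mD mDO); first by move=> x [].
- by apply: (lmf_ext0 mD); exact: itg_mfun iv.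
- by move=> x Dx nDO; apply: ext0_out => Ox; exact: nDO.
apply: (@itg_eq _ _ _ mu _ v _ mDO); first by move=> x [_ Ox]; rewrite ext0_in.
by apply: (itgS mO mDO _ iv) => x [].
Qed.

End extension_by_zero.

Lemma lmf_min {R : realType} {N : nat} (D : set 'rV[R]_N) (f g : 'rV[R]_N -> R) :
  lmfun D f -> lmfun D g ->
  lmfun D (fun x => Num.min (f x) (g x)).
Proof. by move=> mf mg; exact: (measurable_minr mf mg). Qed.

Lemma lmf_max {R : realType} {N : nat} (D : set 'rV[R]_N) (f g : 'rV[R]_N -> R) :
  lmfun D f -> lmfun D g ->
  lmfun D (fun x => Num.max (f x) (g x)).
Proof. by move=> mf mg; exact: (measurable_maxr mf mg). Qed.

(** * Cut-off functions on cubes *)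

Section cutoff.
Context {R : realType} {N : nat}.
Implicit Types (x y c : 'rV[R]_N) (r rho : R).

(** Cubes by centre and half side, for families of concentric cubes. *)
Definition qc c r : set 'rV[R]_N := cube (c - const_mx r) (2 * r).

Lemma qcP c r x : qc c r x <-> forall i, c 0 i - r <= x 0 i < c 0 i + r.
Proof.
have E (i : 'I_N) : c 0 i - r + 2 * r = c 0 i + r by ring.
by split=> h i; have := h i; rewrite !mxE ?E.
Qed.

Lemma qc_sub c r rho : rho <= r -> qc c rho `<=` qc c r.
Proof. by move=> le x /qcP h; apply/qcP => i; have /andP[? ?] := h i; lra. Qed.

Lemma qc_mset c r : mset (qc c r). Proof. exact: cube_mset. Qed.

Lemma partial_prod (I : Type) (s : seq I) (F : I -> 'rV[R]_N -> R) j x :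
  (forall i, smooth (F i)) -> (forall i y, 0 <= F i y <= 1) ->
  `|partial j (fun y => \prod_(i <- s) F i y) x| <= \sum_(i <- s) `|partial j (F i) x|.
Proof.
move=> sF F01; elim: s => [|i s ih].
  rewrite (_ : (fun y => _) = fun=> 1); last by apply/funext => y; rewrite big_nil.
  by rewrite partial_cst normr0 big_nil.
rewrite (_ : (fun y => _) = fun y => F i y * \prod_(i <- s) F i y); last first.
  by apply/funext => y; rewrite big_cons.
rewrite (partialM _ (sF i) (smooth_prod s sF)) big_cons addrC.
apply: le_trans (ler_normD _ _) _; rewrite !normrM; apply: lerD.
  rewrite ler_piMl// ger0_norm ?prodr_ge0// => [|k _]; last by case/andP: (F01 k x).
  by apply: Num.Theory.prodr_ile1 => k _; exact: F01.
have /andP[F0 F1] := F01 i x; apply: le_trans ih; rewrite ler_piMl//.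
by rewrite ger0_norm.
Qed.

Lemma is_derive_expn m (t : R) : is_derive t 1 (fun s : R => s ^+ m.+1) (m.+1%:R * t ^+ m).
Proof.
elim: m t => [|m ih] t.
  by rewrite (_ : (fun s : R => s ^+ 1) = id)// expr0 mulr1; exact: is_derive_id.
rewrite (_ : (fun s : R => s ^+ m.+2) = (fun s => s * s ^+ m.+1)); last by apply/funext => s; rewrite exprS.
apply: (is_derive_val (is_deriveM (is_derive_id t 1) (ih t))).
have e (a b : R) : a *: b = a * b by [].
by rewrite !e mulr1 mulrCA -exprS -[X in _ + X]mul1r -mulrDl natr1.
Qed.

(** One factor exp(-1) for each of the 2 N faces. On the inner cube the cut-off is bounded below by
    this constant instead of being equal to 1. *)
Definition cutoff_cst : R := expR (- 1) ^+ #|{: 'I_N * bool}|.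

Lemma cutoff_cst_gt0 : 0 < cutoff_cst. Proof. by rewrite exprn_gt0// expR_gt0. Qed.

(** A product over the faces of exp(-1/a), with a the distance to the face divided by r - rho, so
    that a >= 1 on the inner cube. *)
Lemma cutoff c r rho : rho < r -> exists z : 'rV[R]_N -> R, [/\ smooth z,
  forall x, 0 <= z x <= 1, forall x, norm1 (grad z x) <= 4 * N%:R ^+ 2 / (r - rho),
  forall x, z x != 0 -> qc c r x /\ box (c - const_mx r) (c + const_mx r) x &
  forall x, qc c rho x -> cutoff_cst <= z x].
Proof.
move=> rr; pose th := (r - rho)^-1; have th0 : 0 < th by rewrite invr_gt0 subr_gt0.
pose a (b : bool) : R := if b then th else - th.
pose arg (ib : 'I_N * bool) x : R := a ib.2 * x 0 ib.1 + (th * r - a ib.2 * c 0 ib.1).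
pose F ib x : R := sexp 1 (arg ib x).
have sarg ib : smooth (arg ib) by apply: smooth_affine; exact: smooth_coord.
have sF ib : smooth (F ib) by apply: (smooth_comp (sarg ib)); exact: smooth1_sexp.
have F01 ib y : 0 <= F ib y <= 1 by rewrite sexp_ge0 sexp_le1.
have na b : `|a b| = th by rewrite /a; case: b; rewrite ?normrN ger0_norm// ltW.
have dF j ib x : `|partial j (F ib) x| <= 2 * th.
  rewrite (_ : F ib = sexp 1 \o arg ib)//.
  rewrite (partial_comp _ (sarg ib) (fun t => is_derive_sexp t ltr01)) normrM.
  apply: ler_pM => //.
    by rewrite ger0_norm ?dsexp_ge0; have := dsexp_le (arg ib x) (@ltr01 R); rewrite divr1.
  have -> : partial j (arg ib) = fun=> a ib.2 * (ib.1 == j)%:R.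
    apply: partialE => y; apply: (is_derive_val (is_deriveD (is_deriveZ (a ib.2) (is_derive_coord j ib.1 y)) (is_derive_cst _ _ _))).
    by rewrite addr0.
  by rewrite normrM na ler_piMr ?(ltW th0)//; case: eqP => _; rewrite ?normr1 ?normr0.
pose z x := \prod_(ib : 'I_N * bool) F ib x.
have rho0 : 0 < r - rho by rewrite subr_gt0.
have thr : th * (r - rho) = 1 by rewrite mulVf// gt_eqF.
exists z; split.
- exact: smooth_prod.
- move=> x; apply/andP; split; first by apply: prodr_ge0 => ib _; exact: sexp_ge0.
  by apply: Num.Theory.prodr_ile1 => ib _; exact: F01.
- move=> x; have -> : 4 * N%:R ^+ 2 / (r - rho) = \sum_(i < N) (2 * th * (2 * N%:R)).
    by rewrite sumr_const card_ord -mulr_natl -/th; ring.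
  apply: ler_sum => i _; rewrite mxE; apply: le_trans (partial_prod _ _ _ sF F01) _.
  apply: le_trans (ler_sum _ (fun ib _ => dF i ib x)) _.
  by rewrite sumr_const card_prod card_ord card_bool -[leLHS]mulr_natr natrM [N%:R * 2]mulrC.
- move=> x zx; have pos ib : 0 < arg ib x.
    apply: (@sexp_neq0 _ 1); move: zx; rewrite /z prodf_seq_neq0 => /allP/(_ ib).
    by rewrite mem_index_enum => /(_ isT).
  have b1 i : th * (x 0 i - c 0 i + r) > 0 by have := pos (i, true); rewrite /arg/=; lra.
  have b2 i : th * (c 0 i + r - x 0 i) > 0 by have := pos (i, false); rewrite /arg/=; lra.
  have {}b1 i : 0 < x 0 i - c 0 i + r by have := b1 i; rewrite pmulr_rgt0.
  have {}b2 i : 0 < c 0 i + r - x 0 i by have := b2 i; rewrite pmulr_rgt0.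
  split; first by apply/qcP => i; have := b1 i; have := b2 i => *; lra.
  by move=> i; rewrite !mxE; have := b1 i; have := b2 i => *; lra.
- move=> x /qcP hx; rewrite /cutoff_cst /z -prodr_const; apply: ler_prod => ib _.
  rewrite expR_ge0/=; have arg1 : 1 <= arg ib x.
    have /andP[h1 h2] := hx ib.1; rewrite -thr.
    have := mulr_ge0 (ltW th0) (_ : 0 <= x 0 ib.1 - c 0 ib.1 + rho).
    have := mulr_ge0 (ltW th0) (_ : 0 <= c 0 ib.1 + rho - x 0 ib.1).
    rewrite /arg /a; case: ib.2 => f1 f2; [move: (f2 ltac:(lra))|move: (f1 ltac:(lra))]; lra.
  have a0 : 0 < arg ib x by exact: lt_le_trans ltr01 arg1.
  rewrite /F /sexp a0 ler_expR lerN2 ler_pdivrMr// mul1r//.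
Qed.

End cutoff.

Section half_powers.
Context {R : realType}.

Lemma half_gt0 j : 0 < (2^-1 : R) ^+ j. Proof. pos. Qed.

Lemma half_le i j : (i <= j)%N -> (2^-1 : R) ^+ j <= 2^-1 ^+ i.
Proof. by move=> ij; apply: ler_wiXn2l => //; rewrite invf_le1// ler1n. Qed.

Lemma half_le1 j : (2^-1 : R) ^+ j <= 1. Proof. exact: (@half_le 0 j isT). Qed.

Lemma ler_pM4 (a r1 r2 z1 z2 I1 I2 : R) : 0 <= a -> 0 <= r1 -> r1 <= r2 -> 0 <= z1 -> z1 <= z2 ->
  0 <= I1 -> I1 <= I2 -> a * (2 * r1) * z1 * (2 * I1) <= a * (2 * r2) * z2 * (2 * I2).
Proof.
move=> a0 r10 r12 z10 z12 I10 I12; have two : (0 : R) <= 2 by [].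
apply: (ler_pM (mulr_ge0 (mulr_ge0 a0 (mulr_ge0 two r10)) z10) (mulr_ge0 two I10)).
  apply: (ler_pM (mulr_ge0 a0 (mulr_ge0 two r10)) z10 _ z12).
  exact: (ler_wpM2l a0 (ler_wpM2l two r12)).
exact: (ler_wpM2l two I12).
Qed.

Lemma half_bound (a n t : R) : 0 < n -> 2 * a / n <= t -> a <= t * (n / 2).
Proof. by move=> n0; rewrite ler_pdivrMr//; lra. Qed.

End half_powers.

(** * The variable exponent setting: measurability, growth, and the slope of V *)

Section double_phase_setting.
Context {R : realType} {N : nat}.
Notation mu := (leb R N).
Local Notation vec := 'rV[R]_N.
Implicit Types (x y xi : vec) (s t e l k d r rho om sg : R) (phi : vec -> R).

(* [La] is a Lipschitz constant for the maximum norm, and [gap] measures how strictly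
   q/p < 1 + 1/N holds. *)
Record double_phase (Omega : set vec) (p q w : vec -> R) (delta eta : R)
    (c0 : vec) (r0 P0 Q1 gap M La : R) : Prop := DoublePhase {
  dp_N : (1 < N)%N;
  dp_vol : forall r : R, 0 < r -> 0 < @vol R N r;
  dp_open : open Omega;
  dp_cube : Omega `<=` cube c0 r0;
  dp_r0 : 0 < r0;
  dp_P0 : 1 < P0;
  dp_Q1 : Q1 < N%:R;
  dp_gap : 0 < gap;
  dp_M : 0 <= M;
  dp_La : 0 <= La;
  dp_delta : 1 <= delta;
  dp_eta : 0 <= eta;
  dp_adm : forall x, Omega x -> adm N%:R P0 Q1 gap M (p x) (q x) (w x);
  dp_p : forall x y, Omega x -> Omega y -> `|p y - p x| <= La * `|y - x|;
  dp_q : forall x y, Omega x -> Omega y -> `|q y - q x| <= La * `|y - x|;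
  dp_w : forall x y, Omega x -> Omega y -> `|w y - w x| <= La * `|y - x| }.

Lemma lmf_powR (D : set vec) (u e : vec -> R) : mset D -> lmfun D u ->
  lmfun D e -> (forall x, D x -> 0 <= u x) -> (forall x, D x -> e x != 0) ->
  lmfun D (fun x => u x `^ e x).
Proof.
move=> mD mu_ me u0 e0.
apply: (lmf_cvg (f_ := fun n x => expR (e x * ln (u x)) * sexp n.+1%:R^-1 (u x))) => [n|x Dx].
  apply: (lmfM mD); last by apply: lmf_comp mu_ _; apply: sexp_continuous; rewrite invr_gt0.
  apply: (measurableT_comp (f := @expR R)); first exact: measurable_expR.
  by apply: (lmfM mD) => //; apply: (measurableT_comp (f := @ln R)); first exact: measurable_ln.
have -> : u x `^ e x = expR (e x * ln (u x)) * (if 0 < u x then 1 else 0).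
  have := u0 x Dx; rewrite le_eqVlt => /orP[/eqP <-|ux].
    by rewrite ltxx mulr0 powR0// e0.
  by rewrite ux mulr1 /powR gt_eqF.
by apply: cvgMr; exact: sexp_cvg.
Qed.

Lemma lmf_ln (D : set vec) (u : vec -> R) : lmfun D u ->
  lmfun D (fun x => ln (u x)).
Proof. by move=> mu_; apply: (measurableT_comp (f := @ln R)) => //; exact: measurable_ln. Qed.

Lemma lipschitz_lmf (D : set vec) (u : vec -> R) (L : R) : open D ->
  (forall x y, D x -> D y -> `|u y - u x| <= L * `|y - x|) -> lmfun D u.
Proof.
move=> oD uL; apply: open_continuous_mfun => // x Dx.
apply: (@slope_continuous _ _ u x L); apply: slope_lip.
by apply: filterS (open_nbhs_nbhs (conj oD Dx)) => y Dy; exact: uL.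
Qed.

Variables (Omega : set vec) (p q w : vec -> R) (delta eta : R) (c0 : vec)
  (r0 P0 Q1 gap M La : R).
Hypothesis S : double_phase Omega p q w delta eta c0 r0 P0 Q1 gap M La.

Local Notation H := (Hlog p q w delta eta).
Local Notation n := (N%:R : R).
Local Notation ns := (n / (n - 1)).

Let oO := dp_open S.
Let OQ := dp_cube S.
Let vol_gt0 := dp_vol S.
Let delta1 := dp_delta S.
Let eta0 := dp_eta S.
Let P01 := dp_P0 S.
Let Q1n := dp_Q1 S.
Let N_gt1 := dp_N S.
Local Notation vol := (@vol R N).
Let mO : mset Omega := Omega_mset oO.
Let Ooo : (mu Omega < +oo)%E := Omega_fin OQ.

Lemma dp_n2 : 2 <= n.
Proof. by rewrite ler_nat; exact: N_gt1. Qed.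

Let n2 : 2 <= n := dp_n2.

Lemma HlogE x t : H x t = Hf delta eta (p x) (q x) (w x) t. Proof. by []. Qed.

Lemma dp_bounds x : Omega x -> [/\ 1 < p x, p x < n, 1 < q x, q x < n & 0 <= w x].
Proof. by move=> /(dp_adm S); apply: adm_bounds; [exact: P01|exact: Q1n]. Qed.

Lemma lmf_p : lmfun Omega p. Proof. exact: lipschitz_lmf oO (dp_p S). Qed.
Lemma lmf_q : lmfun Omega q. Proof. exact: lipschitz_lmf oO (dp_q S). Qed.
Lemma lmf_w : lmfun Omega w. Proof. exact: lipschitz_lmf oO (dp_w S). Qed.

Lemma lmf_Zf (v : vec -> R) : lmfun Omega v -> (forall x, Omega x -> 0 <= v x) ->
  lmfun Omega (fun x => Zf delta eta (q x) (w x) (v x)).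
Proof.
move=> mv v0; apply: (lmfM mO); first apply: (lmfM mO lmf_w).
  by apply: lmf_powR => // [|x /dp_bounds[_ _ ? _ _]]; [exact: lmf_q|pos].
by apply: lmf_ln; apply: (lmfD mO); [exact: lmf_cst|exact: lmfZ].
Qed.

(** Both exponents are below N and the logarithm costs one more power, hence the dilation exponent
    [N.+1]. *)
Lemma Hlog_modular : modular Omega H N.+1 (1 + M * Lg delta eta 1).
Proof.
have d1 := delta1; have e0 := eta0.
split.
- move=> v mv v0; apply: (lmfD mO); last exact: lmf_Zf.
  by apply: lmf_powR => // [|x /dp_bounds[? _ _ _ _]]; [exact: lmf_p|pos].
- by move=> x t /dp_bounds[_ _ _ _ w0] t0; exact: Hf_ge0.
- by move=> x s t /dp_bounds[? _ ? _ ?] s0 st; apply: Hf_le => //; lra.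
- by move=> x l t /dp_bounds[? _ ? _ ?] l0 l1 t0; apply: Hf_shrink => //; lra.
- by move=> x l t /dp_bounds[? ? ? ? ?] l1 t0; apply: Hf_dil => //; exact: ltW.
- by move=> x t /dp_bounds[? _ ? _ ?] t0; apply: Hf_low => //; exact: ltW.
- move=> x /(dp_adm S)[_ _ _ _ /andP[_ wM]].
  rewrite HlogE /Hf /Zf !powR1 mulr1 lerD2l ler_wpM2r//.
  exact: Lg_ge0.
Qed.

Let Hm := Hlog_modular.

Definition Bx x t : R := Bf n delta eta (p x) (q x) (w x) t.

Let gapQ := n - Q1.
Let gapQ0 : 0 < gapQ. Proof. by rewrite subr_gt0; exact: Q1n. Qed.

Lemma inv_lip (a b : R) : gapQ <= a -> gapQ <= b -> `|b^-1 - a^-1| <= (gapQ ^+ 2)^-1 * `|b - a|.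
Proof.
move=> da db; have dp := gapQ0; have a0 : 0 < a by lra. have b0 : 0 < b by lra.
have -> : b^-1 - a^-1 = (a * b)^-1 * (a - b) by field; lra.
rewrite normrM distrC ler_wpM2r// ger0_norm ?invr_ge0 ?mulr_ge0 ?(ltW a0) ?(ltW b0)//.
by rewrite lef_pV2 ?posrE ?mulr_gt0// expr2; apply: ler_pM => //; exact: ltW.
Qed.

Let pd x : Omega x -> gapQ <= n - p x.
Proof. by move=> /(dp_adm S)[_ h1 h2 _ _]; rewrite lerD2l lerN2; exact: le_trans h1 h2. Qed.

Let qd x : Omega x -> gapQ <= n - q x.
Proof. by move=> /(dp_adm S)[_ _ h2 _ _]; rewrite lerD2l lerN2. Qed.

Definition Le : R := n * n * (gapQ ^+ 2)^-1 * La.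

Lemma Le_ge0 : 0 <= Le.
Proof. by rewrite !mulr_ge0 ?invr_ge0 ?exprn_ge0 ?(ltW gapQ0) ?(dp_La S)//; have := dp_n2. Qed.

Lemma invp_lip x y : Omega x -> Omega y ->
  `|(n - p y)^-1 - (n - p x)^-1| <= (gapQ ^+ 2)^-1 * La * `|y - x|.
Proof.
move=> Ox Oy; apply: le_trans (inv_lip (pd Ox) (pd Oy)) _.
rewrite -mulrA ler_wpM2l ?invr_ge0 ?exprn_ge0 ?(ltW gapQ0)//.
by rewrite (_ : n - p y - (n - p x) = - (p y - p x)) ?normrN ?(dp_p S)//; ring.
Qed.

Lemma invq_lip x y : Omega x -> Omega y ->
  `|(n - q y)^-1 - (n - q x)^-1| <= (gapQ ^+ 2)^-1 * La * `|y - x|.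
Proof.
move=> Ox Oy; apply: le_trans (inv_lip (qd Ox) (qd Oy)) _.
rewrite -mulrA ler_wpM2l ?invr_ge0 ?exprn_ge0 ?(ltW gapQ0)//.
by rewrite (_ : n - q y - (n - q x) = - (q y - q x)) ?normrN ?(dp_q S)//; ring.
Qed.

Lemma lmf_Bx (v : vec -> R) : lmfun Omega v -> (forall x, Omega x -> 0 <= v x) ->
  lmfun Omega (fun x => Bx x (v x)).
Proof.
move=> mv v0; apply: (lmfD mO).
  apply: (lmf_powR mO mv) => [|//|x /dp_bounds[? ? _ _ _]].
    apply: (lmfM mO); first exact: (lmfZ _ mO lmf_p). exact: lipschitz_lmf oO invp_lip.
  by rewrite mulf_neq0 ?mulf_neq0 ?invr_eq0//; lra.
apply: (lmf_powR mO (lmf_Zf mv v0)) => [|x Ox|x /dp_bounds[_ _ ? ? _]].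
- by apply: (lmfZ _ mO); exact: lipschitz_lmf oO invq_lip.
- by have [_ _ _ _ w0] := dp_bounds Ox; apply: Zf_ge0; rewrite ?delta1 ?eta0 ?v0.
- by rewrite mulf_neq0 ?invr_eq0//; lra.
Qed.

Lemma a1f_lip x y : Omega x -> Omega y -> `|a1f n (p y) - a1f n (p x)| <= Le * `|y - x|.
Proof.
move=> Ox Oy; have [? ? _ _ _] := dp_bounds Ox; have [? ? _ _ _] := dp_bounds Oy.
have -> : a1f n (p y) - a1f n (p x) = (n - 1) * n * ((n - p y)^-1 - (n - p x)^-1).
  by rewrite /a1f; field; lra.
rewrite normrM ger0_norm; last by rewrite mulr_ge0; lra.
apply: le_trans (ler_wpM2l _ (invp_lip Ox Oy)) _; first by rewrite mulr_ge0; lra.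
rewrite /Le !mulrA; apply: ler_wpM2r => //; apply: ler_wpM2r; first exact: dp_La S.
by apply: ler_wpM2r; [pos|pos].
Qed.

Lemma a2f_lip x y : Omega x -> Omega y -> `|a2f n (q y) - a2f n (q x)| <= Le * `|y - x|.
Proof.
move=> Ox Oy; have [_ _ ? ? _] := dp_bounds Ox; have [_ _ ? ? _] := dp_bounds Oy.
have -> : a2f n (q y) - a2f n (q x) = (n - 1) * ((n - q y)^-1 - (n - q x)^-1).
  by rewrite /a2f; field; lra.
rewrite normrM ger0_norm; last pos.
apply: le_trans (ler_wpM2l _ (invq_lip Ox Oy)) _; first pos.
rewrite /Le !mulrA; apply: ler_wpM2r => //; apply: ler_wpM2r; first exact: dp_La S.
apply: ler_wpM2r; first pos.
by via (n * 1); [lra|rewrite ler_wpM2l; lra].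
Qed.

(* V^{N/(N-1)} dominates B up to a factor, and the slope of V(x, phi x) is controlled by
   B(x, phi x) and phi + H(x, |grad phi|). *)
Definition Vf x t : R :=
  if 0 < t then t `^ a1f n (p x) + ((1 + Zf delta eta (q x) (w x) t) `^ a2f n (q x) - 1) else 0.

Let nearO x (u : vec -> R) (L : R) : Omega x ->
  (forall x y, Omega x -> Omega y -> `|u y - u x| <= L * `|y - x|) -> slope u x L.
Proof.
move=> Ox uL; apply: slope_lip.
by apply: filterS (open_nbhs_nbhs (conj oO Ox)) => y Oy; exact: uL.
Qed.

Lemma slope_powR (u e : vec -> R) x (g k : R) : 0 <= g -> 0 <= k -> 0 < u x -> 0 <= e x ->
  slope u x g -> slope e x k ->
  slope (fun y => u y `^ e y) x (u x `^ e x * (e x * (g / u x) + k * `|ln (u x)|)).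
Proof.
move=> g0 k0 ux0 ex0 ug ek.
have n0 : \forall y \near x, 0 < u y by exact: (cvgr_gt _ (slope_continuous ug) _ ux0).
have sl : slope (@ln R \o u) x (`|(u x)^-1| * g).
  by apply: slope_comp_derive => //; exact: is_derive1_ln.
have := slopeM k0 (mulr_ge0 (normr_ge0 _) g0) ek sl.
move/(slope_comp_derive (F := @expR R) (d := expR (e x * ln (u x)))) => /(_ _ _)/slope_near h.
have E : expR (e x * ln (u x)) = u x `^ e x by rewrite /powR gt_eqF.
have h1 : slope (fun y => u y `^ e y) x
    (`|expR (e x * ln (u x))| * (`|e x| * (`|(u x)^-1| * g) + `|ln (u x)| * k)).
  apply: h; last pos.
  by apply: filterS n0 => y uy; rewrite /= /powR gt_eqF.
apply: slope_le h1.
rewrite /= ger0_norm// E ler_wpM2l ?powR_ge0//.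
by rewrite ger0_norm// ger0_norm ?invr_ge0 ?(ltW ux0)// [`|ln _| * k]mulrC [_^-1 * g]mulrC.
Qed.

Lemma slope_Vf x phi s : Omega x -> 0 < phi x -> 0 <= s -> slope phi x s ->
  slope (fun y => Vf y (phi y)) x (Vslope n delta eta (La + Le) (p x) (q x) (w x) (phi x) s).
Proof.
move=> Ox t0 s0 sp; have [p1 pn q1 qn w0] := dp_bounds Ox.
have a := dp_adm S Ox; have L0 := dp_La S; have Le0 := Le_ge0; have d1 := delta1; have e0 := eta0.
set t := phi x in t0 *.
have lg0 := Lg_ge0 d1 e0 (ltW t0).
have a1p := a1f_ge n2 P01 Q1n a; have a2p := a2f_ge n2 P01 Q1n a.
have n0 : \forall y \near x, 0 < phi y by exact: (cvgr_gt _ (slope_continuous sp) _ t0).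
pose Z y := Zf delta eta (q y) (w y) (phi y).
have z0 : 0 <= Z x by apply: Zf_ge0 => //; exact: ltW.
have arg0 : 0 < delta + eta * t by have := mulr_ge0 e0 (ltW t0); lra.
have sL : slope (fun y => Lg delta eta (phi y)) x (eta / (delta + eta * t) * s).
  have h := slope_comp_derive (F := @ln R) (d := (delta + eta * t)^-1)
    (_ : 0 <= 0 + (`|eta| * s + `|phi x| * 0)) (slopeD (slope_cst delta x) (slopeM (lexx 0) s0 (slope_cst eta x) sp)).
  apply: slope_le (h _ _); last 2 first.
  - pos.
  - by have := is_derive1_ln arg0; rewrite /=.
  by rewrite add0r mulr0 addr0 ger0_norm ?invr_ge0 ?(ltW arg0)// ger0_norm// mulrA [_^-1 * eta]mulrC.
have sq : slope (fun y => phi y `^ q y) x (t `^ q x * (q x * (s / t) + La * `|ln t|)).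
  by apply: slope_powR => //; [lra|exact: nearO (dp_q S)].
have k1 : 0 <= t `^ q x * (q x * (s / t) + La * `|ln t|).
  pos.
have k2 : 0 <= eta / (delta + eta * t) * s by rewrite mulr_ge0// divr_ge0// ltW.
have sZ0 := slopeM (addr_ge0 (mulr_ge0 (normr_ge0 _) k1) (mulr_ge0 (normr_ge0 _) L0)) k2
  (slopeM L0 k1 (nearO Ox (dp_w S)) sq) sL.
pose gZ := (La + Le) * (Lg delta eta t * t `^ q x) + Z x * ((q x + 1) * (s / t) + (La + Le) * `|ln t|).
have gZ0 : 0 <= gZ.
  rewrite addr_ge0 ?mulr_ge0 ?powR_ge0//; first pos.
  pos.
have sZ : slope Z x gZ.
  apply: slope_le sZ0.
  (* The derivative of the logarithm is at most the logarithm divided by t; this turns the factor q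
     into the q + 1 of [gZ]. *)
  have T : eta / (delta + eta * t) * s <= Lg delta eta t * (s / t).
    have := ler_wpM2r (_ : 0 <= s / t) (Lg_tangent d1 e0 (ltW t0)); rewrite divr_ge0 ?(ltW t0)// => /(_ isT).
    by apply: le_trans; apply: eq_ler; field; lra.
  rewrite -/t [`|w x * _|]ger0_norm ?mulr_ge0 ?powR_ge0// [`|Lg _ _ _|]ger0_norm// [`|w x|]ger0_norm//.
  rewrite [`|t `^ _|]ger0_norm ?powR_ge0//.
  have T2 := ler_wpM2l (mulr_ge0 w0 (powR_ge0 t (q x))) T.
  have X1 : 0 <= Le * (Lg delta eta t * t `^ q x) by exact: (mulr_ge0 Le0 (mulr_ge0 lg0 (powR_ge0 _ _))).
  have X2 : 0 <= Z x * (Le * `|ln t|) by exact: (mulr_ge0 z0 (mulr_ge0 Le0 (normr_ge0 _))).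
  have -> : gZ = Le * (Lg delta eta t * t `^ q x) + Z x * (Le * `|ln t|) +
      (w x * t `^ q x * (Lg delta eta t * (s / t)) +
       Lg delta eta t * (w x * (t `^ q x * (q x * (s / t) + La * `|ln t|)) + t `^ q x * La)).
    by rewrite /gZ /Z /Zf -/t; ring.
  pos.
have z1 : 0 < 1 + Z x by lra.
have s1 : slope (fun y => 1 + Z y) x gZ.
  by apply: slope_le (slopeD (slope_cst 1 x) sZ); rewrite add0r.
have sV2 := slope_powR gZ0 Le0 z1 (le_trans ler01 a2p) s1 (nearO Ox a2f_lip).
have sV1 := slope_powR s0 Le0 t0 (le_trans ler01 (le_trans (ltW p1) a1p)) sp (nearO Ox a1f_lip).
have := slopeD sV1 (slopeD sV2 (slope_cst (-1) x)).
move/(slope_near (w := fun y => Vf y (phi y))) => h.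
apply: slope_le (h _); last first.
  by apply: filterS n0 => y py; rewrite /Vf py.
rewrite addr0 -/t /Vslope; apply: lerD.
  rewrite ler_wpM2l ?powR_ge0// lerD2l ler_wpM2r//; lra.
rewrite mulrDr [`|ln (1 + _)|]ger0_norm; last by rewrite ln_ge0//; lra.
apply: lerD.
  rewrite -[Zf delta eta (q x) (w x) t]/(Z x) -/gZ.
  have E : (1 + Z x) `^ a2f n (q x) = (1 + Z x) `^ (a2f n (q x) - 1) * (1 + Z x).
    by rewrite -{3}[1 + Z x]powRr1 ?(ltW z1)// -powRD_pos// subrK.
  rewrite {1}E le_eqVlt; apply/orP; left; apply/eqP; field; lra.
rewrite mulrCA; apply: ler_wpM2r; last pos.
by rewrite mulr_ge0 ?powR_ge0// ln_ge0//; lra.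
Qed.

Lemma ns_ge1 : 1 <= ns.
Proof. by have h := n2; rewrite ler_pdivlMr; lra. Qed.
Let ns_gt0 : 0 < ns. Proof. exact: lt_le_trans ltr01 ns_ge1. Qed.

(** A dilation exponent of B: that of Z times a bound for n / (n - q). Locked to keep it from being
    unfolded. *)
Definition mB : nat := locked (N.+1 * (Num.truncn (emax n Q1)).+1)%N.

Lemma bq_bounds x : Omega x -> 1 <= n / (n - q x) /\ n / (n - q x) <= emax n Q1.
Proof.
move=> Ox; have h2 := n2; have [_ _ h3 h4 _] := dp_bounds Ox; have hq := Q1n.
have [_ _ qq _ _] := dp_adm S Ox; split; first by rewrite ler_pdivlMr; lra.
via (n * n / (n - Q1)); last by rewrite /emax; lra.
apply: ler_pM; [lra|pos| |rewrite lef_pV2 ?posrE; lra].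
by via (n * 1); [lra|rewrite ler_wpM2l; lra].
Qed.

Lemma ps_bounds x : Omega x -> 1 <= n * p x / (n - p x) /\ n * p x / (n - p x) <= emax n Q1.
Proof.
move=> Ox; have h2 := n2; have [h1 h3 _ _ _] := dp_bounds Ox; split; last first.
  by apply: ps_le_emax (dp_adm S Ox); rewrite ?P01 ?Q1n.
rewrite ler_pdivlMr; last pos.
have : n * 1 <= n * p x by rewrite ler_wpM2l; lra.
pos.
Qed.

Lemma emax_le : emax n Q1 <= (Num.truncn (emax n Q1)).+1%:R.
Proof. exact: ltW (truncnS_gt _). Qed.

Lemma Zx_ge0 x t : Omega x -> 0 <= t -> 0 <= Zf delta eta (q x) (w x) t.
Proof. by move=> /(dp_bounds)[_ _ _ _ w0] t0; apply: Zf_ge0; rewrite ?delta1 ?eta0. Qed.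

Lemma Bx_ge0 x t : 0 <= Bx x t.
Proof. exact: Bf_ge0. Qed.

#[local] Hint Extern 1 (is_true (0 <= Bx _ _)) => exact: Bx_ge0 : nonneg.

Lemma Bx_le x s t : Omega x -> 0 <= s -> s <= t -> Bx x s <= Bx x t.
Proof.
move=> Ox s0 st; have [b1 _] := bq_bounds Ox; have [p1 _] := ps_bounds Ox.
have [_ _ ? _ w0] := dp_bounds Ox.
apply: lerD; first by apply: powR_le => //; lra.
apply: powR_le; [lra|exact: Zx_ge0|].
by apply: Zf_le => //; rewrite ?delta1 ?eta0//; lra.
Qed.

Lemma Bx_shrink x l t : Omega x -> 0 <= l -> l <= 1 -> 0 <= t -> Bx x (l * t) <= l * Bx x t.
Proof.
move=> Ox l0 l1 t0; have [b1 _] := bq_bounds Ox; have [p1 _] := ps_bounds Ox.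
have [_ _ ? _ w0] := dp_bounds Ox; rewrite mulrDr; apply: lerD; first exact: powR_shrink.
apply: le_trans (powR_shrink l0 l1 (Zx_ge0 Ox t0) b1).
apply: powR_le; [lra|exact: Zx_ge0 (mulr_ge0 l0 t0)|].
by apply: Zf_shrink => //; rewrite ?delta1 ?eta0//; lra.
Qed.

Lemma Bx_dil x l t : Omega x -> 1 <= l -> 0 <= t -> Bx x (l * t) <= l ^+ mB * Bx x t.
Proof.
move=> Ox l1 t0; have l0 : 0 <= l by lra.
have [b1 b2] := bq_bounds Ox; have [p1 p2] := ps_bounds Ox; have e2 := emax_le.
have [_ _ ? ? w0] := dp_bounds Ox; rewrite mulrDr; apply: lerD.
  apply: le_trans (powR_dil l1 t0 (le_trans p2 e2)) _.
  by rewrite ler_wpM2r ?powR_ge0// /mB -lock; apply: ler_weXn2l => //; rewrite leq_pmull.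
have lN : 1 <= l ^+ N.+1 by rewrite exprn_ege1.
have Zd : Zf delta eta (q x) (w x) (l * t) <= l ^+ N.+1 * Zf delta eta (q x) (w x) t.
  by apply: Zf_dil; rewrite ?delta1 ?eta0// ltW.
apply: le_trans (powR_le _ (Zx_ge0 Ox (mulr_ge0 l0 t0)) Zd) _; first pos.
by apply: le_trans (powR_dil lN (Zx_ge0 Ox t0) (le_trans b2 e2)) _; rewrite /mB -lock -exprM.
Qed.

Definition Bone : R := 1 + (1 + M * Lg delta eta 1) `^ emax n Q1.

Lemma Lg1_ge0 : 0 <= Lg delta eta 1.
Proof. by apply: Lg_ge0; rewrite ?delta1 ?eta0. Qed.

Lemma Bx_one x : Omega x -> Bx x 1 <= Bone.
Proof.
move=> Ox; have [b1 b2] := bq_bounds Ox; have [_ _ _ _ /andP[w0 wM]] := dp_adm S Ox.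
have l0 := Lg1_ge0; have z0 := Zx_ge0 Ox (@ler01 R).
rewrite /Bx /Bf powR1 lerD2l.
via ((1 + M * Lg delta eta 1) `^ (n / (n - q x))).
  apply: powR_le => //; first pos.
  by rewrite /Zf powR1 mulr1; have := ler_wpM2r l0 wM; lra.
by apply: ler_powR => //; rewrite lerDl mulr_ge0// (dp_M S).
Qed.

Lemma Bx_bounded t : exists2 K, 0 <= K & forall x s, Omega x -> 0 <= s -> s <= t -> Bx x s <= K.
Proof.
pose l := Num.max 1 t; have l1 : 1 <= l by rewrite le_max lexx.
have l0 : 0 <= l by lra.
exists (l ^+ mB * Bone).
  by rewrite mulr_ge0 ?exprn_ge0// addr_ge0 ?powR_ge0.
move=> x s Ox s0 st; via (Bx x (l * 1)).
  by apply: Bx_le => //; rewrite mulr1 le_max st orbT.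
apply: le_trans (Bx_dil Ox l1 ler01) _.
by rewrite ler_wpM2l ?exprn_ge0// Bx_one.
Qed.

Lemma Hx_bounded t : exists2 K, 0 <= K & forall x s, Omega x -> 0 <= s -> s <= t -> H x s <= K.
Proof.
pose l := Num.max 1 t; have l1 : 1 <= l by rewrite le_max lexx.
have l0 : 0 <= l by lra.
exists (l ^+ N.+1 * (1 + M * Lg delta eta 1)).
  by rewrite mulr_ge0 ?exprn_ge0// addr_ge0// mulr_ge0 ?Lg1_ge0 ?(dp_M S).
move=> x s Ox s0 st; via (H x (l * 1)).
  by apply: (mod_le Hm) => //; rewrite mulr1 le_max st orbT.
apply: le_trans (mod_dil Hm Ox l1 ler01) _.
by rewrite ler_wpM2l ?exprn_ge0// (mod_one Hm).
Qed.

Lemma Vf_ge0 x t : Omega x -> 0 <= Vf x t.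
Proof.
move=> Ox; rewrite /Vf; case: ifP => // t0.
have z0 := Zx_ge0 Ox (ltW t0); rewrite addr_ge0 ?powR_ge0// subr_ge0.
have a2 := a2f_ge n2 P01 Q1n (dp_adm S Ox).
via (1 `^ a2f n (q x)); first by rewrite powR1.
by apply: powR_le; lra.
Qed.

(** (1 + z)^a - 1 >= z^a for a >= 1, and each of the two summands of V is at most V, whence the
    factor 2. *)
Lemma Bx_le_Vf x t : Omega x -> 0 <= t -> Bx x t <= 2 * Vf x t `^ ns.
Proof.
move=> Ox; have h2 := n2; have [h1 h3 h4 h5 w0] := dp_bounds Ox.
have a2 := a2f_ge n2 P01 Q1n (dp_adm S Ox).
have [b1 _] := bq_bounds Ox; have [p1 _] := ps_bounds Ox.
rewrite le_eqVlt => /orP[/eqP <-|t0].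
  have := Bx_shrink Ox (lexx 0) ler01 (lexx 0); rewrite !mul0r => /le_trans; apply.
  pos.
have z0 := Zx_ge0 Ox (ltW t0); have s1 := ns_ge1.
rewrite /Vf t0; set z := Zf _ _ _ _ _ in z0 *.
have zz : z `^ a2f n (q x) <= (1 + z) `^ a2f n (q x) - 1.
  rewrite lerBrDl; have [z1|z1] := leP z 0.
    have -> : z = 0 by apply/eqP; rewrite eq_le z1 z0.
    by rewrite powR0 ?addr0 ?powR1// gt_eqF//; lra.
  have E (y : R) : 0 < y -> y `^ a2f n (q x) = y * y `^ (a2f n (q x) - 1).
    by move=> y0; rewrite mulr_powRB1//; lra.
  rewrite !E//; last pos.
  have m1 : z `^ (a2f n (q x) - 1) <= (1 + z) `^ (a2f n (q x) - 1) by apply: powR_le; lra.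
  have m2 : 1 <= (1 + z) `^ (a2f n (q x) - 1).
    via (1 `^ (a2f n (q x) - 1)); first by rewrite powR1. by apply: powR_le; lra.
  by have := ler_wpM2l z0 m1; lra.
have t1 := powR_ge0 t (a1f n (p x)); have t2 := powR_ge0 z (a2f n (q x)).
have E1 : t `^ (n * p x / (n - p x)) = (t `^ a1f n (p x)) `^ ns.
  by rewrite -powRrM; congr (_ `^ _); rewrite /a1f; field; lra.
have E2 : z `^ (n / (n - q x)) = (z `^ a2f n (q x)) `^ ns.
  by rewrite -powRrM; congr (_ `^ _); rewrite /a2f; field; lra.
rewrite /Bx /Bf -/z E1 E2 mulrDl mul1r.
have ns0 : 0 <= ns := le_trans ler01 s1.
apply: lerD; apply: powR_le => //; last by apply: le_trans zz _; rewrite lerDr.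
by rewrite lerDl; exact: le_trans zz.
Qed.

Lemma Vf_lin : exists2 K, 0 <= K & forall x t, Omega x -> 0 <= t -> t <= 1 ->
  Vf x t <= K * t `^ P0.
Proof.
have p01 := P01; have e1 := emax_gt1 n2 Q1n.
pose KM := M * Lg delta eta 1; have KM0 : 0 <= KM by rewrite mulr_ge0 ?Lg1_ge0 ?(dp_M S).
have em0 : 0 <= emax n Q1 by lra.
have K0 : 0 <= 1 + emax n Q1 * KM * expR (emax n Q1 * KM).
  pos.
exists (1 + emax n Q1 * KM * expR (emax n Q1 * KM)).
  pos.
move=> x t Ox t_0 t1; rewrite /Vf; case: ifP => tp; last first.
  pos.
have [pP pq _ _ /andP[w0 wM]] := dp_adm S Ox.
have a2 := a2f_ge n2 P01 Q1n (dp_adm S Ox).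
have a2b := a2f_le n2 P01 Q1n (dp_adm S Ox).
have a1 := a1f_ge n2 P01 Q1n (dp_adm S Ox).
have tP := powR_ge0 t P0.
have zK : Zf delta eta (q x) (w x) t <= KM * t `^ P0.
  rewrite /Zf /KM mulrAC; apply: ler_pM; rewrite ?powR_ge0 ?mulr_ge0 ?Lg_ge0 ?delta1 ?eta0//.
    by apply: ler_pM; rewrite ?Lg_ge0 ?Lg_le ?delta1 ?eta0.
  by apply: powR_le1 => //; lra.
have z0 := Zx_ge0 Ox t_0; set z := Zf _ _ _ _ _ in zK z0 *.
have tP1 : t `^ P0 <= 1.
  by via (1 `^ P0); [apply: powR_le => //; lra|rewrite powR1].
have zKM : z <= KM by apply: le_trans zK _; rewrite ler_piMr.
rewrite mulrDl mul1r; apply: lerD; first by apply: powR_le1 => //; lra.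
have az : a2f n (q x) * z <= emax n Q1 * z by rewrite ler_wpM2r.
via (emax n Q1 * z * expR (emax n Q1 * KM)); last first.
  by rewrite [leRHS]mulrAC -(mulrA _ KM) ler_wpM2r// ler_wpM2l.
have ez0 : 0 <= emax n Q1 * z by rewrite mulr_ge0//.
via (expR (emax n Q1 * z) - 1).
  rewrite lerB// /powR gt_eqF; last pos.
  rewrite ler_expR; apply: le_trans az; rewrite ler_wpM2l//; first pos.
  by apply: le_ln1Dx; lra.
have e0 := expR_gt0 (emax n Q1 * z); have := expR_ge1Dx (- (emax n Q1 * z)).
rewrite expRN => h.
have h1 : (1 - emax n Q1 * z) * expR (emax n Q1 * z) <= 1.
  by have := ler_wpM2r (ltW e0) h; rewrite mulVf ?gt_eqF.
have : expR (emax n Q1 * z) <= expR (emax n Q1 * KM) by rewrite ler_expR ler_wpM2l//.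
by move=> h2; have := ler_wpM2l ez0 h2; lra.
Qed.

(** Near its zero x, phi is at most linear in the distance, and V is at most a multiple of phi^P0
    with P0 > 1. *)
Lemma slope_Vf0 x phi s : Omega x -> phi x = 0 -> (forall y, 0 <= phi y) -> slope phi x s ->
  slope (fun y => Vf y (phi y)) x 0.
Proof.
move=> Ox p0 pge sp e e0; have p01 := P01.
have [K K0 hK] := Vf_lin.
pose D := `|s| + 1; have D0 : 0 < D by rewrite ltr_wpDl.
pose E := (e / (K + 1) / D); have K1 : 0 < K + 1 by lra.
have E0 : 0 < E by rewrite !divr_gt0.
have P1i : 0 < (P0 - 1)^-1 by rewrite invr_gt0; lra.
pose rho := Num.min 1 (E `^ (P0 - 1)^-1); have rho0 : 0 < rho by rewrite lt_min ltr01 powR_gt0.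
have cp := slope_continuous sp.
have n1 : \forall y \near x, phi y < rho.
  by apply: (cvgr_lt _ cp); rewrite p0.
have n2' : \forall y \near x, Omega y by exact: open_nbhs_nbhs (conj oO Ox).
have n3 := sp 1 ltr01.
near=> y.
have Oy : Omega y by near: y.
have py : phi y < rho by near: y.
have sy : `|phi y - phi x| <= (s + 1) * `|y - x| by near: y.
rewrite {1}[Vf x _]/Vf p0 ltxx subr0 ger0_norm ?Vf_ge0// add0r.
have y1 : phi y <= 1 by apply: le_trans (ltW py) _; rewrite ge_min lexx.
apply: le_trans (hK _ _ Oy (pge y) y1) _.
have sD : phi y <= D * `|y - x|.
  rewrite p0 subr0 ger0_norm// in sy; apply: le_trans sy _; rewrite ler_wpM2r// /D lerD2r.
  exact: ler_norm.
have -> : phi y `^ P0 = phi y * phi y `^ (P0 - 1) by rewrite mulr_powRB1//; lra.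
have yE : phi y `^ (P0 - 1) <= E.
  via ((E `^ (P0 - 1)^-1) `^ (P0 - 1)).
    apply: powR_le => //; first pos. by apply: le_trans (ltW py) _; rewrite ge_min lexx orbT.
  by rewrite powRVK//; lra.
have KE : (K + 1) * D * E = e by rewrite /E; field; lra.
via ((K + 1) * (D * `|y - x| * E)).
  apply: ler_pM => //; rewrite ?mulr_ge0 ?powR_ge0//; first pos.
  by apply: ler_pM; rewrite ?powR_ge0.
by rewrite -KE le_eqVlt; apply/orP; left; apply/eqP; ring.
Unshelve. all: by end_near. Qed.

(** * The embedding for test functions *)

Definition energy_dens phi x : R := phi x + H x (norm1 (grad phi x)).

Lemma itg_energy_dens phi : test_fun Omega phi -> (forall x, 0 <= phi x) -> itg mu Omega (energy_dens phi).
Proof.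
move=> tp p0; have [M1 M10 hM] := test_bounded tp; have [sp _ _] := tp.
have [K K0 hK] := Hx_bounded (n * M1).
apply: (itgD mO); first exact: (itg_test oO OQ tp).
apply: (@itg_bounded _ _ _ mu Omega _ K mO Ooo).
  apply: (mod_meas Hm) => [|x _]; last pos.
  apply: mfun_norm1 => i; rewrite (_ : (fun x => _) = partial i phi); last by apply/funext => x; rewrite mxE.
  exact: (continuous_mfun (smooth_cont (smooth_partial i sp)) mO).
move=> x Ox; rewrite ger0_norm; last by rewrite (mod_ge0 Hm)// norm1_ge0.
apply: hK => //; first pos.
via (\sum_(i < N) M1); last by rewrite sumr_const card_ord mulr_natl.
by apply: ler_sum => i _; rewrite mxE; have [_] := hM x.
Qed.

Lemma itg_Bx phi : test_fun Omega phi -> (forall x, 0 <= phi x) -> itg mu Omega (fun x => Bx x (phi x)).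
Proof.
move=> tp p0; have [M1 M10 hM] := test_bounded tp; have [sp _ _] := tp.
have [K K0 hK] := Bx_bounded M1.
apply: (@itg_bounded _ _ _ mu Omega _ K mO Ooo).
  apply: (lmf_Bx) => //; exact: (continuous_mfun (smooth_cont sp) mO).
move=> x Ox; rewrite ger0_norm ?Bx_ge0//; apply: hK => //.
by apply: le_trans (ler_norm _) _; have [] := hM x.
Qed.

Let Sob : R := @sobolev_cst R N (2 * r0).

Lemma Sob_ge0 : 0 <= Sob.
Proof.
have h := dp_r0 S; have v := vol_gt0 (mulr_gt0 (@ltr0n R 2 : 0 < 2) h).
by rewrite mulr_ge0// !mulr_ge0 ?invr_ge0 ?powR_ge0//; lra.
Qed.

(** [gagliardo_nirenberg] for V(x, phi x), in a cube of twice the side so that Omega fills at most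
    half of it. *)
Lemma emb_pre e : 0 < e -> exists2 C, 0 <= C & forall phi, test_fun Omega phi -> (forall x, 0 <= phi x) ->
  Int mu Omega (fun x => Bx x (phi x)) <=
  2 * (Sob * (e * Int mu Omega (fun x => Bx x (phi x)) + C * Int mu Omega (energy_dens phi))) `^ ns.
Proof.
move=> e0; have h2 := n2.
have [C C0 hC] := Vslope_controlled n2 P01 Q1n (dp_gap S) (dp_M S) delta1 eta0
  (addr_ge0 (dp_La S) (Le_ge0)) e0.
exists C => // phi tp p0; have [sp kp pO] := tp; have [M1 M10 hM] := test_bounded tp.
have iB := itg_Bx tp p0; have iE := itg_energy_dens tp p0.
have E0 x : Omega x -> 0 <= energy_dens phi x.
  by move=> Ox; rewrite addr_ge0// (mod_ge0 Hm)// norm1_ge0.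
pose G x := if x \in Omega then e * Bx x (phi x) + C * energy_dens phi x else 0.
have GO x : Omega x -> G x = e * Bx x (phi x) + C * energy_dens phi x by move=> Ox; rewrite /G mem_set.
have GN x : ~ Omega x -> G x = 0 by move=> Ox; rewrite /G memNset.
have phi0 x : ~ Omega x -> phi x = 0 by move=> nx; apply: (support_vanish _).1 => /pO.
have Vf0 x : phi x = 0 -> Vf x (phi x) = 0 by move=> ->; rewrite /Vf ltxx.
have gr0 x := norm1_ge0 (grad phi x).
have grE x : \sum_i `|partial i phi x| = norm1 (grad phi x) by apply: eq_bigr => i _; rewrite mxE.
have sl x : slope (fun y => Vf y (phi y)) x (G x).
  have sph := smooth_slope x sp; rewrite grE in sph.
  have [Ox|nO] := pselect (Omega x); last first.
    rewrite GN//; apply: (slope_near _ (slope_cst 0 x)). have nS : ~ support_of phi x by move=> /pO.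
    have oC : open (~` support_of phi) by apply: closed_openC; exact: closed_closure.
    apply: filterS (open_nbhs_nbhs (conj oC nS)) => y ny.
    by rewrite Vf0//; exact: (support_vanish ny).1.
  rewrite GO//; have G0 : 0 <= e * Bx x (phi x) + C * energy_dens phi x.
    pos.
  have := p0 x; rewrite le_eqVlt => /orP[/eqP px|px].
    exact: slope_le G0 (slope_Vf0 Ox (esym px) p0 sph).
  by apply: slope_le (slope_Vf Ox px (gr0 x) sph); apply: hC; [exact: dp_adm S _ Ox| |].
have [KB KB0 hKB] := Bx_bounded M1; have [KH KH0 hKH] := Hx_bounded (n * M1).
have grM x : norm1 (grad phi x) <= n * M1.
  via (\sum_(i < N) M1); last by rewrite sumr_const card_ord mulr_natl.
  by apply: ler_sum => i _; rewrite mxE; have [_] := hM x.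
have pM x : phi x <= M1 by apply: le_trans (ler_norm _) _; have [] := hM x.
pose L := e * KB + C * (M1 + KH).
have GL x : 0 <= G x <= L.
  have [Ox|nO] := pselect (Omega x); last first.
    by rewrite GN// lexx addr_ge0 ?mulr_ge0 ?addr_ge0// ltW.
  rewrite GO// addr_ge0 ?mulr_ge0 ?Bx_ge0 ?E0 ?(ltW e0)//=.
  apply: lerD; rewrite ler_wpM2l ?(ltW e0)//; first exact: hKB.
  by apply: lerD => //; exact: hKH.
have mG : lmfun setT G.
  apply: (lmf_patch mO); apply: (lmfD mO); apply: (lmfZ _ mO); [exact: itg_mfun iB|exact: itg_mfun iE].
have r0' := dp_r0 S; have r20 : 0 < 2 * r0 by rewrite mulr_gt0.
have OQ2 : Omega `<=` cube c0 (2 * r0).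
  move=> x /OQ h j; have := h j => /andP[h1 h3]; apply/andP; split => //.
  pos.
have mQ := @cube_mset R N c0 (2 * r0).
have OV : fine (mu Omega) <= vol (2 * r0) / 2.
  via (vol r0).
    rewrite -(fine_leb_cube c0 r0); apply: le_fine_measure => //; [exact: cube_mset|exact: leb_cube_fin].
  have -> : r0 = 2 * r0 / 2 by field.
  rewrite vol_half// (_ : 2 * (2 * r0 / 2) = 2 * r0); last by field.
  apply: ler_wpM2l; first exact: vol_ge0.
  rewrite lef_pV2 ?posrE//.
  by rewrite -[leLHS]expr1; apply: ler_weXn2l; [lra|exact: ltnW N_gt1].
have Vge x : 0 <= Vf x (phi x).
  have [Ox|nO] := pselect (Omega x); first exact: Vf_ge0.
  by rewrite Vf0 ?phi0.
have VN x : ~ Omega x -> Vf x (phi x) = 0 by move=> nx; rewrite Vf0 ?phi0.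
have := gagliardo_nirenberg vol_gt0 N_gt1 (And3 sl GL mG) r20 mO OQ2 OV Vge VN.
rewrite (@IntS_restrict _ _ _ mu _ _ G mQ mO OQ2) => [GNi|x _ /GN//].
have L0 : 0 <= L by rewrite addr_ge0 ?mulr_ge0 ?addr_ge0// ltW.
have lipV x y : `|Vf y (phi y) - Vf x (phi x)| <= L * `|y - x|.
  apply: (bounded_slope_lipschitz (v := fun y => Vf y (phi y)) L0) => z.
  by apply: slope_le (sl z); have /andP[] := GL z.
have cV : continuous (fun y => Vf y (phi y)) by exact: lipschitz_continuous lipV.
have iV : itg mu Omega (fun x => 2 * Vf x (phi x) `^ ns).
  apply: itgZ => //; pose K := Vf c0 (phi c0) + L * (2 * r0).
  apply: (@itg_bounded _ _ _ mu Omega _ (K `^ ns) mO Ooo).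
    apply: (lmf_powR mO) => [|||x _]; [exact: (continuous_mfun cV mO)|exact: lmf_cst|by []|].
    by rewrite gt_eqF//; exact: lt_le_trans ltr01 ns_ge1.
  move=> x Ox; rewrite ger0_norm ?powR_ge0//; apply: powR_le => //; first pos.
  rewrite -lerBlDl; apply: le_trans (ler_norm _) (le_trans (lipV _ _) _); rewrite ler_wpM2l//.
  apply: norm_rV_le => [|j]; first pos.
  have := OQ2 _ Ox j; rewrite !mxE => /andP[h1 h3].
  by rewrite ler_norml; lra.
have EG : Int mu Omega G = e * Int mu Omega (fun x => Bx x (phi x)) + C * Int mu Omega (energy_dens phi).
  rewrite -!IntZ// -IntD//; [|exact: itgZ|exact: itgZ].
  by apply: eq_Int => x Ox; rewrite GO.
via (Int mu Omega (fun x => 2 * Vf x (phi x) `^ ns)).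
  by apply: le_Int => // x Ox; apply: Bx_le_Vf.
have iV1 : itg mu Omega (fun x => Vf x (phi x) `^ ns).
  have := itgZ 2^-1 mO iV; apply: itg_eq => // x _; by rewrite mulrA mulVf ?mul1r// pnatr_eq0.
rewrite IntZ// ler_wpM2l// -EG; apply: le_trans GNi; apply: eq_ler.
symmetry; apply: IntS_restrict => // x _ nO; rewrite VN// powR0//.
by rewrite gt_eqF//; exact: lt_le_trans ltr01 ns_ge1.
Qed.

Lemma smoothZ (a : R) phi : smooth phi -> smooth (fun x => a * phi x).
Proof.
by move=> sp; have := smooth_affine a 0 sp; congr smooth; apply/funext => x; rewrite addr0.
Qed.

Lemma partialZ (a : R) phi i : smooth phi -> partial i (fun x => a * phi x) = fun x => a * partial i phi x.
Proof.
move=> sp; apply: partialE => x.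
by apply: (is_derive_val (is_deriveZ _ (smooth_is_derive i x sp))).
Qed.

Lemma test_funZ (a : R) phi : test_fun Omega phi -> test_fun Omega (fun x => a * phi x).
Proof.
move=> [sp kp pO]; apply: (test_funP (smoothZ a sp) kp pO) => x nz; apply: subset_closure => /=.
by apply: contra_neq nz => ->; rewrite mulr0.
Qed.

Lemma gradZ (a : R) phi x : smooth phi -> grad (fun x => a * phi x) x = a *: grad phi x.
Proof. by move=> sp; apply/rowP => i; rewrite !mxE partialZ. Qed.

(** For X <= 1 one has X <= X^(1/ns) since ns >= 1; with e = 1/(4 Sr) the term with X inside the
    power is therefore absorbed by the left-hand side. *)
Lemma emb_small : exists2 C, 0 <= C & forall phi, test_fun Omega phi -> (forall x, 0 <= phi x) ->
  Int mu Omega (fun x => Bx x (phi x)) <= 1 ->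
  Int mu Omega (fun x => Bx x (phi x)) <= (C * Int mu Omega (energy_dens phi)) `^ ns.
Proof.
have h2 := dp_n2; have s1 := ns_ge1; have s0 := ns_gt0.
pose Sr := Sob + 1.
have S0 := Sob_ge0.
have S1 : 0 < Sr by rewrite /Sr; lra.
have e0 : 0 < (4 * Sr)^-1 by rewrite invr_gt0 mulr_gt0.
have [C C0 hC] := emb_pre e0.
exists (4 * Sr * C); first pos.
move=> phi tp p0; set X := Int _ _ _ => X1; set Y := Int _ _ _.
have X0 : 0 <= X by apply: Int_ge0 => x _; exact: Bx_ge0.
have Y0 : 0 <= Y.
  by apply: Int_ge0 => x Ox; rewrite addr_ge0// (mod_ge0 Hm)// norm1_ge0.
have := hC phi tp p0; rewrite -/X -/Y => h.
pose z := X `^ ns^-1; have z0 : 0 <= z := powR_ge0 _ _.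
have Xz : X <= z.
  have [X00|X00] := leP X 0; first exact: le_trans X00 z0.
  by apply: ger1_powR; rewrite ?X00// invf_le1.
have zX : X = z `^ ns by rewrite powRVK// gt_eqF.
have a0 : 0 <= (4 * Sr)^-1 * X + C * Y by rewrite addr_ge0 ?mulr_ge0// ltW.
have h' : X <= (2 * (Sr * ((4 * Sr)^-1 * X + C * Y))) `^ ns.
  apply: le_trans h _; rewrite (powRM _ (ler0n _ 2) (mulr_ge0 (ltW S1) a0)).
  apply: ler_pM => //; first pos.
    by apply: le1r_powR => //; lra.
  apply: powR_le; [pos|pos|by rewrite ler_wpM2r /Sr; lra].
have zle : z <= 2 * (Sr * ((4 * Sr)^-1 * X + C * Y)).
  have b0 : 0 <= 2 * (Sr * ((4 * Sr)^-1 * X + C * Y)).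
    pos.
  have i0 : 0 <= ns^-1 by rewrite invr_ge0 ltW.
  have := powR_le i0 X0 h'; rewrite -/z powRKV//; by rewrite gt_eqF.
have E : 2 * (Sr * ((4 * Sr)^-1 * X + C * Y)) = X / 2 + 2 * (Sr * (C * Y)) by field; lra.
rewrite zX; apply: powR_le => //; first pos.
pos.
Qed.

(** phi is halved until the integral of B is at most 1. If that takes a first i >= 1, the preceding
    integral exceeds 1, so the energy at i is bounded below; as it decays like 2^-i, this bounds 2^i
    by D, and undoing the halvings costs at most D^m. *)
Lemma emb_abs Y0 : 0 <= Y0 -> exists2 C, 0 <= C & forall phi, test_fun Omega phi ->
  (forall x, 0 <= phi x) -> Int mu Omega (energy_dens phi) <= Y0 ->
  Int mu Omega (fun x => Bx x (phi x)) <= (C * Int mu Omega (energy_dens phi)) `^ ns.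
Proof.
move=> Y00; have [C C0 hC] := emb_small.
have s1 := ns_ge1; have s0 := ns_gt0.
have [m Bdil] : exists m : nat, forall x l t, Omega x -> 1 <= l -> 0 <= t -> Bx x (l * t) <= l ^+ m * Bx x t.
  by exists mB; exact: (Bx_dil).
pose D : R := C * Y0 * 2 ^+ m; have D0 : 0 <= D by rewrite !mulr_ge0.
pose K : R := 1 + D ^+ m; have K1 : 1 <= K by rewrite /K lerDl exprn_ge0.
exists (K * C); first pos.
move=> phi tp p0 hY.
pose phi_ i x := (2^-1 ^+ i) * phi x.
pose X i := Int mu Omega (fun x => Bx x (phi_ i x)); pose Y i := Int mu Omega (energy_dens (phi_ i)).
have l0 i : 0 <= (2^-1 : R) ^+ i by rewrite exprn_ge0//.
have l1 i : (2^-1 : R) ^+ i <= 1 by rewrite exprn_ile1//; lra.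
have ti i : test_fun Omega (phi_ i) by exact: test_funZ.
have pi0 i x : 0 <= phi_ i x by rewrite mulr_ge0.
have phi0E : phi_ 0%N = phi by apply/funext => x; rewrite /phi_ expr0 mul1r.
have [sp _ _] := tp.
have iB i := itg_Bx (ti i) (pi0 i); have iE i := itg_energy_dens (ti i) (pi0 i).
have Y_ge0 : 0 <= Y 0%N.
  by apply: Int_ge0 => x Ox; rewrite addr_ge0// (mod_ge0 Hm)// norm1_ge0.
have X_ge0 i : 0 <= X i by apply: Int_ge0 => x _; exact: Bx_ge0.
have Yi i : Y i <= 2^-1 ^+ i * Y 0%N.
  rewrite /Y -IntZ//; apply: le_Int => //; first exact: itgZ.
  move=> x Ox; rewrite /energy_dens mulrDr phi0E; apply: lerD => //.
  rewrite gradZ// norm1Z ger0_norm//; apply: (mod_shrink Hm) => //; exact: norm1_ge0.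
have Xi i : X i <= 2^-1 ^+ i * X 0%N.
  rewrite /X -IntZ//; apply: le_Int => //; first exact: itgZ.
  by move=> x Ox; rewrite phi0E; exact: (Bx_shrink).
have two : (1 : R) <= 2 by lra.
have X0i i : X 0%N <= (2 ^+ i) ^+ m * X i.
  rewrite /X -IntZ//; apply: le_Int => //; first exact: itgZ.
  move=> x Ox; rewrite phi0E; apply: le_trans (Bdil _ _ _ Ox (exprn_ege1 i two) (pi0 i x)).
  by rewrite /phi_ mulrA -exprMn mulfV ?expr1n ?mul1r// pnatr_eq0.
have XS i : X i <= 2 ^+ m * X i.+1.
  rewrite /X -(IntZ _ mO (iB i.+1)).
  apply: (le_Int mO (iB i) (itgZ _ mO (iB i.+1))).
  move=> x Ox; apply: le_trans (Bdil _ _ _ Ox two (pi0 i.+1 x)).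
  by rewrite /phi_ mulrA exprS mulrA mulfV ?mul1r// pnatr_eq0.
have ex : exists i, X i <= 1.
  exists (Num.truncn (X 0%N)).+1; apply: le_trans (Xi _) _.
  rewrite exprVn ler_pdivrMl// mulr1; apply: le_trans (ltW (truncnS_gt _)) _.
  by rewrite -natrX ler_nat ltnW// ltn_expl.
have {}hC i : X i <= 1 -> X i <= (C * Y i) `^ ns by move=> h; exact: hC.
have KC : (C * Y 0%N) `^ ns * K <= (K * C * Y 0%N) `^ ns.
  have K0 : 0 <= K by exact: le_trans ler01 K1.
  rewrite -mulrA (powRM _ K0 (mulr_ge0 C0 Y_ge0)).
  by rewrite mulrC ler_wpM2r ?powR_ge0// le1r_powR.
have CY : 0 <= (C * Y 0%N) `^ ns := powR_ge0 _ _.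
have -> : Int mu Omega (fun x => Bx x (phi x)) = X 0%N by rewrite /X phi0E.
have -> : Int mu Omega (energy_dens phi) = Y 0%N by rewrite /Y phi0E.
have {}hY : Y 0%N <= Y0 by rewrite /Y phi0E.
apply: le_trans KC.
case: (ex_minnP ex) => -[|i] hi mi.
  by apply: le_trans (hC _ hi) _; rewrite ler_peMr.
have Xgt : 1 < X i by rewrite ltNge; apply/negP => /mi; rewrite ltnn.
have CYi : C * Y i.+1 <= C * Y 0%N * 2^-1 ^+ i.+1.
  by rewrite -mulrA ler_wpM2l// mulrC.
have Yi0 : 0 <= Y i.+1.
  by apply: Int_ge0 => x Ox; rewrite addr_ge0// (mod_ge0 Hm)// norm1_ge0.
have C1 : 2 ^- m <= C * Y i.+1.
  rewrite leNgt; apply/negP => h.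
  have h3 : X i.+1 < 2 ^- m.
    have m1 : (2 : R) ^- m <= 1 by rewrite invf_le1// exprn_ege1.
    apply: le_lt_trans (hC _ hi) _; apply: le_lt_trans (h). have [c0'|cp] := leP (C * Y i.+1) 0.
      have -> : C * Y i.+1 = 0 by apply/eqP; rewrite eq_le c0' mulr_ge0. by rewrite powR0// gt_eqF.
    by apply: ge1r_powR => //; rewrite cp (le_trans (ltW h)).
  have := XS i; have p2 : 0 < (2 : R) ^+ m by rewrite exprn_gt0.
  move: h3; rewrite -(ltr_pM2l p2) mulfV// => h3 h4.
  by have := lt_le_trans Xgt h4; rewrite ltNge (ltW h3).
have two_i : 2 ^+ i.+1 <= D.
  have := le_trans C1 CYi; rewrite exprVn.
  rewrite ler_pdivlMr// mulrC ler_pdivrMr// => /le_trans; apply.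
  by rewrite /D ler_wpM2r// ler_wpM2l.
apply: le_trans (X0i i.+1) _; rewrite mulrC.
have e2 : 0 <= ((2 : R) ^+ i.+1) ^+ m by rewrite exprn_ge0// exprn_ge0.
apply: (ler_pM (X_ge0 _) e2).
  apply: le_trans (hC _ hi) _; apply: powR_le; [pos|pos|].
  by apply: le_trans CYi _; rewrite -[leRHS]mulr1; exact: (ler_wpM2l (mulr_ge0 C0 Y_ge0) (l1 i.+1)).
via (D ^+ m); last by rewrite /K lerDr.
by apply: lerXn2r; rewrite ?nnegrE// exprn_ge0.
Qed.

Lemma Bx0 x : Omega x -> Bx x 0 = 0.
Proof.
move=> Ox; apply/eqP; rewrite eq_le Bx_ge0 andbT.
by have := Bx_shrink Ox (lexx 0) ler01 (lexx 0); rewrite !mul0r.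
Qed.

(** B at v / 2 is eventually below B at v_i wherever v > 0, so the minimum of both is eventually
    constant. Monotonicity thus serves for continuity, at the price of 2^mB. *)
Lemma Bx_fatou (v_ : nat -> vec -> R) (v : vec -> R) k :
  (forall i, lmfun Omega (v_ i)) -> lmfun Omega v ->
  (forall i x, 0 <= v_ i x) -> (forall x, 0 <= v x) ->
  {ae mu, forall x, Omega x -> v_ i x @[i --> \oo] --> v x} ->
  (forall i, itg mu Omega (fun x => Bx x (v_ i x))) ->
  (forall i, Int mu Omega (fun x => Bx x (v_ i x)) <= k) ->
  itg mu Omega (fun x => Bx x (v x)) /\ Int mu Omega (fun x => Bx x (v x)) <= 2 ^+ mB * k.
Proof.
move=> mv_ mv v_0 v0 cv Bi Bk; have half : (0 : R) <= 2^-1 by lra.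
pose h x := Bx x (2^-1 * v x).
have h0 x : 0 <= 2^-1 * v x by rewrite mulr_ge0.
have mh : lmfun Omega h.
  exact: (@lmf_Bx (fun x => 2^-1 * v x) (lmfZ _ mO mv) (fun x _ => h0 x)).
pose f i x := Num.min (Bx x (v_ i x)) (h x).
have mf i : lmfun Omega (f i).
  exact: (lmf_min (lmf_Bx (mv_ i) (fun x _ => v_0 i x)) mh).
have f0 i x : Omega x -> 0 <= f i x by move=> _; rewrite le_min !Bx_ge0.
have fi i : itg mu Omega (f i).
  apply: (@itg_le _ _ _ mu _ _ (fun x => Bx x (v_ i x)) mO (mf i)) => // x Ox.
  by rewrite ger0_norm ?f0// ge_min lexx.
have cf : {ae mu, forall x, Omega x -> f ^~ x @ \oo --> h x}.
  apply: (ae_imp cv) => x hx Ox; apply: cvg_near_cst.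
  have := v0 x; rewrite le_eqVlt => /orP[/eqP vx|vx].
    apply: nearW => i; by rewrite /f /h -vx mulr0 Bx0// min_r// Bx_ge0.
  have v2 : 2^-1 * v x < v x by lra.
  apply: filterS (cvgr_gt _ (hx Ox) _ v2) => i hi; rewrite /f min_r//.
  by apply: (Bx_le Ox) => //; exact: ltW.
have fk i : Int mu Omega (f i) <= k.
  by apply: le_trans (Bk i); apply: le_Int => // x Ox; rewrite ge_min lexx.
have [hi hk] := Int_fatou mO fi mh f0 cf fk.
have two : (1 : R) <= 2 by lra.
have le x : Omega x -> Bx x (v x) <= 2 ^+ mB * h x.
  move=> Ox; apply: le_trans (Bx_dil Ox two (h0 x)).
  by rewrite mulrA mulfV ?mul1r// pnatr_eq0.
have h2i : itg mu Omega (fun x => 2 ^+ mB * h x) by exact: itgZ.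
have iv : itg mu Omega (fun x => Bx x (v x)).
  apply: (@itg_le _ _ _ mu _ _ (fun x => 2 ^+ mB * h x) mO (lmf_Bx mv (fun x _ => v0 x)) _ h2i).
  by move=> x Ox; rewrite ger0_norm ?Bx_ge0// le.
split => //; apply: le_trans (le_Int mO iv h2i le) _.
by rewrite (IntZ _ mO hi) ler_wpM2l// exprn_ge0.
Qed.

Lemma ratio_le1 (c : R) : 0 <= c -> c / (c + 1) <= 1.
Proof. by move=> cge0; rewrite ler_pdivrMr; lra. Qed.

Lemma le_powR_eps (X a s : R) : 0 <= X -> 0 <= a -> 0 < s -> (forall e, 0 < e -> X <= (a + e) `^ s) ->
  X <= a `^ s.
Proof.
move=> X0 a0 s0 h.
have -> : X = (X `^ s^-1) `^ s by rewrite powRVK ?gt_eqF.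
apply: powR_le; [pos|pos|apply/ler_addgt0Pr => e e0].
have ae : 0 <= a + e by rewrite addr_ge0// ltW.
have i0 : 0 <= s^-1 by rewrite invr_ge0 ltW.
by have := powR_le i0 X0 (h e e0); rewrite powRKV ?gt_eqF.
Qed.

(** * The embedding for truncations of the solution *)

Variables (u : vec -> R) (g : vec -> vec) (phi : nat -> vec -> R)
  (Phi : vec -> R).
Hypothesis ug : approx Omega H u g phi Phi.
Let W1u := approx_W1H0 oO OQ Hm (ex_intro _ phi (ex_intro _ Phi ug)).

Definition above (sg k : R) := Omega `&` [set x | k < sg * u x].

Lemma above_mset sg k : mset (above sg k).
Proof. by have [mu_ _ _ _ _] := ug; apply: mset_gt => //; exact: lmfZ. Qed.

Definition pos_part (sg k : R) x : R := Num.max 0 (sg * u x - k).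

Lemma pos_part_ge0 sg k x : 0 <= pos_part sg k x. Proof. by rewrite le_max lexx. Qed.

Lemma lmf_affine (a b : R) : lmfun Omega (fun x => a * u x - b).
Proof. by have [mu_ _ _ _ _] := ug; apply: (lmfB mO); [exact: lmfZ|exact: lmf_cst]. Qed.

Lemma lmf_pos_part sg k : lmfun Omega (pos_part sg k).
Proof.
by apply: lmf_max; [exact: lmf_cst|exact: lmf_affine].
Qed.

Definition level_energy (sg k : R) : R := Int mu (above sg k) (fun x => sg * u x + H x (norm1 (g x))).

Lemma emb_level : exists2 C, 0 <= C & forall sg k : R, `|sg| = 1 -> 0 <= k ->
  itg mu Omega (fun x => Bx x (pos_part sg k x)) /\
  Int mu Omega (fun x => Bx x (pos_part sg k x)) <= (C * level_energy sg k) `^ ns.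
Proof.
have s1 := ns_ge1; have s0 := ns_gt0.
have [mu_ mg tphi Pi ae0] := ug.
have [_ _ Hu Hg [ui gi]] := W1u.
pose m : nat := N.+1; pose D : R := 2 ^+ m; have D0 : 0 <= D by rewrite exprn_ge0.
have D1 : 1 <= D by rewrite exprn_ege1//; lra.
pose E0 := Int mu Omega (fun x => `|u x| + D * H x (norm1 (g x))).
have iE0 : itg mu Omega (fun x => `|u x| + D * H x (norm1 (g x))).
  by apply: itgD => //; [exact: itg_norm|exact: itgZ].
have E00 : 0 <= E0.
  by apply: Int_ge0 => x Ox; rewrite addr_ge0// mulr_ge0// (mod_ge0 Hm)// norm1_ge0.
have [C C0 hC] := emb_abs (addr_ge0 E00 ler01).
pose K : R := 2 ^+ mB * 2 ^+ mB.
have K1 : 1 <= K by rewrite /K -exprD exprn_ege1//; lra.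
exists (K * (C * D)).
  pos.
move=> sg k sg1 k0.
have m1 := above_mset sg k.
have sg0 t : `|sg * t| = `|t| by rewrite normrM sg1 mul1r.
pose L := Int mu (above sg k) (fun x => sg * u x + D * H x (norm1 (g x))).
have iA : itg mu (above sg k) (fun x => sg * u x + D * H x (norm1 (g x))).
  apply: (itgS mO (above_mset sg k)); first by move=> x [].
  by apply: itgD => //; exact: itgZ.
have L0 : 0 <= L.
  apply: Int_ge0 => x [Ox /= kx]; apply: addr_ge0; first pos.
  by apply: mulr_ge0 => //; rewrite (mod_ge0 Hm)// norm1_ge0.
have LE : L <= D * level_energy sg k.
  have iE : itg mu (above sg k) (fun x => sg * u x + H x (norm1 (g x))).
    apply: (itgS mO (above_mset sg k)); first by move=> x []. by apply: itgD => //; exact: itgZ.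
  rewrite -(IntZ D m1 iE); apply: (le_Int m1 iA (itgZ _ m1 iE)) => x [Ox /= kx].
  have aux (a b : R) : 0 <= a -> a + D * b <= D * (a + b) by move=> a0; rewrite mulrDr lerD2r ler_peMl.
  exact: aux (le_trans k0 (ltW kx)).
have step c : 0 < c -> itg mu Omega (fun x => Bx x (trunc c sg k (u x))) /\
    Int mu Omega (fun x => Bx x (trunc c sg k (u x))) <= 2 ^+ mB * (C * L) `^ ns.
  move=> cp; have cT : continuous (trunc c sg k) by exact: trunc_continuous.
  have cdT : continuous (dtrunc c sg k) by exact: dtrunc_continuous.
  pose v i x := trunc c sg k (phi i x) * 1.
  have sphi i : smooth (phi i) by have [] := tphi i.
  have tv i : test_fun Omega (v i).
    by apply: test_fun_comp (tphi i) (smooth1_trunc sg k cp) (trunc0 c sg k0) (smooth_cst 1).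
  have v0 i x : 0 <= v i x by rewrite /v mulr1 trunc_ge0.
  have gv i x : grad (v i) x = dtrunc c sg k (phi i x) *: grad (phi i) x.
    apply/rowP => j; rewrite !mxE /v (_ : (fun x => _) = trunc c sg k \o phi i); last first.
      by apply/funext => y; rewrite mulr1.
    by rewrite (partial_comp _ (sphi i) (fun t => is_derive_trunc sg k t cp)).
  pose s_ i x := norm1 (grad (phi i) x); pose s x := norm1 (g x).
  pose r_ i x := `|s_ i x - s x|.
  have ms i : lmfun Omega (s_ i).
    apply: mfun_norm1 => j; rewrite (_ : (fun x => _) = partial j (phi i)).
      exact: (continuous_mfun (smooth_cont (smooth_partial j (sphi i))) mO).
    by apply/funext => x; rewrite mxE.
  have ms0 : lmfun Omega s by exact: mfun_norm1.
  have mphi i : lmfun Omega (phi i) := continuous_mfun (smooth_cont (sphi i)) mO.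
  have mdp i : lmfun Omega (fun x => `|dtrunc c sg k (phi i x)|).
    by apply: (lmf_norm mO); exact: (lmf_comp (mphi i) cdT).
  have mH (y : vec -> R) : lmfun Omega y -> (forall x, 0 <= y x) ->
      lmfun Omega (fun x => H x (y x)) by move=> my y0; apply: (mod_meas Hm) => // x _.
  (* H at the gradient of phi_i is split by doubling into H at the gradient of u and H at the
     difference [r_ i], which tends to 0; so the energies converge, to at most [L]. *)
  pose e_ i x := trunc c sg k (phi i x) + `|dtrunc c sg k (phi i x)| * (D * (H x (s x) + H x (r_ i x))).
  pose e x := trunc c sg k (u x) + `|dtrunc c sg k (u x)| * (D * H x (s x)).
  have mr i : lmfun Omega (r_ i) by apply: (lmf_norm mO); exact: lmfB.
  have me_ i : lmfun Omega (e_ i).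
    apply: (lmfD mO); first exact: (lmf_comp (mphi i) cT).
    apply: (lmfM mO (mdp i)); apply: (lmfZ _ mO).
    exact: (lmfD mO (mH s ms0 (fun x => norm1_ge0 _)) (mH (r_ i) (mr i) (fun x => normr_ge0 _))).
  have me : lmfun Omega e.
    apply: (lmfD mO); first exact: (lmf_comp mu_ cT).
    apply: (lmfM mO); first by apply: (lmf_norm mO); exact: (lmf_comp mu_ cdT).
    by apply: (lmfZ _ mO); apply: mH => // x; exact: norm1_ge0.
  have sc : {ae mu, forall x, Omega x -> s_ ^~ x @ \oo --> s x /\ r_ ^~ x @ \oo --> (0 : R)}.
    apply: (ae_imp ae0) => x hx Ox; have [_ cg _] := hx Ox. have c1 : s_ ^~ x @ \oo --> s x.
      by apply: norm1_cvg => j; have := cg j; apply: cvg_trans; apply: near_eq_cvg; apply: nearW => i; rewrite mxE.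
    split => //; rewrite -(normr0 R) -(subrr (s x)); apply: cvg_norm.
    by apply: cvgB c1 _; exact: cvg_cst.
  have s0' x : 0 <= s x := norm1_ge0 _.
  have ce : {ae mu, forall x, Omega x -> e_ ^~ x @ \oo --> e x}.
    apply: (ae_imp2 ae0 sc) => x hx hs Ox; have [cp' _ _] := hx Ox; have [c1 c2] := hs Ox.
    apply: cvgD; first exact: cvg_continuous.
    apply: cvgM; first by apply: cvg_norm; exact: cvg_continuous.
    rewrite -[X in D * X]addr0; apply: cvgMr; apply: cvgD; first exact: cvg_cst.
    exact: (mod_cvg0 Hm Ox (fun i => normr_ge0 _) c2).
  pose Dom x := (1 + Phi x + `|k|) + D * (H x (s x) + (D * (Phi x + H x (s x)))).
  have iHs : itg mu Omega (fun x => H x (s x)) := Hg.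
  have iDom : itg mu Omega Dom.
    by apply: (itgD mO); [apply: (itgD mO); [apply: (itgD mO) => //; exact: itg_cst|exact: itg_cst]
      |apply: (itgZ _ mO); apply: (itgD mO) => //; apply: (itgZ _ mO); exact: (itgD mO)].
  have eDom : {ae mu, forall x, Omega x -> forall i, `|e_ i x| <= Dom x}.
    apply: (ae_imp ae0) => x hx Ox i; have [_ _ /(_ i) hP] := hx Ox.
    have H1 := mod_ge0 Hm Ox (normr_ge0 (phi i x)); have H2 := mod_ge0 Hm Ox (norm1_ge0 (grad (phi i) x)).
    have H3 := mod_ge0 Hm Ox (s0' x); have H4 := mod_ge0 Hm Ox (normr_ge0 (s_ i x - s x)).
    rewrite ger0_norm; last by apply: addr_ge0; [exact: trunc_ge0|pos]. apply: lerD.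
      apply: le_trans (ler_norm _) (le_trans (trunc_norm_le k (phi i x) cp sg1) _); rewrite lerD2r.
      by apply: le_trans (mod_low Hm Ox (normr_ge0 _)) _; rewrite lerD2l; lra.
    via (1 * (D * (H x (s x) + D * (Phi x + H x (s x))))); last by rewrite mul1r.
    have Ha : 0 <= D * (H x (s x) + H x (r_ i x)) := mulr_ge0 D0 (addr_ge0 H3 H4).
    apply: (ler_pM (normr_ge0 _) Ha (dtrunc_le1 _ _ cp sg1)).
    rewrite ler_wpM2l// lerD2l; via (H x (s_ i x + s x)).
      have nB (a b : R) : 0 <= a -> 0 <= b -> `|a - b| <= a + b.
        by move=> a0 b0; apply: le_trans (ler_normB _ _) _; rewrite !ger0_norm.
      exact: (mod_le Hm Ox (normr_ge0 _) (nB _ _ (norm1_ge0 _) (s0' x))).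
    apply: le_trans (modD Hm Ox (norm1_ge0 _) (s0' x)) _. by rewrite ler_wpM2l// lerD2r; lra.
  have [iE cE] := Int_dominated mO me_ me ce iDom eDom.
  have ie_ i : itg mu Omega (e_ i).
    by apply: (itg_le_ae mO (me_ i) _ iDom); apply: (ae_imp eDom) => x hx Ox; exact: hx.
  have IeL : Int mu Omega e <= L.
    have e0 x : Omega x -> ~ above sg k x -> e x = 0.
      move=> Ox nA; have ku : sg * u x - k <= 0.
        by rewrite subr_le0 leNgt; apply/negP => h; exact: nA.
      by rewrite /e /trunc /dtrunc spos_eq0// dspos_eq0// mulr0 normr0 mul0r addr0.
    rewrite (@IntS_restrict _ _ _ mu Omega (above sg k) e mO m1) => [|x []//|//].
    apply: le_Int => //; first by apply: itgS mO m1 _ iE => x []. move=> x [Ox /= kx]; apply: lerD.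
      apply: le_trans (spos_le _ cp) _; rewrite ge_max (le_trans k0 (ltW kx))/=; lra.
    rewrite -[leRHS]mul1r; apply: ler_wpM2r; last exact: dtrunc_le1.
    by rewrite mulr_ge0// (mod_ge0 Hm).
  have LE0 : L <= E0.
    rewrite /L /E0; via (Int mu (above sg k) (fun x => `|u x| + D * H x (norm1 (g x)))).
      apply: le_Int => //; first by apply: itgS mO m1 _ iE0 => x [].
      by move=> x _; rewrite lerD2r; apply: le_trans (ler_norm _) _; rewrite sg0.
    apply: (IntS mO m1 _ iE0); first by move=> x [].
    by move=> x Ox; rewrite addr_ge0// mulr_ge0// (mod_ge0 Hm)// norm1_ge0.
  have iev i : Int mu Omega (energy_dens (v i)) <= Int mu Omega (e_ i).
    apply: (le_Int mO (itg_energy_dens (tv i) (v0 i)) (ie_ i)) => x Ox; apply: lerD.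
      by rewrite /v mulr1.
    rewrite gv norm1Z; apply: le_trans (mod_shrink Hm Ox _ _ (norm1_ge0 _)) _ => //.
      exact: dtrunc_le1.
    rewrite ler_wpM2l//; via (H x (s x + r_ i x)).
      apply: (mod_le Hm Ox); first pos. by rewrite -lerBlDl; exact: ler_norm.
    exact: (modD Hm Ox (s0' x) (normr_ge0 _)).
  have key eps : 0 < eps -> itg mu Omega (fun x => Bx x (trunc c sg k (u x))) /\
      Int mu Omega (fun x => Bx x (trunc c sg k (u x))) <= 2 ^+ mB * (C * L + eps) `^ ns.
    move=> eps0; pose eps' := Num.min 1 (eps / (C + 1)). have C1 : 0 < C + 1 by exact: ltr_wpDl.
    have eps'0 : 0 < eps' by rewrite lt_min ltr01 divr_gt0.
    have near_e : \forall i \near \oo, Int mu Omega (e_ i) <= L + eps'.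
      by apply: (cvgr_le _ cE); apply: le_lt_trans IeL _; rewrite ltrDl.
    have [i0 _ hi0] := near_e. pose v' i := v (i + i0)%N.
    have Ii i : Int mu Omega (energy_dens (v' i)) <= L + eps'.
      by apply: le_trans (iev _) _; apply: hi0; rewrite /= leq_addl.
    have Bi i : Int mu Omega (fun x => Bx x (v' i x)) <= (C * L + eps) `^ ns.
      have E1 : Int mu Omega (energy_dens (v' i)) <= E0 + 1.
        apply: le_trans (Ii i) (lerD LE0 _); by rewrite ge_min lexx.
      apply: le_trans (hC _ (tv _) (v0 _) E1) _; apply: powR_le; first pos.
        rewrite mulr_ge0//; apply: Int_ge0 => x Ox; apply: addr_ge0; first exact: v0.
        by rewrite (mod_ge0 Hm)// norm1_ge0.
      apply: le_trans (ler_wpM2l C0 (Ii i)) _; rewrite mulrDr lerD2l.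
      via (C * (eps / (C + 1))); first by rewrite ler_wpM2l// ge_min lexx orbT.
      rewrite mulrCA ger_pMr//; exact: (ratio_le1 C0).
    apply: (@Bx_fatou v' (fun x => trunc c sg k (u x))) => //.
    - move=> i; have [sv _ _] := tv (i + i0)%N; exact: (continuous_mfun (smooth_cont sv) mO).
    - exact: (lmf_comp mu_ cT).
    - by move=> i x; exact: v0.
    - by move=> x; exact: trunc_ge0.
    - apply: (ae_imp ae0) => x hx Ox; have [cu _ _] := hx Ox.
      have := cvg_continuous cT cu; rewrite -(cvg_shiftn i0); apply: cvg_trans.
      by apply: near_eq_cvg; apply: nearW => i; rewrite /v' /v mulr1.
    - by move=> i; exact: (itg_Bx (tv _) (v0 _)).
  have [iB _] := key 1 ltr01; split => //.
  have p2 : 0 < (2 : R) ^+ mB by rewrite exprn_gt0.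
  rewrite -ler_pdivrMl//; apply: le_powR_eps => //.
  - rewrite mulr_ge0//; apply: Int_ge0 => x _; exact: Bx_ge0.
  - pos.
  - by move=> eps eps0; rewrite ler_pdivrMl//; have [] := key eps eps0.
pose cj (j : nat) : R := j.+1%:R^-1.
have c_0 j : 0 < cj j by rewrite invr_gt0.
have mj j : lmfun Omega (fun x => trunc (cj j) sg k (u x)).
  by apply: (lmf_comp mu_); exact: trunc_continuous.
have cvj : {ae mu, forall x, Omega x -> trunc (cj j) sg k (u x) @[j --> \oo] --> pos_part sg k x}.
  by apply: ae_all => x Ox; exact: spos_cvg.
have [iB hB] := Bx_fatou mj (lmf_pos_part sg k) (fun j x => trunc_ge0 _ _ _ _) (pos_part_ge0 sg k) cvj
  (fun j => (step _ (c_0 j)).1) (fun j => (step _ (c_0 j)).2).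
split => //; apply: le_trans hB _; rewrite mulrA -/K.
have CD : 0 <= C * (D * level_energy sg k) by rewrite mulr_ge0// (le_trans L0).
via (K * (C * (D * level_energy sg k)) `^ ns).
  by rewrite ler_wpM2l ?(le_trans ler01 K1)//; apply: powR_le; rewrite ?(ltW s0) ?mulr_ge0 ?ler_wpM2l.
rewrite -(mulrA K) -(mulrA C) (powRM _ (le_trans ler01 K1) CD).
by rewrite ler_wpM2r ?powR_ge0// le1r_powR.
Qed.

(** * Bounds for the operator and the tested equation *)

Local Notation A := (Alog p q w delta eta).
Local Notation growth := (growth_bound p q w delta eta).

Lemma dotp_norm1 xi h : `|dotp xi h| <= enorm xi * norm1 h.
Proof.
rewrite /dotp /norm1 mulr_sumr; apply: le_trans (ler_norm_sum _ _ _) _; apply: ler_sum => i _.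
by rewrite normrM ler_wpM2r// enorm_coord.
Qed.

Lemma enormE xi : dotp xi xi = enorm xi ^+ 2.
Proof. by rewrite sqr_sqrtr// dotp_ge0. Qed.

Definition flux x s : R :=
  s `^ p x + w x * (Lg delta eta s + eta * s / (q x * (delta + eta * s))) * s `^ q x.

Lemma flux_bounds x s : Omega x -> 0 <= s -> H x s <= flux x s /\ flux x s <= 2 * H x s.
Proof.
move=> Ox s0; have [p1 pn q1 qn w0] := dp_bounds Ox; have d1 := delta1; have e0 := eta0.
rewrite HlogE /Hf /Zf /flux; set L := Lg delta eta s; have L0 : 0 <= L by exact: Lg_ge0.
have hT : eta * s / (delta + eta * s) <= L by exact: Lg_tangent.
have es : 0 <= eta * s by rewrite mulr_ge0.
have ds : 0 < delta + eta * s by lra.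
set T := eta * s / (q x * (delta + eta * s)).
have qp : 0 < q x by lra.
have T0 : 0 <= T by apply: divr_ge0 => //; rewrite ltW// mulr_gt0.
have TL : T <= L.
  apply: le_trans hT; rewrite /T invfM [_^-1 * _]mulrC mulrA ler_pdivrMr//.
  by rewrite ler_peMr ?(ltW q1)// divr_ge0// ltW.
have wq : 0 <= w x * s `^ q x by rewrite mulr_ge0 ?powR_ge0.
have a1 := mulr_ge0 wq T0; have a2 := ler_wpM2l wq TL; have a3 := mulr_ge0 wq L0.
have pp := powR_ge0 s (p x).
have -> : w x * (L + T) * s `^ q x = w x * s `^ q x * L + w x * s `^ q x * T by ring.
pos.
Qed.

(** A(x, xi) is a nonnegative multiple of xi. The second bound carries the factor |xi| to avoid
    negative powers at 0. *)
Lemma Alog_flux x xi h : Omega x ->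
  dotp (A x xi) xi = flux x (enorm xi) /\
  `|dotp (A x xi) h| * enorm xi <= flux x (enorm xi) * norm1 h.
Proof.
move=> Ox; have [p1 pn q1 qn w0] := dp_bounds Ox; have s0 := enorm_ge0 xi.
have e0 := eta0; have d1 := delta1.
pose a := enorm xi `^ (p x - 2) + w x * (Lg delta eta (enorm xi) +
  eta * enorm xi / (q x * (delta + eta * enorm xi))) * enorm xi `^ (q x - 2).
have AE (k : vec) : dotp (A x xi) k = a * dotp xi k.
  rewrite /dotp mulr_sumr; apply: eq_bigr => i _.
  by rewrite /Alog !mxE -mulrDl mulrA.
have fE : flux x (enorm xi) = a * enorm xi ^+ 2.
  have [->|/eqP s1] := pselect (enorm xi = 0).
    by rewrite /flux !powR0 ?expr0n/= ?mulr0 ?addr0// gt_eqF//; lra.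
  have sp : 0 < enorm xi by rewrite lt_def s1.
  have sq r : enorm xi `^ r = enorm xi `^ (r - 2) * enorm xi ^+ 2.
    by rewrite -powR_mulrn// -powRD_pos// subrK.
  by rewrite /flux sq [enorm xi `^ q x]sq /a mulrDl !mulrA.
have a0 : 0 <= a.
  apply: addr_ge0; first pos.
  have L0 : 0 <= Lg delta eta (enorm xi) by exact: Lg_ge0.
  apply: mulr_ge0; last pos.
  apply: mulr_ge0 => //; apply: addr_ge0 => //; apply: divr_ge0; first pos.
  pos.
split; first by rewrite AE enormE fE.
rewrite AE normrM (ger0_norm a0) fE expr2 -!mulrA ler_wpM2l// [leRHS]mulrCA [leLHS]mulrC.
by rewrite ler_wpM2l// dotp_norm1.
Qed.

Lemma Alog_coercive x xi : Omega x -> H x (enorm xi) <= dotp (A x xi) xi.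
Proof.
by move=> Ox; have [-> _] := Alog_flux xi 0 Ox; have [] := flux_bounds Ox (enorm_ge0 xi).
Qed.

Lemma Alog_le x xi h : Omega x ->
  `|dotp (A x xi) h| * enorm xi <= 2 * H x (enorm xi) * norm1 h.
Proof.
move=> Ox; have [_ h1] := Alog_flux xi h Ox; apply: le_trans h1 _; rewrite ler_wpM2r ?norm1_ge0//.
by have [] := flux_bounds Ox (enorm_ge0 xi).
Qed.

Lemma growth_le x t t' xi : Omega x -> `|t| <= t' -> growth x t xi <= growth x t' xi.
Proof.
move=> Ox tt; have [p1 pn q1 qn w0] := dp_bounds Ox; have t0 := normr_ge0 t.
have d1 := delta1; have e0 := eta0.
have t'0 : 0 <= t' := le_trans t0 tt.
have [ps1 _] := ps_bounds Ox; have [bq1 _] := bq_bounds Ox.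
have LL : Lg delta eta `|t| <= Lg delta eta t' by exact: Lg_le.
have L0 : 0 <= Lg delta eta `|t| by exact: Lg_ge0.
have wL := ler_wpM2l w0 LL; have wL0 := mulr_ge0 w0 L0.
have Ls : 0 <= Lg delta eta (enorm xi) by apply: Lg_ge0 => //; exact: enorm_ge0.
have qsE : @sobolev_exp R N (q x) = n / (n - q x) * q x by rewrite /sobolev_exp; field; lra.
have qs1 : 1 <= @sobolev_exp R N (q x) by rewrite qsE; apply: mulr_ege1 => //; exact: ltW.
rewrite /growth_bound (ger0_norm t'0) lerD2r -/(Lg delta eta `|t|) -/(Lg delta eta t').
apply: lerD; last first.
  apply: ler_wpM2r; first pos.
  apply: ler_wpM2r; first pos.
  by apply: powR_le => //; rewrite invr_ge0; lra.
rewrite lerD2r; apply: lerD; first by apply: powR_le => //; rewrite subr_ge0.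
apply: ler_pM; [pos|pos| |].
  by apply: powR_le => //; apply: divr_ge0; lra.
by apply: powR_le => //; rewrite subr_ge0.
Qed.

Lemma growth_ctl e : 0 < e -> exists2 C, 0 <= C & forall x t xi, Omega x ->
  growth x t xi * `|t| <= e * H x (enorm xi) + C * (Bx x `|t| + `|t|).
Proof.
move=> e0.
have [C C0 hC] := growth_controlled gap M n2 P01 Q1n delta1 eta0 e0.
exists C => // x t xi Ox.
exact: (hC _ _ _ _ _ (dp_adm S Ox) (normr_ge0 t) (enorm_ge0 xi) _ _ erefl erefl).
Qed.

Variable f : vec -> R -> vec -> R.
Hypothesis eqn : forall v, W1H0 Omega H v ->
  (\int[mu]_(x in Omega) (dotp (A x (g x)) (nabla Omega v x))%:E =
   \int[mu]_(x in Omega) (f x (u x) (g x) * v x)%:E)%E.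

Lemma itg_Henorm : itg mu Omega (fun x => H x (enorm (g x))).
Proof.
have [mu_ mg _ _ _] := ug.
have [_ _ _ Hg _] := W1u.
apply: (itg_le mO _ _ Hg); first by apply: (mod_meas Hm) => [|x _]; [exact: mfun_enorm|pos].
move=> x Ox; rewrite ger0_norm; last exact: (mod_ge0 Hm Ox (enorm_ge0 _)).
exact: (mod_le Hm Ox (enorm_ge0 _) (enorm_norm1 _)).
Qed.

(** The equation is tested with a smooth truncation of (sg u - k)_+ times z. The truncation is (sg u
    - k) W and its derivative is at least W, so a single weight W occurs in all terms. Each of the
    two almost everywhere hypotheses gives a quarter of the energy to be absorbed, which leaves one
    half. Fatou's lemma lets c tend to 0. *)
Lemma energy_test (sg k : R) (z G1 G2 : vec -> R) (Mz : R) : `|sg| = 1 -> smooth z ->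
  (forall x, 0 <= z x <= 1) -> (forall x i, `|partial i z x| <= Mz) ->
  (0 <= k \/ exists K, [/\ compact K, K `<=` Omega & forall x, z x != 0 -> K x]) ->
  itg mu Omega G1 -> itg mu Omega G2 -> (forall x, Omega x -> 0 <= G1 x) ->
  (forall x, Omega x -> 0 <= G2 x) ->
  {ae mu, forall x, above sg k x -> `|f x (u x) (g x)| * (sg * u x - k) * z x <=
    4^-1 * (z x * H x (enorm (g x))) + G1 x} ->
  {ae mu, forall x, above sg k x -> (sg * u x - k) * `|dotp (A x (g x)) (grad z x)| <=
    4^-1 * (z x * H x (enorm (g x))) + G2 x} ->
  Int mu (above sg k) (fun x => z x * H x (enorm (g x))) <=
    2 * Int mu (above sg k) (fun x => G1 x + G2 x).
Proof.
move=> sg1 sz z01 dz suppz iG1 iG2 G10 G20 ae1 ae2.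
have [mu_ mg tphi _ _] := ug.
have m1 : mset (above sg k) by exact: (above_mset).
have sub : above sg k `<=` Omega by move=> x [].
pose h x := z x * H x (enorm (g x)).
have h0 x : Omega x -> 0 <= h x.
  move=> Ox; have /andP[z0 _] := z01 x; exact: (mulr_ge0 z0 (mod_ge0 Hm Ox (enorm_ge0 _))).
have mz : lmfun Omega z by exact: continuous_mfun (smooth_cont sz) mO.
have ih : itg mu Omega h.
  apply: (@itg_eq _ _ _ mu _ (fun x => H x (enorm (g x)) * z x) _ mO); first by move=> x _; rewrite /h mulrC.
  apply: (itgM_bounded mO itg_Henorm mz (k := 1)) => x _; have /andP[z0 z1] := z01 x.
  by rewrite ger0_norm.
have sgsg : sg * sg = 1.
  have [/eqP|/eqP] : sg = 1 \/ sg = -1.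
  - have : `|sg| == 1 by apply/eqP. by rewrite eqr_norml => /andP[/orP[]/eqP ? _]; [left|right].
  - by move=> /eqP->; rewrite mulr1.
  - by move=> /eqP->; rewrite mulrNN mulr1.
pose W c x := sexp c (sg * u x - k).
have step c : 0 < c -> Int mu (above sg k) (fun x => W c x * h x) <=
    2 * Int mu (above sg k) (fun x => G1 x + G2 x).
  move=> cp; pose F t : R := sg * trunc c sg k t; pose dF t : R := dspos c (sg * t - k).
  have sF : smooth1 F.
    by move=> j; apply: Ck1M; [exact: Ck1_cst|exact: smooth1_trunc].
  have dFF t : is_derive t 1 F (dF t).
    apply: (is_derive_val (is_deriveZ sg (is_derive_trunc sg k t cp))).
    by rewrite /dtrunc /GRing.scale/= mulrA sgsg mul1r.
  have cdF : continuous dF.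
    by apply: (Ck1_cont (n := 0)); apply: (Ck1_affine (F := dspos c)) => /=; exact: dspos_continuous.
  have dF1 t : `|dF t| <= 1 by rewrite ger0_norm ?dspos_le1// dspos_ge0.
  have Fc t : `|F t| <= `|t| + `|k| by rewrite normrM sg1 mul1r; exact: trunc_norm_le.
  have M1 : 1 <= Num.max 1 Mz by rewrite le_max lexx.
  have zM x : `|z x| <= Num.max 1 Mz.
    by have /andP[z0 z1] := z01 x; rewrite ger0_norm// le_max z1.
  have dzM x i : `|partial i z x| <= Num.max 1 Mz by rewrite le_max dz orbT.
  have tF j : test_fun Omega (fun x => F (phi j x) * z x).
    case: suppz => [k0|[K [cK KO zK]]].
      by apply: (test_fun_comp (tphi j) sF _ sz); rewrite /F trunc0// mulr0.
    by have [sp _ _] := tphi j; exact: (test_fun_cutoff sp sF sz cK KO zK).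
  have ap := approx_comp oO OQ Hm ug sF dFF cdF dF1 Fc sz M1 zM dzM tF.
  have [Wv nv _ _ _] := approx_W1H0 oO OQ Hm ap.
  have mW : lmfun Omega (W c).
    apply: (lmf_comp (F := sexp c)); first exact: (lmf_affine). exact: sexp_continuous.
  have W0 x : 0 <= W c x := sexp_ge0 _ _.
  have W1 x : W c x <= 1 by exact: sexp_le1.
  have Wb x : Omega x -> `|W c x| <= 1 by move=> _; rewrite ger0_norm.
  have iW (v : vec -> R) : itg mu Omega v -> itg mu Omega (fun x => W c x * v x).
    move=> iv; apply: (@itg_eq _ _ _ mu _ (fun x => v x * W c x) _ mO); first by move=> x _; rewrite mulrC.
    exact: (itgM_bounded mO iv mW Wb).
  have Wout x : Omega x -> ~ above sg k x -> sg * u x - k <= 0.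
    by move=> Ox nA; rewrite subr_le0 leNgt; apply/negP => hk; exact: nA.
  have iWh := iW _ ih; have iWG1 := iW _ iG1; have iWG2 := iW _ iG2.
  (* Almost everywhere [lo] is below the left integrand of the equation and [hi] above the right
     one. *)
  pose lo x := 3 / 4 * (W c x * h x) - W c x * G2 x.
  pose hi x := 4^-1 * (W c x * h x) + W c x * G1 x.
  have ilo : itg mu Omega lo by apply: (itgB mO) => //; exact: (itgZ _ mO iWh).
  have ihi : itg mu Omega hi by apply: (itgD mO) => //; exact: (itgZ _ mO iWh).
  have lohi : Int mu Omega lo <= Int mu Omega hi.
    rewrite -lee_fin -(IntE mO ilo) -(IntE mO ihi).
    via (\int[mu]_(x in Omega) (dotp (A x (g x)) (nabla Omega (fun x => F (u x) * z x) x))%:E)%E.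
      apply: le_integral_ae; apply: (ae_imp2 ae2 nv) => x h2 hn Ox; rewrite lee_fin (hn Ox).
      have -> a b (v1 v2 : vec) : dotp (A x (g x)) (a *: v1 + b *: v2) =
          a * dotp (A x (g x)) v1 + b * dotp (A x (g x)) v2.
        rewrite /dotp !mulr_sumr -big_split; apply: eq_bigr => i _ /=; rewrite !mxE; ring.
      have [Ax|nA] := pselect (above sg k x); last first.
        have t0 := Wout x Ox nA.
        by rewrite /lo /W sexp_eq0// /dF dspos_eq0// /F /trunc spos_eq0// !(mul0r, mulr0, subrr, addr0).
      have {}h2 := h2 Ax; have co := Alog_coercive (g x) Ox.
      have tp : 0 <= sg * u x - k by case: Ax => _ /= /ltW; rewrite subr_ge0.
      have /andP[z0 z1] := z01 x; have Wx := W0 x.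
      have e1 : W c x * h x <= dF (u x) * z x * dotp (A x (g x)) (g x).
        rewrite -mulrA; apply: (ler_pM Wx (h0 x Ox)); first exact: dspos_ge.
        exact: (ler_wpM2l z0 co).
      have e2 : - (W c x * (4^-1 * h x + G2 x)) <= F (u x) * dotp (A x (g x)) (grad z x).
        rewrite lerNl; apply: le_trans (ler_norm _) _.
        rewrite normrN 2!normrM sg1 mul1r ger0_norm ?trunc_ge0// /trunc /spos -mulrA mulrCA.
        exact: (ler_wpM2l Wx h2).
      rewrite /lo; have := lerD e1 e2; apply: le_trans; apply: eq_ler.
      have -> (aa bb : R) : 3 / 4 * aa - bb = aa + - (4^-1 * aa + bb) by field.
      by congr (_ - _); rewrite (mulrDr (W c x)); congr (_ + _); exact: mulrCA.
    rewrite (eqn Wv); apply: le_integral_ae; apply: (ae_imp ae1) => x h1 Ox; rewrite lee_fin.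
    have [Ax|nA] := pselect (above sg k x); last first.
      have t0 := Wout x Ox nA.
      by rewrite /hi /W sexp_eq0// /F /trunc spos_eq0// !(mul0r, mulr0, addr0).
    have {}h1 := h1 Ax; have /andP[z0 z1] := z01 x.
    apply: le_trans (ler_norm _) _; rewrite 3!normrM sg1 mul1r (ger0_norm (trunc_ge0 _ _ _ _)) (ger0_norm z0).
    have -> : `|f x (u x) (g x)| * (trunc c sg k (u x) * z x) =
      W c x * (`|f x (u x) (g x)| * (sg * u x - k) * z x) by rewrite /trunc /spos /W; ring.
    apply: le_trans (ler_wpM2l (W0 x) h1) _; rewrite mulrDr /hi mulrCA //.
  move: lohi; rewrite (IntB mO (itgZ _ mO iWh) iWG2) (IntD mO (itgZ _ mO iWh) iWG1).
  rewrite !(IntZ _ mO iWh).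
  have rs (v : vec -> R) : Int mu Omega (fun x => W c x * v x) = Int mu (above sg k) (fun x => W c x * v x).
    by apply: (@IntS_restrict _ _ _ mu Omega _ _ mO m1 sub) => x Ox nA; rewrite /W sexp_eq0 ?mul0r//; exact: Wout.
  have le1 (v : vec -> R) : itg mu Omega v -> (forall x, Omega x -> 0 <= v x) ->
      Int mu Omega (fun x => W c x * v x) <= Int mu (above sg k) v.
    move=> iv v0; rewrite rs; apply: (le_Int m1 (itgS mO m1 sub (iW v iv)) (itgS mO m1 sub iv)) => x Ax.
    exact: (ler_piMl (v0 x (sub x Ax)) (W1 x)).
  rewrite -rs (IntD m1 (itgS mO m1 sub iG1) (itgS mO m1 sub iG2)).
  have l1 := le1 _ iG1 G10; have l2 := le1 _ iG2 G20.
  have aux (a b d a1 a2 : R) : d <= a1 -> b <= a2 -> 3 / 4 * a - b <= 4^-1 * a + d -> a <= 2 * (a1 + a2).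
    lra.
  exact: aux l1 l2.
have mWj j : lmfun Omega (W j.+1%:R^-1).
  apply: (lmf_comp (F := sexp j.+1%:R^-1)); first exact: (lmf_affine).
  by apply: sexp_continuous; rewrite invr_gt0.
have jp j : 0 < (j.+1%:R^-1 : R) by rewrite invr_gt0.
have ij j : itg mu (above sg k) (fun x => W j.+1%:R^-1 x * h x).
  apply: (itgS mO m1 sub); apply: (itg_le mO _ _ ih); first by apply: (lmfM mO (mWj j)); exact: itg_mfun ih.

  move=> x Ox; rewrite normrM (ger0_norm (h0 x Ox)) (ger0_norm (sexp_ge0 _ _)).
  exact: (ler_piMl (h0 x Ox) (sexp_le1 _ (jp j))).
have [] := Int_fatou m1 ij (itg_mfun (itgS mO m1 sub ih)) _ _ (fun j => step _ (jp j)) => //.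
- by move=> j x [Ox _]; exact: (mulr_ge0 (sexp_ge0 _ _) (h0 x Ox)).
- apply: ae_all => x [Ox /= kx]; rewrite -[X in _ --> X](mul1r (h x)); apply: cvgM; last exact: cvg_cst.
  by have := @sexp_cvg R (sg * u x - k); rewrite subr_gt0 kx.
Qed.

(** * Boundedness of the solution *)

Variable Cf : R.
Hypothesis Cf0 : 0 < Cf.
Hypothesis fg : {ae mu, forall x, Omega x -> forall t xi, `|f x t xi| <= Cf * growth x t xi}.

Lemma above_pos (sg k : R) x : `|sg| = 1 -> 0 <= k -> above sg k x ->
  `|u x| = sg * u x /\ pos_part sg 0 x = sg * u x.
Proof.
move=> sg1 k0 [_ /= kx]; have s0 : 0 <= sg * u x := le_trans k0 (ltW kx).
split; last by rewrite /pos_part subr0 max_r.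
by rewrite -[LHS]mul1r -sg1 -normrM ger0_norm.
Qed.

Lemma itg_u : itg mu Omega u.
Proof.
by have [_ _ _ _ []] := W1u.
Qed.

(** The cut-off is 1. With e = 1/(4 Cf) in [growth_ctl], the gradient part of f times u is at most a
    quarter of the energy density. *)
Lemma caccioppoli_level : exists2 C, 0 <= C & forall sg k : R, `|sg| = 1 -> 0 <= k ->
  level_energy sg k <= C * Int mu (above sg k) (fun x => Bx x (pos_part sg 0 x) + `|u x|).
Proof.
have e0 : 0 < 4^-1 / Cf by rewrite divr_gt0.
have [C1 C10 hC1] := growth_ctl e0; have [Ce Ce0 hE] := emb_level.
have n1 : 1 <= n by have := dp_n2; lra.
pose D : R := n ^+ N.+1; have D0 : 0 <= D by rewrite exprn_ge0.
exists (1 + D * (2 * (Cf * C1))); first pos.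
move=> sg k sg1 k0; have m1 := above_mset sg k.
have sub : above sg k `<=` Omega by move=> x [].
have [iB _] := hE sg 0 sg1 (lexx 0); have iu := itg_u; have iau := itg_norm mO iu.
pose b x := Bx x (pos_part sg 0 x) + `|u x|.
have ib : itg mu Omega b by exact: (itgD mO iB iau).
have b0 x : 0 <= b x by exact: (addr_ge0 (Bx_ge0 _ _) (normr_ge0 _)).
have sz : smooth (fun _ : vec => 1 : R) := smooth_cst 1.
have z01 (x : vec) : 0 <= (1 : R) <= 1 by rewrite ler01 lexx.
have dz x i : `|partial i (fun _ : vec => 1 : R) x| <= 0 by rewrite partial_cst normr0.
have K0 : 0 <= Cf * C1 by rewrite mulr_ge0// ltW.
have ET := energy_test sg1 sz z01 dz (or_introl k0) (itgZ (Cf * C1) mO ib) (itg_cst 0 mO Ooo)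
  (fun x _ => mulr_ge0 K0 (b0 x)) (fun x _ => lexx 0).
lapply ET; last first.
  apply: (ae_imp fg) => x hf Ax; have Ox := sub x Ax; have [au pu] := above_pos sg1 k0 Ax.
  rewrite mulr1 mul1r; have := hC1 x (u x) (g x) Ox; rewrite -(ler_pM2l Cf0) => h.
  have g1 := hf Ox (u x) (g x).
  have tk : sg * u x - k <= `|u x| by rewrite au gerBl.
  have tk0 : 0 <= sg * u x - k by case: Ax => _ /= /ltW; rewrite subr_ge0.
  have aux (F' k' G' a c hh b' : R) : 0 <= F' -> 0 <= k' -> F' <= Cf * G' -> k' <= a ->
      Cf * (G' * a) <= Cf * (4^-1 / Cf * hh + c * b') -> F' * k' <= 4^-1 * hh + Cf * c * b'.
    move=> F0 k'0 FG ka; have -> : Cf * (4^-1 / Cf * hh + c * b') = 4^-1 * hh + Cf * c * b'.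
      by field; rewrite gt_eqF.
    by apply: le_trans; rewrite mulrA; exact: ler_pM.
  by have := aux _ _ _ _ _ _ _ (normr_ge0 _) tk0 g1 tk h; rewrite /b pu au.
move=> {}ET; lapply ET; last first.
  apply: ae_all => x Ax; have -> : grad (fun _ : vec => 1 : R) x = 0.
    by apply/rowP => i; rewrite !mxE partial_cst.
  have -> : dotp (A x (g x)) 0 = 0 by rewrite /dotp big1// => i _; rewrite [X in _ * X]mxE mulr0.
  rewrite normr0 mulr0.
  by rewrite mul1r addr0; exact: (mulr_ge0 _ (mod_ge0 Hm (sub x Ax) (enorm_ge0 _))).
have ibA := itgS mO m1 sub ib.
have iHe := itgS mO m1 sub (itg_Henorm).
have -> : Int mu (above sg k) (fun x => 1 * H x (enorm (g x))) = Int mu (above sg k) (fun x => H x (enorm (g x))).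
  by apply: eq_Int => x _; rewrite mul1r.
have -> : Int mu (above sg k) (fun x => Cf * C1 * b x + 0) = Cf * C1 * Int mu (above sg k) b.
  by rewrite -(IntZ _ m1 ibA); apply: eq_Int => x _; rewrite addr0.
set I := Int mu (above sg k) (fun x => H x (enorm (g x))); set J := Int mu (above sg k) b => hI.
have J0 : 0 <= J by apply: Int_ge0.
have iau1 := itgS mO m1 sub iau.
have [_ _ _ Hg _] := W1u.
have i1 : itg mu (above sg k) (fun x => sg * u x + H x (norm1 (g x))).
  by apply: (itgS mO m1 sub); apply: (itgD mO _ Hg); exact: (itgZ _ mO iu).
have i2 : itg mu (above sg k) (fun x => b x + D * H x (enorm (g x))).
  by apply: (itgD m1 ibA); exact: (itgZ _ m1 iHe).
via (J + D * I).
  rewrite -(IntZ _ m1 iHe) -(IntD m1 ibA (itgZ _ m1 iHe)); apply: (le_Int m1 i1 i2) => x Ax.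
  have Ox := sub x Ax; have [au pu] := above_pos sg1 k0 Ax; apply: lerD.
    by rewrite /b au lerDr; exact: Bx_ge0.
  apply: le_trans (mod_le Hm Ox (norm1_ge0 _) (norm1_enorm _)) _.
  exact: (mod_dil Hm Ox n1 (enorm_ge0 _)).
rewrite mulrDl mul1r lerD2l -mulrA; apply: (ler_wpM2l D0); apply: le_trans hI _.
by rewrite mulrA.
Qed.

Lemma Bx_ge x t : Omega x -> 1 <= t -> t <= Bx x t.
Proof.
move=> Ox t1; have [ps1 _] := ps_bounds Ox; have t0 : 0 <= t by lra.
have := le1r_powR t1 ps1; rewrite /Bx /Bf => h; apply: le_trans h _.
by rewrite lerDl powR_ge0.
Qed.

(** Above h > k >= 1, dilation bounds B(sg u) by (h/(h-k))^mB B(sg u - k). With the embedding and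
    the energy estimate this gives Z h <= C (h/(h-k))^mB (Z k)^ns, a superlinear recursion because
    ns = 1 + 1/(n - 1). *)
Lemma upper_bound (sg : R) : `|sg| = 1 ->
  exists2 K, 1 <= K & {ae mu, forall x, Omega x -> sg * u x <= K}.
Proof.
move=> sg1; have [Ce Ce0 hE] := emb_level; have [Cc Cc0 hC] := caccioppoli_level.
have [iB _] := hE sg 0 sg1 (lexx 0); have iu := itg_u; have iau := itg_norm mO iu.
pose b x := Bx x (pos_part sg 0 x); pose Z k := Int mu (above sg k) b.
have m1 k := above_mset sg k.
have sub k : above sg k `<=` Omega by move=> x [].
have ib k : itg mu (above sg k) b := itgS mO (m1 k) (sub k) iB.
have b0 x : 0 <= b x by exact: Bx_ge0.
have Z0 k : 0 <= Z k by apply: Int_ge0.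
have mono k h : k <= h -> Z h <= Z k.
  move=> kh; apply: (IntS (m1 k) (m1 h) _ (ib k)) => // x [Ox /= hx]; split => //.
  exact: le_lt_trans kh hx.
have nn2 := n2; have s1 := ns_ge1; have s0 := ns_gt0.
pose C3 := Ce * (Cc * 2) + 1; have C30 : 0 < C3 by rewrite ltr_wpDl// !mulr_ge0.
have step k h : 1 <= k -> k < h -> Z h <= (h / (h - k)) ^+ mB * (C3 * Z k) `^ ns.
  move=> k1 kh; have k0 : 0 <= k by lra.
  have [iBk hB] := hE sg k sg1 k0.
  have hk : 0 < h - k by rewrite subr_gt0.
  have h0 : 0 <= h by lra.
  have l1 : 1 <= h / (h - k) by rewrite ler_pdivlMr// mul1r gerBl.
  have l0 : 0 <= (h / (h - k)) ^+ mB by exact: (exprn_ge0 _ (le_trans ler01 l1)).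
  via ((h / (h - k)) ^+ mB * Int mu Omega (fun x => Bx x (pos_part sg k x))).
    rewrite -(IntZ _ mO iBk); via (Int mu (above sg h) (fun x => (h / (h - k)) ^+ mB * Bx x (pos_part sg k x))).
      apply: (le_Int (m1 h) (ib h)); first exact: (itgS mO (m1 h) (sub h) (itgZ _ mO iBk)).
      move=> x Ax; have Ox := sub h x Ax; have [_ pu] := above_pos sg1 h0 Ax.
      rewrite /b pu; have [_ /= hx] := Ax. have s0' : 0 <= sg * u x by lra.
      apply: le_trans (Bx_dil Ox l1 (pos_part_ge0 sg k x)); apply: (Bx_le Ox s0').
      rewrite /pos_part max_r; last lra.
      rewrite mulrAC ler_pdivlMr//; have := mulr_ge0 k0 (ltW (_ : 0 < sg * u x - h)); rewrite subr_gt0 => /(_ hx).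
      pos.
    apply: (IntS mO (m1 h) (sub h) (itgZ _ mO iBk)) => x Ox; exact: (mulr_ge0 l0 (Bx_ge0 _ _)).
  apply: (ler_wpM2l l0); apply: le_trans hB _.
  have L0 : 0 <= level_energy sg k.
    apply: Int_ge0 => x [Ox /= kx]; apply: (addr_ge0 _ (mod_ge0 Hm Ox (norm1_ge0 _))). pos.
  apply: powR_le; [pos|pos|].
  have hI : Int mu (above sg k) (fun x => Bx x (pos_part sg 0 x) + `|u x|) <= 2 * Z k.
    rewrite -(IntZ _ (m1 k) (ib k)); apply: (le_Int (m1 k)).
    - exact: (itgD (m1 k) (ib k) (itgS mO (m1 k) (sub k) iau)).
    - exact: (itgZ _ (m1 k) (ib k)).
    move=> x Ax; have Ox := sub k x Ax; have [au pu] := above_pos sg1 k0 Ax.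
    have [_ /= kx] := Ax; have t1 : 1 <= sg * u x by lra.
    have := Bx_ge Ox t1; rewrite /b pu au; set bb := Bx x _ => hb; lra.
  have h1 := le_trans (hC sg k sg1 k0) (ler_wpM2l Cc0 hI).
  apply: le_trans (ler_wpM2l Ce0 h1) _; have Zk := Z0 k.
  have -> : Ce * (Cc * (2 * Z k)) = Ce * (Cc * 2) * Z k by ring.
  by rewrite ler_wpM2r// /C3 lerDl.
pose al : R := (n - 1)^-1.
have al0 : 0 < al by rewrite invr_gt0; lra.
have nsE : ns = 1 + al by rewrite /al; field; lra.
pose b2 : R := 2 ^+ mB.+1; have b21 : 1 < b2 by rewrite exprn_egt1//; lra.
pose C4 : R := 4 ^+ mB * C3 `^ ns; have C40 : 0 < C4 by rewrite mulr_gt0// powR_gt0.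
pose thr : R := (C4 * b2 `^ al^-1) `^ (- al^-1).
have thr0 : 0 < thr.
  rewrite /thr powR_gt0// mulr_gt0// powR_gt0//; exact: lt_trans ltr01 b21.
have [dl dl0 hdl] := Int_abs_small mO Ooo iB thr0.
(* By Markov's inequality the set above K is so small that [Z K] is below the threshold of
   [fast_geometric]. *)
pose K := Num.max 1 (Int mu Omega (fun x => `|u x|) / dl); have K1 : 1 <= K by rewrite le_max lexx.
have ZK : Z K <= thr.
  have -> : Z K = Int mu (above sg K) (fun x => `|Bx x (pos_part sg 0 x)|).
    by apply: eq_Int => x _; rewrite (ger0_norm (b0 x)).
  apply: (hdl (above sg K) (m1 K) (sub K)).
  have Kp : 0 < K by exact: lt_le_trans ltr01 K1.
  have fin : (mu (above sg K) < +oo)%E.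
    by apply: le_lt_trans Ooo; apply: le_measure; rewrite ?inE//; exact: m1.
  have IM := @Int_markov _ _ _ mu Omega (above sg K) _ K mO (m1 K) (sub K) iau fin (fun x _ => normr_ge0 _).
  lapply IM; last first.
    by move=> x Ax; have [-> _] := above_pos sg1 (ltW Kp) Ax; case: Ax => _ /= /ltW.
  rewrite mulrC -ler_pdivlMr// => /le_trans; apply; rewrite ler_pdivrMr//.
  by rewrite mulrC -ler_pdivrMr// le_max lexx orbT.
(* The levels rise from K to 2 K, so the limit of the recursion shows that [Z (K * 2)] is 0. *)
pose kj j : R := K * (2 - 2^-1 ^+ j); pose y j := Z (kj j).
have h2 j : 0 < (2^-1 : R) ^+ j by rewrite exprn_gt0//.
have h21 j : (2^-1 : R) ^+ j <= 1 by rewrite exprn_ile1//; lra.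
have ystep j : y j.+1 <= C4 * b2 ^+ j * y j `^ (1 + al).
  have kj1 : 1 <= kj j.
    by rewrite /kj -[leLHS]mulr1; apply: ler_pM => //; have := h21 j; lra.
  have kd : kj j.+1 - kj j = K * 2^-1 ^+ j.+1 by rewrite /kj exprS; field.
  have Kp : 0 < K by exact: lt_le_trans ltr01 K1.
  have kjj : kj j < kj j.+1 by rewrite -subr_gt0 kd mulr_gt0.
  apply: le_trans (step _ _ kj1 kjj) _; rewrite -nsE.
  have -> : C4 * b2 ^+ j * y j `^ ns = (4 * 2 ^+ j) ^+ mB * (2 ^+ j * (C3 * Z (kj j)) `^ ns).
    rewrite (powRM _ (ltW C30) (Z0 _)) /C4 /b2 /y exprMn -!exprM mulSn exprD [(mB * j)%N]mulnC; ring.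
  have ratio : kj j.+1 / (kj j.+1 - kj j) <= 4 * 2 ^+ j.
    rewrite kd ler_pdivrMr ?mulr_gt0//. have -> : 4 * 2 ^+ j * (K * 2^-1 ^+ j.+1) = K * 2.
      rewrite exprS exprVn; field; rewrite gt_eqF// exprn_gt0//.
    by rewrite /kj ler_wpM2l ?(ltW Kp)// gerBl ltW.
  have r0' : 0 <= kj j.+1 / (kj j.+1 - kj j) by apply: divr_ge0; [pos|rewrite subr_ge0 ltW].
  apply: ler_pM; [pos|pos| |].
    by apply: lerXn2r; rewrite ?nnegrE// (le_trans r0' ratio).
  by apply: ler_peMl; [pos|rewrite exprn_ege1//; lra].
have y0 : y 0%N <= thr by rewrite /y /kj expr0 [2 - 1](_ : _ = 1) ?mulr1//; lra.
have cy := fast_geometric C40 b21 al0 (fun j => Z0 _) ystep y0.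
exists (K * 2); first pos.
have Z2 : Z (K * 2) = 0.
  apply/eqP; rewrite eq_le Z0 andbT; apply/ler_addgt0Pl => e e0; rewrite addr0.
  have [j _ /(_ j (leqnn j)) hj] := cvgr_le _ cy _ e0.
  apply: le_trans hj; apply: mono; rewrite /kj.
  by rewrite ler_wpM2l ?(le_trans ler01 K1)// gerBl ltW.
have := Int_eq0_ae (m1 (K * 2)) (ib (K * 2)) (fun x _ => b0 x) Z2; move=> h; apply: (ae_imp h) => x hx Ox.
rewrite leNgt; apply/negP => lt; have Ax : above sg (K * 2) x by [].
have K20 : 0 <= K * 2 by lra.
have [_ pu] := above_pos sg1 K20 Ax.
have t1 : 1 <= sg * u x by lra.
by have := Bx_ge Ox t1; rewrite -{2}pu -/(b x) (hx Ax); lra.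
Qed.

Lemma solution_bounded : exists2 K, 1 <= K & {ae mu, forall x, Omega x -> `|u x| <= K}.
Proof.
have [K K1 hK] := upper_bound (normr1 R); have [K' K'1 hK'] := upper_bound (normrN1 R).
exists (K + K'); first pos.
apply: (ae_imp2 hK hK') => x h h' Ox; rewrite ler_norml.
have := h Ox; have := h' Ox; rewrite mul1r mulN1r => *; lra.
Qed.

(** * Local estimates for the gradient *)

Implicit Type c : vec.

Definition level_step (sg k d : R) x : R := smst k d (sg * ext0 Omega u x).
Definition level_slope (sg k d : R) x : R :=
  dsm k d (sg * ext0 Omega u x) * ext0 Omega (fun x => norm1 (g x)) x.

Lemma level_slope_ge0 sg k d x : 0 <= level_slope sg k d x.
Proof.
apply: mulr_ge0; first exact: dsm_ge0.
by rewrite /ext0; case: ifP => // _; exact: norm1_ge0.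
Qed.

Lemma sobolev_test psi : test_fun Omega psi ->
  exists L, sobolev_pair psi (fun x => norm1 (grad psi x)) L.
Proof.
move=> tp; have [sp _ _] := tp; have [K K0 hK] := test_bounded tp.
exists (N%:R * K); split.
- move=> x; have := smooth_slope x sp; apply: slope_le.
  by apply: ler_sum => i _; rewrite mxE.
- move=> x; rewrite norm1_ge0/=.
  via (\sum_(i < N) K); last by rewrite sumr_const card_ord mulr_natl.
  by apply: ler_sum => i _; rewrite mxE; have [_ ->] := hK x.
- apply: mfun_norm1 => i; rewrite (_ : (fun x => _) = partial i psi); last by apply/funext => x; rewrite mxE.
  exact: (continuous_mfun (smooth_cont (smooth_partial i sp)) measurableT).
Qed.

(** The inequality holds for the same truncation of the approximating test functions. The
    truncations are bounded by d and the slopes have an integrable majorant, so both sides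
    converge. *)
Lemma level_poincare (sg k d : R) : `|sg| = 1 -> 0 < d ->
  poincare_pair (level_step sg k d) (level_slope sg k d).
Proof.
move=> sg1 d0 c r rp; have [mu_ mg tphi iPhi ae0] := ug.
have mQ : mset (cube c r) := cube_mset c r; have V0 := vol_gt0 rp.
pose psi i x := sg * phi i x.
have tpsi i : test_fun Omega (psi i) by exact: test_funZ.
pose v_ i x := smst k d (psi i x); pose G_ i x := dsm k d (psi i x) * norm1 (grad (psi i) x).
have PP i : poincare_pair (v_ i) (G_ i).
  by have [L hL] := sobolev_test (tpsi i); exact: sobolev_poincare (sobolev_pair_smst k d0 hL).
set v := level_step sg k d; set G := level_slope sg k d.
have c_smst : continuous (smst k d) by exact: smst_continuous.
have c_dsm : continuous (dsm k d) by exact: dsm_continuous.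
have outx i x : ~ Omega x -> psi i x = 0 /\ norm1 (grad (psi i) x) = 0.
  move=> nO; have [_ _ sO] := tpsi i; have nS : ~ support_of (psi i) x by move=> /sO.
  have [-> hp] := support_vanish nS; split => //.
  by rewrite /norm1 big1// => j _; rewrite mxE hp normr0.
have mub D : mset D -> lmfun D (fun x => sg * ext0 Omega u x).
  by move=> mD; apply: (lmfZ _ mD); exact: lmf_ext0.
have mv : lmfun (cube c r) v by exact: (lmf_comp (mub _ mQ) c_smst).
have mG : lmfun (cube c r) G.
  apply: (lmfM mQ); first exact: (lmf_comp (mub _ mQ) c_dsm).
  by apply: (lmf_ext0 mO mQ); exact: mfun_norm1.
have cpsi : {ae mu, forall x, psi i x @[i --> \oo] --> sg * ext0 Omega u x}.
  apply: (ae_imp ae0) => x hx; have [Ox|nO] := pselect (Omega x).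
    have [cu _ _] := hx Ox; rewrite ext0_in//; apply: cvgMr; exact: cu.
  by rewrite ext0_out// mulr0; apply: cvg_near_cst; apply: nearW => i; have [] := outx i x nO.
have cv : {ae mu, forall x, cube c r x -> v_ ^~ x @ \oo --> v x}.
  by apply: (ae_imp cpsi) => x hx _; exact: (cvg_continuous c_smst hx).
have nE i x : norm1 (grad (psi i) x) = norm1 (grad (phi i) x).
  by have [sp _ _] := tphi i; rewrite gradZ// norm1Z sg1 mul1r.
have cG : {ae mu, forall x, cube c r x -> G_ ^~ x @ \oo --> G x}.
  apply: (ae_imp2 cpsi ae0) => x hx ax _; apply: cvgM; first exact: (cvg_continuous c_dsm hx).
  have [Ox|nO] := pselect (Omega x).
    have [_ cg _] := ax Ox; rewrite ext0_in//.
    rewrite (_ : (fun i => _) = (fun i => norm1 (grad (phi i) x))); last by apply/funext => i; rewrite nE.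
    apply: norm1_cvg => j; have := cg j; apply: cvg_trans; apply: near_eq_cvg; apply: nearW => i.
    by rewrite mxE.
  by rewrite ext0_out//; apply: cvg_near_cst; apply: nearW => i; have [] := outx i x nO.
have v01 i x : `|v_ i x| <= d by rewrite ger0_norm ?smst_ge0// smst_le.
have iv i : itg mu (cube c r) (v_ i) by have [] := PP i c r rp.
have iG i : itg mu (cube c r) (G_ i) by have [] := PP i c r rp.
have id : itg mu (cube c r) (fun=> d) := itg_cst d mQ (leb_cube_fin c r).
have iDom : itg mu (cube c r) (fun x => 2 * ext0 Omega (fun x => 1 + Phi x) x).
  apply: (itgZ _ mQ); apply: (itg_ext0 mO mQ); apply: (itgD mO) => //.
  exact: itg_cst mO (Omega_fin OQ).
have [iV cV] := Int_dominated mQ (fun i => itg_mfun (iv i)) mv cv id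
  (ae_all mu (fun x _ i => v01 i x)).
have Gdom : {ae mu, forall x, cube c r x -> forall i, `|G_ i x| <= 2 * ext0 Omega (fun x => 1 + Phi x) x}.
  apply: (ae_imp ae0) => x ax _ i; have [Ox|nO] := pselect (Omega x); last first.
    by rewrite ext0_out// /G_; have [_ ->] := outx i x nO; rewrite !mulr0 normr0.
  have [_ _ /(_ i) hP] := ax Ox; rewrite ext0_in// /G_ nE normrM.
  have n0 := norm1_ge0 (grad (phi i) x); rewrite (ger0_norm n0) (ger0_norm (dsm_ge0 _ _ _)).
  apply: (ler_pM (dsm_ge0 _ _ _) n0 (dsm_le _ _ _)).
  apply: le_trans (mod_low Hm Ox n0) _; rewrite lerD2l; apply: le_trans hP.
  by rewrite lerDr; exact: (mod_ge0 Hm Ox (normr_ge0 _)).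
have [iGG cGG] := Int_dominated mQ (fun i => itg_mfun (iG i)) mG cG iDom Gdom.
split => //.
have cavg : avg (v_ i) c r @[i --> \oo] --> avg v c r by apply: cvgMl; exact: cV.
have avg_le i : `|avg (v_ i) c r| <= d.
  rewrite /avg normrM [X in _ * X]ger0_norm ?invr_ge0 ?(ltW V0)// ler_pdivrMr//.
  apply: le_trans (Int_norm mQ (iv i)) _; rewrite -(Int_cst_cube c r d).
  by apply: (le_Int mQ (itg_norm mQ (iv i)) id) => x _; exact: v01.
have ia a : itg mu (cube c r) (fun=> a) := itg_cst a mQ (leb_cube_fin c r).
have [_ cI] : itg mu (cube c r) (fun x => `|v x - avg v c r|) /\
    Int mu (cube c r) (fun x => `|v_ i x - avg (v_ i) c r|) @[i --> \oo] -->
    Int mu (cube c r) (fun x => `|v x - avg v c r|).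
  apply: (Int_dominated mQ _ _ _ (ia (d + d))).
  - by move=> i; exact: (itg_mfun (itg_norm mQ (itgB mQ (iv i) (ia _)))).
  - exact: (itg_mfun (itg_norm mQ (itgB mQ iV (ia _)))).
  - apply: (ae_imp cv) => x hx Qx; apply: cvg_norm; apply: cvgB cavg; exact: hx.
  - by apply: ae_all => x _ i; rewrite normr_id; exact: (le_trans (ler_normB (v_ i x) _) (lerD (v01 i x) (avg_le i))).
have cR : 2 ^+ N * r * Int mu (cube c r) (G_ i) @[i --> \oo] --> 2 ^+ N * r * Int mu (cube c r) G.
  by apply: cvgMr; exact: cGG.
by apply: (ler_cvg_to cI cR); apply: nearW => i; have [] := PP i c r rp.
Qed.

(** If c tau <= z s / 4, the hypothesis alone gives the first term. Otherwise s < s' = 4 c tau / z;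
    shrinking from s' to s and dilating from tau to s' produces z^-(N+1), which is cancelled by z^N
    and the quotient s / s'. This is why cut-offs are raised to the power N + 1. *)
Lemma absorb x (D s c tau z : R) : Omega x -> 0 <= s -> 1 <= c -> 0 < tau -> 0 <= z <= 1 ->
  (s = 0 -> D = 0) -> D * s <= c * H x s * (z ^+ N * tau) ->
  D <= 4^-1 * (z ^+ N.+1 * H x s) + 4^-1 * (c / 4^-1) ^+ N.+1 * H x tau.
Proof.
move=> Ox s0 c1 t0 /andP[z0 z1] D0 hD.
have Hs : 0 <= H x s := mod_ge0 Hm Ox s0; have Ht : 0 <= H x tau := mod_ge0 Hm Ox (ltW t0).
have R0 : 0 <= 4^-1 * (c / 4^-1) ^+ N.+1 * H x tau.
  pos.
have L0 : 0 <= 4^-1 * (z ^+ N.+1 * H x s) by rewrite !mulr_ge0 ?exprn_ge0// invr_ge0.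
move: s0; rewrite le_eqVlt => /orP[/eqP s0|s0].
  pos.
move: z0; rewrite le_eqVlt => /orP[/eqP z0|z0].
  have N0 : N != 0%N by rewrite -lt0n (ltn_trans _ N_gt1).
  have : D * s <= 0 by apply: le_trans hD _; rewrite -z0 expr0n (negbTE N0) mul0r mulr0.
  by rewrite pmulr_lle0// => h; apply: le_trans h (addr_ge0 _ _).
have [h|h] := leP (c * tau) (4^-1 * z * s).
  apply: le_trans (_ : 4^-1 * (z ^+ N.+1 * H x s) <= _); last by rewrite lerDl.
  rewrite -(ler_pM2r s0); apply: le_trans hD _.
  have := ler_wpM2l (mulr_ge0 Hs (exprn_ge0 N (ltW z0))) h.
  by rewrite exprS; lra.
pose s' := c * tau / (4^-1 * z); have q0 : 0 < 4^-1 * z by rewrite mulr_gt0// invr_gt0.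
have s'0 : 0 < s' by rewrite divr_gt0// mulr_gt0; lra.
have ss' : s <= s' by rewrite /s' ler_pdivlMr// mulrC ltW.
have shr : H x s <= s / s' * H x s'.
  have -> : H x s = H x (s / s' * s') by rewrite divfK// gt_eqF.
  apply: (mod_shrink Hm Ox); [pos| |pos].
  by rewrite ler_pdivrMr// mul1r.
have dil : H x s' <= (c / (4^-1 * z)) ^+ N.+1 * H x tau.
  rewrite /s' mulrAC; apply: (mod_dil Hm Ox) => //; last pos.
  by rewrite ler_pdivlMr// mul1r; apply: le_trans c1; apply: mulr_ile1 => //; rewrite ?(ltW z0)// invf_le1// ler1n.
apply: le_trans (_ : 4^-1 * (c / 4^-1) ^+ N.+1 * H x tau <= _); last by rewrite lerDr.
rewrite -(ler_pM2r s0); apply: le_trans hD _.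
have k0 : 0 <= c * (z ^+ N * tau) by rewrite !mulr_ge0 ?exprn_ge0; lra.
have := ler_wpM2l k0 (le_trans shr (ler_wpM2l (_ : 0 <= s / s') dil)).
move=> /(_ (divr_ge0 (ltW s0) (ltW s'0))).
have -> : c * (z ^+ N * tau) * H x s = c * H x s * (z ^+ N * tau) by ring.
move=> /le_trans; apply; apply: eq_ler.
have -> : (c / (4^-1 * z)) ^+ N.+1 = (c / 4^-1) ^+ N.+1 * (z ^+ N.+1)^-1.
  by rewrite -exprVn -exprMn invfM mulrA.
rewrite /s' !exprS; have zN : z ^+ N != 0 by rewrite expf_neq0// gt_eqF.
set X := (c / 4^-1) ^+ N; have z' : z != 0 by rewrite gt_eqF.
have c' : c != 0 by lra.
have t' : tau != 0 by rewrite gt_eqF.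
by field; rewrite zN z' c' t'.
Qed.

Lemma Hx_ge1 x t : Omega x -> 1 <= t -> 1 <= H x t.
Proof.
move=> Ox t1; have [p1 pn q1 qn w0] := dp_bounds Ox; have t0 : 0 <= t by lra.
via (t `^ p x); first by apply: le_trans t1 (le1r_powR t1 (ltW p1)).
by rewrite HlogE /Hf lerDl (Zx_ge0 Ox t0).
Qed.

Lemma Hx_super x l t : Omega x -> 1 <= l -> 0 <= t -> l `^ P0 * H x t <= H x (l * t).
Proof.
move=> Ox l1 t0; have [p1 pn q1 qn w0] := dp_bounds Ox; have [Pp pq _ _ _] := dp_adm S Ox.
have l0 : 0 <= l by lra.
have d1 := delta1; have e0 := eta0.
rewrite !HlogE /Hf /Zf (powRM _ l0 t0) (powRM (q x) l0 t0) mulrDr; apply: lerD.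
  by apply: ler_wpM2r; [pos|apply: ler_powR].
have LL : Lg delta eta t <= Lg delta eta (l * t) by apply: Lg_le => //; rewrite ler_peMl.
have lq : l `^ P0 <= l `^ q x by apply: ler_powR => //; lra.
have Lt : 0 <= Lg delta eta t by exact: Lg_ge0.
have -> : w x * (l `^ q x * t `^ q x) * Lg delta eta (l * t) =
  w x * t `^ q x * (l `^ q x * Lg delta eta (l * t)) by ring.
have -> : l `^ P0 * (w x * t `^ q x * Lg delta eta t) =
  w x * t `^ q x * (l `^ P0 * Lg delta eta t) by ring.
apply: ler_wpM2l; first pos.
by apply: ler_pM => //; exact: powR_ge0.
Qed.

(** For s > lam sg, the quotient H(s)/H(sg) is at least (s/sg)^P0; one power is kept and the others
    are at least lam^(P0-1). Energy is turned into an L^1 bound in this way, with a factor that is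
    small for large lam. *)
Lemma large_gradient x (sg lam s : R) : Omega x -> 1 <= sg -> 1 <= lam -> 0 <= s ->
  s <= lam * sg + lam `^ (1 - P0) * sg * (H x s / H x sg).
Proof.
move=> Ox sg1 lam1 s0; have sg0 : 0 < sg by lra.
have Hs1 := Hx_ge1 Ox sg1; have Hs0 : 0 < H x sg by lra.
have l0 : 0 <= lam `^ (1 - P0) := powR_ge0 _ _.
have Hq : 0 <= H x s / H x sg by apply: divr_ge0; [exact: (mod_ge0 Hm Ox)|pos].
have R0 : 0 <= lam `^ (1 - P0) * sg * (H x s / H x sg) by exact: (mulr_ge0 (mulr_ge0 l0 (ltW sg0)) Hq).
have [h|h] := leP s (lam * sg); first by rewrite ler_wpDr.
apply: le_trans (_ : lam `^ (1 - P0) * sg * (H x s / H x sg) <= _); last first.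
  by rewrite lerDr mulr_ge0; lra.
pose l := s / sg; have lE : s = l * sg by rewrite divfK// gt_eqF.
have ll : lam <= l by rewrite ler_pdivlMr// ltW.
have l1 : 1 <= l by lra.
have := Hx_super Ox l1 (ltW sg0); rewrite -lE -ler_pdivlMr// => hs.
apply: le_trans (ler_wpM2l _ hs); last pos.
rewrite {1}lE [leRHS]mulrAC; apply: (ler_wpM2r (ltW sg0)).
have lp : 0 < l by lra.
have -> : l `^ P0 = l * l `^ (P0 - 1).
  by rewrite -{2}(powRr1 (ltW lp)) -powRD_pos// addrC subrK.
rewrite mulrCA ler_peMr ?(ltW lp)//.
have lamp : 0 < lam by lra.
via (lam `^ (1 - P0) * lam `^ (P0 - 1)).
  by rewrite -powRD_pos// addrA subrK subrr powRr0.
apply: (ler_wpM2l l0); apply: powR_le; [have := P01; lra|lra|exact: ll].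
Qed.

Variable M0 : R.
Hypothesis M01 : 1 <= M0.

(** The exponents at x and y differ by at most 2 La r, and sg^r <= exp(r sg) is bounded. The
    variation of mu adds at most a multiple of r sg^q times the logarithm: here r sg is bounded, and
    q - 1 + gap <= p leaves room for the logarithm below sg^p. *)
Lemma Hx_compare : exists2 K, 1 <= K & forall x y r sg, Omega x -> Omega y -> `|x - y| <= 2 * r ->
  0 < r -> r <= 1 -> 1 <= sg -> sg * r <= 2 * M0 -> H x sg <= K * H y sg.
Proof.
have gp := dp_gap S; have La0 := dp_La S.
have d1 := delta1; have e0 := eta0.
have [CL CL0 hCL] := Lg_powR d1 e0 gp ltr01.
have M00 : 0 <= M0 := le_trans ler01 M01.
have cc : 0 <= 4 * La * M0 * CL by exact: (mulr_ge0 (mulr_ge0 (mulr_ge0 (ler0n R 4) La0) M00) CL0).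
pose Kp := expR (2 * La * (2 * M0)).
have Kp1 : 1 <= Kp by rewrite -expR0 ler_expR; exact: (mulr_ge0 (mulr_ge0 (ler0n R 2) La0) (mulr_ge0 (ler0n R 2) M00)).
exists (Kp * (1 + 4 * La * M0 * CL)).
  by apply: mulr_ege1 => //; rewrite lerDl.
move=> x y r sg Ox Oy xy rp r1 sg1 sgr.
have [p1 pn q1 qn w0] := dp_bounds Ox; have [p1' pn' q1' qn' w0'] := dp_bounds Oy.
have [_ pq _ qp _] := dp_adm S Ox.
have sgp : 0 < sg by lra.
have near (v : vec -> R) : (forall x y, Omega x -> Omega y -> `|v y - v x| <= La * `|y - x|) ->
    v x - v y <= 2 * La * r.
  move=> hv; apply: le_trans (ler_norm _) _; apply: le_trans (hv y x Oy Ox) _.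
  by apply: le_trans (ler_wpM2l La0 xy) _; rewrite mulrA (mulrC La).
have cmp (a b : R) : a - b <= 2 * La * r -> sg `^ a <= Kp * sg `^ b.
  move=> ab; have -> : a = (a - b) + b by rewrite subrK.
  rewrite (powRD_pos _ _ sgp); apply: ler_wpM2r; first pos.
  apply: le_trans (ler_powR sg1 ab) _; rewrite /powR gt_eqF// ler_expR -mulrA; apply: ler_wpM2l; first pos.
  have := ler_wpM2l (ltW rp) (ln_le_sub1 sgp); lra.
have hp := cmp _ _ (near _ (dp_p S)); have hq := cmp _ _ (near _ (dp_q S)).
have hw : w x <= w y + 2 * La * r by have := near _ (dp_w S); lra.
have L0 : 0 <= Lg delta eta sg by apply: Lg_ge0 => //; exact: ltW.
rewrite !HlogE /Hf /Zf.
have Lb := hCL sg sg1.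
have qpg : q x - 1 + gap <= p x.
    have h : q x <= p x * (1 + n^-1 - gap). by move: qp; rewrite ler_pdivrMr; [rewrite mulrC|lra].
  have h2 : p x * n^-1 <= 1 by rewrite ler_pdivrMr; lra.
  have h3 : gap <= p x * gap by rewrite ler_peMl; lra.
  lra.
have Y1 : r * (sg `^ q x * Lg delta eta sg) <= 2 * M0 * (CL * sg `^ p x).
  have -> : sg `^ q x = sg * sg `^ (q x - 1).
    by rewrite -{2}(powRr1 (ltW sgp)) -powRD_pos// addrC subrK.
  have -> : r * (sg * sg `^ (q x - 1) * Lg delta eta sg) = sg * r * (sg `^ (q x - 1) * Lg delta eta sg) by ring.
  have t0 : 0 <= sg `^ (q x - 1) * Lg delta eta sg by rewrite mulr_ge0// powR_ge0.
  apply: ler_pM => //; first pos.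
  apply: le_trans (ler_wpM2l (powR_ge0 _ _) Lb) _; rewrite mulrCA -powRD_pos//.
  by apply: ler_wpM2l => //; apply: ler_powR.
have P0' := powR_ge0 sg (p x); have P1' := powR_ge0 sg (p y); have P2' := powR_ge0 sg (q y).
have P3 := powR_ge0 sg (q x).
have Y2 : w x * sg `^ q x * Lg delta eta sg <= Kp * (w y * sg `^ q y * Lg delta eta sg) + 4 * La * M0 * CL * sg `^ p x.
  via ((w y + 2 * La * r) * (sg `^ q x * Lg delta eta sg)).
    by rewrite -mulrA; apply: ler_wpM2r => //; rewrite mulr_ge0.
  have a1 := ler_wpM2l (mulr_ge0 w0' L0) hq.
  have a2 := ler_wpM2l (mulr_ge0 (ler0n R 2) La0) Y1.
  have E1 : (w y + 2 * La * r) * (sg `^ q x * Lg delta eta sg) =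
    w y * Lg delta eta sg * sg `^ q x + 2 * La * (r * (sg `^ q x * Lg delta eta sg)) by ring.
  rewrite E1; apply: le_trans (lerD a1 a2) _; apply: eq_ler; ring.
set c := 4 * La * M0 * CL in Y2 cc *.
have a3 := ler_wpM2l cc hp.
apply: le_trans (lerD hp Y2) _.
have zz : 0 <= w y * sg `^ q y * Lg delta eta sg by rewrite !mulr_ge0.
have a4 : 0 <= c * Kp * (w y * sg `^ q y * Lg delta eta sg) by rewrite !mulr_ge0//; lra.
have -> : Kp * (1 + c) * (sg `^ p y + w y * sg `^ q y * Lg delta eta sg) =
  Kp * sg `^ p y + Kp * (w y * sg `^ q y * Lg delta eta sg) + c * (Kp * sg `^ p y) +
  c * Kp * (w y * sg `^ q y * Lg delta eta sg) by ring.
have aux (a b d e ff : R) : d <= e -> 0 <= ff -> a + (b + d) <= a + b + e + ff by lra.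
exact: (aux _ _ _ _ _ a3 a4).
Qed.

Hypothesis uM : {ae mu, forall x, Omega x -> `|u x| <= M0}.

(* Either the truncation vanishes on the boundary, or the cube is interior. *)
Definition admissible c r k := 0 <= k \/ box (c - const_mx r) (c + const_mx r) `<=` Omega.

Local Notation below sg c r b := {ae mu, forall x, Omega x -> qc c r x -> sg * u x <= b}.

(** The oscillation times the gradient bound of [cutoff]: the argument of H on the right of the
    energy estimate. *)
Definition tau0 om r rho : R := 4 * n ^+ 2 / (r - rho) * om.

Lemma level_mset (sg k : R) c r : mset (above sg k `&` qc c r).
Proof. by apply: measurableI; [exact: (above_mset)|exact: qc_mset]. Qed.

Lemma tau0_ge om r rho : 0 < rho -> rho < r -> 0 < om ->
  om / r <= tau0 om r rho /\ tau0 om r rho / (om / r) = 4 * n ^+ 2 * (r / (r - rho)) /\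
  1 <= 4 * n ^+ 2 * (r / (r - rho)).
Proof.
move=> rho0 rr om0; have nn2 := n2; have rp : 0 < r by lra.
have d0 : 0 < r - rho by lra.
have n4 : 1 <= 4 * n ^+ 2 by have := ler_pM (ler0n _ 2) (ler0n _ 2) n2 n2; rewrite -expr2; lra.
have rd : 1 <= r / (r - rho) by rewrite ler_pdivlMr//; lra.
have h1 := mulr_ege1 n4 rd.
have E : tau0 om r rho / (om / r) = 4 * n ^+ 2 * (r / (r - rho)).
  by rewrite /tau0; field; rewrite !gt_eqF.
split => //; have := h1; rewrite -E ler_pdivlMr ?divr_gt0// mul1r//.
Qed.

(** Since r <= om, tau is at least 1 and the bounded contribution of f is at most a multiple of H(x,
    tau). The term with the gradient of the cut-off has the form required by [absorb]. If k < 0, the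
    compact support of the cut-off in Omega makes the test function admissible. *)
Lemma local_energy : exists2 C1, 0 <= C1 & forall (sg k : R) c om r rho, `|sg| = 1 -> 0 < rho -> rho < r ->
  r <= om -> om <= 2 * M0 -> admissible c r k ->
  below sg c r (k + om) ->
  Int mu (above sg k `&` qc c rho) (fun x => H x (enorm (g x))) <=
  C1 * Int mu (above sg k `&` qc c r) (fun x => H x (tau0 om r rho)).
Proof.
have e0 : 0 < 8^-1 / Cf by rewrite divr_gt0.
have [Cg Cg0 hCg] := growth_ctl e0; have [KB KB0 hKB] := Bx_bounded M0.
pose C' := 2 * (Cf * (Cg * (KB + M0))).
have M00 : 0 <= M0 := le_trans ler01 M01.
have C'0 : 0 <= C'.
  exact: (mulr_ge0 (ler0n R 2) (mulr_ge0 (ltW Cf0) (mulr_ge0 Cg0 (addr_ge0 KB0 M00)))).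
(* The factor 2 is that of [Alog_le], and [N.+1] comes from differentiating the power of the
   cut-off. *)
pose ca : R := 2 * N.+1%:R; pose Ca : R := 4^-1 * (ca / 4^-1) ^+ N.+1.
have ca1 : 1 <= ca by rewrite /ca -natrM ler1n muln_gt0.
have Ca0 : 0 <= Ca by rewrite mulr_ge0// exprn_ge0// divr_ge0//; lra.
pose kz : R := @cutoff_cst R N ^+ N.+1; have kz0 : 0 < kz by rewrite exprn_gt0// cutoff_cst_gt0.
exists (kz^-1 * (2 * (C' + Ca))).
  pos.
move=> sg k c om r rho sg1 rho0 rr rom omM adm su.
have [et [set_ et01 etg etK et1]] := cutoff c rr.
have om0 : 0 < om by lra.
have [tau_ge [_ _]] := tau0_ge rho0 rr om0; set tau := tau0 om r rho in tau_ge *.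
have tau1 : 1 <= tau by apply: le_trans tau_ge; rewrite ler_pdivlMr; lra.
have tau0' : 0 < tau by lra.
pose z x := et x ^+ N.+1.
have sz : smooth z by exact: smoothX.
have z01 x : 0 <= z x <= 1.
  by have /andP[a b] := et01 x; rewrite exprn_ge0// exprn_ile1.
have dzE x i : partial i z x = N.+1%:R * et x ^+ N * partial i et x.
  rewrite (_ : z = (fun t => t ^+ N.+1) \o et)//.
  by rewrite (partial_comp i set_ (is_derive_expn N)).
have gzE x : grad z x = (N.+1%:R * et x ^+ N) *: grad et x by apply/rowP => i; rewrite !mxE dzE.
pose G := 4 * n ^+ 2 / (r - rho).
have dz x i : `|partial i z x| <= N.+1%:R * G.
  have /andP[a b] := et01 x; rewrite dzE -mulrA normrM ger0_norm//; apply: ler_wpM2l => //.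
  rewrite normrM; apply: le_trans (_ : `|partial i et x| <= _).
    by rewrite ler_piMl// ger0_norm ?exprn_ge0// exprn_ile1.
  by apply: le_trans (etg x); rewrite /norm1 (bigD1 i)//= mxE lerDl sumr_ge0.
have m1 := above_mset sg k; have sub : above sg k `<=` Omega by move=> x [].
pose G0 x := ext0 (Omega `&` qc c r) (fun x => H x tau) x.
have G00 x : Omega x -> 0 <= G0 x.
  by move=> Ox; rewrite /G0 /ext0; case: ifP => // _; exact: (mod_ge0 Hm Ox (ltW tau0')).
have mH : lmfun Omega (fun x => H x tau).
  by apply: (mod_meas Hm) => [|x _]; [exact: lmf_cst|pos].
have [KH KH0 hKH] := Hx_bounded tau.
have iH : itg mu Omega (fun x => H x tau).
  apply: (@itg_bounded _ _ _ mu Omega _ KH mO Ooo mH) => x Ox.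
  by rewrite ger0_norm ?(mod_ge0 Hm Ox (ltW tau0'))//; apply: hKH => //; exact: ltW.
have mOQ : mset (Omega `&` qc c r) by apply: (measurableI _ _ mO); exact: qc_mset.
have iG0 : itg mu Omega G0.
  apply: (itg_vanish mO mOQ); first by move=> x [].
  - apply: (measurable_funS measurableT (@subsetT _ _)); apply: (lmf_patch mOQ).
    by apply: (measurable_funS mO _ mH) => x [].
  - by move=> x Ox nQ; exact: ext0_out.
  apply: (@itg_eq _ _ _ mu _ (fun x => H x tau) _ mOQ); first by move=> x Qx; rewrite /G0 ext0_in.
  by apply: (itgS mO mOQ _ iH) => x [].
have suppz : 0 <= k \/ exists K, [/\ compact K, K `<=` Omega & forall x, z x != 0 -> K x].
  case: adm => [k0|bO]; [by left|right]; exists (box (c - const_mx r) (c + const_mx r)).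
  split => //; first exact: box_compact.
  by move=> x zx; have [] := etK x _ => //; apply: contra_neq zx; rewrite /z => ->; rewrite expr0n.
have zout x : ~ qc c r x -> et x = 0.
  by move=> nQ; apply/eqP/negPn/negP => /etK[].
have ET := energy_test sg1 sz z01 dz suppz (itgZ C' mO iG0) (itgZ Ca mO iG0)
  (fun x Ox => mulr_ge0 C'0 (G00 x Ox)) (fun x Ox => mulr_ge0 Ca0 (G00 x Ox)).
lapply ET; last first.
  apply: (ae_imp2 fg (ae_imp2 uM su (fun x a b => conj a b))) => x hf [hM hs] Ax; have Ox := sub x Ax.
  have Hg := mod_ge0 Hm Ox (enorm_ge0 (g x)); have /andP[z0 z1] := z01 x.
  have [Qx|nQ] := pselect (qc c r x); last first.
    have e1 := zout x nQ; rewrite /z e1 expr0n/= !(mulr0, mul0r) add0r. pos.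
  have t0 : 0 <= sg * u x - k by case: Ax => _ /= /ltW; rewrite subr_ge0.
  have tom : sg * u x - k <= 2 * M0 by have := hs Ox Qx; lra.
  have gl := growth_le (g x) Ox (hM Ox).
  have fl := le_trans (hf Ox (u x) (g x)) (ler_wpM2l (ltW Cf0) gl).
  have := hCg x M0 (g x) Ox; rewrite (ger0_norm M00) => gc.
  have KBx := hKB x M0 Ox M00 (lexx _).
  have H1 := Hx_ge1 Ox tau1; rewrite /G0 (ext0_in _ (conj Ox Qx)).
  have s1 : `|f x (u x) (g x)| * (sg * u x - k) <= Cf * growth x M0 (g x) * (2 * M0).
    exact: (ler_pM (normr_ge0 _) t0 fl tom).
  have aux (F' gr hh B z' ht : R) : 0 <= z' -> z' <= 1 -> F' <= Cf * gr * (2 * M0) ->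
      gr * M0 <= 8^-1 / Cf * hh + Cg * (B + M0) -> B <= KB -> 1 <= ht ->
      F' * z' <= 4^-1 * (z' * hh) + C' * ht.
    move=> z'0 z'1 h1 h2 h3 h4. have k1 := ler_wpM2l (ltW Cf0) h2.
    have k2 : Cf * (8^-1 / Cf * hh + Cg * (B + M0)) = 8^-1 * hh + Cf * (Cg * (B + M0)).
      by field; rewrite gt_eqF.
    have k3 : Cf * (Cg * (B + M0)) <= Cf * (Cg * (KB + M0)).
      by apply: ler_wpM2l; [pos|apply: ler_wpM2l => //; rewrite lerD2r].
    have k4 : F' <= 4^-1 * hh + C'.
      by move: k1 h1 k3; rewrite k2 /C'; lra.
    apply: le_trans (ler_wpM2r z'0 k4) _; rewrite mulrDl; apply: lerD; first by rewrite -mulrA [hh * _]mulrC.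
    by apply: ler_wpM2l => //; exact: le_trans z'1 h4.
  exact: aux z0 z1 s1 gc KBx H1.
move=> {}ET; lapply ET; last first.
  apply: (ae_imp su) => x hs Ax; have Ox := sub x Ax.
  have Hg := mod_ge0 Hm Ox (enorm_ge0 (g x)); have /andP[z0 z1] := et01 x.
  have t0 : 0 <= sg * u x - k by case: Ax => _ /= /ltW; rewrite subr_ge0.
  have dp_eq a (v : vec) : dotp (A x (g x)) (a *: v) = a * dotp (A x (g x)) v.
    by rewrite /dotp mulr_sumr; apply: eq_bigr => i _; rewrite [X in _ * X]mxE mulrCA.
  have [Qx|nQ] := pselect (qc c r x); last first.
    have e1 := zout x nQ; rewrite gzE dp_eq /z e1 !expr0n/=.
    have N0 : (N == 0)%N = false by apply/negbTE; rewrite -lt0n (ltn_trans _ N_gt1).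
    rewrite N0 !(mulr0, mul0r, normr0) add0r; exact: (mulr_ge0 Ca0 (G00 x Ox)).
  rewrite /G0 (ext0_in _ (conj Ox Qx)); apply: (absorb Ox (enorm_ge0 _) ca1 tau0' (et01 x)).
    move=> g0; have -> : g x = 0 by exact: enorm_eq0.
    have -> : A x 0 = 0 by rewrite /Alog !scaler0 addr0.
    by rewrite [dotp _ _](_ : _ = 0) ?normr0 ?mulr0// /dotp big1// => i _; rewrite [X in X * _]mxE mul0r.
  have AL := Alog_le (g x) (grad z x) Ox; rewrite {2}gzE norm1Z in AL.
  have tom : sg * u x - k <= om by have := hs Ox Qx; lra.
  rewrite -mulrA; apply: le_trans (ler_pM t0 _ tom AL) _.
    pos.
  have zN : 0 <= et x ^+ N by rewrite exprn_ge0.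
  rewrite (ger0_norm (mulr_ge0 (ler0n _ _) zN)).
  have k0 : 0 <= om * (2 * H x (enorm (g x)) * (N.+1%:R * et x ^+ N)).
    pos.
  have := ler_wpM2l k0 (etg x); rewrite -/G => h.
  have -> : om * (2 * H x (enorm (g x)) * (N.+1%:R * et x ^+ N * norm1 (grad et x))) =
    om * (2 * H x (enorm (g x)) * (N.+1%:R * et x ^+ N)) * norm1 (grad et x) by ring.
  apply: le_trans h _; apply: eq_ler.
  by rewrite /ca /tau /tau0 -/G; ring.
move=> {}ET.
have mA1 := level_mset sg k c rho; have mA2 := level_mset sg k c r.
have sA : above sg k `&` qc c rho `<=` above sg k by move=> x [].
have sA2 : above sg k `&` qc c r `<=` above sg k by move=> x [].
have iHe := itg_Henorm.
have iG0A := itgS mO m1 sub iG0.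
have izH : itg mu (above sg k) (fun x => z x * H x (enorm (g x))).
  apply: (itg_le m1 _ _ (itgS mO m1 sub iHe)).
    apply: (lmfM m1); last exact: itg_mfun (itgS mO m1 sub iHe).
    exact: (continuous_mfun (smooth_cont sz) m1).
  move=> x Ax; have Hg := mod_ge0 Hm (sub x Ax) (enorm_ge0 (g x)); have /andP[z0 z1] := z01 x.
  by rewrite ger0_norm ?(mulr_ge0 z0 Hg)//; exact: ler_piMl.
have E1 : Int mu (above sg k) (fun x => C' * G0 x + Ca * G0 x) =
    (C' + Ca) * Int mu (above sg k `&` qc c r) (fun x => H x tau).
  have -> : Int mu (above sg k `&` qc c r) (fun x => H x tau) = Int mu (above sg k) G0.
    rewrite (@IntS_restrict _ _ _ mu (above sg k) _ G0 m1 mA2 sA2); last first.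
      by move=> x Ax nQ; apply: ext0_out => -[_ Qx]; exact: nQ.
    by apply: eq_Int => x [[Ox _] Qx]; rewrite /G0 (ext0_in _ (conj Ox Qx)).
  by rewrite -(IntZ _ m1 iG0A); apply: eq_Int => x _; rewrite mulrDl.
rewrite E1 mulrA in ET; rewrite -(mulrA kz^-1) ler_pdivlMl//; apply: le_trans ET.
have iHA : itg mu (above sg k `&` qc c rho) (fun x => H x (enorm (g x))).
  by apply: (itgS mO mA1 _ iHe) => x [[]].
rewrite -(IntZ _ mA1 iHA).
via (Int mu (above sg k `&` qc c rho) (fun x => z x * H x (enorm (g x)))).
  apply: (le_Int mA1 (itgZ _ mA1 iHA) (itgS m1 mA1 sA izH)) => x [Ax Qx].
  apply: (ler_wpM2r (mod_ge0 Hm (sub x Ax) (enorm_ge0 _))).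
  by apply: lerXn2r; rewrite ?nnegrE; [exact: ltW (@cutoff_cst_gt0 R N)|case/andP: (et01 x)|exact: et1].
apply: (IntS m1 mA1 sA izH) => x Ax; have /andP[z0 _] := z01 x.
exact: (mulr_ge0 z0 (mod_ge0 Hm (sub x Ax) (enorm_ge0 _))).
Qed.

(** The L^1 norm of the gradient in units of om / r. The parameter lam weighs the measure of D,
    which will telescope, against that of the whole superlevel set, which gets a small factor. *)
Definition l1_bound C := forall (sg k : R) c om r rho lam (D : set vec), `|sg| = 1 -> 0 < rho -> rho < r ->
  r <= 1 -> r <= om -> om <= 2 * M0 -> admissible c r k ->
  below sg c r (k + om) ->
  1 <= lam -> mset D -> D `<=` above sg k `&` qc c rho ->
  Int mu D (fun x => norm1 (g x)) <= C * (om / r) *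
    (lam * fine (mu D) + lam `^ (1 - P0) * (r / (r - rho)) ^+ N.+1 * fine (mu (above sg k `&` qc c r))).

Lemma gradient_bound : exists2 C, 1 <= C & l1_bound C.
Proof.
have [C1 C10 hC1] := local_energy; have [K K1 hK] := Hx_compare.
pose C2 := K * (C1 * ((4 * n ^+ 2) ^+ N.+1 * K)).
have nn2 := n2; have K0 : 0 <= K by lra.
have n40 : 0 <= 4 * n ^+ 2 by rewrite mulr_ge0.
have C20 : 0 <= C2 by rewrite !mulr_ge0.
exists (n * (1 + C2)); first by apply: mulr_ege1; lra.
move=> sg k c om r rho lam D sg1 rho0 rr r1 rom omM adm su lam1 mD DA.
have rp : 0 < r by lra.
have om0 : 0 < om by lra.
have lam0 : 0 <= lam by lra.
have d0 : 0 < r - rho by lra.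
have lp := powR_ge0 lam (1 - P0).
have DO : D `<=` Omega by move=> x /DA[[]].
have mA := level_mset sg k c r; have mAr := level_mset sg k c rho.
have fin (E : set vec) : mset E -> E `<=` Omega -> (mu E < +oo)%E.
  by move=> mE EO; apply: le_lt_trans Ooo; apply: le_measure; rewrite ?inE.
have [[y0 y0D]|nD] := pselect (exists y0, D y0); last first.
  have -> : D = set0 by apply/seteqP; split => // x Dx; apply: nD; exists x.
  rewrite [Int _ _ _](_ : _ = 0) ?measure0 ?mulr0 ?add0r.
    apply: mulr_ge0; first pos. pos.
  by rewrite /Int Rintegral_set0.
pose s0 := om / r; have s1 : 1 <= s0 by rewrite ler_pdivlMr//; lra.
have s00 : 0 < s0 by lra.
have Oy0 := DO _ y0D.
have s0r : s0 * r <= 2 * M0 by rewrite divfK ?gt_eqF.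
have [Ay0 Qy0] := DA _ y0D.
have qrr : qc c rho `<=` qc c r by apply: qc_sub; exact: ltW.
have near x y : qc c r x -> qc c r y -> `|x - y| <= 2 * r.
  move=> /qcP hx /qcP hy; apply: norm_rV_le => [|i]; first lra.
  by rewrite !mxE; have /andP[? ?] := hx i; have /andP[? ?] := hy i; rewrite ler_norml; lra.
pose h0 := H y0 s0; have h01 : 1 <= h0 by exact: Hx_ge1.
have h00 : 0 < h0 by lra.
have cmp1 x : Omega x -> qc c r x -> H x s0 <= K * h0.
  by move=> Ox Qx; apply: (hK x y0 r) => //; apply: near => //; exact: qrr.
have cmp2 x : Omega x -> qc c r x -> (H x s0)^-1 <= K / h0.
  move=> Ox Qx; have Hx1 : 1 <= H x s0 by exact: Hx_ge1.
  rewrite -[leLHS]mul1r ler_pdivrMr; last lra.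
  rewrite mulrAC ler_pdivlMr// mul1r; apply: (hK y0 x r) => //; apply: near => //; exact: qrr.
have iHe := itg_Henorm.
have [mu_ mg _ _ _] := ug.
have [_ _ _ _ [_ ig]] := W1u.
have ign : itg mu Omega (fun x => norm1 (g x)).
  by apply: (itg_sum _ mO) => i; exact: (itg_norm mO).
have ien : itg mu Omega (fun x => enorm (g x)).
  apply: (itg_le mO _ _ ign); first exact: mfun_enorm.
  by move=> x _; rewrite ger0_norm ?enorm_ge0// enorm_norm1.
have ienD := itgS mO mD DO ien; have iHeD := itgS mO mD DO iHe.
have ignD := itgS mO mD DO ign.
have fD := fin D mD DO.
via (n * Int mu D (fun x => enorm (g x))).
  rewrite -(IntZ _ mD ienD); apply: (le_Int mD ignD (itgZ _ mD ienD)) => x _; exact: norm1_enorm.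
have -> : n * (1 + C2) * (om / r) = n * (s0 * (1 + C2)) by rewrite /s0; ring.
rewrite -[leRHS]mulrA; apply: ler_wpM2l; first lra.
pose b := lam `^ (1 - P0) * s0 * (K / h0).
have b0 : 0 <= b by exact: (mulr_ge0 (mulr_ge0 lp (ltW s00)) (divr_ge0 K0 (ltW h00))).
have ic : itg mu D (fun=> lam * s0) := itg_cst _ mD fD.
via (lam * s0 * fine (mu D) + b * Int mu D (fun x => H x (enorm (g x)))).
  rewrite -(Int_cst _ _ mD) -(IntZ _ mD iHeD) -(IntD mD ic (itgZ _ mD iHeD)).
  apply: (le_Int mD ienD (itgD mD ic (itgZ _ mD iHeD))) => x Dx; have Ox := DO x Dx.
  have [_ Qx] := DA x Dx.
  apply: le_trans (large_gradient Ox s1 lam1 (enorm_ge0 (g x))) _; rewrite lerD2l /b.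
  have Hg := mod_ge0 Hm Ox (enorm_ge0 (g x)).
  rewrite -[leRHS](mulrA (lam `^ (1 - P0) * s0)); apply: (ler_wpM2l (mulr_ge0 lp (ltW s00))).
  by rewrite [leRHS]mulrC; apply: (ler_wpM2l Hg); exact: cmp2 Ox (qrr _ Qx).
have tE := tau0_ge rho0 rr om0; have [tge [tq tq1]] := tE.
pose tq' := 4 * n ^+ 2 * (r / (r - rho)).
have tauE : tau0 om r rho = tq' * s0 by rewrite /tq' -tq divfK// gt_eqF.
have iA x : Omega x -> qc c r x -> H x (tau0 om r rho) <= tq' ^+ N.+1 * (K * h0).
  move=> Ox Qx; rewrite tauE; apply: le_trans (mod_dil Hm Ox tq1 (ltW s00)) _.
  apply: ler_wpM2l; last exact: cmp1.
  pos.
have mH : lmfun Omega (fun x => H x (tau0 om r rho)).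
  apply: (mod_meas Hm) => [|x _]; first exact: lmf_cst.
  by apply: le_trans tge; exact: ltW.
have AO : above sg k `&` qc c r `<=` Omega by move=> x [[]].
have iHt : itg mu (above sg k `&` qc c r) (fun x => H x (tau0 om r rho)).
  apply: (@itg_bounded _ _ _ mu _ _ (tq' ^+ N.+1 * (K * h0)) mA (fin _ mA AO)).
    exact: measurable_funS mO AO mH.
  move=> x [[Ox _] Qx]; rewrite ger0_norm; first exact: iA.
  by apply: (mod_ge0 Hm Ox); apply: le_trans tge; exact: ltW.
have E1 : Int mu D (fun x => H x (enorm (g x))) <=
    C1 * (tq' ^+ N.+1 * (K * h0) * fine (mu (above sg k `&` qc c r))).
  have ArO : above sg k `&` qc c rho `<=` Omega by move=> x [[]].
  apply: le_trans (IntS mAr mD DA (itgS mO mAr ArO iHe) _) _.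
    by move=> x [[Ox _] _]; exact: (mod_ge0 Hm Ox (enorm_ge0 _)).
  apply: le_trans (hC1 sg k c om r rho sg1 rho0 rr rom omM adm su) _.
  apply: ler_wpM2l => //; rewrite -(Int_cst _ _ mA).
  apply: (le_Int mA iHt (itg_cst _ mA (fin _ mA AO))) => x [[Ox _] Qx]; exact: iA.
apply: le_trans (lerD (lexx _) (ler_wpM2l b0 E1)) _.
set a := fine (mu D); set d := fine (mu _).
have a0 : 0 <= a by exact: fine_ge0.
have dd0 : 0 <= d by exact: fine_ge0.
have -> : b * (C1 * (tq' ^+ N.+1 * (K * h0) * d)) = s0 * C2 * (lam `^ (1 - P0) * (r / (r - rho)) ^+ N.+1 * d).
  have -> : tq' ^+ N.+1 = (4 * n ^+ 2) ^+ N.+1 * (r / (r - rho)) ^+ N.+1 by rewrite -exprMn.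
  have aux (l' s' k' h' c' x' y' d' : R) : h' != 0 -> l' * s' * (k' / h') * (c' * (x' * y' * (k' * h') * d')) =
    s' * (k' * (c' * (x' * k'))) * (l' * y' * d') by move=> hh; field.
  by apply: aux; rewrite gt_eqF.
set e := lam `^ _ * _ * d.
have ee : 0 <= e by exact: (mulr_ge0 (mulr_ge0 lp (exprn_ge0 _ (divr_ge0 (ltW rp) (ltW d0)))) dd0).
have aux (s' c' l' a' e' : R) : 0 <= s' -> 0 <= c' -> 0 <= l' -> 0 <= a' -> 0 <= e' ->
    l' * s' * a' + s' * c' * e' <= s' * (1 + c') * (l' * a' + e').
  move=> h1 h2 h3 h4 h5; have x1 := mulr_ge0 (mulr_ge0 h1 h2) (mulr_ge0 h3 h4); have x2 := mulr_ge0 h1 h5.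
  have -> : s' * (1 + c') * (l' * a' + e') = l' * s' * a' + s' * c' * e' + (s' * c' * (l' * a') + s' * e') by ring.
  by rewrite lerDl addr_ge0.
pos.
Qed.

(** * De Giorgi's lemmas on superlevel sets *)

Implicit Type b : R.
Variables (C : R) (C1 : 1 <= C).

Hypothesis GB : l1_bound C.

Let lmf_sgu sg : lmfun Omega (fun x => sg * u x).
Proof. by have [mu_ _ _ _ _] := ug; exact: (lmfZ sg mO mu_). Qed.

Definition lev sg k c r : set vec := above sg k `&` qc c r.

Lemma lev_mset sg k c r : mset (lev sg k c r).
Proof. by apply: measurableI; [exact: mset_gt mO (lmf_sgu sg)|exact: qc_mset]. Qed.

Definition band sg k d c r : set vec :=
  (above sg k `&` qc c r) `&` (Omega `&` [set x | sg * u x < k + d]).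

Lemma band_mset sg k d c r : mset (band sg k d c r).
Proof. by apply: measurableI; [exact: lev_mset|exact: mset_lt mO (lmf_sgu sg)]. Qed.

Definition ms (D : set vec) : R := fine (mu D).

Lemma ms_ge0 D : 0 <= ms D. Proof. exact: fine_ge0. Qed.

Lemma qc_fin c r D : mset D -> D `<=` qc c r -> (mu D < +oo)%E.
Proof.
move=> mD DQ; apply: le_lt_trans (leb_cube_fin (c - const_mx r) (2 * r)).
by apply: le_measure; rewrite ?inE//; exact: cube_mset.
Qed.

Lemma ms_le c r D E : mset D -> mset E -> D `<=` E -> E `<=` qc c r -> ms D <= ms E.
Proof. by move=> mD mE DE EQ; apply: le_fine_measure => //; exact: qc_fin mE EQ. Qed.

Lemma ms_qc c r : ms (qc c r) = vol (2 * r). Proof. exact: fine_leb_cube. Qed.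

Lemma lev_sub sg k c r : lev sg k c r `<=` qc c r. Proof. by move=> x []. Qed.

Lemma lev_le sg k k' c r r' : k <= k' -> r' <= r -> lev sg k' c r' `<=` lev sg k c r.
Proof.
move=> kk rr x [[Ox /= kx] Qx]; split; last exact: qc_sub Qx.
by split => //=; exact: le_lt_trans kk kx.
Qed.

Lemma ms_lev_le sg k k' c r r' : k <= k' -> r' <= r -> ms (lev sg k' c r') <= ms (lev sg k c r).
Proof.
move=> kk rr; apply: (@ms_le c r); [exact: lev_mset|exact: lev_mset|exact: lev_le|exact: lev_sub].
Qed.

Lemma ms_band sg k d c r : 0 <= d -> ms (band sg k d c r) <= ms (lev sg k c r) - ms (lev sg (k + d) c r).
Proof.
move=> d0; have mA := lev_mset sg k c r; have mA' := lev_mset sg (k + d) c r.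
have fA : (mu (lev sg k c r) < +oo)%E by exact: (qc_fin mA (@lev_sub _ _ _ _)).
have sA : lev sg (k + d) c r `<=` lev sg k c r by apply: lev_le => //; rewrite lerDl.
rewrite /ms -(fine_measureD mA mA' fA sA); apply: (@ms_le c r).
- exact: band_mset.
- exact: measurableD.
- move=> x [[Ax Qx] [Ox /= lt]]; split; first by split.
  by move=> [[_ /= gt] _]; have := lt_trans gt lt; rewrite ltxx.
- by move=> x [[]].
Qed.

Lemma admissible_le c r r' k k' : admissible c r k -> k <= k' -> r' <= r -> admissible c r' k'.
Proof.
move=> [k0|bO] kk rr; [by left; exact: le_trans kk|right => x hx; apply: bO => i].
by have := hx i; rewrite !mxE => ?; lra.
Qed.

Lemma not_above sg k c r x : admissible c r k -> qc c r x -> ~ above sg k x -> sg * ext0 Omega u x <= k.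
Proof.
move=> adm Qx nA; have [Ox|nO] := pselect (Omega x).
  by rewrite ext0_in// leNgt; apply/negP => h; exact: nA.
rewrite ext0_out// mulr0; case: adm => // bO; exfalso; apply: nO; apply: bO => i.
by have /qcP/(_ i)/andP[? ?] := Qx; rewrite !mxE; lra.
Qed.

Lemma level_slope_int sg k d c r : 0 < d -> 0 < r -> `|sg| = 1 ->
  Int mu (qc c r) (level_slope sg k d) <= 2 * Int mu (band sg k d c r) (fun x => norm1 (g x)).
Proof.
move=> d0 rp sg1; have r2 : 0 < 2 * r by lra.
have [_ iG _] := level_poincare k sg1 d0 (c - const_mx r) r2.
have mB := band_mset sg k d c r.
have sB : band sg k d c r `<=` qc c r by move=> x [[]].
have sO : band sg k d c r `<=` Omega by move=> x [_ []].
have [_ _ _ _ [_ ig]] := W1u.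
have ign : itg mu Omega (fun x => norm1 (g x)).
  by apply: (itg_sum _ mO) => i; exact: (itg_norm mO).
have ignB := itgS mO mB sO ign.
rewrite (@IntS_restrict _ _ _ mu (qc c r) _ _ (qc_mset c r) mB sB).
  rewrite -(IntZ _ mB ignB); apply: (le_Int mB (itgS (qc_mset c r) mB sB iG) (itgZ _ mB ignB)) => x Bx.
  rewrite /level_slope !(ext0_in _ (sO _ Bx)).
  by apply: ler_wpM2r; [pos|exact: dsm_le].
move=> x Qx nB; rewrite /level_slope; have [Ox|nO] := pselect (Omega x); last first.
  by rewrite !(ext0_out _ nO) mulr0.
rewrite !(ext0_in _ Ox) dsm_eq0 ?mul0r//.
have [h|h] := leP (sg * u x) k; first by left.
by right; rewrite leNgt; apply/negP => h'; apply: nB.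
Qed.

Lemma level_step_markov sg k d c r : 0 < d -> 0 < r -> `|sg| = 1 ->
  d * ms (lev sg (k + d) c r) <= Int mu (qc c r) (level_step sg k d).
Proof.
move=> d0 rp sg1; have r2 : 0 < 2 * r by lra.
have [iv _ _] := level_poincare k sg1 d0 (c - const_mx r) r2.
have mA := lev_mset sg (k + d) c r.
apply: (@Int_markov _ _ _ mu (qc c r) (lev sg (k + d) c r) (level_step sg k d) d (qc_mset c r) mA (@lev_sub _ _ _ _) iv).
- exact: (qc_fin mA (@lev_sub _ _ _ _)).
- by move=> x _; exact: smst_ge0.
- by move=> x [[Ox /= kx] _]; rewrite /level_step ext0_in// smst_eq// ltW.
Qed.

(** [poincare_zero] for the step between k and k + d: the step vanishes where sg u is not above k,
    its slope lives on the band, and Markov's inequality recovers the set above k + d. *)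
Lemma level_shrink sg k d c r th : 0 < d -> 0 < r -> `|sg| = 1 -> admissible c r k -> 0 < th ->
  th * vol (2 * r) <= ms (qc c r `\` above sg k) ->
  d * ms (lev sg (k + d) c r) <=
    th^-1 * (2 ^+ N * (2 * r) * (2 * Int mu (band sg k d c r) (fun x => norm1 (g x)))).
Proof.
move=> d0 rp sg1 adm th0 hth; have r2 : 0 < 2 * r by lra.
have PP := level_poincare k sg1 d0.
apply: le_trans (level_step_markov k c d0 rp sg1) _.
have mE : mset (qc c r `\` above sg k).
  by apply: measurableD; [exact: qc_mset|exact: mset_gt mO (lmf_sgu sg)].
apply: le_trans (poincare_zero vol_gt0 PP r2 th0 mE _ _ _ hth) _.
- by move=> x [].
- by move=> x _; exact: smst_ge0.
- move=> x [Qx nA]; apply: (smst_eq0 d0); exact: not_above adm Qx nA.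
apply: ler_wpM2l; first pos.
by apply: ler_wpM2l; [pos|exact: level_slope_int].
Qed.

(** Here [faber_krahn] is used instead: a small superlevel set contributes the power 1/N of its
    relative measure, the gain that drives [fast_decay]. *)
Lemma level_shrink_small sg k d c r : 0 < d -> 0 < r -> `|sg| = 1 -> admissible c r k ->
  ms (lev sg k c r) <= vol (2 * r) / 2 ->
  d * ms (lev sg (k + d) c r) <=
    2 ^+ (N + 3) * (2 * r) * (ms (lev sg k c r) / vol (2 * r)) `^ N%:R^-1 *
    (2 * Int mu (band sg k d c r) (fun x => norm1 (g x))).
Proof.
move=> d0 rp sg1 adm small; have r2 : 0 < 2 * r by lra.
have PP := level_poincare k sg1 d0.
apply: le_trans (level_step_markov k c d0 rp sg1) _.
apply: le_trans (faber_krahn vol_gt0 N_gt1 PP (level_slope_ge0 _ _ _) r2 (lev_mset sg k c r) (@lev_sub _ _ _ _) _ _ small) _.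
- by move=> x _; exact: smst_ge0.
- move=> x Qx nA; apply: (smst_eq0 d0); apply: (not_above adm Qx) => Ax; exact: nA.
apply: ler_wpM2l; last exact: level_slope_int.
pos.
Qed.

Lemma fast_decay : exists2 nu : R, 0 < nu & forall sg c r b om, `|sg| = 1 -> 0 < r -> r <= 1 ->
  r <= om -> om <= 2 * M0 -> admissible c r (b - om) ->
  below sg c r b ->
  ms (lev sg (b - om) c (r / 2)) <= nu * vol r ->
  below sg c (r / 4) (b - om / 2).
Proof.
pose al : R := N%:R^-1.
have Np : 0 < N%:R :> R by rewrite ltr0n ltnW.
have al0 : 0 < al by rewrite invr_gt0.
pose b2 : R := 2 ^+ (N + 2); have b21 : 1 < b2 by rewrite exprn_egt1// ?ltr1n// addn_eq0 andbF.
pose C4 : R := C * 2 ^+ (N + 7) * 2 ^+ (2 * (N + 2)).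
have Cp : 0 < C by exact: lt_le_trans ltr01 C1.
have C40 : 0 < C4 by rewrite /C4 !mulr_gt0.
pose thr : R := (C4 * b2 `^ al^-1) `^ (- al^-1).
have thr0 : 0 < thr by rewrite powR_gt0// mulr_gt0// powR_gt0//; exact: lt_trans ltr01 b21.
(* The first bound keeps every superlevel set below half of its cube, as [level_shrink_small]
   requires; the second one starts the fast convergence. *)
pose nu := Num.min (2 ^- (N.+1)) thr.
have nu0 : 0 < nu by rewrite lt_min thr0 invr_gt0 exprn_gt0.
exists nu => // sg c r b om sg1 rp r1 rom omM adm su small.
have V0 := vol_gt0 rp.
pose h j : R := 2^-1 ^+ j.
have h0 j : 0 < h j := half_gt0 j.
have h1 j : h j <= 1 := half_le1 j.
have hS j : h j.+1 = h j / 2 by rewrite /h exprS mulrC.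
have omp : 0 < om by exact: lt_le_trans rp rom.
pose kj j := b - om / 2 - om / 2 * h j; pose rj j := r / 4 + r / 4 * h j.
pose y j := ms (lev sg (kj j) c (rj j)) / vol r.
have y0 j : 0 <= y j by rewrite divr_ge0 ?ms_ge0// ltW.
have kj_ge j : b - om <= kj j.
  have := ler_wpM2l (ltW omp) (h1 j); rewrite /kj; lra.
have rj_le j : rj j <= r / 2.
  have := ler_wpM2l (ltW rp) (h1 j); rewrite /rj; lra.
have rj_ge j : r / 4 <= rj j.
  have := mulr_ge0 (ltW rp) (ltW (h0 j)); rewrite /rj; lra.
have kjS j : kj j.+1 = kj j + om / 4 * h j by rewrite /kj hS; field.
have rjS j : rj j - rj j.+1 = r / 8 * h j by rewrite /rj hS; field.
have rd j : 0 < r / 8 * h j by rewrite mulr_gt0 ?divr_gt0.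
have ystep j : y j.+1 <= C4 * b2 ^+ j * y j `^ (1 + al).
  have d0 : 0 < om / 4 * h j by rewrite mulr_gt0 ?divr_gt0.
  have rlt : rj j.+1 < rj j by rewrite -subr_gt0 rjS.
  have rp1 : 0 < rj j.+1 by apply: lt_le_trans (rj_ge _); rewrite divr_gt0.
  have rpj : 0 < rj j by exact: lt_trans rp1 rlt.
  have adj : admissible c (rj j) (kj j).
    by apply: admissible_le adm (kj_ge j) _; apply: le_trans (rj_le j) _; lra.
  have adj1 : admissible c (rj j.+1) (kj j) by apply: admissible_le adj (lexx _) (ltW rlt).
  have V1 : vol r / 2 ^+ N <= vol (2 * rj j.+1).
    by rewrite -vol_half//; apply: le_vol; have := rj_ge j.+1; lra.
  have V1p : 0 < vol (2 * rj j.+1) by apply: vol_gt0; rewrite mulr_gt0.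
  have sub1 : ms (lev sg (kj j) c (rj j.+1)) <= ms (lev sg (kj j) c (rj j)).
    by apply: ms_lev_le => //; exact: ltW.
  have small1 : ms (lev sg (kj j) c (rj j.+1)) <= vol (2 * rj j.+1) / 2.
    via (ms (lev sg (b - om) c (r / 2))); first exact: ms_lev_le.
    apply: le_trans small _; via (2 ^- (N.+1) * vol r).
      by apply: ler_wpM2r; [pos|rewrite ge_min lexx].
    apply: le_trans (ler_wpM2r _ V1); last pos.
    by apply: eq_ler; rewrite exprS; field; rewrite expf_neq0.
  have LS := level_shrink_small d0 rp1 sg1 adj1 small1; rewrite -kjS in LS.
  have bB : band sg (kj j) (om / 4 * h j) c (rj j.+1) `<=` above sg (kj j) `&` qc c (rj j.+1) by move=> x [].
  pose omj := om / 2 + om / 2 * h j.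
  have omj_le : omj <= om by have := ler_wpM2l (ltW omp) (h1 j); rewrite /omj; lra.
  have omj_ge : om / 2 <= omj by have := mulr_ge0 (ltW omp) (ltW (h0 j)); rewrite /omj; lra.
  have su' : below sg c (rj j) (kj j + omj).
    apply: (ae_imp su) => x hx Ox Qx; have -> : kj j + omj = b by rewrite /kj /omj; ring.
    by apply: hx => //; apply: qc_sub Qx; apply: le_trans (rj_le j) _; lra.
  have rj1 : rj j <= 1 by apply: le_trans (rj_le j) _; lra.
  have rjo : rj j <= omj by apply: le_trans (rj_le j) _; lra.
  have G := GB sg1 rp1 rlt rj1 rjo (le_trans omj_le omM) adj su' (lexx 1) (band_mset _ _ _ _ _) bB.
  rewrite powR1 !mul1r -/(ms _) -/(lev _ _ _ _) -/(ms _) in G.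
  have bandle : ms (band sg (kj j) (om / 4 * h j) c (rj j.+1)) <= ms (lev sg (kj j) c (rj j)).
    apply: le_trans sub1; apply: (@ms_le c (rj j.+1)) bB (@lev_sub _ _ _ _); [exact: band_mset|exact: lev_mset].
  pose X : R := 2 ^+ (j + 2).
  have Xh : X * h j = 4 by rewrite /X /h exprD exprVn mulrAC mulfV ?mul1r// -natrX.
  have X1 : 1 <= X by rewrite /X exprn_ege1// ler1n.
  have ratio : rj j / (rj j - rj j.+1) <= X.
    by rewrite rjS ler_pdivrMr// mulrCA Xh; have := rj_le j; lra.
  have ratio0 : 0 <= rj j / (rj j - rj j.+1) by rewrite divr_ge0 ?(ltW rpj)// rjS ltW.
  set Aj := ms (lev sg (kj j) c (rj j)) in y0 sub1 G bandle *.
  have A0 : 0 <= Aj := ms_ge0 _.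
  have XN : 1 <= X ^+ N.+1 by rewrite exprn_ege1.
  have G2 : Int mu (band sg (kj j) (om / 4 * h j) c (rj j.+1)) (fun x => norm1 (g x)) <=
      C * (om / rj j) * (2 * X ^+ N.+1 * Aj).
    have om0' : 0 <= omj by apply: le_trans omj_ge; rewrite divr_ge0// ltW.
    apply: le_trans G _; apply: ler_pM.
    - pos.
    - by rewrite addr_ge0 ?ms_ge0// mulr_ge0// exprn_ge0.
    - by apply: (ler_wpM2l (ltW Cp)); apply: ler_wpM2r => //; rewrite invr_ge0 ltW.
    have -> : 2 * X ^+ N.+1 * Aj = X ^+ N.+1 * Aj + X ^+ N.+1 * Aj by ring.
    apply: lerD; first by apply: le_trans bandle _; rewrite ler_peMl.
    by apply: ler_wpM2r => //; apply: lerXn2r; rewrite ?nnegrE// (le_trans ratio0 ratio).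
  have Yr : (ms (lev sg (kj j) c (rj j.+1)) / vol (2 * rj j.+1)) `^ al <= 2 * y j `^ al.
    rewrite [leRHS](_ : _ = (2 ^+ N) `^ al * y j `^ al); last first.
      by congr (_ * _); rewrite -powR_mulrn// -powRrM mulfV ?powRr1// gt_eqF.
    rewrite -powRM//; apply: powR_le; first pos.
      by rewrite divr_ge0 ?ms_ge0// ltW.
    rewrite ler_pdivrMr//; apply: le_trans sub1 _.
    have := ler_wpM2l (mulr_ge0 (exprn_ge0 N (ler0n R 2)) (y0 j)) V1; apply: le_trans.
    apply: eq_ler; rewrite /y -/Aj; field. by rewrite expf_neq0//= gt_eqF.
  have yal0 := powR_ge0 (y j) al.
  have fin : om / 4 * h j * ms (lev sg (kj j.+1) c (rj j.+1)) <=
      2 ^+ (N + 3) * (2 * rj j) * (2 * y j `^ al) * (2 * (C * (om / rj j) * (2 * X ^+ N.+1 * Aj))).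
    apply: le_trans LS _; apply: (ler_pM4 _ (ltW rp1) (ltW rlt) (powR_ge0 _ _) Yr _ G2).
      pos.
    by apply: Int_ge0 => x _; exact: norm1_ge0.
  have e1 : 2 ^+ (N + 3) * (2 * rj j) * (2 * y j `^ al) * (2 * (C * (om / rj j) * (2 * X ^+ N.+1 * Aj))) =
      om * (C * 2 ^+ (N + 7) * X ^+ N.+1 * y j `^ al * Aj).
    have -> : (2 : R) ^+ (N + 7) = 2 ^+ (N + 3) * 16 by rewrite !exprD -!natrX; ring.
    by field; rewrite gt_eqF.
  have e2 : om / 4 * h j * ms (lev sg (kj j.+1) c (rj j.+1)) = om * (h j / 4 * ms (lev sg (kj j.+1) c (rj j.+1))) by field.
  rewrite e1 e2 (ler_pM2l omp) in fin.
  have fin2 : ms (lev sg (kj j.+1) c (rj j.+1)) <= X * (C * 2 ^+ (N + 7) * X ^+ N.+1 * y j `^ al * Aj).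
    have := ler_wpM2l (le_trans ler01 X1) fin; apply: le_trans.
    have -> : X * (h j / 4 * ms (lev sg (kj j.+1) c (rj j.+1))) = X * h j / 4 * ms (lev sg (kj j.+1) c (rj j.+1)) by field.
    by rewrite Xh mulfV// mul1r.
  rewrite /y ler_pdivrMr//; apply: le_trans fin2 _.
  have yy : y j `^ (1 + al) = y j * y j `^ al.
    have [e|/eqP ne] := pselect (y j = 0).
      by rewrite e mul0r powR0// (gt_eqF (addr_gt0 ltr01 al0)).
    by rewrite powRD_pos ?lt_def ?y0 ?ne// powRr1.
  rewrite -/(y j) yy; have -> : Aj = y j * vol r by rewrite /y -/Aj divfK// gt_eqF.
  apply: eq_ler.
  have -> : C4 * b2 ^+ j = C * 2 ^+ (N + 7) * (X * X ^+ N.+1).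
    rewrite /C4 /b2 -exprS /X -!exprM -mulrA -exprD; congr (_ * 2 ^+ _).
    by rewrite !addn2 [(2 * _)%N]mulnC -mulnDr add2n mulnC.
  ring.
have yle : y 0%N <= thr.
  rewrite /y /kj /rj /h expr0 !mulr1 ler_pdivrMr//.
  have -> : b - om / 2 - om / 2 = b - om by field.
  have -> : r / 4 + r / 4 = r / 2 by field.
  by apply: le_trans small _; apply: ler_wpM2r; [pos|rewrite ge_min lexx orbT].
have cy := fast_geometric C40 b21 al0 y0 ystep yle.
have z0 : ms (lev sg (b - om / 2) c (r / 4)) = 0.
  apply/eqP; rewrite eq_le ms_ge0 andbT; apply/ler_addgt0Pl => e e0; rewrite addr0.
  have e0' : 0 < e / vol r by rewrite divr_gt0.
  have [j _ /(_ j (leqnn j)) hj] := cvgr_le _ cy _ e0'.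
  move: hj; rewrite /y ler_pM2r ?invr_gt0//; apply: le_trans; apply: ms_lev_le => //.
  by rewrite /kj gerBl mulr_ge0 ?divr_ge0// ltW.
have mA := lev_mset sg (b - om / 2) c (r / 4).
exists (lev sg (b - om / 2) c (r / 4)); split => //.
  have fA := qc_fin mA (@lev_sub _ _ _ _).
  by apply/eqP; rewrite -(@fineK _ (mu _)) ?ge0_fin_numE// -/(ms _) z0.
move=> x /= nx; split; last by apply: contrapT => nQ; apply: nx => _ /nQ.
by split; [apply: contrapT => nO; apply: nx => /nO|rewrite /= ltNge; apply/negP => h'; exact: nx].
Qed.

(** [level_shrink] is summed over s dyadic levels. The bands are disjoint, so the part with lam
    telescopes to at most one cube, whereas the left-hand side is at least s times the last
    superlevel set. The remaining part grows with s but carries lam^(1-P0). *)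
Lemma measure_shrink th lam (s : nat) sg c r b om : 0 < th -> 1 <= lam -> `|sg| = 1 -> 0 < r -> r <= 1 ->
  2 ^+ s * r <= om -> om <= 2 * M0 -> admissible c r (b - om / 2) ->
  below sg c r b ->
  th * vol r <= ms (qc c (r / 2) `\` above sg (b - om / 2)) ->
  s%:R * ms (lev sg (b - om * 2^-1 ^+ s.+1) c (r / 2)) <=
    th^-1 * C * 2 ^+ (N + 2) * (lam + s%:R * (lam `^ (1 - P0) * 2 ^+ (2 * N + 1))) * vol r.
Proof.
move=> th0 lam1 sg1 rp r1 rom omM adm su hth.
have V0 := vol_gt0 rp.
pose h j : R := 2^-1 ^+ j.
have h0 j : 0 < h j := half_gt0 j.
have hS j : h j.+1 = h j / 2 by rewrite /h exprS mulrC.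
have h_le i j : (i <= j)%N -> h j <= h i := @half_le R i j.
have two1 : (1 : R) <= 2 ^+ s by rewrite exprn_ege1// ler1n.
have omp : 0 < om by apply: lt_le_trans rom; rewrite mulr_gt0// exprn_gt0.
pose k j := b - om * h j.+1; pose a j := ms (lev sg (k j) c (r / 2)).
have r2E : 2 * (r / 2) = r by field.
have r20 : 0 < r / 2 by rewrite divr_gt0.
have r2r : r / 2 < r by lra.
have a_le i j : (i <= j)%N -> a j <= a i.
  move=> ij; apply: ms_lev_le => //; rewrite lerD2l lerN2; apply: (ler_wpM2l (ltW omp)).
  exact: h_le.
have aV : a 0%N <= vol r.
  rewrite -[in leRHS]r2E -(ms_qc c); apply: (@ms_le c (r / 2)) => //; [exact: lev_mset|exact: qc_mset|exact: lev_sub].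
pose K1 := th^-1 * C * 2 ^+ (N + 2); pose K2 := lam `^ (1 - P0) * 2 ^+ (2 * N + 1) * vol r.
have Cp : 0 < C by exact: lt_le_trans ltr01 C1.
have K10 : 0 <= K1 by rewrite /K1 !mulr_ge0 ?invr_ge0 ?ltW.
have k0E : k 0%N = b - om / 2 by rewrite /k /h expr1.
have step j : (j < s)%N -> a j.+1 <= K1 * (lam * (a j - a j.+1) + K2).
  move=> js; have d0 : 0 < om * h j.+2 by rewrite mulr_gt0.
  have kS : k j.+1 = k j + om * h j.+2 by rewrite /k [h j.+2]hS; field.
  have kk : b - om / 2 <= k j.
    by rewrite -k0E /k lerD2l lerN2; apply: (ler_wpM2l (ltW omp)); exact: h_le.
  have adj : admissible c r (k j) by exact: admissible_le adm kk (lexx _).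
  have adj2 : admissible c (r / 2) (k j) by exact: admissible_le adj (lexx _) (ltW r2r).
  have hthj : th * vol (2 * (r / 2)) <= ms (qc c (r / 2) `\` above sg (k j)).
    rewrite r2E; apply: le_trans hth _; apply: (@ms_le c (r / 2)).
    - by apply: measurableD; [exact: qc_mset|exact: mset_gt mO (lmf_sgu sg)].
    - by apply: measurableD; [exact: qc_mset|exact: mset_gt mO (lmf_sgu sg)].
    - move=> x [Qx nA]; split => // -[Ox /= kx]; apply: nA; split => //=; exact: le_lt_trans kk kx.
    - by move=> x [].
  have LS := level_shrink d0 r20 sg1 adj2 th0 hthj; rewrite -kS r2E -/(a j.+1) in LS.
  have omj : r <= om * h j.+1.
    have e : 2 ^+ s * h s = 1 by rewrite /h exprVn mulfV// expf_neq0.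
    have := ler_wpM2r (ltW (h0 s)) rom; rewrite mulrAC e mul1r => /le_trans; apply.
    by apply: (ler_wpM2l (ltW omp)); exact: h_le.
  have omj2 : om * h j.+1 <= 2 * M0.
    apply: le_trans omM; rewrite ler_piMr ?(ltW omp)//; have := h_le 0%N j.+1 isT.
    by rewrite {2}/h expr0.
  have su' : below sg c r (k j + om * h j.+1).
    by apply: (ae_imp su) => x hx Ox Qx; rewrite /k subrK; exact: hx.
  have bB : band sg (k j) (om * h j.+2) c (r / 2) `<=` above sg (k j) `&` qc c (r / 2) by move=> x [].
  have G := GB sg1 r20 r2r r1 omj omj2 adj su' lam1 (band_mset _ _ _ _ _) bB.
  rewrite -/(ms _) -/(lev _ _ _ _) -/(ms _) in G.
  have e1 : r / (r - r / 2) = 2.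
    have -> : r - r / 2 = r / 2 by field. by rewrite invfM invrK mulrA mulfV ?mul1r// gt_eqF.
  have mb := ms_band sg (k j) c (r / 2) (ltW d0); rewrite -kS -/(a j) -/(a j.+1) in mb.
  have Vr : ms (lev sg (k j) c r) <= 2 ^+ N * vol r.
    have -> : 2 ^+ N * vol r = ms (qc c r).
      by rewrite ms_qc -{1}(_ : 2 * r / 2 = r) ?vol_half ?mulr_gt0//; field; rewrite ?expf_neq0.
    apply: (@ms_le c r) => //; [exact: lev_mset|exact: qc_mset|exact: lev_sub].
  have lam0 : 0 <= lam by exact: le_trans ler01 lam1.
  have lp := powR_ge0 lam (1 - P0).
  have G2 : Int mu (band sg (k j) (om * h j.+2) c (r / 2)) (fun x => norm1 (g x)) <=
      C * (om * h j.+1 / r) * (lam * (a j - a j.+1) + K2).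
    apply: le_trans G _; apply: ler_wpM2l.
      pos.
    apply: lerD; first exact: ler_wpM2l. rewrite e1 /K2 -!mulrA; apply: ler_wpM2l => //.
    have -> : (2 : R) ^+ (2 * N + 1) = 2 ^+ N.+1 * 2 ^+ N by rewrite -exprD addn1 mul2n -addnn addSn.
    by rewrite -mulrA; apply: ler_wpM2l => //; exact: exprn_ge0.
  have c1 : 0 <= th^-1 * (2 ^+ N * r * 2) by rewrite !mulr_ge0 ?invr_ge0// ltW.
  have := ler_wpM2l c1 G2; move=> /(le_trans _) G3.
  rewrite -(ler_pM2l d0); apply: le_trans LS _; rewrite -2!mulrA.
  set I := Int _ _ _ in G2 *; have := ler_wpM2l c1 G2.
  have -> : th^-1 * (2 ^+ N * r * 2) * I = th^-1 * (2 ^+ N * (r * (2 * I))) by ring.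
  move=> /le_trans; apply; apply: eq_ler.
  rewrite [h j.+2]hS /K1 (exprD 2 N 2); have -> : (2 : R) ^+ 2 = 4 by rewrite -natrX.
  by field; rewrite !gt_eqF.
have ind j : (j <= s)%N -> j%:R * a j <= K1 * (lam * (a 0%N - a j) + j%:R * K2).
  elim: j => [|j ih] js; first by rewrite subrr mulr0 !mul0r addr0 mulr0.
  have := lerD (ih (ltnW js)) (step j js); rewrite -mulrDr => h'.
  via (j%:R * a j + a j.+1).
    by rewrite -natr1 mulrDl mul1r lerD2r; apply: ler_wpM2l => //; exact: a_le.
  apply: le_trans h' _; apply: eq_ler; rewrite -natr1; ring.
apply: le_trans (ind s (leqnn s)) _; rewrite -/K1 -[leRHS]mulrA; apply: ler_wpM2l => //.
have -> : (lam + s%:R * (lam `^ (1 - P0) * 2 ^+ (2 * N + 1))) * vol r = lam * vol r + s%:R * K2.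
  by rewrite /K2; ring.
rewrite lerD2r; apply: ler_wpM2l; first pos.
by apply: le_trans aV; rewrite gerBl ms_ge0.
Qed.

(** lam is so large that the part of [measure_shrink] that does not telescope stays below half of
    nu; given lam, s is so large that the telescoping part divided by s stays below the other half.
    [fast_decay] then applies to om 2^-(s+1) and halves it once more, whence [s.+2]. *)
Lemma degiorgi th : 0 < th -> exists s : nat, forall sg c r b om, `|sg| = 1 -> 0 < r -> r <= 1 ->
  2 ^+ s.+2 * r <= om -> om <= 2 * M0 -> admissible c r (b - om / 2) ->
  below sg c r b ->
  th * vol r <= ms (qc c (r / 2) `\` above sg (b - om / 2)) ->
  below sg c (r / 4) (b - om * 2^-1 ^+ s.+2).
Proof.
move=> th0; have [nu nu0 hnu] := fast_decay.
have Cp : 0 < C by exact: lt_le_trans ltr01 C1.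
pose K1 := th^-1 * C * 2 ^+ (N + 2); pose K2 : R := 2 ^+ (2 * N + 1).
have K10 : 0 < K1 by rewrite !mulr_gt0// invr_gt0.
have K20 : 0 < K2 by rewrite exprn_gt0.
pose lam := Num.max 1 ((nu / (2 * K1 * K2)) `^ (- (P0 - 1)^-1)).
have lam1 : 1 <= lam by rewrite le_max lexx.
have q0 : 0 < nu / (2 * K1 * K2) := divr_gt0 nu0 (mulr_gt0 (mulr_gt0 (ltr0Sn R 1) K10) K20).
have P1 : 0 < P0 - 1 by rewrite subr_gt0.
have lamP : lam `^ (1 - P0) <= nu / (2 * K1 * K2).
  have hh : (nu / (2 * K1 * K2)) `^ (- (P0 - 1)^-1) <= lam by rewrite le_max lexx orbT.
  have lp : 0 < (nu / (2 * K1 * K2)) `^ (- (P0 - 1)^-1) by rewrite powR_gt0.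
  have -> : nu / (2 * K1 * K2) = ((nu / (2 * K1 * K2)) `^ (- (P0 - 1)^-1)) `^ (1 - P0).
    rewrite -powRrM -[X in _ = _ `^ X](_ : 1 = _) ?powRr1 ?ltW//.
    by rewrite -[1 - P0]opprB mulrNN mulVf// gt_eqF.
  have -> : 1 - P0 = - (P0 - 1) by rewrite opprB.
  have lam0 : 0 < lam := lt_le_trans lp hh.
  rewrite (powRN lam) (powRN (_ `^ _) (P0 - 1)) lef_pV2 ?posrE ?powR_gt0//.
  by apply: powR_le; [pos|pos|].
have [s sp sK] : exists2 s : nat, (0 < s)%N & 2 * (K1 * lam) / nu <= s%:R.
  by exists (Num.truncn (2 * (K1 * lam) / nu)).+1 => //; exact: ltW (truncnS_gt _).
exists s => sg c r b om sg1 rp r1 rom omM adm su hth.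
have two j : 0 < (2 : R) ^+ j by rewrite exprn_gt0.
have rom1 : 2 ^+ s * r <= om.
  apply: le_trans rom; apply: ler_wpM2r; [pos|].
  by apply: ler_weXn2l; [rewrite ler1n|rewrite -addn2 leq_addr].
have MS := measure_shrink th0 lam1 sg1 rp r1 rom1 omM adm su hth.
have V0 := vol_gt0 rp; have s0 : 0 < s%:R :> R by rewrite ltr0n.
have i1 := half_bound nu0 sK.
pose om' := om * 2^-1 ^+ s.+1.
have rom' : r <= om'.
  rewrite /om' exprVn ler_pdivlMr//; apply: le_trans rom; rewrite mulrC; apply: ler_wpM2r; first pos.
  by apply: ler_weXn2l; rewrite ?ler1n.
have omp : 0 < om by apply: lt_le_trans rom; rewrite mulr_gt0.
have om'2 : om' <= om / 2.
  rewrite /om' exprS mulrA; rewrite ger_pMr ?divr_gt0//.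
  exact: half_le1.
have adm' : admissible c r (b - om').
  by apply: admissible_le adm _ (lexx _); rewrite lerD2l lerN2.
have om'M : om' <= 2 * M0 by apply: le_trans om'2 (le_trans _ omM); rewrite ler_pdivrMr// ler_peMr ?(ltW omp)// ler1n.
have sm : ms (lev sg (b - om') c (r / 2)) <= nu * vol r.
  rewrite -(ler_pM2l s0); apply: le_trans MS _; rewrite [leRHS]mulrA; apply: (ler_wpM2r (ltW V0)).
  rewrite -/K1 -/K2 mulrDr.

  have i2 : K1 * (s%:R * (lam `^ (1 - P0) * K2)) <= s%:R * (nu / 2).
    rewrite mulrCA; apply: ler_wpM2l; first pos. have := ler_wpM2l (ltW (mulr_gt0 K10 K20)) lamP.
    have -> : K1 * K2 * (nu / (2 * K1 * K2)) = nu / 2 by field; rewrite !gt_eqF.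
    by rewrite [lam `^ _ * K2]mulrC mulrA.
  by apply: le_trans (lerD i1 i2) _; rewrite -mulrDr -splitr.
apply: (ae_imp (hnu sg c r b om' sg1 rp r1 rom' om'M adm' su sm)) => x hx Ox Qx.
apply: le_trans (hx Ox Qx) _; rewrite lerD2l lerN2 /om' [_ ^+ s.+2]exprS.
by rewrite mulrCA [X in _ <= X]mulrC.
Qed.

(** * Decay of the oscillation *)

Variables (th1 R1 : R) (th10 : 0 < th1) (R10 : 0 < R1).
Local Notation ub := (ext0 Omega u).

Hypothesis exterior : forall y r, ~ Omega y -> 0 < r -> r <= R1 ->
  th1 * vol (2 * r) <= ms (qc y r `\` Omega).

Let mA := above_mset.

(** The two sets cover the cube because u > k and - u > - k exclude each other. *)
Lemma half_measure c r k : 0 < r ->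
  2^-1 * vol (2 * r) <= ms (qc c r `\` above 1 k) \/
  2^-1 * vol (2 * r) <= ms (qc c r `\` above (-1) (- k)).
Proof.
move=> rp; have mQ := qc_mset c r.
have mD sg k' : mset (qc c r `\` above sg k') by exact: measurableD.
have [h|h] := leP (2^-1 * vol (2 * r)) (ms (qc c r `\` above 1 k)); [by left|right].
have sub : qc c r `\` above 1 k `|` qc c r `\` above (-1) (- k) = qc c r.
  apply/seteqP; split => [x [[]|[]]//|x Qx].
  have [A1|nA] := pselect (above 1 k x); last by left.
  right; split => // -[_ /=]; case: A1 => _ /=; rewrite mul1r mulN1r ltrN2 => h1 h2.
  by have := lt_trans h1 h2; rewrite ltxx.
have f1 (D : set vec) : mset D -> D `<=` qc c r -> mu D \is a fin_num.
  by move=> m_ s; rewrite ge0_fin_numE//; exact: (qc_fin m_ s).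
have s1 sg k' : qc c r `\` above sg k' `<=` qc c r by move=> x [].
have le : ms (qc c r) <= ms (qc c r `\` above 1 k) + ms (qc c r `\` above (-1) (- k)).
  rewrite /ms -fineD ?f1// fine_le ?f1//.
    by rewrite fin_numD !f1.
  by rewrite -[X in (mu X <= _)%E]sub; apply: measureU2.
rewrite ms_qc in le; lra.
Qed.

(** Inside Omega, one of u and - u is below the middle level on half of the cube of half side r/8,
    and [degiorgi] in the cube of half side r/4 leads to r/16. If the closed cube of half side r/4
    contains a point outside Omega, the sign is chosen so that the middle level is nonnegative; the
    truncation above it then vanishes outside Omega, and the exterior supplies the density. *)
Lemma osc_step : exists th : R, 3 / 4 <= th /\ th < 1 /\ exists2 Ra : R, 0 < Ra & forall c r om m,
  0 < r -> r <= 1 -> r <= R1 -> r <= Ra * om -> om <= 2 * M0 ->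
  {ae mu, forall x, qc c r x -> m <= ub x <= m + om} ->
  exists m', {ae mu, forall x, qc c (r / 16) x -> m' <= ub x <= m' + th * om}.
Proof.
pose th := Num.min 2^-1 (th1 / 2 ^+ N).
have thp : 0 < th by rewrite lt_min invr_gt0 ltr0n/= divr_gt0// exprn_gt0.
have [s hs] := degiorgi thp; pose h : R := 2^-1 ^+ s.+2.
have h0 : 0 < h := half_gt0 _.
have h4 : h <= 4^-1.
  have -> : 4^-1 = (2^-1 : R) ^+ 2 by rewrite expr2; field.
  exact: half_le.
exists (1 - h); split; first lra; split; first lra; exists h => // c r om m rp r1 rR rom omM osc.
have rom' : 2 ^+ s.+2 * r <= om.
  by move: rom; rewrite /h exprVn -ler_pdivlMl// invrK.
have omp : 0 < om.
  by apply: lt_le_trans rom'; rewrite mulr_gt0// exprn_gt0.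
have q4 : 0 < r / 4 by rewrite divr_gt0.
have m1 : (-1 == 1 :> R) = false by rewrite eq_sym -subr_eq0 opprK -[1 + 1]/(2%:R) pnatr_eq0.
pose bb sg := if sg == 1 then m + om else - m : R.
have bbE sg : sg = 1 \/ sg = -1 -> below sg c r (bb sg).
  move=> sgE; apply: (ae_imp osc) => x hx Ox Qx; have := hx Qx; rewrite ext0_in// => /andP[l1 l2].
  case: sgE => ->; rewrite /bb ?eqxx; first by rewrite mul1r.
  by rewrite m1 mulN1r lerN2.
have bN : bb (-1) = - m by rewrite /bb m1.
have bP : bb 1 = m + om by rewrite /bb eqxx.
have fin sg : sg = 1 \/ sg = -1 ->
    {ae mu, forall x, qc c (r / 16) x -> sg * ub x <= bb sg - om * h} ->
    exists m', {ae mu, forall x, qc c (r / 16) x -> m' <= ub x <= m' + (1 - h) * om}.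
  have qs : qc c (r / 16) `<=` qc c r by apply: qc_sub; lra.
  move=> sgE ae1; exists (if sg == 1 then m else m + om * h); apply: (ae_imp2 ae1 osc) => x h1 h2 Qx.
  have := h1 Qx; have /andP[l1 l2] := h2 (qs x Qx); case: sgE => ->.
    by rewrite eqxx bP mul1r => ?; lra.
  rewrite bN m1 mulN1r => ?.
  pos.
have sg1 sg : sg = 1 \/ sg = -1 -> `|sg| = 1 by case=> ->; rewrite ?normrN normr1.
have omh : om * h <= om / 4 by apply: ler_wpM2l; [pos|exact: h4].
have [bO|nbO] := pselect (box (c - const_mx (r / 4)) (c + const_mx (r / 4)) `<=` Omega).
  have [sg [sgE hm]] : exists sg, (sg = 1 \/ sg = -1) /\
      2^-1 * vol (2 * (r / 4 / 2)) <= ms (qc c (r / 4 / 2) `\` above sg (bb sg - om / 2)).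
    have q8 : 0 < r / 4 / 2 by rewrite divr_gt0.
    have [hm|hm] := half_measure c (m + om / 2) q8; [exists 1|exists (-1)]; split; [by left| |by right|].
      by move: hm; rewrite bP (_ : m + om - om / 2 = m + om / 2)//; field.
    by move: hm; rewrite bN (_ : - m - om / 2 = - (m + om / 2))//; ring.
  apply: (fin sg sgE).
  have e1 : 2 * (r / 4 / 2) = r / 4 by field.
  have hm2 : th * vol (r / 4) <= ms (qc c (r / 4 / 2) `\` above sg (bb sg - om / 2)).
    apply: le_trans hm; rewrite e1; apply: ler_wpM2r; first exact: vol_ge0. by rewrite ge_min lexx.
  have qr : qc c (r / 4) `<=` qc c r by apply: qc_sub; lra.
  have r41 : r / 4 <= 1 by lra.
  have r4o : 2 ^+ s.+2 * (r / 4) <= om.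
    pos.
  have su : below sg c (r / 4) (bb sg).
    by apply: (ae_imp (bbE sg sgE)) => x hx Ox Qx; apply: hx => //; exact: qr.
  have res := hs sg c (r / 4) (bb sg) om (sg1 sg sgE) q4 r41 r4o omM (or_intror bO) su hm2.
  apply: (ae_imp res) => x hx Qx; have Ox : Omega x.
    by apply: bO => i; have /qcP/(_ i)/andP[? ?] := Qx; rewrite !mxE; lra.
  rewrite ext0_in//; apply: hx => //; by rewrite (_ : r / 4 / 4 = r / 16)//; field.
have [y [yb nOy]] : exists y, box (c - const_mx (r / 4)) (c + const_mx (r / 4)) y /\ ~ Omega y.
  apply: contrapT => hn; apply: nbO => x bx; apply: contrapT => nOx; apply: hn; by exists x.
have [sg [sgE sg0]] : exists sg, (sg = 1 \/ sg = -1) /\ 0 <= bb sg - om / 2.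
  have [hm|hm] := leP 0 (m + om / 2); [exists 1|exists (-1)]; split; [by left| |by right|].
    pos.
  pos.
apply: (fin sg sgE).
have r4R : r / 4 <= R1 by lra.
have ext := exterior nOy q4 r4R.
have hm : th * vol r <= ms (qc c (r / 2) `\` above sg (bb sg - om / 2)).
  via (ms (qc y (r / 4) `\` Omega)).
    apply: le_trans ext; rewrite (_ : 2 * (r / 4) = r / 2); last by field.
    rewrite vol_half// mulrCA [leRHS]mulrC; apply: ler_wpM2r; first exact: vol_ge0.
    by rewrite ge_min lexx orbT.
  apply: (@ms_le c (r / 2)).
  - by apply: measurableD => //; exact: qc_mset.
  - by apply: measurableD => //; exact: qc_mset.
  - move=> x [/qcP Qx nO]; split; last by move=> [].
    apply/qcP => i; have := Qx i; have := yb i; rewrite !mxE => /andP[? ?] /andP[? ?]. pos.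
  - by move=> x [].
have res := hs sg c r (bb sg) om (sg1 sg sgE) rp r1 rom' omM (or_introl sg0) (bbE sg sgE) hm.
apply: (ae_imp res) => x hx Qx; have [Ox|nO] := pselect (Omega x); last by rewrite ext0_out// mulr0; lra.
rewrite ext0_in//; apply: hx => //; apply: qc_sub Qx; lra.
Qed.

(** R0 is small enough for the initial oscillation 2 M0. Since 1/16 <= th, the radii decrease at
    least as fast as the bounds on the oscillation, so the relation between them required by
    [osc_step] persists. *)
Lemma osc_decay : exists th R0 : R, [/\ 3 / 4 <= th, th < 1, 0 < R0 & forall c j, exists m,
  {ae mu, forall x, qc c (R0 * 16^-1 ^+ j) x -> m <= ub x <= m + 2 * M0 * th ^+ j}].
Proof.
have [th [th34 [th1' [Ra Ra0 hstep]]]] := osc_step.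
pose R0 := Num.min (Num.min 1 R1) (Ra * (2 * M0)).
have M00 : 0 < M0 by exact: lt_le_trans ltr01 M01.
have R00 : 0 < R0 by rewrite !lt_min ltr01 R10 !mulr_gt0.
have R0a : R0 <= Ra * (2 * M0) by rewrite ge_min lexx orbT.
have R0b : R0 <= 1 by rewrite !ge_min lexx.
have R0c : R0 <= R1 by rewrite !ge_min lexx orbT.
have thp : 0 < th by lra.
exists th, R0; split => // c; elim=> [|j [m ih]].
  exists (- M0); rewrite !expr0 !mulr1; apply: (ae_imp uM) => x hx _.
  have [Ox|nO] := pselect (Omega x); last by rewrite ext0_out//; lra.
  by rewrite ext0_in//; have := hx Ox; rewrite ler_norml => ?; lra.
have p16 : 0 < (16^-1 : R) ^+ j by rewrite exprn_gt0// invr_gt0.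
have p161 : (16^-1 : R) ^+ j <= 1 by rewrite exprn_ile1//// invf_le1// ler1n.
have rp : 0 < R0 * 16^-1 ^+ j by rewrite mulr_gt0.
have rR : R0 * 16^-1 ^+ j <= R0 by rewrite ler_piMr// ltW.
have p16th : (16^-1 : R) ^+ j <= th ^+ j.
  by apply: lerXn2r; rewrite ?nnegrE; lra.
have rom : R0 * 16^-1 ^+ j <= Ra * (2 * M0 * th ^+ j).
  rewrite mulrA; apply: ler_pM => //; exact: ltW.
have omM : 2 * M0 * th ^+ j <= 2 * M0.
  exact: (ler_piMr (mulr_ge0 (ler0n R 2) (ltW M00)) (exprn_ile1 j (ltW thp) (ltW th1'))).
have [m' hm'] := hstep c _ _ m rp (le_trans rR R0b) (le_trans rR R0c) rom omM ih.
exists m'; apply: (ae_imp hm') => x hx Qx.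
have -> : 2 * M0 * th ^+ j.+1 = th * (2 * M0 * th ^+ j) by rewrite exprS mulrCA.
apply: hx; rewrite (_ : _ / 16 = R0 * 16^-1 ^+ j.+1)// exprS; ring.
Qed.

End double_phase_setting.

#[global] Hint Extern 1 (is_true (0 <= Bx _ _ _ _ _ _ _)) => exact: Bx_ge0 : nonneg.

(** * The Hoelder continuous representative *)

Section holder_representative.
Context {R : realType} {N : nat}.
Notation mu := (leb R N).
Implicit Types (x y c : 'rV[R]_N) (r : R) (i j : nat).
Hypothesis vol_gt0 : forall r : R, 0 < r -> 0 < @vol R N r.
Variables (v : 'rV[R]_N -> R) (M0 W th R0 : R).
Hypotheses (vM : {ae mu, forall x, `|v x| <= M0}) (W0 : 0 <= W) (th16 : 16^-1 <= th) (th1 : th < 1)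
  (R00 : 0 < R0).
Let rho j : R := R0 * 16^-1 ^+ j.
Hypothesis osc : forall c j, exists m,
  {ae mu, forall x, qc c (R0 * 16^-1 ^+ j) x -> m <= v x <= m + W * th ^+ j}.

Let th0 : 0 < th. Proof. by apply: lt_le_trans th16; rewrite invr_gt0. Qed.
Let rho_gt0 j : 0 < rho j. Proof. by rewrite mulr_gt0// exprn_gt0// invr_gt0. Qed.
Let rhoS j : rho j.+1 <= rho j.
Proof.
apply: (ler_wpM2l (ltW R00)); by apply: ler_wiXn2l => //; rewrite invf_le1// ler1n.
Qed.

(** Cubes have positive measure, so none is contained in the exceptional null set. *)
Lemma ae_point (P : 'rV[R]_N -> Prop) c r : 0 < r -> {ae mu, forall x, P x} -> exists2 x, qc c r x & P x.
Proof.
move=> rp [Z [mZ Z0 PZ]]; apply: contrapT => hn.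
have sub : qc c r `<=` Z by move=> x Qx; apply: PZ => /= Px; apply: hn; exists x.
have : (mu (qc c r) <= 0)%E by rewrite -Z0; apply: le_measure; rewrite ?inE//; exact: qc_mset.
have -> : mu (qc c r) = (@vol R N (2 * r))%:E by exact: leb_cube.
by rewrite lee_fin leNgt vol_gt0// mulr_gt0.
Qed.

Let m c j : R := sval (cid (osc c j)).
Let mP c j : {ae mu, forall x, qc c (rho j) x -> m c j <= v x <= m c j + W * th ^+ j}.
Proof. exact: (svalP (cid (osc c j))). Qed.

(** The cubes about x and y share the cube of half side rho/2 about the midpoint, and a common point
    lies in both ranges. *)
Lemma osc_close x y j : `|x - y| <= rho j -> `|m x j - m y j| <= W * th ^+ j.
Proof.
move=> xy; have r2 : 0 < rho j / 2 by rewrite divr_gt0.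
have [z Qz [h1 h2]] := ae_point (2^-1 *: (x + y)) r2 (ae_imp2 (mP x j) (mP y j) (fun z a b => conj a b)).
have hc (i : 'I_N) : `|x 0 i - y 0 i| <= rho j by have := norm_coord (x - y) i; rewrite !mxE => /le_trans; apply.
have Qx : qc x (rho j) z.
  apply/qcP => i; have /qcP/(_ i) := Qz; have := hc i; rewrite !mxE ler_norml => /andP[? ?] /andP[? ?].
  pos.
have Qy : qc y (rho j) z.
  apply/qcP => i; have /qcP/(_ i) := Qz; have := hc i; rewrite !mxE ler_norml => /andP[? ?] /andP[? ?].
  pos.
have /andP[? ?] := h1 Qx; have /andP[? ?] := h2 Qy.
by rewrite ler_norml; lra.
Qed.

Lemma osc_succ x j : `|m x j.+1 - m x j| <= W * th ^+ j.
Proof.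
have [z Qz [h1 h2]] := ae_point x (rho_gt0 j.+1) (ae_imp2 (mP x j) (mP x j.+1) (fun z a b => conj a b)).
have /andP[a1 a2] := h1 (qc_sub (rhoS j) Qz); have /andP[a3 a4] := h2 Qz.
have : W * th ^+ j.+1 <= W * th ^+ j.
  by apply: (ler_wpM2l W0); rewrite exprS ler_piMl ?exprn_ge0// ltW.
by rewrite ler_norml => ?; lra.
Qed.

(** The sum of the geometric series of errors: the tail from j on amounts to K th^j. *)
Let K : R := W / (1 - th).
Let K0 : 0 <= K. Proof. by apply: divr_ge0 => //; rewrite subr_ge0 ltW. Qed.

Let KS j : W * th ^+ j + K * th ^+ j.+1 = K * th ^+ j.
Proof.
rewrite /K exprS; field; rewrite gt_eqF// subr_gt0//.
Qed.

Lemma osc_tail x j i : `|m x (j + i)%N - m x j| <= K * th ^+ j - K * th ^+ (j + i).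
Proof.
elim: i => [|i ih]; first by rewrite addn0 !subrr normr0.
have -> : m x (j + i.+1)%N - m x j = (m x (j + i).+1 - m x (j + i)%N) + (m x (j + i)%N - m x j).
  by rewrite addnS; ring.
apply: le_trans (ler_normD _ _) _; apply: le_trans (lerD (osc_succ x (j + i)) ih) _.
by rewrite addnS -(KS (j + i)); lra.
Qed.

Let thj j : 0 <= th ^+ j. Proof. pos. Qed.

Lemma osc_order x i j : m x i - K * th ^+ i <= m x j + K * th ^+ j.
Proof.
have [ij|ji] := leqP i j.
  have := osc_tail x i (j - i); rewrite subnKC// ler_norml => /andP[h1 h2].
  by have := mulr_ge0 K0 (thj j); lra.
have := osc_tail x j (i - j); rewrite subnKC ?(ltnW ji)// ler_norml => /andP[h1 h2].
by have := mulr_ge0 K0 (thj i); lra.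
Qed.

(** The values m x j form a Cauchy sequence with error K th^j; the supremum of these lower ends is
    its limit. *)
Definition rep x : R := sup (range (fun j => m x j - K * th ^+ j)).

Lemma rep_close x j : `|rep x - m x j| <= K * th ^+ j.
Proof.
have ub i : ubound (range (fun j => m x j - K * th ^+ j)) (m x i + K * th ^+ i).
  by move=> _ [k _ <-]; exact: osc_order.
have hs : has_sup (range (fun j => m x j - K * th ^+ j)).
  by split; [exists (m x 0%N - K * th ^+ 0), 0%N|exists (m x 0%N + K * th ^+ 0); exact: ub].
have u1 : rep x <= m x j + K * th ^+ j by apply: ge_sup; [case: hs|exact: ub].
have u2 : m x j - K * th ^+ j <= rep x by apply: ub_le_sup; [case: hs|exists j].
by rewrite ler_norml; lra.
Qed.

Lemma rep_osc x y j : `|x - y| <= rho j -> `|rep x - rep y| <= (2 * K + W) * th ^+ j.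
Proof.
move=> xy; have h1 := rep_close x j; have h2 := rep_close y j; have h3 := osc_close xy.
have -> : rep x - rep y = (rep x - m x j) + (m x j - m y j) - (rep y - m y j) by ring.
apply: le_trans (ler_normB _ _) _; apply: le_trans (lerD (ler_normD _ _) (lexx _)) _.
pos.
Qed.

Lemma rep_bounded x : `|rep x| <= M0 + W + K.
Proof.
have [z Qz [h1 h2]] := ae_point x (rho_gt0 0) (ae_imp2 (mP x 0) vM (fun z a b => conj a b)).
have := rep_close x 0; have /andP[a1 a2] := h1 Qz; rewrite expr0 mulr1 in a2 *.
by move: h2; rewrite !ler_norml => ? ?; lra.
Qed.

Lemma small_pow (d : R) : 0 < d -> exists j, rho j < d.
Proof.
move=> d0; exists (Num.truncn (R0 / d)).+1; rewrite /rho exprVn ltr_pdivrMr//.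
rewrite mulrC -ltr_pdivrMr//; apply: lt_le_trans (truncnS_gt _) _.
by rewrite -natrX ler_nat ltnW// ltn_expl.
Qed.

(** beta is defined by 16^-beta = th; it is at most 1 because th >= 1/16. For |x - y| <= R0 the
    oscillation is taken at the last scale that is not below the distance; for larger distances
    boundedness suffices. *)
Lemma rep_holder : exists beta L : R, [/\ 0 < beta, beta <= 1, 0 <= L &
  forall x y, `|rep x - rep y| <= L * `|x - y| `^ beta].
Proof.
pose beta : R := - ln th / ln 16.
have l16 : 0 < ln (16 : R) by rewrite ln_gt0// ltr1n.
have lth : ln th < 0 by rewrite ln_lt0// th0.
have b0 : 0 < beta by rewrite divr_gt0// oppr_gt0.
have b1 : beta <= 1.
  by rewrite ler_pdivrMr// mul1r lerNl -lnV ?posrE// ler_ln ?posrE.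
have thE j : th ^+ j = (16^-1 ^+ j) `^ beta.
  rewrite -!powR_mulrn ?(ltW th0)// -powRrM mulrC powRrM; congr (_ `^ _).
  rewrite /powR invr_eq0 pnatr_eq0/= lnV ?posrE// (_ : beta * _ = ln th) ?lnK//.
  by rewrite /beta mulrN mulNr mulNr opprK divfK// gt_eqF.
pose L : R := (2 * K + W) / th * R0 `^ (- beta) + 2 * (M0 + W + K) * R0 `^ (- beta).
have M00 : 0 <= M0 + W + K by apply: le_trans (rep_bounded 0).
have R0b := powR_ge0 R0 (- beta).
have L1 : 0 <= (2 * K + W) / th * R0 `^ (- beta).
  pos.
have L2 : 0 <= 2 * (M0 + W + K) * R0 `^ (- beta) by rewrite !mulr_ge0.
exists beta, L; split => //; first exact: addr_ge0.
move=> x y; have [->|/eqP xy] := pselect (x = y).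
  by rewrite subrr normr0 mulr_ge0// addr_ge0.
have d0 : 0 < `|x - y| by rewrite normr_gt0 subr_eq0.
set d := `|x - y| in d0 *.
have dp := powR_ge0 d beta.
have scale (t : R) : 0 < t -> (R0 * t) `^ beta * R0 `^ (- beta) = t `^ beta.
  by move=> tp; rewrite powRM ?ltW// mulrAC -powRD_pos// subrr powRr0 mul1r.
have [dR|dR] := leP d R0; last first.
  via (2 * (M0 + W + K)).
    by apply: le_trans (ler_normB _ _) _; have := rep_bounded x; have := rep_bounded y; lra.
  via (2 * (M0 + W + K) * (R0 `^ (- beta) * d `^ beta)).
    rewrite ler_peMr ?mulr_ge0//; via (R0 `^ (- beta) * R0 `^ beta).
      by rewrite -powRD_pos// addNr powRr0.
    by apply: (ler_wpM2l R0b); apply: powR_le; exact: ltW.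
  by rewrite /L mulrA; apply: (ler_wpM2r dp); rewrite lerDr.
have [] := ex_minnP (small_pow d0); case=> [|j] hj jmin.
  by move: hj; rewrite /rho expr0 mulr1 ltNge dR.
have dj : d <= rho j by rewrite leNgt; apply/negP => /jmin; rewrite ltnn.
apply: le_trans (rep_osc dj) _.
via ((2 * K + W) / th * R0 `^ (- beta) * d `^ beta); last first.
  by apply: (ler_wpM2r dp); rewrite lerDl.
have -> : (2 * K + W) * th ^+ j = (2 * K + W) / th * th ^+ j.+1.
  by rewrite exprS mulrA divfK// gt_eqF.
have k0 : 0 <= (2 * K + W) / th by rewrite divr_ge0 ?(ltW th0)// addr_ge0// mulr_ge0.
rewrite -[leRHS]mulrA; apply: (ler_wpM2l k0).
have t16 : 0 < (16^-1 : R) ^+ j.+1 by rewrite exprn_gt0// invr_gt0.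
rewrite thE -(scale _ t16) mulrC; apply: (ler_wpM2l R0b); apply: powR_le; [pos| |exact: ltW].
pos.
Qed.

(** At every scale the cubes centred at the lattice points of rho_j Z^N cover space. There are
    countably many of them over all scales, so outside one null set all their oscillation bounds
    hold together. *)
Lemma rep_ae : {ae mu, forall x, v x = rep x}.
Proof.
pose ctr j (z : 'rV[int]_N) : 'rV[R]_N := \row_i (rho j * (z 0 i)%:~R).
have aeP : {ae mu, forall x, forall l : nat, forall j (z : 'rV[int]_N), unpickle l = Some (j, z) ->
    qc (ctr j z) (rho j) x -> m (ctr j z) j <= v x <= m (ctr j z) j + W * th ^+ j}.
  apply: ae_nat => l; case E : (unpickle l) => [[j z]|].
    by apply: (ae_imp (mP (ctr j z) j)) => x hx j' z' [<- <-].
  exact: ae_all.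
apply: (ae_imp aeP) => x hx; apply/eqP; rewrite -subr_eq0 -normr_le0; apply/ler_addgt0Pr => e e0.
rewrite add0r.
have [j hj] : exists j, (2 * W + K) * th ^+ j <= e.
  have : (fun n => (2 * W + K) * th ^+ n) @ \oo --> (2 * W + K) * (0 : R).
    by apply: cvgMr; apply: cvg_expr; rewrite ger0_norm// ltW.
  rewrite mulr0 => cv; have [j _ /(_ j (leqnn j)) hj] := cvgr_le _ cv _ e0.
  by exists j.
apply: le_trans hj; pose z : 'rV[int]_N := \row_i Num.floor (x 0 i / rho j).
have fl (i : 'I_N) : (Num.floor (x 0 i / rho j))%:~R * rho j <= x 0 i < ((Num.floor (x 0 i / rho j))%:~R + 1) * rho j.
  have := floor_itv (x 0 i / rho j); rewrite intrD => /andP[h1 h2].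
  by rewrite -ler_pdivlMr// h1 -ltr_pdivrMr.
have zi (i : 'I_N) : ctr j z 0 i <= x 0 i < ctr j z 0 i + rho j.
  by have := fl i; rewrite !mxE mulrDl mul1r [_ * rho j]mulrC.
have Qx : qc (ctr j z) (rho j) x.
  by apply/qcP => i; have /andP[? ?] := zi i; have := rho_gt0 j => ?; lra.
have close : `|ctr j z - x| <= rho j.
  apply: norm_rV_le => [|i]; first pos.
  by rewrite !mxE; have := zi i; rewrite !mxE => /andP[? ?]; rewrite ler_norml; lra.
have /andP[a1 a2] := hx (pickle (j, z)) j z (pickleK _) Qx.
have h2 := osc_close close; have h3 := rep_close x j.
move: h2 h3; rewrite !ler_norml => /andP[? ?] /andP[? ?].
pos.
Qed.

End holder_representative.

(** * Uniform constants on compact sets; comparison of norms *)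

Section compactness.
Context {R : realType} {N : nat}.
Implicit Types (x y : 'rV[R]_N) (K : set 'rV[R]_N) (e : R).

Lemma compact_uniform K (P : R -> 'rV[R]_N -> Prop) : compact K ->
  (forall e e' x, e' <= e -> P e x -> P e' x) ->
  (forall x, K x -> exists2 e, 0 < e & forall y, `|y - x| < e -> P e y) ->
  exists2 e, 0 < e & forall x, K x -> P e x.
Proof.
move=> /compact_near_coveringP cK mono loc.
have h : \forall e \near (0 : R)^'+, K `<=` P e.
  apply: cK => x Kx; have [e e0 he] := loc x Kx.
  exists (ball (x : 'rV[R]_N) e, [set e' | e' < e]).
    by split; [exact: nbhsx_ballx|exact: nbhs_right_lt].
  move=> [y e'] /= [xy e'e]; apply: (mono e) (ltW e'e) _; apply: he; rewrite distrC.
  by move: xy; rewrite -ball_normE.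
have h2 : \forall e \near (0 : R)^'+, 0 < e by exact: nbhs_right_gt.
near (0 : R)^'+ => e; exists e; first by near: e; exact: h2.
by near: e; exact: h.
Unshelve. all: by end_near. Qed.

Lemma lipschitz_pos K (F : 'rV[R]_N -> R) (L : R) : compact K -> 0 <= L ->
  (forall x y, K x -> K y -> `|F y - F x| <= L * `|y - x|) -> (forall x, K x -> 0 < F x) ->
  exists2 e, 0 < e & forall x, K x -> e <= F x.
Proof.
move=> cK L0 lip pos; suff [e e0 he] : exists2 e, 0 < e & forall x, K x -> K x -> e <= F x.
  by exists e => // x Kx; exact: he.
apply: (compact_uniform (P := fun e x => K x -> e <= F x) cK) => [e e' x ee h Kx|x Kx].
  exact: le_trans ee (h Kx).
have Fx := pos x Kx; have L1 : 0 < 2 * (L + 1) by lra.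
exists (Num.min (F x / 2) (F x / (2 * (L + 1)))); first by rewrite lt_min !divr_gt0.
move=> y; rewrite lt_min => /andP[_ yx] Ky; rewrite ge_min; apply/orP; left.
have := lip x y Kx Ky; rewrite ler_norml => /andP[h _].
move: yx; rewrite ltr_pdivlMr// => yx; have := normr_ge0 (y - x); nra.
Qed.

Lemma enorm_max x : enorm x <= N%:R * `|x|.
Proof.
apply: le_trans (enorm_norm1 x) _; rewrite mulr_natl -[X in _ *+ X]card_ord -sumr_const.
by apply: ler_sum => i _; exact: norm_coord.
Qed.

Lemma norm_enorm x : `|x| <= enorm x.
Proof. by apply: norm_rV_le => [|i]; [pos|exact: enorm_coord]. Qed.

Lemma holder1_lipschitz K (v : 'rV[R]_N -> R) : holder_on K 1 v ->
  exists2 L, 0 <= L & forall x y, K x -> K y -> `|v y - v x| <= L * `|y - x|.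
Proof.
move=> [L hL]; exists (`|L| * N%:R); first pos.
move=> x y Kx Ky; apply: le_trans (hL y x Ky Kx) _; rewrite powRr1 ?enorm_ge0// -mulrA.
apply: le_trans (ler_norm _) _; rewrite normrM (ger0_norm (enorm_ge0 _)); apply: ler_wpM2l => //.
exact: enorm_max.
Qed.

End compactness.

(** * Density of the exterior of a Lipschitz domain *)

Section exterior_density.
Context {R : realType} {N : nat}.
Notation mu := (leb R N).
Implicit Types (x y : 'rV[R]_N) (e r : R).
Variable Omega : set 'rV[R]_N.
Hypothesis oO : open Omega.
Hypothesis N_gt0 : (0 < N)%N.
Let mO : mset Omega := open_mset oO.

Lemma dotp_mx x y : dotp x y = (x *m y^T) 0 0.
Proof. by rewrite /dotp mxE; apply: eq_bigr => i _; rewrite mxE. Qed.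

Lemma enorm_orth (Q : 'M[R]_N) x : Q *m Q^T = 1%:M -> enorm (x *m Q) = enorm x.
Proof. by move=> QQ; rewrite /enorm !dotp_mx trmx_mul mulmxA -(mulmxA x) QQ mulmx1. Qed.

Lemma enorm_delta (i : 'I_N) : enorm (delta_mx 0 i : 'rV[R]_N) = 1.
Proof.
rewrite /enorm /dotp (bigD1 i)//= big1 ?addr0; last first.
  by move=> j ji; rewrite !mxE eqxx (negbTE ji) mulr0.
by rewrite !mxE !eqxx mulr1 sqrtr1.
Qed.

Lemma enorm_col' (i : 'I_N) x : enorm (col' i x) <= N%:R * enorm x.
Proof.
apply: le_trans (enorm_norm1 _) _; via (\sum_(j < N.-1) enorm x).
  by apply: ler_sum => j _; rewrite mxE; exact: enorm_coord.
rewrite sumr_const card_ord -[leLHS]mulr_natl; apply: ler_wpM2r; first pos.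
by rewrite ler_nat leq_pred.
Qed.

(* Outside Omega, a vertical cone below the graph lies outside Omega; it contains a cube of
   comparable size. *)
Lemma graph_density x0 (Q : 'M[R]_N) (i : 'I_N) (gamma : 'rV[R]_N.-1 -> R) :
  Q *m Q^T = 1%:M -> holder_on setT 1 gamma ->
  (\forall x \near x0, Omega x <-> gamma (col' i (x *m Q)) < (x *m Q) 0 i) ->
  exists2 e, 0 < e & forall y, `|y - x0| <= e -> ~ Omega y -> forall r, 0 < r -> r <= e ->
    e * @vol R N (2 * r) <= ms (qc y r `\` Omega).
Proof.
move=> QQ [Lg hLg] /nbhs_normP[e1 /= e10 near].
pose L := `|Lg|; pose n : R := N%:R; have n1 : 1 <= n by rewrite ler1n.
have L0 : 0 <= L by exact: normr_ge0.
(* With rho = r / D and a = r / 4 this gives n rho + L n^2 rho = a: lowering a cube by a outweighs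
   its extent and the variation of the graph over it. *)
pose D := 4 * (n + L * n ^+ 2).
have Ln : 0 <= L * n ^+ 2 by rewrite mulr_ge0// exprn_ge0//.
have D4 : 4 <= D by rewrite /D; lra.
(* The ratio D is rounded up to a power of 2, so that [vol] can be compared by repeated halving. *)
have [k hk] : exists k : nat, D <= 2 ^+ k.
  exists (Num.truncn D).+1; apply: le_trans (ltW (truncnS_gt _)) _.
  by rewrite -natrX ler_nat ltnW// ltn_expl.
have p2 : 0 < (2 : R) ^+ (N * k) by rewrite exprn_gt0.
exists (Num.min (e1 / 4) (2 ^- (N * k))); first by rewrite lt_min divr_gt0//= invr_gt0.
move=> y; rewrite le_min => /andP[yx0 _] nOy r r0; rewrite le_min => /andP[re1 _].
have he1 : e1 / 4 * 4 = e1 by field.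
(* The unit vector that Q maps to the vertical axis i. *)
pose es : 'rV[R]_N := delta_mx 0 i *m Q^T.
have QQ' : Q^T *m Q = 1%:M by exact: mulmx1C.
have esQ : es *m Q = delta_mx 0 i by rewrite -mulmxA QQ' mulmx1.
have es1 : enorm es = 1 by rewrite -(enorm_orth es QQ) esQ enorm_delta.
have esj j : `|es 0 j| <= 1 by rewrite -es1 enorm_coord.
pose a := r / 4; pose rho := r / D.
have Dp : 0 < D by lra.
have rho0 : 0 < rho by rewrite divr_gt0.
have a0 : 0 <= a by rewrite divr_ge0// ltW.
have r20 : 0 <= r / 2 by rewrite divr_ge0// ltW.
have rho4 : rho <= r / 4 by rewrite ler_pM2l// lef_pV2 ?posrE.
have rhoa : n * rho + L * n ^+ 2 * rho = a by rewrite /rho /a /D; field; rewrite gt_eqF//; lra.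
have ny : (y *m Q) 0 i <= gamma (col' i (y *m Q)).
  have yn : ball_ Num.norm x0 e1 y by rewrite /= distrC; lra.
  by have [_ h] := near y yn; rewrite leNgt; apply/negP => lt; exact: nOy (h lt).
pose xs := y - a *: es.
have hx x : qc xs rho x -> [/\ forall j, `|x 0 j - y 0 j| <= r / 2 & ~ Omega x].
  move=> /qcP Qx; pose h := x - xs.
  have hj j : `|h 0 j| <= rho.
    have := Qx j; rewrite /h !mxE => /andP[? ?]; rewrite ler_norml; lra.
  have xE : x = y - a *: es + h by rewrite /h addrC subrK.
  have coord j : `|x 0 j - y 0 j| <= r / 2.
    have -> : x 0 j - y 0 j = h 0 j - a * es 0 j by rewrite {1}xE !mxE; ring.
    apply: le_trans (ler_normB _ _) _; rewrite normrM (ger0_norm a0).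
    by have := ler_wpM2l a0 (esj j); have := hj j; rewrite /a in a0 *; lra.
  split => // Ox.
  have xn : ball_ Num.norm x0 e1 x.
    have : `|x - y| <= r / 2 by apply: norm_rV_le => [//|j]; rewrite !mxE; exact: coord.
    have := ler_distD y x x0; rewrite /= (distrC x0 x); lra.
  have [hO _] := near x xn; have := hO Ox.
  have xQ : x *m Q = y *m Q - a *: delta_mx 0 i + h *m Q.
    by rewrite {1}xE mulmxDl mulmxBl -scalemxAl esQ.
  have xQj j : (x *m Q) 0 j = (y *m Q) 0 j - a * (j == i)%:R + (h *m Q) 0 j.
    by rewrite xQ; move: (y *m Q) (h *m Q) => A1 A2; rewrite !mxE eqxx.
  have he : enorm (h *m Q) <= n * rho.
    rewrite enorm_orth//; apply: le_trans (enorm_max _) _; apply: ler_wpM2l; first lra.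
    by apply: norm_rV_le => //; exact: ltW.
  have xQi : (x *m Q) 0 i <= (y *m Q) 0 i - a + n * rho.
    have := le_trans (enorm_coord (h *m Q) i) he; rewrite xQj ler_norml => /andP[_ ?].
    by rewrite eqxx mulr1; lra.
  have cQ : col' i (y *m Q) - col' i (x *m Q) = - col' i (h *m Q).
    apply/rowP => j; have := xQj (lift i j); rewrite eq_sym (negbTE (neq_lift i j)) mulr0.
    by move: (y *m Q) (h *m Q) (x *m Q) => A1 A2 A3; rewrite !mxE => ->; ring.
  have eN v : enorm (- v : 'rV[R]_N.-1) = enorm v.
    by rewrite /enorm /dotp; congr Num.sqrt; apply: eq_bigr => j _; rewrite !mxE mulrNN.
  have hg := hLg (col' i (y *m Q)) (col' i (x *m Q)) Logic.I Logic.I.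
  rewrite powRr1 ?enorm_ge0// cQ eN in hg.
  have hg2 : gamma (col' i (y *m Q)) - gamma (col' i (x *m Q)) <= L * (n * (n * rho)).
    apply: le_trans (ler_norm _) (le_trans hg _); via (L * enorm (col' i (h *m Q))).
      by apply: ler_wpM2r; [pos|exact: ler_norm].
    apply: (ler_wpM2l L0); apply: le_trans (enorm_col' i _) _; apply: ler_wpM2l => //.
  move=> lt; move: hg2; have -> : L * (n * (n * rho)) = L * n ^+ 2 * rho by ring.
  lra.
via (ms (qc xs rho)).
  rewrite ms_qc; via (2 ^- (N * k) * @vol R N (2 * r)).
    by apply: ler_wpM2r; [exact: vol_ge0|rewrite ge_min lexx orbT].
  rewrite mulrC -vol_half_iter ?mulr_gt0//; apply: le_vol.
  by rewrite -mulrA ler_pM2l// /rho ler_pM2l// lef_pV2 ?posrE// exprn_gt0.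
apply: (@ms_le _ _ y r).
- exact: qc_mset.
- by apply: measurableD => //; exact: qc_mset.
- move=> x /hx[co nO]; split => //; apply/qcP => j; have := co j; rewrite ler_norml => /andP[? ?].
  lra.
- by move=> x [].
Qed.

(** Near a point of Omega small cubes have no centre outside; near a boundary point the graph gives
    the density. Compactness of the closure makes the constant uniform, and a cube that misses Omega
    has density 1. *)
Lemma exterior_density : compact (closure Omega) -> lipschitz_boundary Omega ->
  exists th1 R1 : R, [/\ 0 < th1, 0 < R1 & forall y r, ~ Omega y -> 0 < r -> r <= R1 ->
    th1 * @vol R N (2 * r) <= ms (qc y r `\` Omega)].
Proof.
move=> cK lip.
pose P e x := forall y, `|y - x| <= e -> ~ Omega y -> forall r, 0 < r -> r <= e ->
    e * @vol R N (2 * r) <= ms (qc y r `\` Omega).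
have mono e e' x : e' <= e -> P e x -> P e' x.
  move=> ee h y yx nO r r0 re; apply: le_trans (h y (le_trans yx ee) nO r r0 (le_trans re ee)).
  by apply: ler_wpM2r => //; exact: vol_ge0.
have loc x : closure Omega x -> exists2 e, 0 < e & forall y, `|y - x| < e -> P e y.
  move=> Kx; suff [e e0 he] : exists2 e, 0 < e & P e x.
    have e2 : 0 < e / 2 by rewrite divr_gt0. have h2 : e / 2 <= e by lra.
    exists (e / 2) => // y yx z zy nO r r0 re; apply: le_trans (he z _ nO r r0 (le_trans re h2)).
      by apply: ler_wpM2r => //; exact: vol_ge0.
    have := ler_distD y z x; lra.
  have [Ox|nO] := pselect (Omega x).
    have /nbhs_normP[e /= e0 he] := open_nbhs_nbhs (conj oO Ox). exists (e / 2); first pos.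
    move=> y yx nO; exfalso; apply: nO; apply: he => /=; rewrite distrC; lra.
  have bx : (closure Omega `\` interior Omega) x by split => // /interior_subset.
  have [Q [i [gamma [QQ hg near]]]] := lip x bx.
  exact: graph_density QQ hg near.
have [e e0 he] := compact_uniform cK mono loc.
exists (Num.min e 1), e; split => //; first by rewrite lt_min e0 ltr01.
move=> y r nO r0 re; have V0 := @vol_ge0 R N (2 * r).
have [[x [Qx Ox]]|hn] := pselect (exists x, qc y r x /\ Omega x).
  via (e * @vol R N (2 * r)); first by apply: ler_wpM2r; rewrite ?ge_min ?lexx.
  apply: (he x (subset_closure Ox)) => //; apply: norm_rV_le => [|j]; first pos.
  have /qcP/(_ j)/andP[? ?] := Qx; rewrite !mxE ler_norml; lra.
have -> : qc y r `\` Omega = qc y r.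
  by apply/seteqP; split => [x []//|x Qx]; split => // Ox; apply: hn; exists x.
by rewrite ms_qc ler_piMl// ge_min lexx orbT.
Qed.

End exterior_density.

Lemma bounded_sub_box {R : realType} {N : nat} (A : set 'rV[R]_N) : bounded_set A ->
  exists2 r : R, 0 < r & forall x, A x -> `|x| <= r.
Proof.
move=> [M [Mr hM]]; exists (Num.max 1 (M + 1)); first by rewrite lt_max ltr01.
move=> x Ax; apply: le_trans (hM (M + 1) _ x Ax) _; first by rewrite ltrDl.
by rewrite le_max lexx orbT.
Qed.

Lemma closure_norm_le {R : realType} {N : nat} (A : set 'rV[R]_N) (r : R) :
  (forall x, A x -> `|x| <= r) -> forall x, closure A x -> `|x| <= r.
Proof.
move=> h x; rewrite (closureE A) => /(_ [set y | `|y| <= r]); apply; split => //.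
have -> : [set y : 'rV[R]_N | `|y| <= r] = (fun y => `|y|) @^-1` [set t | t <= r] by [].
apply: preimage_closed => [y _|]; [exact: norm_continuous|exact: closed_le].
Qed.

(** * Uniform constants from the hypotheses on the domain and the exponents *)

Section main.
Context {R : realType} {N : nat}.
Notation mu := (leb R N).
Implicit Types (x y : 'rV[R]_N).
Variables (Omega : set 'rV[R]_N) (p q w : 'rV[R]_N -> R) (delta eta : R).
Hypotheses (N2 : (2 <= N)%N) (domO : bounded_domain Omega)
  (p_lip : holder_on (closure Omega) 1 p) (q_lip : holder_on (closure Omega) 1 q)
  (w_lip : holder_on (closure Omega) 1 w) (w0 : forall x, closure Omega x -> 0 <= w x)
  (pq : forall x, closure Omega x -> [/\ 1 < p x, p x <= q x & q x < N%:R])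
  (qp : forall x, closure Omega x -> q x / p x < 1 + 1 / N%:R)
  (delta1 : 1 <= delta) (eta0 : 0 <= eta).

Lemma domain_compact : compact (closure Omega).
Proof.
have [_ _ _ /bounded_sub_box[r r0 hr]] := domO.
have c := @closed_closure _ Omega; have cl := closure_norm_le hr.
have sub : closure Omega `<=` box (const_mx (- r)) (const_mx r).
  by move=> x /cl xr i; rewrite !mxE -ler_norml; exact: le_trans (norm_coord x i) xr.
by apply: (subclosed_compact c _ sub); exact: box_compact.
Qed.

Lemma domain_cube : exists (c0 : 'rV[R]_N) (r0 : R), 0 < r0 /\ Omega `<=` cube c0 r0.
Proof.
have [_ _ _ /bounded_sub_box[r r0 hr]] := domO.
exists (const_mx (- r)), (2 * r + 1); split; first lra.
move=> x /hr xr i; have := le_trans (norm_coord x i) xr; rewrite ler_norml !mxE => /andP[? ?].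
lra.
Qed.

(** By halving backwards, a null cube of side r forces all cubes of side r 2^k to be null, and one
    of these sides exceeds that of a cube around Omega. *)
Lemma degenerate_null : (exists2 r : R, 0 < r & @vol R N r <= 0) -> mu Omega = 0%E.
Proof.
move=> [r r0 v0]; have [c [s [s0 hs]]] := domain_cube; have [_ oO _ _] := domO.
have [k hk] : exists k : nat, s <= r * 2 ^+ k.
  exists (Num.truncn (s / r)).+1; rewrite mulrC -ler_pdivrMr//; apply: le_trans (ltW (truncnS_gt _)) _.
  by rewrite -natrX ler_nat ltnW// ltn_expl.
have r2 : 0 < r * 2 ^+ k by rewrite mulr_gt0// exprn_gt0.
have z : @vol R N (r * 2 ^+ k) <= 0.
  have := @vol_half_iter R N (r * 2 ^+ k) k r2; rewrite mulfK// => e.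
  by move: v0; rewrite e pmulr_lle0// invr_gt0 exprn_gt0.
apply/eqP; rewrite eq_le measure_ge0 andbT.
via (mu (cube c s)).
  by apply: le_measure; rewrite ?inE//; [exact: open_mset|exact: cube_mset].
by rewrite leb_cube lee_fin; apply: le_trans (le_vol hk) z.
Qed.

(** On the compact closure, Lipschitz continuity turns the strict pointwise inequalities into
    uniform margins e1, e2 and e3. *)
Lemma double_phaseP : (forall r : R, 0 < r -> 0 < @vol R N r) ->
  exists c0 r0 P0 Q1 gap M La, double_phase Omega p q w delta eta c0 r0 P0 Q1 gap M La.
Proof.
move=> vol_gt0; have cK := domain_compact; have [c0 [r0 [r00 hc]]] := domain_cube.
have [[x0 Ox0] oO _ /bounded_sub_box[rb rb0 hb]] := domO.
have [Lp Lp0 hp] := holder1_lipschitz p_lip; have [Lq Lq0 hq] := holder1_lipschitz q_lip.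
have [Lw Lw0 hw] := holder1_lipschitz w_lip.
pose n : R := N%:R; have n2 : 2 <= n by rewrite ler_nat.
have i0 : 0 <= n^-1 by rewrite invr_ge0.
have i1 : n^-1 <= 1 by rewrite invf_le1; lra.
have nn : n * n^-1 = 1 by rewrite mulfV// gt_eqF//; lra.
have [e1 e10 h1] : exists2 e : R, 0 < e & forall x, closure Omega x -> e <= p x - 1.
  apply: (lipschitz_pos cK Lp0) => [x y Kx Ky|x Kx]; last by have [? _ _] := pq Kx; lra.
  by rewrite opprB addrA subrK; exact: hp.
have [e2 e20 h2] : exists2 e : R, 0 < e & forall x, closure Omega x -> e <= n - q x.
  apply: (lipschitz_pos cK Lq0) => [x y Kx Ky|x Kx]; last by have [_ _ ?] := pq Kx; rewrite subr_gt0.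
  by rewrite opprB addrC addrA subrK distrC; exact: hq.
have LL : 0 <= 2 * Lp + Lq by lra.
have [e3 e30 h3] : exists2 e : R, 0 < e & forall x, closure Omega x -> e <= p x * (1 + n^-1) - q x.
  apply: (lipschitz_pos cK LL) => [x y Kx Ky|x Kx]; last first.
    have [? _ _] := pq Kx; have := qp Kx; rewrite ltr_pdivrMr; last lra. pos.
  have -> : p y * (1 + n^-1) - q y - (p x * (1 + n^-1) - q x) = (p y - p x) * (1 + n^-1) - (q y - q x) by ring.
  apply: le_trans (ler_normB _ _) _; rewrite [leRHS]mulrDl; apply: lerD; last exact: hq.
  rewrite normrM mulrC [X in _ <= X](_ : _ = 2 * (Lp * `|y - x|)); last by rewrite mulrA.
  have a0 : 0 <= 1 + n^-1 by lra.
  by apply: ler_pM => //; [rewrite ger0_norm//; lra|exact: hp].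
have [Mw Mw0 hM] : exists2 Mw : R, 0 <= Mw & forall x, closure Omega x -> w x <= Mw.
  have K0 := subset_closure Ox0; have cb := closure_norm_le hb.
  exists (`|w x0| + Lw * (2 * rb)); first pos.
  move=> x Kx; have := hw x0 x K0 Kx; have d : `|x - x0| <= 2 * rb.
    by apply: le_trans (ler_normB _ _) _; have := cb x Kx; have := cb x0 K0; lra.
  have := ler_wpM2l Lw0 d; rewrite ler_norml => ? /andP[_ ?].
  by have := ler_norm (w x0); lra.
pose La := Lp + Lq + Lw; have sc := @subset_closure _ Omega.
(* As p < n, the margin e3 of p (1 + 1/n) - q becomes the margin e3 / n for the quotient q / p. *)
exists c0, r0, (1 + e1), (n - e2), (e3 / n), Mw, La; split => //.
- pos.
- by rewrite ltrBlDr ltrDl.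
- pos.
- by rewrite !addr_ge0.
- move=> x /sc Kx; have [p1 ppq qn] := pq Kx; have g1 := h1 x Kx; have g2 := h2 x Kx; have g3 := h3 x Kx.
  split; [lra|exact: ppq|lra| |by rewrite w0//= hM].
  rewrite ler_pdivrMr; last lra.
  have pn : p x * n^-1 <= 1 by rewrite ler_pdivrMr; lra.
  have := ler_wpM2l (ltW e30) pn; lra.
- move=> x y /sc Kx /sc Ky; apply: le_trans (hp x y Kx Ky) _; apply: ler_wpM2r => //; rewrite /La; lra.
- move=> x y /sc Kx /sc Ky; apply: le_trans (hq x y Kx Ky) _; apply: ler_wpM2r => //; rewrite /La; lra.
- move=> x y /sc Kx /sc Ky; apply: le_trans (hw x y Kx Ky) _; apply: ler_wpM2r => //; rewrite /La; lra.
Qed.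

End main.

Theorem corollary1p5 (R : realType) (N : nat) (Omega : set 'rV[R]_N)
    (p q mu : 'rV[R]_N -> R) (delta eta C : R)
    (f : 'rV[R]_N -> R -> 'rV[R]_N -> R) (u : 'rV[R]_N -> R)
    (N_ge2 : (2 <= N)%N)
    (domOmega : bounded_domain Omega)
    (lipOmega : lipschitz_boundary Omega)
    (p_lip : holder_on (closure Omega) 1 p)
    (q_lip : holder_on (closure Omega) 1 q)
    (mu_lip : holder_on (closure Omega) 1 mu)
    (mu_ge0 : forall x, closure Omega x -> 0 <= mu x)
    (pq : forall x, closure Omega x -> [/\ 1 < p x, p x <= q x & q x < N%:R])
    (qp : forall x, closure Omega x -> q x / p x < 1 + 1 / N%:R)
    (delta_bnd : 1 <= delta <= expR 1)
    (eta_ge0 : 0 <= eta)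
    (delta_eta : 1 < delta + eta)
    (f_car : caratheodory_fun Omega f)
    (C_gt0 : 0 < C)
    (f_growth : {ae leb R N, forall x, Omega x -> forall t xi,
      `|f x t xi| <= C * growth_bound p q mu delta eta x t xi})
    (u_sol : weak_solution Omega (Hlog p q mu delta eta)
      (Alog p q mu delta eta) f u) :
  exists beta : R, 0 < beta <= 1 /\
    exists v : 'rV[R]_N -> R, holder_on (closure Omega) beta v /\
      {ae leb R N, forall x, Omega x -> u x = v x}.
Proof.
have [_ oO _ _] := domOmega; have mO := open_mset oO; have /andP[d1 _] := delta_bnd.
have [vol_gt0|nvol] := pselect (forall r : R, 0 < r -> 0 < @vol R N r); last first.
  (* Some cube is null, hence so is Omega, and the zero function is a representative. *)
  exists 1; rewrite ltr01 lexx; split => //; exists (fun=> 0); split.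
    by exists 0 => x y _ _; rewrite subrr normr0 mul0r.
  exists Omega; split => //; last by move=> x /= nx; apply: contrapT => nO; apply: nx.
  apply: degenerate_null => //; apply: contrapT => hn; apply: nvol => r r0.
  by rewrite ltNge; apply/negP => le; apply: hn; exists r.
have [c0 [r0 [P0 [Q1 [gap [M [La S]]]]]]] :=
  double_phaseP N_ge2 domOmega p_lip q_lip mu_lip mu_ge0 pq qp d1 eta_ge0 vol_gt0.
have [uW eqn] := u_sol; have OQ := dp_cube S; have Hm := Hlog_modular S.
have [[phi [Phi ug]] _] := W1H0_approx oO OQ Hm uW.
have [M0 M01 uM] := solution_bounded S ug eqn C_gt0 f_growth.
have [Cg Cg1 GB] := gradient_bound S ug eqn C_gt0 f_growth M01 uM.
have [th1 [R1 [th10 R10 ext]]] := exterior_density oO (ltnW N_ge2) (domain_compact domOmega) lipOmega.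
have [th [R0 [th34 th_1 R00 osc]]] := osc_decay S ug M01 uM Cg1 GB th10 R10 ext.
have M00 : 0 <= 2 * M0 by lra.
have uM' : {ae leb R N, forall x, `|ext0 Omega u x| <= M0}.
  apply: (ae_imp uM) => x hx; have [Ox|nO] := pselect (Omega x); first by rewrite ext0_in//; exact: hx.
  by rewrite ext0_out// normr0; lra.
have th16 : 16^-1 <= th by lra.
have [beta [L [b0 b1 L0 hol]]] := rep_holder vol_gt0 uM' M00 th16 th_1 R00 osc.
exists beta; rewrite b0 b1; split => //; exists (rep osc); split.
  exists L => x y _ _; apply: le_trans (hol x y) _; apply: ler_wpM2l => //.
  by apply: powR_le; [pos|pos|exact: norm_enorm].
apply: (ae_imp (rep_ae vol_gt0 M00 th16 th_1 R00 osc)) => x hx Ox.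
by rewrite -hx ext0_in.
Qed.
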